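(* Let $k$ be an algebraically closed field. Let $R=R(X,D)\cong k[u,v,w]/(f)$ be a $2$-dimensional normal graded hypersurface of type $(a,b,c;h)$ with $a\le b\le c$ and $a(R)=h-(a+b+c)=1$, and let $g$ be the genus of $X$. Then, up to linear equivalence of $D$, the triple ($g$, $D$, type) is one of the following $31$, where $P,P_1,P_2,\dots$ denote distinct points of $X$ (within each item); and conversely each of the listed types occurs as the type of such a ring $R$. Genus $g\ge 1$: (1) $g=3$, $D=K_X$; $(1,1,1;4)$. (2) $g=2$, $D=K_X$; $(1,1,3;6)$. (3) $g=2$, $D=K_X+\frac12P$; $(1,1,2;5)$. (4) $g=1$, $D=\frac12(P_1+P_2+P_3)$; $(1,2,2;6)$. (5) $g=1$, $D=\frac12(P_1+P_2)$; $(1,2,4;8)$. (6) $g=1$, $D=\frac12P_1+\frac23P_2$; $(1,2,3;7)$. (7) $g=1$, $D=\frac12P$; $(1,4,6;12)$. (8) $g=1$, $D=\frac23P$; $(1,3,5;10)$. (9) $g=1$, $D=\frac34P$; $(1,3,4;9)$. Genus $g=0$, at least four fractional points: (10) $D=K_X+\frac12(P_1+\cdots+P_5)$; $(2,2,5;10)$. (11) $D=K_X+\frac12(P_1+P_2+P_3+P_4)+\frac23P_5$; $(2,2,3;8)$. (12) $D=K_X+\frac12P_1+\frac23(P_2+P_3+P_4)$; $(2,3,3;9)$. (13) $D=K_X+\frac12(P_1+P_2)+\frac23(P_3+P_4)$; $(2,3,6;12)$. (14) $D=K_X+\frac12(P_1+P_2)+\frac23P_3+\frac34P_4$; $(2,3,4;10)$.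 (15) $D=K_X+\frac12(P_1+P_2+P_3)+\frac45P_4$; $(2,4,5;12)$. (16) $D=K_X+\frac12(P_1+P_2+P_3)+\frac34P_4$; $(2,4,7;14)$. (17) $D=K_X+\frac12(P_1+P_2+P_3)+\frac23P_4$; $(2,6,9;18)$. Genus $g=0$, three fractional points: (18) $D=K_X+\frac34(P_1+P_2+P_3)$; $(3,4,4;12)$. (19) $D=K_X+\frac23P_1+\frac34P_2+\frac45P_3$; $(3,4,5;13)$. (20) $D=K_X+\frac23P_1+\frac34(P_2+P_3)$; $(3,4,8;16)$. (21) $D=K_X+\frac23(P_1+P_2)+\frac56P_3$; $(3,5,6;15)$. (22) $D=K_X+\frac23(P_1+P_2)+\frac45P_3$; $(3,5,9;18)$. (23) $D=K_X+\frac23(P_1+P_2)+\frac34P_3$; $(3,8,12;24)$. (24) $D=K_X+\frac12P_1+\frac23P_2+\frac67P_3$; $(6,14,21;42)$. (25) $D=K_X+\frac12P_1+\frac23P_2+\frac78P_3$; $(6,8,15;30)$. (26) $D=K_X+\frac12P_1+\frac23P_2+\frac89P_3$; $(6,8,9;24)$. (27) $D=K_X+\frac12P_1+\frac45P_2+\frac56P_3$; $(4,5,6;16)$. (28) $D=K_X+\frac12P_1+\frac45(P_2+P_3)$; $(4,5,10;20)$. (29) $D=K_X+\frac12P_1+\frac34P_2+\frac45P_3$; $(4,10,15;30)$. (30) $D=K_X+\frac12P_1+\frac34P_2+\frac56P_3$; $(4,6,11;22)$. (31) $D=K_X+\frac12P_1+\frac34P_2+\frac67P_3$; $(4,6,7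;18)$.
   Context: The characteristic of $k$ is arbitrary. A $2$-dimensional normal graded hypersurface of type $(a,b,c;h)$ is a $2$-dimensional normal domain $R=\bigoplus_{n\ge0}R_n=k[u,v,w]/(f)$ with $\deg u=a$, $\deg v=b$, $\deg w=c$ positive integers and $f$ homogeneous of degree $h$; it is always assumed that $R_n\ne0$ for $n\gg0$ (so $\gcd(a,b,c)=1$). Put $X=\mathrm{Proj}(R)$, a smooth projective curve over $k$, with canonical divisor $K_X$. By the Dolgachev–Pinkham–Demazure construction there is a divisor $D$ on $X$ with rational coefficients, with $ND$ an ample integral divisor for some $N>0$, such that as graded rings $$R\cong R(X,D)=\bigoplus_{n\ge0}H^0(X,\mathcal O_X(nD))\,T^n\subset k(X)[T],$$ where $H^0(X,\mathcal O_X(nD))=\{\phi\in k(X)^\times : \mathrm{div}_X(\phi)+nD\ge0\}\cup\{0\}$. For divisors with rational coefficients, $D_1\sim D_2$ (linear equivalence) means $D_1-D_2=\mathrm{div}_X(\phi)$ for some $\phi\in k(X)^\times$. *)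

(* Defs.v *)
From HB Require Import structures.
From mathcomp Require Import all_boot all_order all_algebra.
From mathcomp Require Import boolp classical_sets.
From mathcomp Require Export mpoly.

Set Implicit Arguments.
Unset Strict Implicit.
Unset Printing Implicit Defensive.

Import Order.TTheory GRing.Theory Num.Theory.
Local Open Scope ring_scope.
Local Open Scope classical_set_scope.

Local Notation "x %:F" := (@FracField.tofrac _ x).

(* ------------------------------------------------------------------------ *)
(* Ring-theoretic notions.  An ideal is a boolean predicate (idealr_closed   *)
(* includes properness), classically the same as a subset.                  *)

Definition prime_ideal (R : comNzRingType) (I : {pred R}) : Prop :=
  idealr_closed I /\ prime_idealr_closed I.

(* I 0 < I 1 < ... < I n, all prime *)
Definition prime_chain (R : comNzRingType) (n : nat) : Prop :=
  exists I : nat -> {pred R},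
    (forall i, (i <= n)%N -> prime_ideal (I i)) /\
    (forall i, (i < n)%N -> {subset I i <= I i.+1} /\
       exists x, x \in I i.+1 /\ x \notin I i).

Definition krull_dim (R : comNzRingType) (d : nat) : Prop :=
  prime_chain R d /\ ~ prime_chain R d.+1.

Definition normal_domain (R : idomainType) : Prop :=
  forall z : {fraction R}, integralOver (@FracField.tofrac R) z ->
    exists x : R, z = x%:F.

(* ------------------------------------------------------------------------ *)
(* The curve X = Proj R attached to a graded k-domain R = (+)_n gr n, with   *)
(* structure map cst : k -> R, for R normal of dimension 2.                  *)

Section Proj.

Variables (k : fieldType) (R : idomainType) (cst : k -> R).
Variable gr : nat -> set R.

(* k(X), as a subfield of Frac(R) *)
Definition ratfun : set {fraction R} :=
  [set phi | exists n x y,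
     [/\ gr n x, gr n y, y != 0 & phi = x%:F / y%:F]].

(* A (closed) point of X: a homogeneous prime that does not contain the      *)
(* irrelevant ideal and is not the generic point (0).                        *)
Record point := Point {
  pt_ideal :> {pred R};
  _ : prime_ideal pt_ideal;
  _ : forall x, x \in pt_ideal -> exists n (s : 'I_n -> R),
        (forall i : 'I_n, gr i (s i) /\ s i \in pt_ideal) /\ x = \sum_i s i;
  _ : exists n x, [/\ (0 < n)%N, gr n x & x \notin pt_ideal];
  _ : exists x, x \in pt_ideal /\ x != 0
}.

Definition local_ring (P : point) : set {fraction R} :=
  [set phi | exists n x y,
     [/\ gr n x, gr n y, y \notin P & phi = x%:F / y%:F]].

Definition local_max (P : point) : set {fraction R} :=
  [set phi | exists n x y,
     [/\ gr n x, gr n y, x \in P, y \notin P & phi = x%:F / y%:F]].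

Definition uniformizer (P : point) (t : {fraction R}) : Prop :=
  [/\ local_max P t, t != 0 &
      forall s, local_max P s -> exists2 r, local_ring P r & s = r * t].

(* The local rings are discrete valuation rings; ord P is the normalized     *)
(* valuation, meaningful on k(X)^* only (the value at 0 is junk).            *)
Definition ord (P : point) (phi : {fraction R}) : int :=
  xget 0 [set n : int | exists t r,
    [/\ uniformizer P t, local_ring P r, local_ring P r^-1, r != 0
      & phi = r * t ^ n]].

(* Divisors with rational coefficients are functions E : point -> rat        *)
(* with finite support.                                                      *)
Definition finite_support (E : point -> rat) : Prop :=
  exists n (s : 'I_n -> point), forall P, E P != 0 -> exists i, P = s i.

Definition integral_divisor (E : point -> rat) : Prop :=
  finite_support E /\ forall P, E P \is a Num.int.

Definition linear_equiv (E1 E2 : point -> rat) : Prop :=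
  exists phi, [/\ ratfun phi, phi != 0 &
    forall P, E1 P - E2 P = (ord P phi)%:~R].

Definition H0 (E : point -> rat) : set {fraction R} :=
  [set phi | phi = 0 \/
     [/\ ratfun phi, phi != 0 & forall P, 0 <= (ord P phi)%:~R + E P]].

(* the k-dimension of H0 E is d *)
Definition h0 (E : point -> rat) (d : nat) : Prop :=
  exists e : 'I_d -> {fraction R}, (forall i, H0 E (e i)) /\
    forall phi, H0 E phi ->
      exists! x : 'rV[k]_d, phi = \sum_(i < d) (cst (x 0 i))%:F * e i.

(* The complete linear system of E separates points and tangent vectors,     *)
(* i.e. it embeds X in a projective space (here k is algebraically closed).  *)
Definition very_ample (E : point -> rat) : Prop :=
  (forall P Q, P <> Q -> exists s, [/\ H0 E s, s != 0,
     (ord P s)%:~R + E P = 0 & 0 < (ord Q s)%:~R + E Q]) /\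
  (forall P, exists s, [/\ H0 E s, s != 0 & (ord P s)%:~R + E P = 1]).

Definition ample (E : point -> rat) : Prop :=
  exists2 m : nat, (0 < m)%N & very_ample (fun P => m%:R * E P).

(* some positive multiple of D is an ample integral divisor *)
Definition ample_qdivisor (D : point -> rat) : Prop :=
  finite_support D /\ exists N : nat, [/\ (0 < N)%N,
    integral_divisor (fun P => N%:R * D P) & ample (fun P => N%:R * D P)].

(* k-derivations of k(X) (the values outside k(X) are irrelevant) *)
Definition kderivation (delta : {fraction R} -> {fraction R}) : Prop :=
  [/\ forall x, ratfun x -> ratfun (delta x),
      forall x, delta (cst x)%:F = 0,
      forall x y, ratfun x -> ratfun y -> delta (x + y) = delta x + delta y &
      forall x y, ratfun x -> ratfun y ->
        delta (x * y) = delta x * y + x * delta y].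

(* E = div(y dx) for a nonzero rational differential y dx.  At P, with       *)
(* uniformizer t, one has y dx = y (dx/dt) dt, and x |-> dx/dt is the        *)
(* k-derivation of k(X) taking t to 1; dx is nonzero iff some k-derivation   *)
(* does not kill x.                                                          *)
Definition canonical_divisor (E : point -> rat) : Prop :=
  exists x y, [/\ ratfun x, ratfun y, y != 0,
    exists delta, kderivation delta /\ delta x != 0 &
    forall P, exists t delta, [/\ uniformizer P t, kderivation delta,
      delta t = 1 & E P = (ord P (y * delta x))%:~R]].

Definition genus (g : nat) : Prop :=
  exists K, canonical_divisor K /\ h0 K g.

(* R(X,D), as a subring of k(X)[T] *)
Definition section_ring (D : point -> rat) : set {poly {fraction R}} :=
  [set p | forall n : nat, H0 (fun P => n%:R * D P) p`_n].

(* R and R(X,D) are isomorphic as graded rings *)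
Definition is_section_ring (D : point -> rat) : Prop :=
  exists theta : {rmorphism R -> {poly {fraction R}}},
    [/\ injective theta,
        forall p, section_ring D p <-> exists x, theta x = p &
        forall n x, gr n x -> exists phi, theta x = phi *: 'X^n].

(* q_0 P_0 + q_1 P_1 + ... *)
Definition sum_points (q : seq rat) (P : 'I_(size q) -> point) : point -> rat :=
  fun Q => \sum_(i < size q) q`_i *+ `[< Q = P i >].

(* D ~ K_X + q_0 P_0 + ... (if withK) or D ~ q_0 P_0 + ... (if not), for     *)
(* some distinct points P_0, P_1, ...                                        *)
Definition equiv_to_listed (withK : bool) (q : seq rat) (D : point -> rat)
    : Prop :=
  exists P : 'I_(size q) -> point, injective P /\
    if withK then
      exists K, canonical_divisor K /\
        linear_equiv D (fun Q => K Q + sum_points P Q)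
    else linear_equiv D (sum_points P).

End Proj.

(* ------------------------------------------------------------------------ *)
(* Graded hypersurfaces k[u,v,w]/(f), presented by a surjection              *)
(* pi : k[u,v,w] -> R with kernel (f).                                       *)

Definition wdeg (a b c : nat) (m : 'X_{1..3}) : nat :=
  (\sum_(i < 3) m i * nth 0 [:: a; b; c] i)%N.

Lemma wdeg0 a b c : wdeg a b c 0%MM = 0%N.
Proof. by rewrite /wdeg big1 // => i _; rewrite mnm0E mul0n. Qed.

Lemma wdegD a b c :
  {morph wdeg a b c : m1 m2 / (m1 + m2)%MM >-> (m1 + m2)%N}.
Proof.
by move=> m1 m2; rewrite /wdeg -big_split; apply: eq_bigr => i _;
   rewrite mnmDE mulnDl.
Qed.

HB.instance Definition _ a b c :=
  isMeasure.Build 3 (wdeg a b c) (@wdeg0 a b c) (@wdegD a b c).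

Section Hypersurface.

Variables (k : fieldType) (a b c : nat) (R : idomainType).
Variable pi : {rmorphism {mpoly k[3]} -> R}.

(* the homogeneous part R_n *)
Definition piece (n : nat) : set R :=
  [set x | exists2 p : {mpoly k[3]}, p \is n.-homog for (wdeg a b c)
                                   & pi p = x].

Definition structure_map (x : k) : R := pi x%:MP.

Definition normal_graded_hypersurface (h : nat) : Prop :=
  [/\ [/\ (0 < a)%N, (0 < b)%N & (0 < c)%N],
      forall x, exists p, pi p = x,
      exists2 f : {mpoly k[3]}, f \is h.-homog for (wdeg a b c) &
        forall p, pi p = 0 <-> exists q, p = q * f,
      krull_dim R 2 /\ normal_domain R &
      exists n0, forall n, (n0 <= n)%N -> exists x, piece n x /\ x != 0].

End Hypersurface.

(* ------------------------------------------------------------------------ *)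
(* Entries: (genus, K_X present in D?, coefficients of the points, type).    *)

Definition entry : Type := (nat * bool * seq rat * (nat * nat * nat * nat))%type.

Definition hypersurface_list : seq entry := [::
  (3, true,  [::], (1, 1, 1, 4));
  (2, true,  [::], (1, 1, 3, 6));
  (2, true,  [:: 1/2], (1, 1, 2, 5));
  (1, false, [:: 1/2; 1/2; 1/2], (1, 2, 2, 6));
  (1, false, [:: 1/2; 1/2], (1, 2, 4, 8));
  (1, false, [:: 1/2; 2/3], (1, 2, 3, 7));
  (1, false, [:: 1/2], (1, 4, 6, 12));
  (1, false, [:: 2/3], (1, 3, 5, 10));
  (1, false, [:: 3/4], (1, 3, 4, 9));
  (0, true,  [:: 1/2; 1/2; 1/2; 1/2; 1/2], (2, 2, 5, 10));
  (0, true,  [:: 1/2; 1/2; 1/2; 1/2; 2/3], (2, 2, 3, 8));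
  (0, true,  [:: 1/2; 2/3; 2/3; 2/3], (2, 3, 3, 9));
  (0, true,  [:: 1/2; 1/2; 2/3; 2/3], (2, 3, 6, 12));
  (0, true,  [:: 1/2; 1/2; 2/3; 3/4], (2, 3, 4, 10));
  (0, true,  [:: 1/2; 1/2; 1/2; 4/5], (2, 4, 5, 12));
  (0, true,  [:: 1/2; 1/2; 1/2; 3/4], (2, 4, 7, 14));
  (0, true,  [:: 1/2; 1/2; 1/2; 2/3], (2, 6, 9, 18));
  (0, true,  [:: 3/4; 3/4; 3/4], (3, 4, 4, 12));
  (0, true,  [:: 2/3; 3/4; 4/5], (3, 4, 5, 13));
  (0, true,  [:: 2/3; 3/4; 3/4], (3, 4, 8, 16));
  (0, true,  [:: 2/3; 2/3; 5/6], (3, 5, 6, 15));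
  (0, true,  [:: 2/3; 2/3; 4/5], (3, 5, 9, 18));
  (0, true,  [:: 2/3; 2/3; 3/4], (3, 8, 12, 24));
  (0, true,  [:: 1/2; 2/3; 6/7], (6, 14, 21, 42));
  (0, true,  [:: 1/2; 2/3; 7/8], (6, 8, 15, 30));
  (0, true,  [:: 1/2; 2/3; 8/9], (6, 8, 9, 24));
  (0, true,  [:: 1/2; 4/5; 5/6], (4, 5, 6, 16));
  (0, true,  [:: 1/2; 4/5; 4/5], (4, 5, 10, 20));
  (0, true,  [:: 1/2; 3/4; 4/5], (4, 10, 15, 30));
  (0, true,  [:: 1/2; 3/4; 5/6], (4, 6, 11, 22));
  (0, true,  [:: 1/2; 3/4; 6/7], (4, 6, 7, 18))
]%N.

(* Main.v *)
From HB Require Import structures.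
From mathcomp Require Import all_boot all_order all_algebra.
From mathcomp Require Import boolp classical_sets.
From mathcomp Require Import ring lra zify.
From mathcomp Require Import generic_quotient.
Require Import Defs.

Set Implicit Arguments.
Unset Strict Implicit.
Unset Printing Implicit Defensive.

Import Order.TTheory GRing.Theory Num.Theory.
Local Open Scope ring_scope.

(* Normality of R = k[u,v,w]/(f) means that f is smooth away from the origin.
   At a point P of X the degrees of the homogeneous elements of R not vanishing
   at P generate a group q_P Z, and a local parameter transversal to the orbit
   of P defines a valuation val_P on the homogeneous fractions, equal to q_P ord_P
   in degree 0.  A homogeneous fraction without poles belongs to R, hence
   R = R(X, D0) with D0 = sum_P (val_P(T) / q_P) P for any homogeneous fraction T
   of degree 1, and a graded isomorphism of section rings carries D to D0 up to
   linear equivalence and a permutation of the points preserving the orders of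
   functions.  When a(R) = 1 the Jacobian derivation attached to f induces, up to a
   power of T, a derivation of k(X), and computing it on local parameters gives
   K_X = sum_P ((val_P(T) - q_P + 1) / q_P) P,
   that is D0 = K_X + sum_P (1 - 1/q_P) P, while H^0(K_X) is the degree 1 part of R.
   The points with q_P > 1 lie on the coordinate axes and planes, where smoothness
   turns into divisibility conditions on (a, b, c) with finitely many solutions.
   Conversely each type has an explicit equation: it is prime by an Eisenstein
   argument, and smooth because powers of the variables lie in the ideal generated
   by f and its derivatives. *)

(** * Weighted gradings of k[u,v,w] *)

(** The characteristic is arbitrary, so neither weights nor degrees may be inverted in k. Hence
    local coordinates come from Bezout relations between the weights, which keep the decisive
    determinants nonzero, and the derivation of k(X) is formed with dlog T, whose pairing with the
    Euler vector is deg T = 1 in every characteristic. A graded isomorphism with R(X,D) is not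
    assumed to be k-linear: it is followed through valuations, which recover the points, and
    derivations are conjugated by it. Dimension theory is replaced by one count of monomials: any
    three elements of R are algebraically dependent. This bounds chains of primes and, in the form
    of products of linear factors lying in a principal ideal, gives the residue fields, the
    finiteness of zeros and a graded Nullstellensatz. In genus 1 the list has no K_X: there R_1 is
    spanned by u, and val_P(u) = q_P - 1 exhibits K_X as principal. In the converse, a sparse
    equation with coefficients 1 may be singular in one characteristic, so some types carry a second
    equation. *)

Definition wt (a b c : nat) (i : 'I_3) : nat := nth 0%N [:: a; b; c] i.

Section WeightedPolynomials.

Variables (k : fieldType) (a b c : nat).

Local Notation w := (wt a b c).
Local Notation hom n p := (p \is n.-homog for (wdeg a b c)).
Local Notation hpart := (pihomog (wdeg a b c)).

Lemma wdegE m : wdeg a b c m = (\sum_(i < 3) m i * w i)%N.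
Proof. by []. Qed.

Lemma wdegU i : wdeg a b c U_(i)%MM = w i.
Proof.
rewrite wdegE (bigD1 i) //= big1 ?addn0; last first.
  by move=> j; rewrite mnm1E eq_sym => /negbTE ->.
by rewrite mnm1E eqxx mul1n.
Qed.

Lemma hom_wdeg n (p : {mpoly k[3]}) m :
  hom n p -> m \in msupp p -> wdeg a b c m = n.
Proof. by move=> /dhomogP hp; apply: hp. Qed.

Lemma homX i : hom (w i) ('X_i : {mpoly k[3]}).
Proof. by rewrite dhomogX; apply/eqP; exact: wdegU. Qed.

Lemma homC (x : k) : hom 0%N (x%:MP : {mpoly k[3]}).
Proof.
apply/dhomogP => m; rewrite msuppC; case: ifP => // _; rewrite inE => /eqP ->.
exact: wdeg0.
Qed.

Lemma mmap_monomial (S : comNzRingType) (g : {rmorphism k -> S}) (v : 'I_3 -> S)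
    (m : 'X_{1..3}) :
  mmap1 (fun i => v i *: 'X^(w i)) m = mmap1 v m *: 'X^(wdeg a b c m).
Proof.
rewrite /mmap1 wdegE !big_ord_recl !big_ord0 !mulr1 !addn0.
rewrite !exprZn -!exprM -!scalerAl -!scalerAr !scalerA -!exprD.
by rewrite ![(_ * m _)%N]mulnC.
Qed.

(** Evaluation along an orbit: X_i goes to v_i T^w_i, so the n-th coefficient of the image is the
    value at v of the part of degree n. With v the classes of the variables it gives the grading of
    R, with v a point the restriction to its orbit. *)
Definition gmap (S : comNzRingType) (g : {rmorphism k -> S}) (v : 'I_3 -> S) :
    {mpoly k[3]} -> {poly S} :=
  mmap (polyC \o g) (fun i => v i *: 'X^(w i)).

HB.instance Definition _ S g v := GRing.RMorphism.on (@gmap S g v).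

Lemma gmap_hom S g v n (p : {mpoly k[3]}) :
  hom n p -> @gmap S g v p = mmap g v p *: 'X^n.
Proof.
move=> /dhomogP hp; rewrite /gmap /mmap scaler_suml; apply: eq_big_seq => m mp.
rewrite mmap_monomial // (hp _ mp) /=.
by rewrite mul_polyC scalerA.
Qed.

Lemma mpoly_hparts (p : {mpoly k[3]}) : exists N,
  forall M, (N <= M)%N -> p = \sum_(d < M) hpart d p.
Proof.
by exists (mmeasure (wdeg a b c) p) => M; apply: pihomog_partitionE.
Qed.

Lemma gmap_coef S g v n (p : {mpoly k[3]}) :
  (@gmap S g v p)`_n = mmap g v (hpart n p).
Proof.
have [N hN] := mpoly_hparts p.
rewrite {1}(hN (maxn N n.+1)) ?leq_maxl // raddf_sum coef_sum.
have ltn : (n < maxn N n.+1)%N by rewrite leq_max ltnSn orbT.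
rewrite (bigD1 (Ordinal ltn)) //= big1 ?addr0.
  by rewrite (gmap_hom _ _ (pihomogP _ _ _)) coefZ coefXn eqxx mulr1.
move=> i; rewrite -val_eqE /= => ne.
by rewrite (gmap_hom _ _ (pihomogP _ _ _)) coefZ coefXn eq_sym (negbTE ne) mulr0.
Qed.

Lemma euler n (p : {mpoly k[3]}) : hom n p ->
  \sum_(i < 3) (w i)%:R *: ('X_i * p^`M(i)) = n%:R *: p.
Proof.
move=> /dhomogP hp; rewrite {2}(mpolyE p) scaler_sumr.
have dE i : p^`M(i) = \sum_(m <- msupp p) p@_m *: ('X_[m])^`M(i).
  by rewrite {1}(mpolyE p) raddf_sum; apply: eq_bigr => m _; rewrite /= mderivZ.
under eq_bigr => i _ do rewrite dE mulr_sumr scaler_sumr.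
rewrite exchange_big /=; apply: eq_big_seq => m mp.
transitivity (p@_m *: \sum_(i < 3) ((m i * w i)%:R *: 'X_[m] : {mpoly k[3]})).
  rewrite scaler_sumr; apply: eq_bigr => i _.
  rewrite mderivX -!scalerAr !scalerA; case: (posnP (m i)) => [->|mi0].
    by rewrite mul0n !mulr0 !scale0r.
  rewrite -mpolyXD natrM addmC submK; last by rewrite lep1mP -lt0n.
  by congr (_ *: _); ring.
by rewrite -scaler_suml -natr_sum -wdegE (hp _ mp) !scalerA mulrC.
Qed.

Lemma hom_deriv n i (p : {mpoly k[3]}) : hom n p ->
  hom (n - w i)%N (p^`M(i)).
Proof.
move=> hp; apply/dhomogP => m; rewrite mcoeff_msupp mcoeff_deriv => ne.
have: (m + U_(i))%MM \in msupp p.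
  by rewrite mcoeff_msupp; apply: contraNneq ne => ->; rewrite mul0rn.
by move/(hom_wdeg hp); rewrite wdegD wdegU => <-; rewrite addnK.
Qed.

Lemma deriv_small n i (p : {mpoly k[3]}) : hom n p -> (n < w i)%N -> p^`M(i) = 0.
Proof.
move=> hp lt; apply/mpolyP => m; rewrite mcoeff_deriv mcoeff0.
suff ->: p@_(m + U_(i)) = 0 by rewrite mul0rn.
apply/eqP; rewrite mcoeff_eq0; apply/negP => /(hom_wdeg hp).
by rewrite wdegD wdegU => E; move: lt; rewrite -E ltnNge leq_addl.
Qed.

End WeightedPolynomials.

Lemma rmorphism_factor (A : comNzRingType) (B R : comNzRingType)
    (pi : {rmorphism A -> R}) (Phi : {rmorphism A -> B}) :
  (forall x, exists p, pi p = x) -> (forall p, pi p = 0 -> Phi p = 0) ->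
  exists th : {rmorphism R -> B}, forall p, th (pi p) = Phi p.
Proof.
move=> sj kr.
have eqP p q : pi p = pi q -> Phi p = Phi q.
  by move=> e; apply/eqP; rewrite -subr_eq0 -rmorphB; apply/eqP/kr; rewrite rmorphB e subrr.
pose g x := Phi (projT1 (cid (sj x))).
have gE p : g (pi p) = Phi p by rewrite /g; case: cid => q /= /eqP.
have addg : GRing.zmod_morphism g.
  move=> x y; have [p <-] := sj x; have [q <-] := sj y.
  by rewrite -rmorphB !gE rmorphB.
have mulg : GRing.monoid_morphism g.
  split; first by rewrite -(rmorph1 pi) gE rmorph1.
  move=> x y; have [p <-] := sj x; have [q <-] := sj y.
  by rewrite -rmorphM !gE rmorphM.
pose gA := GRing.isZmodMorphism.Build _ _ g addg.
pose gM := GRing.isMonoidMorphism.Build _ _ g mulg.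
pose th : {rmorphism R -> B} := HB.pack g gA gM.
by exists th => p; rewrite /th /= gE.
Qed.

Lemma linear_dependency (k : fieldType) (T C : finType) (G : T -> C -> k) :
  (#|C| < #|T|)%N ->
  exists v : T -> k, (exists t, v t != 0) /\ forall c, \sum_t v t * G t c = 0.
Proof.
move=> lt; pose M := \matrix_(i < #|T|, j < #|C|) G (enum_val i) (enum_val j).
have : kermx M != 0.
  rewrite kermx_eq0 /row_free; apply: contraTneq lt => <-.
  by rewrite -leqNgt rank_leq_col.
case/matrix0Pn => i [j ne]; pose u := row i (kermx M).
have uM : u *m M = 0 by apply/sub_kermxP; apply: row_sub.
exists (fun t => u 0 (enum_rank t)); split.
  by exists (enum_val j); rewrite enum_valK mxE.
move=> c; have := congr1 (fun A : 'rV_#|C| => A 0 (enum_rank c)) uM.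
rewrite mxE [RHS]mxE => E; rewrite -[RHS]E [RHS](reindex enum_rank) /=; last first.
  by exists enum_val => x _; rewrite ?enum_rankK ?enum_valK.
by apply: eq_bigr => t _; rewrite !mxE !enum_rankK.
Qed.

(** * Algebraic dependence by counting monomials *)

Section AlgebraicDependence.

Variable k : fieldType.

Implicit Types p q : {mpoly k[3]}.

Definition box_supported n p := forall m, m \in msupp p -> forall i, (m i <= n)%N.

Lemma box_supportedW n n' p :
  (n <= n')%N -> box_supported n p -> box_supported n' p.
Proof. by move=> le h m mp i; apply: leq_trans (h m mp i) le. Qed.

Lemma box_supportedM n n' p q :
  box_supported n p -> box_supported n' q -> box_supported (n + n') (p * q).
Proof.
move=> hp hq m /msuppM_le /allpairsP[[m1 m2] /= [h1 h2 ->]] i.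
by rewrite mnmDE leq_add ?hp ?hq.
Qed.

Lemma box_supportedX n p j : box_supported n p -> box_supported (j * n) (p ^+ j).
Proof.
move=> hp; elim: j => [|j IH].
  by move=> m; rewrite expr0 msupp1 inE => /eqP -> i; rewrite mnm0E.
by rewrite exprS mulSn; apply: box_supportedM.
Qed.

Lemma box_supported_ex p : exists n, box_supported n p.
Proof.
exists (msize p) => m mp i; apply: leq_trans (ltnW (msize_mdeg_lt mp)).
by rewrite mdegE (bigD1 i) //= leq_addr.
Qed.

Definition box_mnm n (e : {ffun 'I_3 -> 'I_n}) : 'X_{1..3} := [multinom e i : nat | i < 3].

Lemma box_mnm_inj n : injective (@box_mnm n).
Proof.
move=> e e' E; apply/ffunP => i; apply/val_inj.
by have := congr1 (fun m : 'X_{1..3} => m i) E; rewrite !mnmE.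
Qed.

Lemma box_mnm_onto n (m : 'X_{1..3}) : (forall i, (m i < n)%N) ->
  exists e : {ffun 'I_3 -> 'I_n}, box_mnm e = m.
Proof.
move=> h; exists [ffun i => Ordinal (h i)].
by apply/mnmP => i; rewrite mnmE ffunE.
Qed.

Lemma box_supported_mnm n (e : {ffun 'I_3 -> 'I_n.+1}) :
  box_supported n ('X_[box_mnm e] : {mpoly k[3]}).
Proof.
move=> m /mem_msuppXP <- i; rewrite mnmE; exact: (leq_ord (e i)).
Qed.

Lemma mpoly_box0 n (P : {mpoly k[3]}) : box_supported n P ->
  (forall e : {ffun 'I_3 -> 'I_n.+1}, P@_(box_mnm e) = 0) -> P = 0.
Proof.
move=> bP h; apply/mpolyP => m; rewrite mcoeff0; apply/eqP; rewrite mcoeff_eq0.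
apply/negP => mP; have [e E] := @box_mnm_onto n.+1 m (bP m mP).
by move: mP; rewrite mcoeff_msupp -E h eqxx.
Qed.

Lemma box_sum0 n (v : {ffun 'I_3 -> 'I_n} -> k) :
  \sum_e v e *: 'X_[box_mnm e] = 0 :> {mpoly k[3]} -> forall e, v e = 0.
Proof.
move=> E e; have := congr1 (mcoeff (box_mnm e)) E.
rewrite mcoeff0 raddf_sum /= (bigD1 e) //= mcoeffZ mcoeffX eqxx mulr1.
rewrite big1 ?addr0 // => e' ne; rewrite mcoeffZ mcoeffX.
by case: eqP => [/box_mnm_inj /eqP|_]; rewrite ?(negbTE ne) ?mulr0.
Qed.

(** The count behind [alg_dependent_mod]: N^3 + (A - s + 1)^3 unknowns against (A + 1)^3 equations.
    The difference (A + 1)^3 - (A - s + 1)^3 is at most 3 s (A + 1)^2, quadratic in N, and A = 3 N r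
    + s bounds the partial degrees of all the polynomials involved. *)
Lemma cube_bound (s N r A : nat) :
  ((3 * s * (3 * r + s + 1) ^ 2) < N)%N -> A = (3 * N * r + s)%N ->
  (A.+1 ^ 3 < N ^ 3 + (A - s).+1 ^ 3)%N.
Proof.
move=> ltN AE; have sA : (s <= A)%N by rewrite AE leq_addl.
set B := (A - s)%N; have AB : A = (B + s)%N by rewrite /B subnK.
have N0 : (0 < N)%N by apply: leq_ltn_trans ltN.
have h1 : (A.+1 <= N * (3 * r + s + 1))%N.
  have -> : (N * (3 * r + s + 1) = 3 * N * r + s * N + N)%N by ring.
  by rewrite AE -addn1 !leq_add // leq_pmulr.
have h2 : (A.+1 ^ 3 <= B.+1 ^ 3 + 3 * s * A.+1 ^ 2)%N.
  have -> : (B.+1 ^ 3 + 3 * s * A.+1 ^ 2 =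
             A.+1 ^ 3 + (3 * B.+1 * s ^ 2 + 2 * s ^ 3))%N.
    by rewrite AB; ring.
  exact: leq_addr.
have h3 : (3 * s * A.+1 ^ 2 <= (3 * s * (3 * r + s + 1) ^ 2) * N ^ 2)%N.
  have -> : (3 * s * (3 * r + s + 1) ^ 2 * N ^ 2 =
             3 * s * (N * (3 * r + s + 1)) ^ 2)%N by ring.
  by rewrite leq_mul // leq_sqr.
have h4 : (3 * s * (3 * r + s + 1) ^ 2 * N ^ 2 < N ^ 3)%N.
  by rewrite [(N ^ 3)%N]expnS ltn_mul2r ltN expn_gt0 N0.
by rewrite addnC; lia.
Qed.

(* There are N^3 monomials in X with exponents below N, while polynomials of
   partial degrees at most A modulo multiples of f have dimension O(A^2). *)
Lemma alg_dependent_mod (f : {mpoly k[3]}) (X : 'I_3 -> {mpoly k[3]}) : f != 0 ->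
  exists F : {mpoly k[3]}, F != 0 /\
    exists e, mmap (@mpolyC 3 k) X F = e * f.
Proof.
move=> f0; have [s hs] := box_supported_ex f.
have [r hr] : exists r, forall i, box_supported r (X i).
  have [r0 h0] := box_supported_ex (X 0).
  have [r1 h1] := box_supported_ex (X 1).
  have [r2 h2] := box_supported_ex (X 2%:R).
  exists (maxn r0 (maxn r1 r2)) => i.
  have : i \in [:: 0; 1; 2%:R] by case: i => [[|[|[|]]]].
  by rewrite !inE => /or3P[]/eqP->;
    [move: h0|move: h1|move: h2]; apply: box_supportedW; rewrite !leq_max leqnn ?orbT.
set N := (3 * s * (3 * r + s + 1) ^ 2).+1.
have [A AE] : exists A, A = (3 * N * r + s)%N by exists (3 * N * r + s)%N.
have cnt := @cube_bound s N r A (ltnSn _) AE.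
(* The unknowns are the coefficients of F and of the multiplier of f; the equations are indexed by
   the monomials of the box of side A. *)
pose T := ({ffun 'I_3 -> 'I_N} + {ffun 'I_3 -> 'I_(A - s).+1})%type.
pose C := {ffun 'I_3 -> 'I_A.+1}.
pose G (t : T) : {mpoly k[3]} := match t with
  | inl e => mmap1 X (box_mnm e) | inr e => 'X_[box_mnm e] * f end.
have bG t : box_supported A (G t).
  case: t => e /=; last first.
    apply: (@box_supportedW ((A - s) + s)%N); first by rewrite subnK // AE leq_addl.
    exact: box_supportedM (@box_supported_mnm _ _) hs.
  apply: (@box_supportedW (3 * N * r)%N); first by rewrite AE leq_addr.
  rewrite /mmap1 !big_ord_recl big_ord0 mulr1.
  have h j : box_supported (N * r) (X j ^+ box_mnm e j).
    apply: (@box_supportedW (box_mnm e j * r)%N); last exact: box_supportedX.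
    by rewrite leq_mul2r mnmE ltnW ?orbT.
  have -> : (3 * N * r = N * r + (N * r + N * r))%N by ring.
  by do 2?apply: box_supportedM => //; apply: h.
have [v [[t0 vt0] hv]] : exists v : T -> k, (exists t, v t != 0) /\
    forall c : C, \sum_t v t * (G t)@_(box_mnm c) = 0.
  apply: linear_dependency; rewrite card_sum !card_ffun !card_ord; exact: cnt.
have E0 : \sum_t v t *: G t = 0.
  apply: (@mpoly_box0 A).
    move=> m /msupp_sum_le /flattenP[/= _ /mapP[t _ ->]] /msuppZ_le mt.
    exact: bG mt.
  by move=> c; rewrite raddf_sum -[RHS](hv c); apply: eq_bigr => t _; rewrite /= mcoeffZ.
pose F : {mpoly k[3]} := \sum_e v (inl e) *: 'X_[box_mnm e].
pose e0 : {mpoly k[3]} := \sum_e v (inr e) *: 'X_[box_mnm e].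
have FE : mmap (@mpolyC 3 k) X F + e0 * f = 0.
  rewrite -E0 big_sumType /= /F raddf_sum mulr_suml; congr (_ + _).
    by apply: eq_bigr => e _; rewrite /= mmapZ mmapX mul_mpolyC.
  by apply: eq_bigr => e _; rewrite scalerAl.
exists F; split; last by exists (- e0); rewrite mulNr; apply/eqP; rewrite -addr_eq0 FE.
apply/eqP => F0; move: FE; rewrite F0 raddf0 add0r => /eqP.
rewrite mulf_eq0 (negbTE f0) orbF => /eqP e00.
case: t0 vt0 => e; first by rewrite (box_sum0 F0) eqxx.
by rewrite (box_sum0 e00) eqxx.
Qed.

End AlgebraicDependence.

(** * Graded hypersurfaces and their dimension *)

(** The presentation alone, without dimension or normality: the classification derives smoothness of
    f from normality, the realization derives normality and dimension from smoothness. *)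
Record hsurf (k : fieldType) (a b c : nat) (R : idomainType)
    (pi : {rmorphism {mpoly k[3]} -> R}) (h : nat) (f : {mpoly k[3]}) : Prop :=
  Hsurf {
    wt_gt0 : forall i, (0 < wt a b c i)%N;
    pi_surj : forall x, exists p, pi p = x;
    f_hom : f \is h.-homog for (wdeg a b c);
    f_neq0 : f != 0;
    pi_ker : forall p, pi p = 0 <-> exists q, p = q * f }.

(** Factoring out the least power of z leaves, modulo z, only the terms of least exponent. Relations
    are cut down in this way one element at a time. *)
Lemma mul_powers_min (R : comNzRingType) (T : eqType) (s : seq T) (A : T -> R)
    (e : T -> nat) (z : R) (m0 : T) : m0 \in s ->
  exists2 m1, m1 \in s & exists r,
    \sum_(m <- s) A m * z ^+ e m =
    z ^+ e m1 * (\sum_(m <- s | e m == e m1) A m + z * r).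
Proof.
move=> ms; have [m1 m1s hm] : exists2 m1, m1 \in s &
    forall m, m \in s -> (e m1 <= e m)%N.
  have ex : exists n, has (fun m => e m == n) s.
    by exists (e m0); apply/hasP; exists m0.
  have [n /hasP[m1 m1s /eqP En] hn] := ex_minnP ex.
  by exists m1 => // m ms'; rewrite En; apply: hn; apply/hasP; exists m.
exists m1 => //; exists (\sum_(m <- s | e m != e m1) A m * z ^+ (e m - (e m1).+1)).
rewrite mulrDr (bigID (fun m => e m == e m1)) /=; congr (_ + _).
  by rewrite mulr_sumr; apply: eq_bigr => m /eqP ->; rewrite mulrC.
rewrite !mulr_sumr big_seq_cond [RHS]big_seq_cond; apply: eq_bigr => m /andP[ms' ne].
have lt : (e m1 < e m)%N by rewrite ltn_neqAle eq_sym ne hm.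
by rewrite mulrA -exprSr mulrCA -exprD subnKC.
Qed.

(** In the fraction field the sum is Y^n P(X / Y), and P splits over the closed field k. *)
Lemma homogenized_split (k : closedFieldType) (A : idomainType)
    (g : {rmorphism k -> A}) (X Y : A) (T : eqType) (s : seq T) (c : T -> k)
    (t : T -> nat) (n : nat) (P : {poly k}) :
  Y != 0 -> {in s, forall m, (t m <= n)%N} ->
  P = \sum_(m <- s) c m *: 'X^(t m) -> P != 0 ->
  exists zs : seq k, [/\ (size zs <= n)%N,
    P = lead_coef P *: \prod_(z <- zs) ('X - z%:P) &
    \sum_(m <- s) g (c m) * X ^+ t m * Y ^+ (n - t m) =
    g (lead_coef P) * Y ^+ (n - size zs) * \prod_(z <- zs) (X - g z * Y)].
Proof.
move=> Y0 tn PE P0.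
have field_aux (K : fieldType) (A' x y y' : K) : y != 0 ->
    A' * x * y' = y * y' * A' * (x / y) by move=> ne; field.
have szP : (size P <= n.+1)%N.
  apply/leq_sizeP => j nj; rewrite PE coef_sum big_seq_cond big1 // => m /andP[ms _].
  by rewrite coefZ coefXn gtn_eqF ?mulr0 //; apply: leq_trans nj; rewrite ltnS tn.
have [zs Es] := closed_field_poly_normal P.
have szs : (size zs <= n)%N.
  move: szP; rewrite {1}Es size_scale ?lead_coef_eq0 // size_prod_XsubC.
  by rewrite ltnS.
exists zs; split=> //; apply/eqP; rewrite -tofrac_eq; apply/eqP.
pose tc := @FracField.tofrac A \o g.
pose x := FracField.tofrac X; pose y := FracField.tofrac Y.
have y0 : y != 0 by rewrite tofrac_eq0.
transitivity (y ^+ n * (map_poly tc P).[x / y]).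
  rewrite PE [map_poly _ _]rmorph_sum horner_sum mulr_sumr rmorph_sum.
  apply: eq_big_seq => m ms.
  rewrite /= map_polyZ map_polyXn !hornerE !rmorphM !rmorphXn exprMn exprVn.
  have -> : y ^+ n = y ^+ t m * y ^+ (n - t m) by rewrite -exprD subnKC ?tn.
  exact: field_aux (expf_neq0 _ y0).
rewrite {1}Es map_polyZ hornerZ [map_poly _ _]rmorph_prod horner_prod rmorphM mulrCA.
rewrite -[in LHS](subnK szs) exprD rmorphM rmorphXn -!mulrA; congr (_ * (_ * _)).
rewrite [RHS]rmorph_prod; elim: {Es szs} zs => [|z zs IH].
  by rewrite !big_nil expr0 mul1r.
rewrite !big_cons -IH exprS mulrACA; congr (_ * _).
rewrite -[(poly_map_poly__canonical__GRing_RMorphism _ _)]/(map_poly tc ('X - z%:P)).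
rewrite [RHS]tofracB tofracM map_polyXsubC !hornerE mulrBr.
by rewrite mulrCA mulfV // mulr1 mulrC.
Qed.

Section GradedHypersurface.

Variables (k : fieldType) (a b c : nat) (R : idomainType).
Variables (pi : {rmorphism {mpoly k[3]} -> R}) (h : nat) (f : {mpoly k[3]}).
Hypothesis H : hsurf a b c pi h f.

Local Notation w := (wt a b c).
Local Notation hom n p := (p \is n.-homog for (wdeg a b c)).
Local Notation hpart := (pihomog (wdeg a b c)).
Local Notation gr := (piece a b c pi).
Local Notation cst := (structure_map pi).

HB.instance Definition _ := GRing.RMorphism.copy cst (pi \o @mpolyC 3 k).

Lemma cst_eq0 x : (cst x == 0) = (x == 0).
Proof. exact: (fmorph_eq0 (pi \o @mpolyC 3 k)). Qed.

Lemma cstM x p : cst x * pi p = pi (x *: p).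
Proof. by rewrite /structure_map -rmorphM mul_mpolyC. Qed.

Lemma pi_mmap p : mmap cst (fun i => pi 'X_i) p = pi p.
Proof.
rewrite {2}(mpolyE p) rmorph_sum; apply: eq_bigr => m _ /=.
rewrite -cstM; congr (_ * _); rewrite mpolyXE_id rmorph_prod.
by apply: eq_bigr => i _; rewrite rmorphXn.
Qed.

(** The coaction x -> sum of x_n T^n, which is well defined because f is homogeneous; its
    coefficients are the homogeneous parts of x. *)
Lemma grading_ex : exists g : {rmorphism R -> {poly R}},
  forall p, g (pi p) = gmap a b c cst (fun i => pi 'X_i) p.
Proof.
apply: (rmorphism_factor (pi_surj H)) => p /(pi_ker H)[q ->].
by rewrite rmorphM /= (gmap_hom _ _ (f_hom H)) pi_mmap (iffRL (pi_ker H f)) ?scale0r ?mulr0 //;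
  exists 1; rewrite mul1r.
Qed.

Definition grading : {rmorphism R -> {poly R}} := projT1 (cid grading_ex).

Lemma gradingE p : grading (pi p) = gmap a b c cst (fun i => pi 'X_i) p.
Proof. exact: (projT2 (cid grading_ex)). Qed.

Lemma grading_coef p n : (grading (pi p))`_n = pi (hpart n p).
Proof. by rewrite gradingE gmap_coef pi_mmap. Qed.

Lemma grP n x : gr n x <-> grading x = x *: 'X^n.
Proof.
split=> [[p hp <-]|E].
  by rewrite gradingE (gmap_hom _ _ hp) pi_mmap.
have [p Ep] := pi_surj H x; exists (hpart n p); first exact: pihomogP.
by rewrite -grading_coef Ep E coefZ coefXn eqxx mulr1.
Qed.

Lemma gr_coef x n : gr n (grading x)`_n.
Proof.
have [p <-] := pi_surj H x; rewrite grading_coef.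
by exists (hpart n p) => //; apply: pihomogP.
Qed.

Lemma grading1 x : (grading x).[1] = x.
Proof.
have [p <-] := pi_surj H x; have [N hN] := mpoly_hparts a b c p.
rewrite (hN N (leqnn _)) !rmorph_sum horner_sum; apply: eq_bigr => i _ /=.
by rewrite gradingE (gmap_hom _ _ (pihomogP _ _ _)) pi_mmap !hornerE expr1n mulr1.
Qed.

Lemma gr_decomp x : x = \sum_(i < size (grading x)) (grading x)`_i.
Proof.
by rewrite -{1}(grading1 x) horner_coef; apply: eq_bigr => i _; rewrite expr1n mulr1.
Qed.

Lemma gr0 n : gr n 0.
Proof. by apply/grP; rewrite rmorph0 scale0r. Qed.

Lemma gr1 : gr 0 1.
Proof. by apply/grP; rewrite rmorph1 scale1r. Qed.

Lemma grD n x y : gr n x -> gr n y -> gr n (x + y).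
Proof. by move=> /grP hx /grP hy; apply/grP; rewrite rmorphD hx hy scalerDl. Qed.

Lemma grN n x : gr n x -> gr n (- x).
Proof. by move=> /grP hx; apply/grP; rewrite rmorphN hx scaleNr. Qed.

Lemma grM n m x y : gr n x -> gr m y -> gr (n + m) (x * y).
Proof.
move=> /grP hx /grP hy; apply/grP; rewrite rmorphM hx hy.
by rewrite -scalerAl -scalerAr scalerA exprD.
Qed.

Lemma grXn n x j : gr n x -> gr (n * j) (x ^+ j).
Proof.
move=> hx; elim: j => [|j IH]; first by rewrite muln0; apply: gr1.
by rewrite exprS mulnS; apply: grM.
Qed.

Lemma gr_cst x : gr 0 (cst x).
Proof. by exists x%:MP => //; apply: homC. Qed.

Lemma gr_scale n x y : gr n y -> gr n (cst x * y).
Proof. by move=> hy; rewrite -[n]add0n; apply: grM => //; apply: gr_cst. Qed.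

Lemma gr_sum n (I : Type) (r : seq I) (P : pred I) F :
  (forall i, P i -> gr n (F i)) -> gr n (\sum_(i <- r | P i) F i).
Proof. by move=> hF; apply: big_ind => //; [apply: gr0|apply: grD]. Qed.

Lemma gr_prod (I : Type) (r : seq I) (d : nat) F :
  (forall i, gr d (F i)) -> gr (d * size r) (\prod_(i <- r) F i).
Proof.
move=> hF; elim: r => [|i r IH]; first by rewrite big_nil muln0; apply: gr1.
by rewrite big_cons /= mulnS; apply: grM.
Qed.

Lemma gr_X i : gr (w i) (pi 'X_i).
Proof. by exists 'X_i => //; apply: homX. Qed.

Lemma gr_coef_ne n m x : gr n x -> m != n -> (grading x)`_m = 0.
Proof. by move=> /grP -> /negbTE ne; rewrite coefZ coefXn ne mulr0. Qed.

Lemma gr_coef_eq n x : gr n x -> (grading x)`_n = x.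
Proof. by move=> /grP ->; rewrite coefZ coefXn eqxx mulr1. Qed.

Lemma gr_div n m x y z : gr n x -> gr m y -> y != 0 -> x = y * z ->
  (x != 0 -> (m <= n)%N) /\ gr (n - m) z.
Proof.
move=> /grP hx /grP hy y0 E.
have E2 j : x * (j == n)%:R = y * (if (j < m)%N then 0 else (grading z)`_(j - m)).
  have := congr1 (fun u => (grading u)`_j) E.
  by rewrite rmorphM hx hy coefZ coefXn -scalerAl coefZ coefXnM.
case: (leqP m n) => [le|lt].
  split=> //; apply/grP; apply/polyP => j; rewrite coefZ coefXn.
  have := E2 (j + m)%N; rewrite ltnNge leq_addl /= addnK.
  have -> : ((j + m)%N == n) = (j == (n - m)%N).
    by rewrite -{1}(subnK le) eqn_add2r.
  by rewrite E -mulrA => /(mulfI y0) <-.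
have x0 : x = 0 by have := E2 n; rewrite eqxx lt mulr1 mulr0.
have z0 : z = 0 by apply/eqP; have /esym/eqP := E; rewrite x0 mulf_eq0 (negbTE y0).
by rewrite x0 eqxx z0; split => //; apply: gr0.
Qed.

Lemma gr0_cst x : gr 0 x -> exists y, x = cst y.
Proof.
move=> [p hp <-]; exists p@_0%MM; rewrite /structure_map; congr (pi _).
apply/mpolyP => m; rewrite mcoeffC; case: eqP => [->|ne]; first by rewrite mulr1.
rewrite mulr0; apply/eqP; rewrite mcoeff_eq0; apply/negP => /(hom_wdeg hp).
rewrite wdegE => /eqP; rewrite sum_nat_eq0 => /forallP /= m0.
apply: ne; apply/mnmP => i; have := m0 i.
by rewrite mnm0E muln_eq0 (gtn_eqF (wt_gt0 H i)) orbF => /eqP.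
Qed.

(** This stands in for the transcendence degree of Frac R, both in the bound on the dimension and in
    eliminations. *)
Lemma alg_dependent (X : 'I_3 -> R) :
  exists F : {mpoly k[3]}, F != 0 /\ mmap cst X F = 0.
Proof.
have [Y hY] : exists Y, forall i, pi (Y i) = X i.
  exists (fun i => projT1 (cid (pi_surj H (X i)))) => i; by case: cid.
have [F [F0 [e E]]] := alg_dependent_mod Y (f_neq0 H).
exists F; split=> //; have : pi (mmap (@mpolyC 3 k) Y F) = 0.
  by apply/(pi_ker H); exists e.
rewrite [in X in X -> _]/mmap rmorph_sum => <-; apply: eq_bigr => m _.
rewrite rmorphM; congr (_ * _); rewrite /mmap1 rmorph_prod.
by apply: eq_bigr => i _; rewrite rmorphXn hY.
Qed.

(** Powers of z lie outside the prime I, so the relation may be divided by the least of them; the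
    terms of higher exponent keep a factor z and disappear modulo J. *)
Lemma prime_chain_step (I J : {pred R}) (T : eqType) (s : seq T) (A : T -> R)
    (e : T -> nat) (z : R) :
  prime_ideal I -> prime_ideal J -> {subset I <= J} -> z \in J -> z \notin I ->
  s != [::] -> \sum_(m <- s) A m * z ^+ e m \in I ->
  exists2 s', subseq s' s & s' != [::] /\
    {in s' &, forall m m', e m = e m'} /\ \sum_(m <- s') A m \in J.
Proof.
move=> [Ii Ip] [[J0 _ Jl] _] IJ zJ zI; case: s => // m0 s _.
have [m1 m1s [r ->]] := mul_powers_min A e z (mem_head m0 s).
move=> /Ip /orP[|/IJ].
  have : z ^+ e m1 \notin I.
    elim: (e m1) => [|n IH]; first by rewrite expr0; case: Ii.
    by rewrite exprS; apply/negP => /Ip; rewrite (negbTE zI) (negbTE IH).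
  by move=> /negbTE ->.
rewrite -big_filter; set s' := [seq _ <- _ | _] => hJ; exists s'; first exact: filter_subseq.
have m1s' : m1 \in s' by rewrite mem_filter eqxx.
split; first by apply: contraTneq m1s' => ->.
split; first by move=> m m'; rewrite !mem_filter => /andP[/eqP -> _] /andP[/eqP ->].
have := Jl (- r) _ _ zJ hJ; congr (_ \in J); ring.
Qed.

(** Choose x_i in I_(i+1) outside I_i and a relation F(x0, x1, x2) = 0. Dividing out least powers of
    x0, x1, x2 in turn leaves monomials of F with equal exponents, hence a single one, and puts its
    nonzero scalar coefficient in I_3. *)
Lemma no_prime_chain3 : ~ prime_chain R 3.
Proof.
move=> [I [pI sI]].
have [S0 [x0 [x0J x0I]]] := sI 0%N isT.
have [S1 [x1 [x1J x1I]]] := sI 1%N isT.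
have [S2 [x2 [x2J x2I]]] := sI 2%N isT.
pose X (i : 'I_3) := nth 0 [:: x0; x1; x2] i.
have [F [F0 FX]] := alg_dependent X.
have E : \sum_(m <- msupp F) (cst F@_m * x2 ^+ m 2%:R * x1 ^+ m 1) * x0 ^+ m 0 \in I 0%N.
  have -> : \sum_(m <- msupp F) (cst F@_m * x2 ^+ m 2%:R * x1 ^+ m 1) * x0 ^+ m 0 =
            mmap cst X F.
    apply: eq_bigr => m _; rewrite /mmap1 !big_ord_recl big_ord0 mulr1 /=.
    rewrite (_ : lift _ _ = 1); last exact/val_inj.
    rewrite (_ : lift _ _ = 2%:R); last exact/val_inj.
    by rewrite /X /=; ring.
  by rewrite FX; have [[]] := pI 0%N isT.
have s0 : msupp F != [::] by rewrite msupp_eq0.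
have [s1 sub1 [n1 [e1 E1]]] := prime_chain_step (pI 0%N isT) (pI 1%N isT) S0 x0J x0I s0 E.
have [s2 sub2 [n2 [e2 E2]]] := prime_chain_step (pI 1%N isT) (pI 2%N isT) S1 x1J x1I n1 E1.
have [s3 sub3 [n3 [e3 E3]]] := prime_chain_step (pI 2%N isT) (pI 3%N isT) S2 x2J x2I n2 E2.
have sub31 := subseq_trans sub3 sub2; have sub30 := subseq_trans sub31 sub1.
case: s3 n3 sub3 e3 E3 sub31 sub30 => // m s3 _ sub3 e3 E3 sub31 sub30.
have m0 : m \in msupp F by apply: (mem_subseq sub30); rewrite mem_head.
have s3E : s3 = [::].
  case: s3 sub3 e3 E3 sub31 sub30 => // m' s3 sub3 e3 _ sub31 sub30.
  have mm' : m = m'.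
    have i0 : m \in [:: m, m' & s3] by rewrite mem_head.
    have i1 : m' \in [:: m, m' & s3] by rewrite !inE eqxx orbT.
    apply/mnmP => i; have : i \in [:: 0; 1; 2%:R] by case: i => [[|[|[|]]]].
    rewrite !inE => /or3P[]/eqP ->; last exact: e3.
      by apply: e1; apply: (mem_subseq sub31).
    by apply: e2; apply: (mem_subseq sub3).
  by have := subseq_uniq sub30 (msupp_uniq F); rewrite /= mm' !inE eqxx.
have [[_ n1I cI] _] := pI 3%N isT.
move: E3; rewrite s3E big_seq1 => E3; case/negP: n1I.
have [[I0 _ _] _] := pI 3%N isT.
have := cI (cst (F@_m)^-1) _ _ E3 I0; rewrite addr0 -rmorphM mulVf ?rmorph1 //.
by rewrite -mcoeff_msupp.
Qed.

End GradedHypersurface.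

(** * Elimination: products of linear forms in a principal ideal *)

Section BinaryForms.

Variables (k : closedFieldType) (a b c : nat) (R : idomainType).
Variables (pi : {rmorphism {mpoly k[3]} -> R}) (h : nat) (f : {mpoly k[3]}).
Hypothesis H : hsurf a b c pi h f.

Local Notation gr := (piece a b c pi).
Local Notation cst := (structure_map pi).

(* X, Y, G satisfy a relation over k, homogeneous for the weights d, d, e; it
   is divided by a power of G and then read modulo G.  Homogeneous binary
   forms over k are products of linear ones. *)
Lemma binary_form_in_ideal d e X Y G : gr d X -> gr d Y -> (0 < d)%N ->
  gr e G -> G != 0 ->
  exists (s : seq k) (j : nat) (r : R),
    Y ^+ j * \prod_(z <- s) (X - cst z * Y) = G * r.
Proof.
move=> hX hY d0 hG G0; have [->|Y0] := eqVneq Y 0.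
  by exists [::], 1%N, 0; rewrite mulr0 expr1 mul0r.
pose V (i : 'I_3) := nth 0 [:: X; Y; G] i.
have [F [F0 FV]] := alg_dependent H V.
(* Applying the grading of R to F(X, Y, G) = 0 shows that every part of F homogeneous for the
   weights d, d, e vanishes at (X, Y, G). *)
have gE : gmap d d e cst V F = 0.
  rewrite -(rmorph0 (grading H)) -FV [in RHS]/mmap rmorph_sum /gmap /mmap.
  apply: eq_bigr => m _; rewrite rmorphM; congr (_ * _).
    by have /(grP H) -> := gr_cst a b c pi F@_m; rewrite expr0 alg_polyC.
  rewrite /mmap1 rmorph_prod; apply: eq_bigr => i _; rewrite rmorphXn; congr (_ ^+ _).
  have : gr (wt d d e i) (V i) by case: i => [[|[|[|]]]].
  by move/(grP H) => ->.
have [D FD0] : exists D, pihomog (wdeg d d e) D F != 0.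
  apply/not_existsP => all0; case/eqP: F0; have [N hN] := mpoly_hparts d d e F.
  rewrite (hN N (leqnn _)) big1 // => i _; apply/eqP/negPn/negP; exact: all0.
set F1 := pihomog _ _ _ in FD0; have hF1 : F1 \is D.-homog for (wdeg d d e) by apply: pihomogP.
have F1V : mmap cst V F1 = 0 by rewrite -gmap_coef gE coef0.
have [m0 ms0] : exists m0, m0 \in msupp F1.
  by case: (msupp F1) (msupp_eq0 F1) FD0 => [|m s]; [move=> <-|exists m; rewrite mem_head].
have [m1 m1s [r Er]] := mul_powers_min
  (fun m : 'X_{1..3} => cst F1@_m * X ^+ m 0 * Y ^+ m 1)
  (fun m : 'X_{1..3} => m 2%:R) G ms0.
have E0 : \sum_(m <- msupp F1 | m 2%:R == m1 2%:R) cst F1@_m * X ^+ m 0 * Y ^+ m 1 = G * (- r).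
  rewrite mulrN; apply/eqP; rewrite -addr_eq0; move: Er.
  have -> : \sum_(m <- msupp F1) cst F1@_m * X ^+ m 0 * Y ^+ m 1 * G ^+ m 2%:R =
            mmap cst V F1.
    apply: eq_bigr => m _; rewrite /mmap1 !big_ord_recl big_ord0 mulr1 /=.
    rewrite (_ : lift _ _ = 1); last exact/val_inj.
    rewrite (_ : lift _ _ = 2%:R); last exact/val_inj.
    by rewrite /V /= !mulrA.
  rewrite F1V => /esym/eqP; rewrite mulf_eq0 expf_eq0 (negbTE G0) andbF /=.
  by [].
(* The retained monomials have the same exponent of G, hence by homogeneity and d > 0 the same total
   degree n in X and Y. *)
pose n := (m1 0%R + m1 1%R)%N.
have hn m : m \in msupp F1 -> m 2%:R == m1 2%:R -> (m 0%R + m 1%R = n)%N.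
  have wE m' : wdeg d d e m' = ((m' 0%R + m' 1%R) * d + m' 2%R * e)%N.
    rewrite wdegE !big_ord_recl big_ord0 /wt /=.
    rewrite (_ : lift _ _ = 1); last exact/val_inj.
    rewrite (_ : lift _ _ = 2%:R); last exact/val_inj.
    by rewrite addn0 mulnDl addnA.
  move=> mF /eqP m2; have := hom_wdeg hF1 mF.
  rewrite -(hom_wdeg hF1 m1s) !wE m2 => /eqP.
  by rewrite eqn_add2r eqn_mul2r gtn_eqF //= => /eqP.
pose P : {poly k} := \sum_(m <- msupp F1 | m 2%:R == m1 2%:R) F1@_m *: 'X^(m 0).
have P0 : P != 0.
  apply/eqP => /(congr1 (fun p : {poly k} => p`_(m1 0))); rewrite coef0 coef_sum.
  rewrite -big_filter (bigD1_seq m1) ?mem_filter ?eqxx ?filter_uniq //=.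
  rewrite coefZ coefXn eqxx mulr1 big_seq_cond big1; last first.
    move=> m; rewrite mem_filter -andbA => /and3P[/eqP m2 mF ne]; rewrite coefZ coefXn; case: eqP => [m10|_]; last exact: mulr0.
    case/eqP: ne; apply/mnmP => i; have : i \in [:: 0; 1; 2%:R] by case: i => [[|[|[|]]]].
    have := hn m mF (introT eqP m2); rewrite /n -m10 => /addnI m11.
    by rewrite !inE => /or3P[]/eqP ->.
  by rewrite addr0; apply/eqP; rewrite -mcoeff_msupp.
rewrite -big_filter in E0; set S := [seq _ <- _ | _] in E0.
have PE : P = \sum_(m <- S) F1@_m *: 'X^(m 0) by rewrite /P -big_filter.
have Sn : forall m, m \in S -> (m 0%R + m 1%R = n)%N.
  by move=> m; rewrite mem_filter => /andP[m2 mF]; apply: hn.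
have [|zs [szs Es Ez]] := @homogenized_split _ _ cst X Y _ S _ (fun m => m 0%R) n P Y0 _ PE P0.
  by move=> m /Sn <-; rewrite leq_addr.
exists zs, (n - size zs)%N, (cst (lead_coef P)^-1 * - r).
have l0 : lead_coef P != 0 by rewrite lead_coef_eq0.
have ll : cst (lead_coef P)^-1 * cst (lead_coef P) = 1.
  by rewrite -rmorphM mulVf // rmorph1.
rewrite [RHS]mulrCA -E0 (_ : \sum_(m <- S) _ = \sum_(m <- S)
  cst F1@_m * X ^+ m 0 * Y ^+ (n - m 0%R)%N).
  by rewrite Ez [RHS]mulrA [in RHS]mulrA ll mul1r.
by apply: eq_big_seq => m /Sn <-; rewrite addKn.
Qed.

End BinaryForms.

(** * Prime ideals and points of the curve *)

Section PrimeIdeals.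

Variables (R : comNzRingType) (I : {pred R}).
Hypothesis pI : prime_ideal I.

Lemma pid0 : 0 \in I. Proof. by case: pI => [[]]. Qed.

Lemma pid1 : (1 \in I) = false. Proof. by case: pI => [[_ /negbTE]]. Qed.

Lemma pidD x y : x \in I -> y \in I -> x + y \in I.
Proof. by case: pI => [[_ _ cl] _] xI yI; have := cl 1 x y xI yI; rewrite mul1r. Qed.

Lemma pidMl x y : y \in I -> x * y \in I.
Proof. by case: pI => [[I0 _ cl] _] yI; have := cl x y 0 yI I0; rewrite addr0. Qed.

Lemma pidMr x y : x \in I -> x * y \in I.
Proof. by rewrite mulrC; apply: pidMl. Qed.

Lemma pidN x : (- x \in I) = (x \in I).
Proof.
suff h y : y \in I -> - y \in I by apply/idP/idP => [/h|/h]; rewrite ?opprK.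
by rewrite -mulN1r; apply: pidMl.
Qed.

Lemma pidB x y : x \in I -> y \in I -> x - y \in I.
Proof. by move=> xI yI; apply: pidD; rewrite ?pidN. Qed.

Lemma pidM x y : (x * y \in I) = (x \in I) || (y \in I).
Proof.
by apply/idP/orP => [|[/pidMr|/pidMl]] //; case: pI => _ h /h /orP.
Qed.

Lemma pidX x n : (x ^+ n \in I) = (0 < n)%N && (x \in I).
Proof.
elim: n => [|n IH]; first by rewrite expr0 pid1.
by rewrite exprS pidM IH; case: (x \in I); rewrite ?andbF ?andbT.
Qed.

Lemma pid_sum (T : Type) (r : seq T) (P : pred T) F :
  (forall i, P i -> F i \in I) -> \sum_(i <- r | P i) F i \in I.
Proof. by move=> hF; apply: (big_ind (fun x => x \in I)) => //; [exact: pid0|exact: pidD]. Qed.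

Lemma pid_prod (T : Type) (r : seq T) F :
  (forall i, F i \notin I) -> \prod_(i <- r) F i \notin I.
Proof.
move=> hF; apply: (big_ind (fun x => x \notin I)) => [|x y|i _]; rewrite ?pid1 // pidM negb_or.
by move=> -> ->.
Qed.

Lemma pid_prodP (T : eqType) (r : seq T) F :
  \prod_(i <- r) F i \in I -> exists2 i, i \in r & F i \in I.
Proof.
elim: r => [|i r IH]; first by rewrite big_nil pid1.
rewrite big_cons pidM => /orP[h|/IH[j jr h]].
  by exists i; rewrite ?mem_head.
by exists j; rewrite // in_cons jr orbT.
Qed.

Lemma pid_eqr x y : x - y \in I -> (x \in I) = (y \in I).
Proof.
move=> h; apply/idP/idP => hx; last by rewrite -(subrK y x) pidD.
by rewrite -(subKr x y) pidB.
Qed.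

Lemma pid_congM x y x' y' : x - y \in I -> x' - y' \in I -> x * x' - y * y' \in I.
Proof.
move=> h h'; rewrite (_ : _ - _ = x' * (x - y) + y * (x' - y')); last by ring.
by rewrite pidD ?pidMl.
Qed.

Lemma pid_congX x y n : x - y \in I -> x ^+ n - y ^+ n \in I.
Proof.
move=> h; elim: n => [|n IH]; first by rewrite !expr0 subrr pid0.
by rewrite !exprS pid_congM.
Qed.

Lemma pid_cong_prod (T : Type) (r : seq T) (F G : T -> R) :
  (forall i, F i - G i \in I) -> \prod_(i <- r) F i - \prod_(i <- r) G i \in I.
Proof.
move=> h; elim: r => [|i r IH]; first by rewrite !big_nil subrr pid0.
by rewrite !big_cons pid_congM.
Qed.

End PrimeIdeals.

Lemma wdegMn a b c m n : wdeg a b c (m *+ n)%MM = (n * wdeg a b c m)%N.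
Proof. by elim: n => [|n IH]; rewrite ?mulm0n ?wdeg0 // mulmS wdegD IH mulSn. Qed.

(* q is the least positive difference of weights of monomials supported on I *)
Lemma bezout_monomials a b c (I : pred 'I_3) i0 : I i0 -> (0 < wt a b c i0)%N ->
  exists q m1 m2, [/\ (0 < q)%N, wdeg a b c m1 = (wdeg a b c m2 + q)%N,
    forall i, ~~ I i -> m1 i = 0%N /\ m2 i = 0%N &
    forall i, I i -> (q %| wt a b c i)%N].
Proof.
move=> Ii0 w0.
pose S q := (0 < q)%N /\ exists m1 m2 : 'X_{1..3},
  wdeg a b c m1 = (wdeg a b c m2 + q)%N /\
  forall i, ~~ I i -> m1 i = 0%N /\ m2 i = 0%N.
have ex : exists q, `[< S q >].
  exists (wt a b c i0); apply/asboolP; split=> //; exists U_(i0)%MM, 0%MM.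
  rewrite wdeg0 wdegU; split=> // i Ii; rewrite mnm0E mnm1E; split=> //.
  by case: eqP => // ii; move: Ii; rewrite -ii Ii0.
case: (ex_minnP ex) => q /asboolP[q0 [m1 [m2 [e supp]]]] min; exists q, m1, m2.
split=> // i Ii; apply: contraT => nd.
have r0 : (0 < wt a b c i %% q)%N by rewrite lt0n.
suff /min : `[< S (wt a b c i %% q)%N >] by rewrite leqNgt ltn_mod q0.
apply/asboolP; split=> //.
exists (U_(i) + m2 *+ (wt a b c i %/ q))%MM, (m1 *+ (wt a b c i %/ q))%MM.
split.
  rewrite wdegD wdegU !wdegMn e {1}(divn_eq (wt a b c i) q); lia.
move=> j Ij; have [h1 h2] := supp j Ij; rewrite mnmDE !mulmnE h1 h2 mnm1E.
by split=> //; case: eqP => // ij; move: Ij; rewrite -ij Ii.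
Qed.

Lemma ord3_cases (i j l : 'I_3) : j != i -> l != i -> j != l ->
  forall t : 'I_3, [\/ t = i, t = j | t = l].
Proof.
move=> ji li jl t; suff : [|| t == i, t == j | t == l].
  by case/or3P=> /eqP ->; [constructor 1|constructor 2|constructor 3].
move: ji li jl; rewrite -!val_eqE /=; move: (ltn_ord i) (ltn_ord j) (ltn_ord l) (ltn_ord t).
by lia.
Qed.

Lemma ord3_split (i : 'I_3) : exists j l : 'I_3, [/\ j != i, l != i & j != l].
Proof.
by case: i => [[|[|[|]]]] // p; [exists 1, 2%:R|exists 0, 2%:R|exists 0, 1].
Qed.

Lemma mpolyX_neq0 (k : fieldType) n (m : 'X_{1..n}) : 'X_[m] != 0 :> {mpoly k[n]}.
Proof. by rewrite -msupp_eq0 msuppX. Qed.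

Section Points.

Variables (k : closedFieldType) (a b c : nat) (R : idomainType).
Variables (pi : {rmorphism {mpoly k[3]} -> R}) (h : nat) (f : {mpoly k[3]}).
Hypothesis H : hsurf a b c pi h f.

Local Notation w := (wt a b c).
Local Notation hom n p := (p \is n.-homog for (wdeg a b c)).
Local Notation hpart := (pihomog (wdeg a b c)).
Local Notation gr := (piece a b c pi).
Local Notation cst := (structure_map pi).

(** The restriction of p to the orbit t -> (t^w_i p0_i), as a polynomial in t; a point P is given by
    p0 when P is the kernel of this restriction. *)
Definition chi (p0 : 'I_3 -> k) : {mpoly k[3]} -> {poly k} := gmap a b c idfun p0.

HB.instance Definition _ p0 := GRing.RMorphism.on (chi p0).

Lemma chi_hom p0 n p : hom n p -> chi p0 p = p.@[p0] *: 'X^n.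
Proof. exact: gmap_hom. Qed.

Lemma chi_hom_eq0 p0 n p : hom n p -> (chi p0 p == 0) = (p.@[p0] == 0).
Proof.
by move=> hp; rewrite (chi_hom _ hp) scaler_eq0 -size_poly_eq0 size_polyXn orbF.
Qed.

Lemma chi_coef p0 n p : (chi p0 p)`_n = (hpart n p).@[p0].
Proof. exact: gmap_coef. Qed.

Definition kpoint (P : point gr) (p0 : 'I_3 -> k) :=
  (exists i, p0 i != 0) /\ forall p, (pi p \in P) = (chi p0 p == 0).

Lemma kpoint_hom P p0 n p : kpoint P p0 -> hom n p -> (pi p \in P) = (p.@[p0] == 0).
Proof. by move=> [_ ->]; apply: chi_hom_eq0. Qed.

Lemma point_prime (P : point gr) : prime_ideal P.
Proof. by case: P. Qed.

Lemma point_eq (P Q : point gr) : (forall x, (x \in P) = (x \in Q)) -> P = Q.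
Proof.
case: P Q => [I p1 p2 p3 p4] [J q1 q2 q3 q4] /= E.
have EI : I = J by apply/funext => x; have := E x.
by subst J; congr Point; apply: Prop_irrelevance.
Qed.

Lemma point_coef (P : point gr) x n : x \in P -> (grading H x)`_n \in P.
Proof.
have pP := point_prime P.
case: P pP => I p1 p2 p3 p4 pP /= /p2 [N [s [hs ->]]].
rewrite rmorph_sum coef_sum; apply: pid_sum => // i _.
have [gi si] := hs i; have [<-|ne] := eqVneq (i : nat) n.
  by rewrite (gr_coef_eq H gi).
by rewrite (gr_coef_ne H gi) ?pid0 // eq_sym.
Qed.

Lemma point_coefP (P : point gr) x :
  (forall n, (grading H x)`_n \in P) -> x \in P.
Proof.
by move=> hx; rewrite (gr_decomp H x); apply: pid_sum => //; exact: point_prime.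
Qed.

Lemma point_gr_neq0 (P : point gr) :
  exists n x, [/\ gr n x, x \in P & x != 0].
Proof.
have [y [yP y0]] : exists y, y \in P /\ y != 0 by case: P => I p1 p2 p3 p4.
have : exists n, (grading H y)`_n != 0.
  apply/not_existsP => all0; case/eqP: y0; rewrite (gr_decomp H y) big1 // => i _.
  by apply/eqP/negPn/negP; apply: all0.
move=> [n yn]; exists n, (grading H y)`_n; split=> //; first exact: gr_coef.
exact: point_coef.
Qed.

Lemma mpolyX_prod3 m : pi 'X_[m] = \prod_i pi 'X_i ^+ m i.
Proof. by rewrite mpolyXE_id rmorph_prod; apply: eq_bigr => i _; rewrite rmorphXn. Qed.

Lemma mem_mpolyX (P : point gr) (m : 'X_{1..3}) i :
  pi 'X_i \in P -> (0 < m i)%N -> pi 'X_[m] \in P.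
Proof.
move=> iP mi; have pP := point_prime P.
by rewrite mpolyX_prod3 (bigD1 i) //= pidMr // pidX // mi.
Qed.

Lemma point_var (P : point gr) : exists i, pi 'X_i \notin P.
Proof.
have pP := point_prime P.
have [n [x [n0 [p hp <-] xP]]] : exists n x, [/\ (0 < n)%N, gr n x & x \notin P].
  by case: P {pP} => I p1 p2 p3 p4.
apply/not_existsP => all; case/negP: xP; rewrite (mpolyE p) rmorph_sum.
rewrite big_seq; apply: pid_sum => // m mp; rewrite -cstM pidMl //.
have [i mi] : exists i, (0 < m i)%N.
  apply/not_existsP => m0; move: n0; rewrite -(hom_wdeg hp mp) wdegE big1 // => i _.
  by have := m0 i; case: (m i).
apply: mem_mpolyX mi; apply/negPn/negP; exact: all.
Qed.

Lemma cst_notin (P : point gr) x : x != 0 -> cst x \notin P.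
Proof.
move=> x0; have pP := point_prime P; apply/negP => /(pidMl pP (cst x^-1)).
by rewrite -rmorphM mulVf // rmorph1 pid1.
Qed.

(** The residue field is k. For n > 0, a power of y times a product of forms x - z y is a multiple
    of a nonzero homogeneous element of P, so one of the factors x - z y is in the prime P. *)
Lemma residue (P : point gr) n x y : gr n x -> gr n y -> y \notin P ->
  exists z, x - cst z * y \in P.
Proof.
move=> hx hy yP; have pP := point_prime P; case: (posnP n) => [n0|n0].
  move: hx hy; rewrite n0 => /(gr0_cst H)[u ->] /(gr0_cst H)[v vE]; exists (u / v).
  have v0 : v != 0 by apply: contraNneq yP => v0; rewrite vE v0 rmorph0 pid0.
  by rewrite vE -rmorphM divfK // subrr pid0.
have [e [g [hg gP g0]]] := point_gr_neq0 P.
have [s [j [r E]]] := binary_form_in_ideal H hx hy n0 hg g0.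
have : y ^+ j * \prod_(z <- s) (x - cst z * y) \in P by rewrite E pidMr.
rewrite pidM // pidX // (negbTE yP) andbF /= => /(pid_prodP pP)[z _ hz].
by exists z.
Qed.

(** U1 / U2 is a unit at P whose degree q divides the weights of all variables outside P. The
    coordinate p0_i is the value at P of X_i (U2 / U1)^(w_i / q), which selects a representative of
    the orbit where U1 / U2 = 1. *)
Lemma kpoint_ex (P : point gr) : exists p0, kpoint P p0.
Proof.
have pP := point_prime P; have [i0 iP0] := point_var P.
pose I i := pi 'X_i \notin P.
have [q [m1 [m2 [q0 wm supp qdvd]]]] := @bezout_monomials a b c I i0 iP0 (wt_gt0 H i0).
pose U1 := pi 'X_[m1]; pose U2 := pi 'X_[m2].
have notP (m : 'X_{1..3}) : (forall i, ~~ I i -> m i = 0%N) -> pi 'X_[m] \notin P.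
  move=> hm; rewrite mpolyX_prod3 pid_prod // => i.
  have [Ii|/hm ->] := boolP (I i); last by rewrite expr0 pid1.
  by rewrite pidX // negb_and -/(I i) Ii orbT.
have U1P : U1 \notin P by apply: notP => i /supp[].
have U2P : U2 \notin P by apply: notP => i /supp[].
have gU1 : gr (wdeg a b c m1) U1 by exists 'X_[m1]; rewrite ?dhomogX ?eqxx.
have gU2 : gr (wdeg a b c m2) U2 by exists 'X_[m2]; rewrite ?dhomogX ?eqxx.
pose e i := (w i %/ q)%N.
have ex i : exists z, if I i then pi 'X_i * U2 ^+ e i - cst z * U1 ^+ e i \in P
                      else z == 0.
  case Ii: (I i); last by exists 0; apply: eqxx.
  apply: (@residue P (w i + wdeg a b c m2 * e i)%N); last by rewrite pidX // negb_and U1P orbT.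
    by apply: (grM H); [exact: gr_X | exact: (grXn H)].
  have -> : (w i + wdeg a b c m2 * e i = wdeg a b c m1 * e i)%N.
    by rewrite wm mulnDl addnC; congr addn; rewrite mulnC divnK // qdvd.
  exact: (grXn H).
pose p0 i := projT1 (cid (ex i)).
have p0P i : if I i then pi 'X_i * U2 ^+ e i - cst (p0 i) * U1 ^+ e i \in P else p0 i == 0.
  by rewrite /p0; case: cid.
have p0I i : (p0 i == 0) = ~~ I i.
  have := p0P i; have [Ii hi|_ ->] := boolP (I i) => //.
  apply/negbTE; apply/negP => /eqP pi0; move: hi; rewrite pi0 rmorph0 mul0r subr0.
  by rewrite pidM // [pi _ \in P](negbTE Ii) pidX // (negbTE U2P) andbF.
(* A monomial either contains a variable of P, and then both sides vanish, or has degree a multiple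
   of q and is compared with a power of U1 / U2. *)
have mono (m : 'X_{1..3}) : (exists2 i, ~~ I i & (0 < m i)%N) \/
    (q %| wdeg a b c m)%N /\
    pi 'X_[m] * U2 ^+ (wdeg a b c m %/ q) -
    cst (mmap1 p0 m) * U1 ^+ (wdeg a b c m %/ q) \in P.
  have [[i Ii mi]|no] := pselect (exists2 i, ~~ I i & (0 < m i)%N).
    by left; exists i.
  right.
  have mI i : ~~ I i -> m i = 0%N.
    by move=> Ii; apply/eqP; rewrite -leqn0 leqNgt; apply/negP => mi; apply: no; exists i.
  have wE : wdeg a b c m = ((\sum_i m i * e i) * q)%N.
    rewrite wdegE big_distrl /=; apply: eq_bigr => i _.
    have [Ii|/mI ->] := boolP (I i); last by rewrite !mul0n.
    by rewrite -mulnA divnK // qdvd.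
  split; first by rewrite wE dvdn_mull.
  rewrite wE mulnK // mpolyX_prod3 /mmap1 rmorph_prod -!prodrXr -!big_split /=.
  apply: pid_cong_prod => // i; rewrite [(m i * _)%N]mulnC !exprM rmorphXn -!exprMn.
  have [Ii|/mI ->] := boolP (I i); last by rewrite !expr0 subrr pid0.
  by apply: pid_congX => //; have := p0P i; rewrite Ii.
have nonsupp (m : 'X_{1..3}) i : ~~ I i -> (0 < m i)%N ->
    pi 'X_[m] \in P /\ mmap1 p0 m = 0.
  move=> Ii mi; split; first by apply: mem_mpolyX mi; move: Ii; rewrite negbK.
  rewrite /mmap1 (bigD1 i) //=; have /eqP -> : p0 i == 0 by rewrite p0I.
  by rewrite expr0n gtn_eqF // mul0r.
have homcase n p : hom n p -> (pi p \in P) = (p.@[p0] == 0).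
  move=> hp; have pE : p.@[p0] = \sum_(m <- msupp p) p@_m * mmap1 p0 m by [].
  have piE : pi p = \sum_(m <- msupp p) cst p@_m * pi 'X_[m].
    by rewrite {1}(mpolyE p) rmorph_sum; apply: eq_bigr => m _; rewrite cstM.
  (* If q does not divide n, every monomial of degree n contains a variable of P. *)
  have [qn|qn] := boolP (q %| n)%N; last first.
    have ns m : m \in msupp p -> pi 'X_[m] \in P /\ mmap1 p0 m = 0.
      move=> mp; have [[i Ii mi]|[qm _]] := mono m; first exact: nonsupp Ii mi.
      by move: qn; rewrite -(hom_wdeg hp mp) qm.
    rewrite pE piE big_seq pid_sum //; last first.
      by move=> m /ns[mP _]; apply: pidMl.
    by rewrite big_seq big1 ?eqxx // => m /ns[_ ->]; rewrite mulr0.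
  set j := (n %/ q)%N.
  have key : pi p * U2 ^+ j - cst p.@[p0] * U1 ^+ j \in P.
    rewrite pE piE rmorph_sum !mulr_suml -sumrB big_seq; apply: pid_sum => // m mp.
    have [[i Ii mi]|[_]] := mono m.
      have [mP ->] := nonsupp m i Ii mi; rewrite mulr0 rmorph0 mul0r subr0.
      by rewrite pidMr // pidMl.
    rewrite (hom_wdeg hp mp) -/j => hm; rewrite rmorphM -!mulrA -mulrBr.
    exact: pidMl.
  have -> : (pi p \in P) = (pi p * U2 ^+ j \in P).
    by rewrite pidM // pidX // (negbTE U2P) andbF orbF.
  rewrite (pid_eqr pP key) pidM // pidX // (negbTE U1P) andbF orbF.
  by have [->|/(cst_notin P)/negbTE //] := eqVneq p.@[p0] 0; rewrite rmorph0 pid0.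
exists p0; split; first by exists i0; rewrite p0I negbK.
move=> p; apply/idP/eqP => [pp|p00].
  apply/polyP => n; rewrite coef0 chi_coef; apply/eqP.
  by rewrite -(homcase n) ?pihomogP // -(grading_coef H) point_coef.
apply: point_coefP => n; rewrite (grading_coef H) (homcase n) ?pihomogP //.
by rewrite -chi_coef p00 coef0.
Qed.

Lemma h_gt0 : (0 < h)%N.
Proof.
rewrite lt0n; apply/eqP => h0; have fh := f_hom H; rewrite h0 in fh.
have [y E] : exists y, f = y%:MP.
  exists f@_0%MM; apply/mpolyP => m; rewrite mcoeffC.
  case: eqP => [->|ne]; first by rewrite mulr1.
  rewrite mulr0; apply/eqP; rewrite mcoeff_eq0; apply/negP => /(hom_wdeg fh).
  rewrite wdegE => /eqP; rewrite sum_nat_eq0 => /forallP /= m0.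
  apply: ne; apply/mnmP => i; have := m0 i.
  by rewrite mnm0E muln_eq0 (gtn_eqF (wt_gt0 H i)) orbF => /eqP.
have : cst y = 0 by rewrite /structure_map -E; apply/(pi_ker H); exists 1; rewrite mul1r.
by move/eqP; rewrite cst_eq0 => /eqP y0; case/eqP: (f_neq0 H); rewrite E y0 mpolyC0.
Qed.

End Points.

(** * Restriction of forms to the coordinate planes *)

Section PlaneSections.

Variables (k : closedFieldType) (a b c : nat).

Local Notation w := (wt a b c).
Local Notation hom n p := (p \is n.-homog for (wdeg a b c)).

Hypothesis w_gt0 : forall i, (0 < w i)%N.

Lemma wdeg3 i j l m : j != i -> l != i -> j != l ->
  wdeg a b c m = (m i * w i + m j * w j + m l * w l)%N.
Proof.
move=> ji li jl; rewrite wdegE (bigD1 i) //= (bigD1 j) //= (bigD1 l) /=; last by rewrite li eq_sym.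
rewrite big1 ?addn0 ?addnA // => t /andP[/andP[ti tj] tl].
by case: (ord3_cases ji li jl t) => e; move: ti tj tl; rewrite e eqxx.
Qed.

(* The part of p not divisible by X_i is a form in two variables, hence the
   product of monomials and binomials X_j^w_l' - z X_l^w_j'. *)
Lemma plane_split n p i j l : j != i -> l != i -> j != l -> hom n p ->
  let g := gcdn (w j) (w l) in
  (exists2 E : {mpoly k[3]}, hom (n - w i)%N E & p = 'X_i * E) \/
  exists (u : k) r s (zs : seq k) (E : {mpoly k[3]}),
    [/\ u != 0, 0 \notin zs, hom (n - w i)%N E,
      (r * w j + s * w l + size zs * (w j * (w l %/ g)) = n)%N &
      p = u *: ('X_j ^+ r * 'X_l ^+ s *
        \prod_(z <- zs) ('X_j ^+ (w l %/ g) - z *: 'X_l ^+ (w j %/ g))) + 'X_i * E].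
Proof.
move=> ji li jl hp g.
pose E := \sum_(m <- msupp p | m i != 0%N) p@_m *: 'X_[m - U_(i)] : {mpoly k[3]}.
pose S := [seq m : 'X_{1..3} <- msupp p | m i == 0%N].
have hE : hom (n - w i)%N E.
  rewrite /E big_seq_cond; apply: rpred_sum => m /andP[mp mi]; apply: rpredZ.
  rewrite dhomogX; apply/eqP/(@addIn (wdeg a b c U_(i))).
  rewrite -[LHS]wdegD submK ?lep1mP // wdegU (hom_wdeg hp mp) subnK //.
  by rewrite -(hom_wdeg hp mp) (wdeg3 m ji li jl) -addnA (leq_trans _ (leq_addr _ _)) // leq_pmull // lt0n.
have pE : p = \sum_(m <- S) p@_m *: 'X_[m] + 'X_i * E.
  rewrite {1}(mpolyE p) (bigID (fun m : 'X_{1..3} => m i == 0%N)) /= big_filter; congr (_ + _).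
  rewrite /E mulr_sumr; apply: eq_bigr => m mi; rewrite -scalerAr -mpolyXD addmC submK //.
  by rewrite lep1mP.
have [S0|S0] := eqVneq S [::].
  by left; exists E => //; rewrite {1}pE S0 big_nil add0r.
right.
have minS t : exists2 m0, m0 \in S & forall m, m \in S -> (m0 t <= m t)%N.
  have ex : exists n0, has (fun m : 'X_{1..3} => m t == n0) S.
    have [m mS] : exists m, m \in S.
      by move: S0; case: (S) => // m s _; exists m; rewrite mem_head.
    by exists (m t); apply/hasP; exists m.
  have [n0 /hasP[m1 m1s /eqP En] hn] := ex_minnP ex.
  by exists m1 => // m ms; rewrite En; apply: hn; apply/hasP; exists m.
have [mr mrS hr] := minS j; have [ms msS hs] := minS l.
have wS m : m \in S -> m i = 0%N /\ (m j * w j + m l * w l = n)%N.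
  rewrite mem_filter => /andP[/eqP mi mp]; split=> //.
  by rewrite -(hom_wdeg hp mp) (wdeg3 m ji li jl) mi.
have g0 : (0 < g)%N by rewrite gcdn_gt0 w_gt0.
set b' := (w l %/ g)%N; set a' := (w j %/ g)%N.
have wjE : w j = (a' * g)%N by rewrite divnK // dvdn_gcdl.
have wlE : w l = (b' * g)%N by rewrite divnK // dvdn_gcdr.
have b0 : (0 < b')%N by move: (w_gt0 l); rewrite wlE muln_gt0 => /andP[].
have a0 : (0 < a')%N by move: (w_gt0 j); rewrite wjE muln_gt0 => /andP[].
have cop : coprime b' a'.
  by rewrite /coprime -(eqn_pmul2r g0) muln_gcdl -wjE -wlE mul1n gcdnC.
(* Two monomials of equal degree in X_j and X_l differ by a power of X_j^b' / X_l^a', because a' and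
   b' are coprime. So the X_j-exponents in S form part of a progression of step b' starting at that
   of [mr]. *)
have step m m' : m \in S -> m' \in S -> (m' j <= m j)%N -> exists t,
    m j = (m' j + t * b')%N /\ m' l = (m l + t * a')%N.
  move=> /wS[_ e] /wS[_ e'] le.
  have E1 : ((m j - m' j) * a' + m l * b' = m' l * b')%N.
    apply/eqP; rewrite -(eqn_pmul2r g0); apply/eqP.
    have : (m j * w j + m l * w l = m' j * w j + m' l * w l)%N by rewrite e e'.
    rewrite wjE wlE -{1}(subnK le) => E0; apply: (@addnI (m' j * (a' * g))%N).
    by rewrite -[(_ * b' * g)%N]mulnA -E0; ring.
  have bd : (b' %| m j - m' j)%N.
    rewrite -(Gauss_dvdl _ cop); move/(congr1 (dvdn b')): E1.
    by rewrite (dvdn_addl _ (dvdn_mull (m l) (dvdnn b'))) (dvdn_mull (m' l) (dvdnn b')).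
  exists ((m j - m' j) %/ b')%N; rewrite divnK // subnKC //; split=> //.
  apply/eqP; rewrite -(eqn_pmul2r b0) mulnDl; apply/eqP; rewrite -E1 addnC.
  by congr addn; rewrite mulnAC divnK.
have tex m : exists t, m \in S -> m j = (mr j + t * b')%N.
  have [mS|] := boolP (m \in S); last by exists 0%N.
  by have [t [-> _]] := step m mr mS mrS (hr m mS); exists t.
pose t m := projT1 (cid (tex m)).
have tj m : m \in S -> m j = (mr j + t m * b')%N by rewrite /t; case: cid.
have sl m : m \in S -> (m l = ms l + (t ms - t m) * a')%N /\ (t m <= t ms)%N.
  move=> mS.
  have le : (m j <= ms j)%N.
    rewrite -(leq_pmul2r (w_gt0 j)); have [_ e] := wS m mS; have [_ e'] := wS ms msS.
    by rewrite -(leq_add2r (ms l * w l)) e' -e leq_add2l leq_mul2r hs ?orbT.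
  have [u [e1 e2]] := step ms m msS mS le.
  have : (t ms * b' = (t m + u) * b')%N.
    by move: e1; rewrite (tj m mS) (tj ms msS) mulnDl -addnA => /addnI.
  move/eqP; rewrite eqn_pmul2r // => /eqP ->; rewrite addKn leq_addr; split=> //.
have tinj : {in S &, injective t}.
  move=> m m' mS m'S e; apply/mnmP => v.
  have [mi _] := wS m mS; have [mi' _] := wS m' m'S.
  have [ml _] := sl m mS; have [ml' _] := sl m' m'S.
  have mj := tj m mS; have mj' := tj m' m'S.
  by case: (ord3_cases ji li jl v) => ->; rewrite ?mi ?mi' ?mj ?mj' ?ml ?ml' ?e.
pose P : {poly k} := \sum_(m <- S) p@_m *: 'X^(t m).
have PE : P = \sum_(m <- S) p@_m *: 'X^(t m) by [].
have uS : uniq S by rewrite filter_uniq // msupp_uniq.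
have Pco m : m \in S -> P`_(t m) = p@_m.
  move=> mS; rewrite PE coef_sum (bigD1_seq m) //= coefZ coefXn eqxx mulr1.
  rewrite big_seq_cond big1 ?addr0 // => m' /andP[m'S ne]; rewrite coefZ coefXn.
  by case: eqP => [/(tinj _ _ mS m'S) e|_]; [rewrite e eqxx in ne|rewrite mulr0].
have co0 m : m \in S -> p@_m != 0 by rewrite mem_filter mcoeff_msupp => /andP[].
have P0 : P != 0 by apply: contraNneq (co0 _ mrS) => e; rewrite -(Pco _ mrS) e coef0.
have Y0 : ('X_l ^+ a' : {mpoly k[3]}) != 0 by rewrite expf_neq0 // mpolyX_neq0.
have [|zs [szs Es Ez]] := @homogenized_split k _ (@mpolyC 3 k) ('X_j ^+ b') ('X_l ^+ a')
    _ S (fun m => p@_m) t (t ms) P Y0 _ PE P0; first by move=> m /sl[].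
have l0 : lead_coef P != 0 by rewrite lead_coef_eq0.
have szE : size zs = t ms.
  apply/eqP; rewrite eqn_leq szs /= -ltnS.
  have -> : (size zs).+1 = size P by rewrite {1}Es size_scale // size_prod_XsubC.
  rewrite ltnNge; apply/negP => /leq_sizeP/(_ _ (leqnn _)).
  by rewrite Pco // => /eqP; rewrite (negbTE (co0 _ msS)).
exists (lead_coef P), (mr j), (ms l), zs, E; split=> //.
(* The constant coefficient of P is the coefficient of [mr], the monomial of least X_j-exponent, so
   0 is not a root. *)
- apply/negP => z0; have : P.[0] == 0.
    by rewrite {1}Es hornerZ horner_prod (big_rem 0 z0) /= hornerXsubC subrr mul0r mulr0.
  have tr : t mr = 0%N.
    by apply/eqP; rewrite -(eqn_pmul2r b0) -(eqn_add2l (mr j)) -(tj mr mrS) addn0.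
  by rewrite horner_coef0 -tr Pco // (negbTE (co0 _ mrS)).
- have [_ <-] := wS ms msS; rewrite (tj ms msS) szE -/b'; ring.
rewrite {1}pE; congr (_ + _).
transitivity (('X_j ^+ mr j * 'X_l ^+ ms l) * \sum_(m <- S)
    (p@_m)%:MP * ('X_j ^+ b') ^+ t m * ('X_l ^+ a') ^+ (t ms - t m)).
  rewrite mulr_sumr; apply: eq_big_seq => m mS; have [mi _] := wS m mS.
  have [ml _] := sl m mS; rewrite -mul_mpolyC mpolyXE_id (bigD1 i) //= mi expr0 mul1r.
  rewrite (bigD1 j) //= (bigD1 l) /=; last by rewrite li eq_sym.
  rewrite big1 ?mulr1; last first.
    move=> v /andP[/andP[vi vj] vl].
    by case: (ord3_cases ji li jl v) => e; move: vi vj vl; rewrite e eqxx.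
  rewrite (tj m mS) ml !exprD [(t m * b')%N]mulnC [((t ms - t m) * a')%N]mulnC !exprM.
  by rewrite -(mulrA (p@_m)%:MP) [RHS]mulrCA mulrACA.
rewrite Ez szE subnn expr0 mulr1 -mul_mpolyC mulrCA; congr (_ * (_ * _)).
by apply: eq_bigr => z _; rewrite mul_mpolyC.
Qed.

End PlaneSections.

Section MorePoints.

Variables (k : closedFieldType) (a b c : nat) (R : idomainType).
Variables (pi : {rmorphism {mpoly k[3]} -> R}) (h : nat) (f : {mpoly k[3]}).
Hypothesis H : hsurf a b c pi h f.

Local Notation w := (wt a b c).
Local Notation hom n p := (p \is n.-homog for (wdeg a b c)).
Local Notation gr := (piece a b c pi).

Lemma closed_root (n : nat) (z : k) : (0 < n)%N -> exists x, x ^+ n = z.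
Proof.
move=> n0; have [|x] := closed_rootP ('X^n - z%:P : {poly k}) _.
  by rewrite size_XnsubC // eqSS -lt0n.
by rewrite /root !hornerE subr_eq0 => /eqP; exists x.
Qed.

(** On the plane X_i = 0 the form f is either zero or a product of monomials and binomials of
    positive degree h > 0, and each possible factor has a nontrivial zero. *)
Lemma f_plane_zero i : exists p0 : 'I_3 -> k,
  [/\ exists j, p0 j != 0, p0 i = 0 & f.@[p0] = 0].
Proof.
have [j [l [ji li jl]]] := ord3_split i.
have := plane_split (wt_gt0 H) ji li jl (f_hom H) => /=.
set g := gcdn _ _; case=> [[E _ ->]|[u [r [s [zs [E [u0 z0 _ e ->]]]]]]].
  exists (fun t => (t != i)%:R); split; first by exists j; rewrite ji oner_neq0.
    by rewrite eqxx.
  by rewrite mevalM mevalXU eqxx mul0r.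
pose ev (x y : k) t := if t == j then x else if t == l then y else 0 : k.
have evi x y : ev x y i = 0 by rewrite /ev [i == j]eq_sym [i == l]eq_sym (negbTE ji) (negbTE li).
have evj x y : ev x y j = x by rewrite /ev eqxx.
have evl x y : ev x y l = y by rewrite /ev eqxx eq_sym (negbTE jl).
have val x y : (u *: ('X_j ^+ r * 'X_l ^+ s *
      \prod_(z <- zs) ('X_j ^+ (w l %/ g) - z *: 'X_l ^+ (w j %/ g))) + 'X_i * E).@[ev x y] =
    u * (x ^+ r * y ^+ s * \prod_(z <- zs) (x ^+ (w l %/ g) - z * y ^+ (w j %/ g))).
  rewrite mevalD !(mevalM, mevalZ) mevalXU evi mul0r addr0 !rmorphXn /= !mevalXU evj evl.
  congr (_ * (_ * _)); rewrite rmorph_prod; apply: eq_bigr => z _ /=.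
  by rewrite mevalB mevalZ !rmorphXn /= !mevalXU evj evl.
case: (posnP r) => [r0|r0]; last first.
  exists (ev 0 1); split=> //; first by exists l; rewrite evl oner_neq0.
  by rewrite val expr0n gtn_eqF // !mul0r mulr0.
case: (posnP s) => [s0|s0]; last first.
  exists (ev 1 0); split=> //; first by exists j; rewrite evj oner_neq0.
  by rewrite val expr0n [s == _]gtn_eqF // mulr0 !mul0r mulr0.
case: zs z0 e val => [|z zs] z0 e val.
  by move: (h_gt0 H); rewrite -e r0 s0.
have lg : (0 < w l %/ g)%N.
  by rewrite divn_gt0 ?gcdn_gt0 ?(wt_gt0 H) // dvdn_leq ?(wt_gt0 H) // dvdn_gcdr.
have [x xE] := closed_root z lg; exists (ev x 1); split=> //.
  by exists l; rewrite evl oner_neq0.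
by rewrite val big_cons xE !expr1n !mulr1 subrr mul0r !mulr0.
Qed.

Lemma chi_kernel p0 p : f.@[p0] = 0 -> pi p = 0 -> chi a b c p0 p = 0.
Proof.
move=> f0 /(pi_ker H)[q ->]; rewrite rmorphM /= (chi_hom _ (f_hom H)) f0.
by rewrite scale0r mulr0.
Qed.

Lemma chi_X (p0 : 'I_3 -> k) i : chi a b c p0 'X_i = p0 i *: 'X^(w i).
Proof. by rewrite (chi_hom _ (homX _ _ _ _ i)) mevalXU. Qed.

Lemma chi_neq0 p0 (n : nat) : p0 *: 'X^n == 0 :> {poly k} = (p0 == 0).
Proof. by rewrite scaler_eq0 -[X in _ || X]size_poly_eq0 size_polyXn orbF. Qed.

(* The ideal of p0 is nonzero: the binomials x_j^w_i - z x_i^w_j through p0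
   cannot all vanish on a point of the curve with x_i = 0. *)
Lemma point_of_kpoint p0 : (exists i, p0 i != 0) -> f.@[p0] = 0 ->
  exists P : point gr, kpoint P p0.
Proof.
move=> [i pi0] fp0.
have [ch chE'] := rmorphism_factor (pi_surj H) (fun p => @chi_kernel p0 p fp0).
have chE p : ch (pi p) = chi a b c p0 p := chE' p.
pose I : {pred R} := fun x => ch x == 0.
have IE x : (x \in I) = (ch x == 0) by [].
have pI : prime_ideal I.
  split.
    split; rewrite ?IE ?rmorph0 ?rmorph1 ?oner_neq0 // => x y z; rewrite !IE.
    by move=> /eqP y0 /eqP z0; rewrite rmorphD rmorphM y0 z0 mulr0 addr0.
  by move=> x y; rewrite !IE rmorphM mulf_eq0.
have hI x : x \in I -> exists n (s : 'I_n -> R),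
    (forall i : 'I_n, gr i (s i) /\ s i \in I) /\ x = \sum_i s i.
  move=> xI; exists (size (grading H x)), (fun i => (grading H x)`_i).
  split; last exact: gr_decomp.
  move=> t; split; first exact: gr_coef.
  move: (t : nat) xI => n; have [p <-] := pi_surj H x.
  rewrite !IE (grading_coef H) !chE => /eqP e; rewrite (chi_hom _ (pihomogP _ _ _)) -chi_coef e coef0.
  by rewrite scale0r.
have nI : exists n x, [/\ (0 < n)%N, gr n x & x \notin I].
  exists (w i), (pi 'X_i); split; [exact: (wt_gt0 H) | exact: gr_X|].
  by rewrite IE chE chi_X chi_neq0.
have zI : exists x, x \in I /\ x != 0.
  have [p1 [[j p1j] p1i fp1]] := f_plane_zero i.
  pose z := p0 j ^+ w i / p0 i ^+ w j.
  exists (pi ('X_j ^+ w i - z *: 'X_i ^+ w j)); split.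
    rewrite IE chE rmorphB /= -mul_mpolyC rmorphM /= !rmorphXn /= !chi_X.
    rewrite (chi_hom _ (homC _ _ _ z)) mevalC expr0 alg_polyC mul_polyC.
    rewrite !exprZn scalerA divfK ?expf_neq0 // -!exprM mulnC subrr.
    exact: eqxx.
  apply/eqP => /(chi_kernel fp1).
  rewrite rmorphB /= -mul_mpolyC rmorphM /= !rmorphXn /= !chi_X p1i scale0r.
  rewrite expr0n gtn_eqF ?(wt_gt0 H) // mulr0 subr0 exprZn -exprM => /eqP.
  by rewrite chi_neq0 expf_eq0 (negbTE p1j) andbF.
exists (Point pI hI nI zI); split; first by exists i.
by move=> p; rewrite -chE.
Qed.

Lemma plane_point i : exists P : point gr, pi 'X_i \in P.
Proof.
have [p0 [ex p0i f0]] := f_plane_zero i.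
have [P [_ hP]] := point_of_kpoint ex f0; exists P.
by rewrite hP chi_X p0i scale0r.
Qed.

Lemma other_point (P : point gr) : exists Q : point gr, Q <> P.
Proof.
have [i iP] := point_var P; have [Q iQ] := plane_point i.
by exists Q => E; move: iP; rewrite -E iQ.
Qed.

(** [Phi] is the grading of k[u,v,w] itself: it sends a multiple of f to a multiple of T^h, which
    has no coefficient in degree n < h. *)
Lemma pi_small n p : hom n p -> (n < h)%N -> pi p = 0 -> p = 0.
Proof.
move=> hp lt /(pi_ker H)[q E].
pose Phi := gmap a b c (structure_map (idfun : {rmorphism {mpoly k[3]} -> {mpoly k[3]}})) (fun i => 'X_i).
have PhiE m r : hom m r -> Phi r = r *: 'X^m.
  move=> hr; rewrite /Phi (gmap_hom _ _ hr); congr (_ *: _).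
  exact: (pi_mmap (idfun : {rmorphism {mpoly k[3]} -> {mpoly k[3]}})).
have := congr1 (fun u : {poly {mpoly k[3]}} => u`_n) (congr1 Phi E).
have PhiM : Phi (q * f) = Phi q * Phi f by rewrite /Phi; exact: rmorphM.
rewrite PhiM (PhiE n) // (PhiE _ _ (f_hom H)) -scalerAr !coefZ coefXn coefMXn lt.
by rewrite eqxx mulr0 mulr1.
Qed.

Lemma pi_X_neq0 i : (w i < h)%N -> pi 'X_i != 0.
Proof.
move=> lt; apply/eqP => e0; have /eqP := pi_small (homX k a b c i) lt e0.
by rewrite (negbTE (mpolyX_neq0 _ _)).
Qed.

End MorePoints.

(** * Local coordinates and the gradient *)

Definition det3 (A : comNzRingType) (i j l : 'I_3) (u v w : 'I_3 -> A) : A :=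
  u i * (v j * w l - v l * w j) - u j * (v i * w l - v l * w i)
  + u l * (v i * w j - v j * w i).

Lemma det3_perm (A : comNzRingType) (i j l : 'I_3) (u v w : 'I_3 -> A) :
  j != i -> l != i -> j != l ->
  det3 i j l u v w = det3 0 1 2%:R u v w \/
  det3 i j l u v w = - det3 0 1 2%:R u v w.
Proof.
have all3 (x : 'I_3) : [\/ x = 0, x = 1 | x = 2%:R].
  by case: x => [[|[|[|]]]] // p; [constructor 1|constructor 2|constructor 3]; exact/val_inj.
by case: (all3 i) => ->; case: (all3 j) => ->; case: (all3 l) => -> // _ _ _;
  rewrite /det3; by [left; ring|right; ring].
Qed.

Lemma det3_rmorph (A B : comNzRingType) (g : {rmorphism A -> B}) i j l u v w :
  g (det3 i j l u v w) = det3 i j l (g \o u) (g \o v) (g \o w).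
Proof. by rewrite /det3 /= rmorphD rmorphB !rmorphM !rmorphB !rmorphM. Qed.

Section Frames.

Variables (k : closedFieldType) (a b c : nat).

Local Notation w := (wt a b c).
Local Notation hom n p := (p \is n.-homog for (wdeg a b c)).

Hypothesis w_gt0 : forall i, (0 < w i)%N.

Definition gradat (p0 : 'I_3 -> k) (p : {mpoly k[3]}) (t : 'I_3) : k := p^`M(t).@[p0].

(** The gradient of U1 / U2 at p0 times U2^2, that is U1 U2 dlog(U1 / U2), written without
    division. *)
Definition dlogat (p0 : 'I_3 -> k) (U1 U2 : {mpoly k[3]}) (t : 'I_3) : k :=
  U2.@[p0] * gradat p0 U1 t - U1.@[p0] * gradat p0 U2 t.

(* Local coordinates at p0: Ny, Nz are transversal to the orbit of p0, and U1 / U2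
   is a unit of degree q, the gcd of the weights of the nonzero coordinates. *)
Record frame (p0 : 'I_3 -> k) (q : nat) (m1 m2 : 'X_{1..3})
    (Ny Nz : {mpoly k[3]}) (dy dz : nat) : Prop := Frame {
  fr_q_gt0 : (0 < q)%N;
  fr_U_deg : wdeg a b c m1 = (wdeg a b c m2 + q)%N;
  fr_U_supp : forall i, p0 i = 0 -> m1 i = 0%N /\ m2 i = 0%N;
  fr_y_hom : hom dy Ny;
  fr_z_hom : hom dz Nz;
  fr_y0 : Ny.@[p0] = 0;
  fr_z0 : Nz.@[p0] = 0;
  fr_gen : forall n p, hom n p -> p.@[p0] = 0 ->
    exists N A B, 'X_[m2] ^+ N * p = A * Ny + B * Nz;
  fr_det : det3 0 1 2%:R (gradat p0 Ny) (gradat p0 Nz)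
             (dlogat p0 'X_[m1] 'X_[m2]) != 0;
  fr_dvd : forall n p, hom n p -> p.@[p0] != 0 -> (q %| n)%N }.

Lemma mnm1Mn (i t : 'I_3) n : (U_(i) *+ n)%MM t = ((i == t) * n)%N.
Proof. by rewrite mulmnE mnm1E. Qed.

Lemma dmonomial (p0 : 'I_3 -> k) m t :
  p0 t * gradat p0 'X_[m] t = (m t)%:R * ('X_[m] : {mpoly k[3]}).@[p0].
Proof.
rewrite /gradat mderivX mevalZ; case: (posnP (m t)) => [->|mt].
  by rewrite !mul0r mulr0.
have -> : 'X_[m] = 'X_t * 'X_[m - U_(t)] :> {mpoly k[3]}.
  by rewrite -mpolyXD addmC submK // lep1mP -lt0n.
by rewrite mevalM mevalXU mulrCA.
Qed.

Lemma gradatB p0 p q t : gradat p0 (p - q) t = gradat p0 p t - gradat p0 q t.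
Proof. by rewrite /gradat mderivB mevalB. Qed.

Lemma gradatZ p0 x p t : gradat p0 (x *: p) t = x * gradat p0 p t.
Proof. by rewrite /gradat mderivZ mevalZ. Qed.

Lemma meval_monomial_neq0 (p0 : 'I_3 -> k) (m : 'X_{1..3}) :
  (('X_[m] : {mpoly k[3]}).@[p0] != 0) <-> (forall i, p0 i = 0 -> m i = 0%N).
Proof.
rewrite mevalX; split=> [/prodf_neq0 ne i pi0|hm].
  by have := ne i isT; rewrite pi0 expr0n; case: (m i) => // m'; rewrite eqxx.
apply/prodf_neq0 => i _; have [/hm ->|ne] := eqVneq (p0 i) 0.
  by rewrite expr0 oner_neq0.
by rewrite expf_neq0.
Qed.

(** A monomial that does not vanish at p0 involves only variables nonzero at p0, whose weights q
    divides. *)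
Lemma hom_dvd (p0 : 'I_3 -> k) q : (forall i, p0 i != 0 -> (q %| w i)%N) ->
  forall n p, hom n p -> p.@[p0] != 0 -> (q %| n)%N.
Proof.
move=> hq n p hp; apply: contraNT => qn.
rewrite mevalE big_seq big1 // => m mp.
suff [i pi0 mi] : exists2 i, p0 i = 0 & m i != 0%N.
  by rewrite (bigD1 i) //= pi0 expr0n (negbTE mi) mul0r mulr0.
apply: contrapT => no; case/negP: qn; rewrite -(hom_wdeg hp mp) wdegE.
apply: dvdn_sum => i _; have [->|mi] := eqVneq (m i) 0%N; first by rewrite mul0n.
rewrite dvdn_mull // hq //; apply/eqP => pi0; apply: no; by exists i.
Qed.

Lemma bezout_nat m n : (0 < m)%N -> exists u v, (u * m = v * n + gcdn m n)%N.
Proof. by move=> m0; case: (egcdnP n m0) => u v e _; exists u, v. Qed.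

(** At a vertex X_i itself is the unit, of degree w_i, and the other two variables are transversal
    to the orbit. *)
Lemma frame1 (i j l : 'I_3) : j != i -> l != i -> j != l ->
  exists B, forall p0, p0 i != 0 -> p0 j = 0 -> p0 l = 0 ->
    exists q m1 m2 Ny Nz dy dz, frame p0 q m1 m2 Ny Nz dy dz /\
      (wdeg a b c m1 + wdeg a b c m2 + dy + dz <= B)%N.
Proof.
move=> ji li jl; exists (w i + w j + w l)%N => p0 pi0 pj pl.
exists (w i), U_(i)%MM, 0%MM, 'X_j, 'X_l, (w j), (w l).
rewrite wdegU wdeg0 addn0; split=> //; split.
- exact: w_gt0.
- by rewrite wdegU wdeg0.
- move=> t pt0; rewrite mnm0E mnm1E; split=> //; case: eqP => // it.
  by move: pi0; rewrite it pt0 eqxx.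
- exact: homX.
- exact: homX.
- by rewrite mevalXU.
- by rewrite mevalXU.
- move=> n p hp pp; exists 0%N; rewrite expr0 mul1r.
  have ij : i != j by rewrite eq_sym.
  have il : i != l by rewrite eq_sym.
  have := plane_split w_gt0 (i := l) (j := i) (l := j) il jl ij hp => /=.
  case=> [[E _ ->]|[u [r [s [zs [E [u0 z0 _ _ pE]]]]]]].
    by exists 0, E; rewrite mul0r add0r mulrC.
  case: s pE => [|s] pE; last first.
    exists (u *: ('X_i ^+ r * 'X_j ^+ s * \prod_(z <- zs)
       ('X_i ^+ (w j %/ gcdn (w i) (w j)) - z *: 'X_j ^+ (w i %/ gcdn (w i) (w j))))), E.
    rewrite pE [E * _]mulrC; congr (_ + _); rewrite -scalerAl exprSr; congr (_ *: _).
    by rewrite mulrA -!mulrA; congr (_ * (_ * _)); rewrite mulrC.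
  exfalso; move/eqP: pp; rewrite pE mevalD mevalZ !mevalM mevalXU pl mul0r addr0.
  rewrite !rmorphXn /= mevalXU expr0 mulr1 !mulf_eq0 (negbTE u0) expf_eq0 (negbTE pi0) andbF /=.
  rewrite rmorph_prod prodf_seq_eq0 => /hasP[z _ /=].
  rewrite mevalB mevalZ !rmorphXn /= !mevalXU pj expr0n gtn_eqF ?mulr0 ?subr0.
    by rewrite expf_eq0 (negbTE pi0) andbF.
  by rewrite divn_gt0 ?gcdn_gt0 ?w_gt0 // dvdn_leq ?w_gt0 // dvdn_gcdl.
- have gX t s : gradat p0 'X_t s = (t == s)%:R.
    rewrite /gradat mderivX mnm1E mevalZ mevalX; case: eqP => [->|_].
      rewrite mul1r big1 // => v _; rewrite (_ : _ v = 0%N) ?expr0 //.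
      by rewrite mnmBE subnn.
    by rewrite mul0r.
  have dl t : dlogat p0 'X_[U_(i)] 'X_[0] t = (i == t)%:R.
    rewrite /dlogat gX /gradat mpolyX0 mderivC meval0 mulr0 subr0.
    by rewrite meval1 mul1r.
  have : det3 i j l (gradat p0 'X_j) (gradat p0 'X_l) (dlogat p0 'X_[U_(i)] 'X_[0]) != 0.
    rewrite /det3 !gX !dl !eqxx [j == i](negbTE ji) [l == i](negbTE li).
    rewrite [j == l](negbTE jl) [l == j]eq_sym [i == j]eq_sym [i == l]eq_sym.
    rewrite (negbTE jl) (negbTE ji) (negbTE li).
    by rewrite !(mul0r, mulr0, mul1r, subr0, sub0r, addr0, oppr0, add0r, opprK) oner_neq0.
  set u1 := gradat _ _; set u2 := gradat _ _; set u3 := dlogat _ _ _.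
  by case: (det3_perm u1 u2 u3 ji li jl) => ->; rewrite ?oppr_eq0.
apply: hom_dvd => t; case: (ord3_cases ji li jl t) => -> //; first by rewrite pj eqxx.
by rewrite pl eqxx.
Qed.

(** With two nonzero coordinates, al w_i = be w_j + g makes X_i^al / X_j^be a unit of degree g. The
    transversal coordinates are X_l and the binomial of the orbit in the plane X_l = 0; the
    determinant is a unit because al a' - be b' = 1 in every characteristic. *)
Lemma frame2 (i j l : 'I_3) : j != i -> l != i -> j != l ->
  exists B, forall p0, p0 i != 0 -> p0 j != 0 -> p0 l = 0 ->
    exists q m1 m2 Ny Nz dy dz, frame p0 q m1 m2 Ny Nz dy dz /\
      (wdeg a b c m1 + wdeg a b c m2 + dy + dz <= B)%N.
Proof.
move=> ji li jl; set g := gcdn (w i) (w j).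
have [al [be e]] := bezout_nat (w j) (w_gt0 i); rewrite -/g in e.
set b' := (w j %/ g)%N; set a' := (w i %/ g)%N.
have g0 : (0 < g)%N by rewrite gcdn_gt0 w_gt0.
have wiE : w i = (a' * g)%N by rewrite divnK // dvdn_gcdl.
have wjE : w j = (b' * g)%N by rewrite divnK // dvdn_gcdr.
have e1 : (al * a' = be * b' + 1)%N.
  apply/eqP; rewrite -(eqn_pmul2r g0); apply/eqP.
  by rewrite mulnDl mul1n -!mulnA -wiE -wjE.
exists (al * w i + be * w j + b' * w i + w l)%N => p0 pi0 pj0 pl.
pose la := p0 i ^+ b' / p0 j ^+ a'.
pose Ny : {mpoly k[3]} := 'X_[U_(i) *+ b'] - la *: 'X_[U_(j) *+ a'].
exists g, (U_(i) *+ al)%MM, (U_(j) *+ be)%MM, Ny, 'X_l, (b' * w i)%N, (w l).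
have evX t n : ('X_[U_(t) *+ n] : {mpoly k[3]}).@[p0] = p0 t ^+ n.
  by rewrite -mpolyXn rmorphXn /= mevalXU.
have laE : la * p0 j ^+ a' = p0 i ^+ b' by rewrite divfK ?expf_neq0.
rewrite !wdegMn !wdegU; split=> //; split=> //.
- by rewrite !wdegMn !wdegU.
- move=> t pt0; rewrite !mnm1Mn; split; case: eqP => // tt.
    by move: pi0; rewrite tt pt0 eqxx.
  by move: pj0; rewrite tt pt0 eqxx.
- apply: rpredB; last apply: rpredZ; rewrite dhomogX; apply/eqP; rewrite -?[LHS]/(wdeg a b c _).
    by rewrite wdegMn wdegU.
  by rewrite wdegMn wdegU wiE wjE mulnCA.
- exact: homX.
- by rewrite /Ny mevalB mevalZ !evX laE subrr.
- by rewrite mevalXU.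
- move=> n p hp pp; exists 0%N; rewrite expr0 mul1r.
  have ij : i != j by rewrite eq_sym.
  have il : i != l by rewrite eq_sym.
  have := plane_split w_gt0 (i := l) (j := i) (l := j) il jl ij hp => /=.
  rewrite -/g -/b' -/a'; case=> [[E _ ->]|[u [r [s [zs [E [u0 z0 _ _ pE]]]]]]].
    by exists 0, E; rewrite mul0r add0r mulrC.
  move/eqP: pp; rewrite {1}pE mevalD mevalZ !mevalM mevalXU pl mul0r addr0.
  rewrite !rmorphXn /= !mevalXU !mulf_eq0 (negbTE u0) !expf_eq0 (negbTE pi0) (negbTE pj0) !andbF /=.
  rewrite rmorph_prod prodf_seq_eq0 => /hasP[z zzs /=].
  rewrite mevalB mevalZ !rmorphXn /= !mevalXU subr_eq0 => /eqP ez.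
  have zE : z = la by rewrite /la ez mulfK // expf_neq0.
  exists (u *: ('X_i ^+ r * 'X_j ^+ s * \prod_(z <- rem z zs) ('X_i ^+ b' - z *: 'X_j ^+ a'))), E.
  rewrite {1}pE (big_rem z) //= [E * _]mulrC; congr (_ + _).
  rewrite -scalerAl; congr (_ *: _); rewrite -[RHS]mulrA; congr (_ * _).
  by rewrite mulrC /Ny -!mpolyXn zE.
- have gl t (m : 'X_{1..3}) : m l = 0%N -> t = l -> gradat p0 'X_[m] t = 0.
    by move=> ml ->; rewrite /gradat mderivX ml mevalZ mul0r.
  have gZ t : gradat p0 'X_l t = (l == t)%:R.
    rewrite /gradat mderivX mnm1E mevalZ mevalX; case: eqP => [->|_].
      rewrite mul1r big1 // => v _; rewrite (_ : _ v = 0%N) ?expr0 //.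
      by rewrite mnmBE subnn.
    by rewrite mul0r.
  set U := dlogat _ _ _.
  have Ul : U l = 0.
    rewrite /U /dlogat !(gl l) ?mulr0 ?subrr // mnm1Mn.
      by rewrite (negbTE jl).
    by rewrite eq_sym (negbTE li).
  pose W := p0 i ^+ al * p0 j ^+ be; pose Y := p0 i ^+ b'.
  have ij : (i == j) = false by rewrite eq_sym (negbTE ji).
  have Ui : p0 i * U i = al%:R * W.
    rewrite /U /dlogat mulrBr ![p0 i * (_ * _)]mulrCA !dmonomial !evX !mnm1Mn eqxx (negbTE ji).
    by rewrite mul1n mul0n mul0r mulr0 subr0 /W; ring.
  have Uj : p0 j * U j = - (be%:R * W).
    rewrite /U /dlogat mulrBr ![p0 j * (_ * _)]mulrCA !dmonomial !evX !mnm1Mn eqxx ij.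
    by rewrite mul1n mul0n mul0r mulr0 sub0r /W; ring.
  have Yi : p0 i * gradat p0 Ny i = b'%:R * Y.
    rewrite gradatB gradatZ mulrBr [p0 i * (la * _)]mulrCA !dmonomial !evX !mnm1Mn eqxx (negbTE ji).
    by rewrite mul1n mul0n mul0r mulr0 subr0.
  have Yj : p0 j * gradat p0 Ny j = - (a'%:R * Y).
    rewrite gradatB gradatZ mulrBr [p0 j * (la * _)]mulrCA !dmonomial !evX !mnm1Mn eqxx ij.
    by rewrite mul1n mul0n mul0r sub0r mulrCA laE.
  have Yl : gradat p0 Ny l = 0.
    rewrite gradatB gradatZ !(gl l) ?mulr0 ?subrr // mnm1Mn.
      by rewrite (negbTE jl).
    by rewrite eq_sym (negbTE li).
  have : p0 i * p0 j * det3 i j l (gradat p0 Ny) (gradat p0 'X_l) U = - (W * Y).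
    rewrite /det3 !gZ Ul Yl eqxx (negbTE li) [l == j]eq_sym (negbTE jl).
    transitivity ((p0 j * gradat p0 Ny j) * (p0 i * U i) - (p0 i * gradat p0 Ny i) * (p0 j * U j)).
      by rewrite /=; ring.
    rewrite Ui Uj Yi Yj; transitivity ((be * b')%:R * (W * Y) - (al * a')%:R * (W * Y)).
      by rewrite !natrM; ring.
    by rewrite e1 natrD; ring.
  have ne : - (W * Y) != 0 by rewrite oppr_eq0 !mulf_neq0 ?expf_neq0.
  move=> dE; move: ne; rewrite -dE; apply: contraNneq => d0.
  by case: (det3_perm (gradat p0 Ny) (gradat p0 'X_l) U ji li jl) => ->;
    rewrite d0 ?oppr0 mulr0.
apply: hom_dvd => t; case: (ord3_cases ji li jl t) => ->.
- by rewrite wiE dvdn_mull.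
- by rewrite wjE dvdn_mull.
- by rewrite pl eqxx.
Qed.

(** Congruence modulo the ideal (Ny, Nz). *)
Definition cg (Ny Nz x y : {mpoly k[3]}) := exists A B, x - y = A * Ny + B * Nz.

Lemma cg_refl Ny Nz x : cg Ny Nz x x.
Proof. by exists 0, 0; rewrite subrr !mul0r addr0. Qed.

Lemma cg_sym Ny Nz x y : cg Ny Nz x y -> cg Ny Nz y x.
Proof. by move=> [A [B E]]; exists (- A), (- B); rewrite -opprB E; ring. Qed.

Lemma cg_add Ny Nz x y x' y' : cg Ny Nz x y -> cg Ny Nz x' y' -> cg Ny Nz (x + x') (y + y').
Proof.
move=> [A [B E]] [A' [B' E']]; exists (A + A'), (B + B').
have -> : x + x' - (y + y') = (x - y) + (x' - y') by ring.
by rewrite E E'; ring.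
Qed.

Lemma cg_mul Ny Nz x y x' y' : cg Ny Nz x y -> cg Ny Nz x' y' -> cg Ny Nz (x * x') (y * y').
Proof.
move=> [A [B E]] [A' [B' E']]; exists (x' * A + y * A'), (x' * B + y * B').
have -> : x * x' - y * y' = x' * (x - y) + y * (x' - y') by ring.
by rewrite E E'; ring.
Qed.

Lemma cg_exp Ny Nz x y n : cg Ny Nz x y -> cg Ny Nz (x ^+ n) (y ^+ n).
Proof.
move=> h; elim: n => [|n IH]; first exact: cg_refl.
by rewrite !exprS; apply: cg_mul.
Qed.

Lemma cg_scale Ny Nz z x y : cg Ny Nz x y -> cg Ny Nz (z *: x) (z *: y).
Proof.
by rewrite -!mul_mpolyC => h; apply: cg_mul => //; apply: cg_refl.
Qed.

Lemma cg_unscale Ny Nz z x y : z != 0 -> cg Ny Nz x (z *: y) -> cg Ny Nz y (z^-1 *: x).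
Proof.
by move=> z0 /(cg_scale z^-1); rewrite scalerA mulVf // scale1r => /cg_sym.
Qed.

(** Modulo (Ny, Nz) each X_t U2^(w_t / q) is a scalar multiple of U1^(w_t / q). Hence p U2^N is
    congruent to z U1^N for a scalar z, and evaluation at p0, where p vanishes and U1 does not,
    gives z = 0. *)
Lemma frame3_gen (i j l : 'I_3) (a' b' c' g' q al be ga ep : nat) (la mu : k)
    (Ny Nz : {mpoly k[3]}) (p0 : 'I_3 -> k) : j != i -> l != i -> j != l ->
  (0 < q)%N ->
  w i = (a' * g' * q)%N -> w j = (b' * g' * q)%N -> w l = (c' * q)%N ->
  (al * a' = be * b' + 1)%N -> (ga * g' = ep * c' + 1)%N ->
  la != 0 -> mu != 0 ->
  Ny = 'X_i ^+ b' - la *: 'X_j ^+ a' ->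
  Nz = 'X_i ^+ (al * c') - mu *: ('X_j ^+ (be * c') * 'X_l ^+ g') ->
  Ny.@[p0] = 0 -> Nz.@[p0] = 0 -> (forall i, p0 i != 0) ->
  forall n p, hom n p -> p.@[p0] = 0 ->
    exists N A B, ('X_j ^+ (be * ga) * 'X_l ^+ ep) ^+ N * p = A * Ny + B * Nz.
Proof.
move=> ji li jl q0 wi wj wl e1 e2 la0 mu0 NyE NzE Ny0 Nz0 pn0 n p hp pp.
pose V1 : {mpoly k[3]} := 'X_i ^+ al; pose V2 : {mpoly k[3]} := 'X_j ^+ be.
pose U1 := V1 ^+ ga; pose U2 := V2 ^+ ga * 'X_l ^+ ep.
have U2E : U2 = 'X_j ^+ (be * ga) * 'X_l ^+ ep by rewrite /U2 /V2 exprM.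
rewrite -U2E; pose C := cg Ny Nz.
have r1 : C ('X_i ^+ b') (la *: 'X_j ^+ a').
  by exists 1, 0; rewrite mul1r mul0r addr0 NyE.
have r2 : C (V1 ^+ c') (mu *: (V2 ^+ c' * 'X_l ^+ g')).
  by exists 0, 1; rewrite mul1r mul0r add0r NzE /V1 /V2 -!exprM.
(* V1 / V2 has degree g and U1 / U2 degree q. Multiplying by the power ep m of [r2] passes from one
   to the other; the exponents match since ga g' = ep c' + 1. *)
have lift X m z : C (X * V2 ^+ m) (z *: V1 ^+ m) ->
    exists z', C (X * U2 ^+ (m * g')) (z' *: U1 ^+ (m * g')).
  move=> h; have mu1 : mu ^+ (ep * m) != 0 by rewrite expf_neq0.
  have := cg_exp (ep * m) r2; rewrite exprZn => /(cg_unscale mu1) h2.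
  exists (z * (mu ^+ (ep * m))^-1); have := cg_mul h h2.
  have -> : X * V2 ^+ m * (V2 ^+ c' * 'X_l ^+ g') ^+ (ep * m) = X * U2 ^+ (m * g').
    rewrite /U2 !exprMn -!exprM -!mulrA; congr (_ * _); rewrite mulrA -exprD.
    congr (_ ^+ _ * _ ^+ _); last by ring.
    have -> : (ga * (m * g') = m * (ga * g'))%N by ring.
    by rewrite e2; ring.
  have -> // : z *: V1 ^+ m * ((mu ^+ (ep * m))^-1 *: V1 ^+ c' ^+ (ep * m)) =
            (z * (mu ^+ (ep * m))^-1) *: U1 ^+ (m * g').
  rewrite -scalerAl -scalerAr scalerA /U1 -!exprM -exprD; congr (_ *: _ ^+ _).
  have -> : (ga * (m * g') = m * (ga * g'))%N by ring.
  by rewrite e2; ring.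
have hi : exists z, C ('X_i * U2 ^+ (a' * g')) (z *: U1 ^+ (a' * g')).
  apply: (@lift _ _ (la ^+ be)^-1); apply: cg_unscale; first by rewrite expf_neq0.
  have := cg_mul (cg_refl Ny Nz 'X_i) (cg_exp be r1).
  rewrite exprZn -scalerAr /V1 /V2 -!exprM -exprS e1 addn1 mulnC [(a' * be)%N]mulnC.
  by [].
have hj : exists z, C ('X_j * U2 ^+ (b' * g')) (z *: U1 ^+ (b' * g')).
  apply: (@lift _ _ (la ^+ al)^-1); apply: cg_unscale; first by rewrite expf_neq0.
  have := cg_exp al r1; rewrite exprZn /V1 /V2 -!exprM -exprS [(b' * al)%N]mulnC.
  by rewrite [(a' * al)%N]mulnC e1 addn1.
have hl : exists z, C ('X_l * U2 ^+ c') (z *: U1 ^+ c').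
  exists (mu ^+ ga)^-1; apply: cg_unscale; first by rewrite expf_neq0.
  have := cg_exp ga r2; rewrite exprZn /U1 /U2 -!exprM [(c' * ga)%N]mulnC.
  congr (C _ (_ *: _)); rewrite !exprMn -!exprM mulrCA -exprS; congr (_ ^+ _ * _ ^+ _).
    by ring.
  by rewrite mulnC e2 addn1.
pose e t := (w t %/ q)%N.
have ht t : exists z, C ('X_t * U2 ^+ e t) (z *: U1 ^+ e t).
  by case: (ord3_cases ji li jl t) => ->; rewrite /e ?wi ?wj ?wl mulnK.
have wq t : w t = (e t * q)%N.
  by rewrite divnK //; case: (ord3_cases ji li jl t) => ->; rewrite ?wi ?wj ?wl dvdn_mull.
pose N := (n %/ q)%N.
have hm m : m \in msupp p -> exists z, C ('X_[m] * U2 ^+ N) (z *: U1 ^+ N).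
  move=> mp; have EN : N = (\sum_t m t * e t)%N.
    rewrite /N -(hom_wdeg hp mp).
    suff -> : wdeg a b c m = ((\sum_t m t * e t) * q)%N by rewrite mulnK.
    by rewrite wdegE big_distrl; apply: eq_bigr => t _; rewrite /= -mulnA -wq.
  pose z t := projT1 (cid (ht t)).
  have hz t : C ('X_t * U2 ^+ e t) (z t *: U1 ^+ e t) by rewrite /z; case: cid.
  exists (\prod_t z t ^+ m t).
  have -> : 'X_[m] * U2 ^+ N = \prod_t ('X_t * U2 ^+ e t) ^+ m t.
    rewrite mpolyXE_id EN -prodrXr -big_split; apply: eq_bigr => t _ /=.
    by rewrite [RHS]exprMn -[in RHS]exprM [(e t * _)%N]mulnC.
  have -> : (\prod_t z t ^+ m t) *: U1 ^+ N = \prod_t (z t *: U1 ^+ e t) ^+ m t.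
    rewrite -mul_mpolyC rmorph_prod EN -prodrXr -big_split; apply: eq_bigr => t _ /=.
    by rewrite [RHS]exprZn -[in RHS]exprM [(e t * _)%N]mulnC mul_mpolyC.
  rewrite !big_ord_recl !big_ord0 !mulr1.
  by apply: cg_mul; [|apply: cg_mul]; exact: (cg_exp _ (hz _)).
have [z hz] : exists z, C (p * U2 ^+ N) (z *: U1 ^+ N).
  rewrite {1}(mpolyE p) mulr_suml big_seq.
  elim/big_ind: _ => [|x y [z hz] [z' hz']|m mp].
  - by exists 0; rewrite scale0r; apply: cg_refl.
  - by exists (z + z'); rewrite scalerDl; apply: cg_add.
  - have [z hz] := hm m mp; exists (p@_m * z).
    by rewrite -scalerAl -scalerA; apply: cg_scale.
exists N; have [A [B E]] := hz; exists A, B; rewrite -E.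
suff -> : z = 0 by rewrite scale0r subr0 mulrC.
have /eqP := congr1 (meval p0) E.
rewrite mevalB mevalD !mevalM pp Ny0 Nz0 !mulr0 addr0 mul0r sub0r oppr_eq0 mevalZ mulf_eq0.
case/orP => [/eqP //|]; rewrite /U1 /V1 !rmorphXn /= mevalXU -!exprM expf_eq0 (negbTE (pn0 i)).
by rewrite andbF.
Qed.

(** Two Bezout relations, for (w_i, w_j) and for (g, w_l). The determinant is a product of values of
    monomials times (al a' - be b') (ga g' - ep c'), and both factors are 1. *)
Lemma frame3 (i j l : 'I_3) : j != i -> l != i -> j != l ->
  exists B, forall p0, (forall i, p0 i != 0) ->
    exists q m1 m2 Ny Nz dy dz, frame p0 q m1 m2 Ny Nz dy dz /\
      (wdeg a b c m1 + wdeg a b c m2 + dy + dz <= B)%N.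
Proof.
move=> ji li jl; set g := gcdn (w i) (w j); set q := gcdn g (w l).
have g0 : (0 < g)%N by rewrite gcdn_gt0 w_gt0.
have q0 : (0 < q)%N by rewrite gcdn_gt0 g0.
have [al [be e]] := bezout_nat (w j) (w_gt0 i); rewrite -/g in e.
have [ga [ep e']] := bezout_nat (w l) g0; rewrite -/q in e'.
pose b' := (w j %/ g)%N; pose a' := (w i %/ g)%N.
pose g' := (g %/ q)%N; pose c' := (w l %/ q)%N.
have gE : g = (g' * q)%N by rewrite divnK // dvdn_gcdl.
have wiE : w i = (a' * g)%N by rewrite divnK // dvdn_gcdl.
have wjE : w j = (b' * g)%N by rewrite divnK // dvdn_gcdr.
have wlE : w l = (c' * q)%N by rewrite divnK // dvdn_gcdr.
have e1 : (al * a' = be * b' + 1)%N.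
  apply/eqP; rewrite -(eqn_pmul2r g0); apply/eqP.
  by rewrite mulnDl mul1n -!mulnA -wiE -wjE.
have e2 : (ga * g' = ep * c' + 1)%N.
  apply/eqP; rewrite -(eqn_pmul2r q0); apply/eqP.
  by rewrite mulnDl mul1n -!mulnA -gE -wlE.
pose mA := (U_(i) *+ b')%MM; pose mB := (U_(j) *+ a')%MM.
pose mC := (U_(i) *+ (al * c'))%MM; pose mD := (U_(j) *+ (be * c') + U_(l) *+ g')%MM.
pose m1 := (U_(i) *+ (al * ga))%MM; pose m2 := (U_(j) *+ (be * ga) + U_(l) *+ ep)%MM.
have wAB : wdeg a b c mB = wdeg a b c mA.
  by rewrite /mA /mB !wdegMn !wdegU wiE wjE mulnCA.
have wCD : wdeg a b c mD = wdeg a b c mC.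
  rewrite /mC /mD wdegD !wdegMn !wdegU wlE.
  have -> : (al * c' * w i = c' * (al * w i))%N by ring.
  by rewrite e gE; ring.
have w12 : wdeg a b c m1 = (wdeg a b c m2 + q)%N.
  rewrite /m1 /m2 wdegD !wdegMn !wdegU.
  have -> : (al * ga * w i = ga * (al * w i))%N by ring.
  by rewrite e mulnDr e'; ring.
exists (wdeg a b c m1 + wdeg a b c m2 + wdeg a b c mA + wdeg a b c mC)%N => p0 pn0.
pose ev m := ('X_[m] : {mpoly k[3]}).@[p0].
have ev0 m : ev m != 0.
  by apply/meval_monomial_neq0 => t /eqP; rewrite (negbTE (pn0 t)).
pose la := ev mA / ev mB; pose mu := ev mC / ev mD.
pose Ny : {mpoly k[3]} := 'X_[mA] - la *: 'X_[mB].
pose Nz : {mpoly k[3]} := 'X_[mC] - mu *: 'X_[mD].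
exists q, m1, m2, Ny, Nz, (wdeg a b c mA), (wdeg a b c mC); split=> //.
have Ny0 : Ny.@[p0] = 0 by rewrite mevalB mevalZ -/(ev _) -/(ev mA) divfK ?subrr.
have Nz0 : Nz.@[p0] = 0 by rewrite mevalB mevalZ -/(ev _) -/(ev mC) divfK ?subrr.
split=> //.
- by move=> t /eqP; rewrite (negbTE (pn0 t)).
- apply: rpredB; last apply: rpredZ; rewrite dhomogX; apply/eqP; first by [].
  exact: wAB.
- apply: rpredB; last apply: rpredZ; rewrite dhomogX; apply/eqP; first by [].
  exact: wCD.
- move=> n p hp pp; rewrite /m2 mpolyXD -!mpolyXn.
  apply: (@frame3_gen i j l a' b' c' g' q al be ga ep la mu Ny Nz p0) hp pp => //.
  + by rewrite -mulnA -gE.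
  + by rewrite -mulnA -gE.
  + by rewrite mulf_neq0 ?invr_eq0.
  + by rewrite mulf_neq0 ?invr_eq0.
  + by rewrite /Ny -!mpolyXn.
  + by rewrite /Nz /mC /mD mpolyXD -!mpolyXn.
- set U := dlogat _ _ _.
  have UE t : p0 t * U t = ((m1 t)%:R - (m2 t)%:R) * (ev m1 * ev m2).
    by rewrite /U /dlogat mulrBr ![p0 t * (_ * _)]mulrCA !dmonomial -!/(ev _); ring.
  have YE t : p0 t * gradat p0 Ny t = ((mA t)%:R - (mB t)%:R) * ev mA.
    rewrite gradatB gradatZ mulrBr [p0 t * (la * _)]mulrCA !dmonomial -!/(ev _).
    rewrite [la * _]mulrCA /la divfK //; ring.
  have ZE t : p0 t * gradat p0 Nz t = ((mC t)%:R - (mD t)%:R) * ev mC.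
    rewrite gradatB gradatZ mulrBr [p0 t * (mu * _)]mulrCA !dmonomial -!/(ev _).
    rewrite [mu * _]mulrCA /mu divfK //; ring.
  have jiF : (j == i) = false by apply/negbTE.
  have ijF : (i == j) = false by rewrite eq_sym; apply/negbTE.
  have liF : (l == i) = false by apply/negbTE.
  have ilF : (i == l) = false by rewrite eq_sym; apply/negbTE.
  have jlF : (j == l) = false by apply/negbTE.
  have ljF : (l == j) = false by rewrite eq_sym; apply/negbTE.
  have E : p0 i * p0 j * p0 l * det3 i j l (gradat p0 Ny) (gradat p0 Nz) U =
      ev mA * ev mC * (ev m1 * ev m2).
    transitivity (det3 i j l (fun t => p0 t * gradat p0 Ny t)
      (fun t => p0 t * gradat p0 Nz t) (fun t => p0 t * U t)).
      by rewrite /det3; ring.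
    rewrite /det3 !UE !YE !ZE /mA /mB /mC /mD /m1 /m2 !mnmDE !mnm1Mn !eqxx.
    rewrite jiF ijF liF ilF jlF ljF !mul0n !mul1n !addn0 !add0n -/mA -/mC -/m1 -/m2.
    have E1 : (al%:R * a'%:R = be%:R * b'%:R + 1 :> k) by rewrite -!natrM e1 natrD.
    have E2 : (ga%:R * g'%:R = ep%:R * c'%:R + 1 :> k) by rewrite -!natrM e2 natrD.
    rewrite !natrM.
    move: (ev mA) (ev mC) (ev m1 * ev m2) => Y Z W.
    transitivity ((al%:R * a'%:R - be%:R * b'%:R) * (ga%:R * g'%:R - ep%:R * c'%:R) * (Y * Z * W)).
      by ring.
    by rewrite E1 E2; ring.
  have ne : ev mA * ev mC * (ev m1 * ev m2) != 0 by rewrite !mulf_neq0.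
  move: ne; rewrite -E; apply: contraNneq => d0.
  by case: (det3_perm (gradat p0 Ny) (gradat p0 Nz) U ji li jl) => ->;
    rewrite d0 ?oppr0 mulr0.
apply: hom_dvd => t _; case: (ord3_cases ji li jl t) => ->.
- by rewrite wiE gE dvdn_mull // dvdn_mull.
- by rewrite wjE gE dvdn_mull // dvdn_mull.
- by rewrite wlE dvdn_mull.
Qed.

(** The exponents of a frame depend only on which coordinates vanish, so the degrees are bounded
    uniformly in p0. The ampleness of D0 needs this: one multiple must serve all points. *)
Lemma frame_ex : exists B, forall p0 : 'I_3 -> k, (exists i, p0 i != 0) ->
  exists q m1 m2 Ny Nz dy dz, frame p0 q m1 m2 Ny Nz dy dz /\
    (wdeg a b c m1 + wdeg a b c m2 + dy + dz <= B)%N.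
Proof.
pose good (p0 : 'I_3 -> k) B := exists q m1 m2 Ny Nz dy dz,
  frame p0 q m1 m2 Ny Nz dy dz /\ (wdeg a b c m1 + wdeg a b c m2 + dy + dz <= B)%N.
have step (t : 'I_3 * 'I_3 * 'I_3) : exists B, forall p0 : 'I_3 -> k,
    let: (i, j, l) := t in [&& j != i, l != i & j != l] -> p0 i != 0 ->
    (p0 j = 0 -> p0 l = 0) -> good p0 B.
  case: t => [[i j] l]; have [/and3P[ji li jl]|_] := boolP [&& j != i, l != i & j != l];
    last by exists 0%N.
  have [B1 h1] := frame1 ji li jl; have [B2 h2] := frame2 ji li jl.
  have [B3 h3] := frame3 ji li jl.
  exists (B1 + B2 + B3)%N => p0 _ pi0 pjl.
  have [pj|pj] := eqVneq (p0 j) 0.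
    have [q [m1 [m2 [Ny [Nz [dy [dz [hf le]]]]]]]] := h1 p0 pi0 pj (pjl pj).
    exists q, m1, m2, Ny, Nz, dy, dz; split=> //; apply: leq_trans le _.
    by rewrite -addnA leq_addr.
  have [pl|pl] := eqVneq (p0 l) 0.
    have [q [m1 [m2 [Ny [Nz [dy [dz [hf le]]]]]]]] := h2 p0 pi0 pj pl.
    exists q, m1, m2, Ny, Nz, dy, dz; split=> //; apply: leq_trans le _.
    by rewrite addnAC leq_addl.
  have [|q [m1 [m2 [Ny [Nz [dy [dz [hf le]]]]]]]] := h3 p0.
    by move=> t; case: (ord3_cases ji li jl t) => ->.
  exists q, m1, m2, Ny, Nz, dy, dz; split=> //; apply: leq_trans le _.
  by rewrite leq_addl.
pose Bt t := projT1 (cid (step t)).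
exists (\sum_t Bt t)%N => p0 [i pi0].
have [j [l [ji li jl]]] := ord3_split i.
suff [t ht] : exists t, good p0 (Bt t).
  have [q [m1 [m2 [Ny [Nz [dy [dz [hf le]]]]]]]] := ht.
  exists q, m1, m2, Ny, Nz, dy, dz; split=> //; apply: leq_trans le _.
  by rewrite (bigD1 t) //= leq_addr.
have [/eqP pj|pj] := boolP (p0 j == 0).
  exists (i, l, j); rewrite /Bt; case: cid => B /= /(_ p0); apply=> //.
  by rewrite ji li eq_sym jl.
exists (i, j, l); rewrite /Bt; case: cid => B /= /(_ p0); apply=> //.
  by rewrite ji li jl.
by move=> /eqP; rewrite (negbTE pj).
Qed.

End Frames.

(** * Local rings of the hypersurface: normality implies smoothness *)

Section LocalStructure.

Variables (k : closedFieldType) (a b c : nat) (R : idomainType).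
Variables (pi : {rmorphism {mpoly k[3]} -> R}) (h : nat) (f : {mpoly k[3]}).
Hypothesis H : hsurf a b c pi h f.

Local Notation w := (wt a b c).
Local Notation hom n p := (p \is n.-homog for (wdeg a b c)).
Local Notation gr := (piece a b c pi).
Local Notation cst := (structure_map pi).
Local Notation "x %:F" := (@FracField.tofrac R x).

Definition smooth := forall p0 : 'I_3 -> k, (exists i, p0 i != 0) ->
  f.@[p0] = 0 -> exists t, f^`M(t).@[p0] != 0.

Lemma chiM (p0 : 'I_3 -> k) x y :
  chi a b c p0 (x * y) = chi a b c p0 x * chi a b c p0 y.
Proof. exact: rmorphM. Qed.

Lemma chiD (p0 : 'I_3 -> k) x y :
  chi a b c p0 (x + y) = chi a b c p0 x + chi a b c p0 y.
Proof. exact: rmorphD. Qed.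

Lemma chiB (p0 : 'I_3 -> k) x y :
  chi a b c p0 (x - y) = chi a b c p0 x - chi a b c p0 y.
Proof. exact: rmorphB. Qed.

Lemma chi1 (p0 : 'I_3 -> k) p : (chi a b c p0 p).[1] = p.@[p0].
Proof.
have [N hN] := mpoly_hparts a b c p.
rewrite (hN N (leqnn _)) !rmorph_sum horner_sum; apply: eq_bigr => i _ /=.
by rewrite (chi_hom _ (pihomogP _ _ _)) !hornerE expr1n mulr1.
Qed.

Lemma kpoint_notin (P : point gr) p0 p : kpoint P p0 -> p.@[p0] != 0 -> pi p \notin P.
Proof.
move=> [_ hP] ne; rewrite hP; apply: contra ne => /eqP e.
by rewrite -chi1 e horner0.
Qed.

Lemma kpoint_f (P : point gr) p0 : kpoint P p0 -> f.@[p0] = 0.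
Proof.
move=> hP; apply/eqP; rewrite -(kpoint_hom hP (f_hom H)).
rewrite (_ : pi f = 0) ?pid0 //; first exact: point_prime.
by apply/(pi_ker H); exists 1; rewrite mul1r.
Qed.

(** The local ring at P has dimension one. Apply [binary_form_in_ideal] to X_i^n and x^w_i with X_i
    outside P: the factors X_i^n - z x^w_i are units at P, so G divides a power of x up to a
    unit. *)
Lemma power_in_ideal (P : point gr) n e x G : gr n x -> x \in P -> gr e G -> G != 0 ->
  exists j s r, s \notin P /\ s * x ^+ j = G * r.
Proof.
move=> hx xP hG G0; have pP := point_prime P.
have [x0|x0] := eqVneq x 0.
  by exists 1%N, 1, 0; rewrite x0 expr1 !mulr0 pid1.
have [i iP] := point_var P; have wi := wt_gt0 H i.
have n0 : (0 < n)%N.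
  rewrite lt0n; apply/eqP => n0; move: hx; rewrite n0 => /(gr0_cst H)[y yE].
  have y0 : y != 0 by apply: contraNneq x0 => y0; rewrite yE y0 rmorph0.
  by move: xP; rewrite yE (negbTE (cst_notin P y0)).
have hX : gr (w i * n) (pi 'X_i ^+ n) by apply: (grXn H); apply: gr_X.
have hY : gr (w i * n) (x ^+ w i) by rewrite mulnC; apply: (grXn H).
have d0 : (0 < w i * n)%N by rewrite muln_gt0 wi.
have [zs [j [r E]]] := binary_form_in_ideal H hX hY d0 hG G0.
exists (w i * j)%N, (\prod_(z <- zs) (pi 'X_i ^+ n - cst z * x ^+ w i)), r; split.
  apply: pid_prod => // z; apply/negP => hz.
  have : pi 'X_i ^+ n \in P.
    rewrite (pid_eqr pP hz) pidMl // pidX // wi xP //.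
  by rewrite pidX // (negbTE iP) andbF.
by rewrite exprM mulrC.
Qed.

Section AtPoint.

Variables (P : point gr) (p0 : 'I_3 -> k) (q : nat) (m1 m2 : 'X_{1..3}).
Variables (Ny Nz : {mpoly k[3]}) (dy dz : nat).
Hypothesis hP : kpoint P p0.
Hypothesis fr : frame a b c p0 q m1 m2 Ny Nz dy dz.

Local Notation U1 := (pi 'X_[m1]).
Local Notation U2 := (pi 'X_[m2]).

Lemma frame_U1 : U1 \notin P.
Proof.
apply: (kpoint_notin hP); apply/meval_monomial_neq0 => i pi0.
by have [] := fr_U_supp fr pi0.
Qed.

Lemma frame_U2 : U2 \notin P.
Proof.
apply: (kpoint_notin hP); apply/meval_monomial_neq0 => i pi0.
by have [] := fr_U_supp fr pi0.
Qed.

Lemma frame_y : pi Ny \in P.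
Proof. by rewrite (kpoint_hom hP (fr_y_hom fr)) (fr_y0 fr). Qed.

Lemma frame_z : pi Nz \in P.
Proof. by rewrite (kpoint_hom hP (fr_z_hom fr)) (fr_z0 fr). Qed.

Lemma frame_gen_mem x : x \in P ->
  exists N A B, U2 ^+ N * x = A * pi Ny + B * pi Nz.
Proof.
move=> xP; rewrite (gr_decomp H x); elim/big_ind: _.
- by exists 0%N, 0, 0; rewrite mulr0 !mul0r addr0.
- move=> y z [N [A [B E]]] [N' [A' [B' E']]]; exists (N + N')%N.
  exists (U2 ^+ N' * A + U2 ^+ N * A'), (U2 ^+ N' * B + U2 ^+ N * B').
  rewrite exprD; transitivity (U2 ^+ N' * (U2 ^+ N * y) + U2 ^+ N * (U2 ^+ N' * z)).
    by ring.
  by rewrite E E'; ring.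
move=> i _; have : (grading H x)`_i \in P by apply: point_coef.
have [p hp <-] := gr_coef H x i.
rewrite (kpoint_hom hP hp) => /eqP /(fr_gen fr hp)[N [A [B E]]].
exists N, (pi A), (pi B); move/(congr1 pi): E.
by rewrite rmorphM rmorphD !rmorphM rmorphXn.
Qed.

Lemma frame_neq0 : (pi Ny != 0) || (pi Nz != 0).
Proof.
rewrite -negb_and; apply/negP => /andP[/eqP y0 /eqP z0].
have [n [x [hx xP /negP x0]]] := point_gr_neq0 H P; apply: x0.
have [N [A [B]]] := frame_gen_mem xP; rewrite y0 z0 !mulr0 addr0.
move/eqP; rewrite mulf_eq0 => /orP[|//]; rewrite expf_eq0 => /andP[_ /eqP U0].
have pP := point_prime P.
by have := frame_U2; rewrite U0 pid0.
Qed.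

Lemma kpoint_chi0 p : pi p \in P -> chi a b c p0 p = 0.
Proof. by case: hP => _ ->; move/eqP. Qed.

(* Compare gradients along the orbit of p0. *)
Lemma gradient_relation s x n y e t :
  s * x - n * y = e * f -> pi x \in P -> pi y \in P ->
  chi a b c p0 s * chi a b c p0 x^`M(t) - chi a b c p0 n * chi a b c p0 y^`M(t)
  = chi a b c p0 e * chi a b c p0 f^`M(t).
Proof.
move=> E /kpoint_chi0 x0 /kpoint_chi0 y0.
have f0 : chi a b c p0 f = 0.
  by rewrite (chi_hom _ (f_hom H)) (kpoint_f hP) scale0r.
have /(congr1 (chi a b c p0)) := congr1 (mderiv t) E.
rewrite mderivB !mderivM chiB !chiD !chiM x0 y0 f0.
by rewrite !mulr0 !add0r.
Qed.

(** When df = 0 at p0, [gradient_relation] turns either relation with unit s into proportionality of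
    the gradients of Ny and Nz, against the determinant of the frame. *)
Lemma frame_indep s r : s \notin P ->
  (forall t, f^`M(t).@[p0] = 0) ->
  ~ (s * pi Nz = r * pi Ny) /\ ~ (s * pi Ny = r * pi Nz).
Proof.
move=> sP df0.
have [s' sE] := pi_surj H s; have [r' rE] := pi_surj H r.
have s0 : chi a b c p0 s' != 0 by move: sP; rewrite -sE; case: hP => _ ->.
have cf0 t : chi a b c p0 f^`M(t) = 0.
  by rewrite (chi_hom _ (hom_deriv t (f_hom H))) df0 scale0r.
have key X Y : pi X \in P -> pi Y \in P -> s * pi X = r * pi Y ->
    forall i j, gradat p0 X i * gradat p0 Y j = gradat p0 X j * gradat p0 Y i.
  move=> XP YP E i j.
  have /(pi_ker H)[e E'] : pi (s' * X - r' * Y) = 0.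
    by rewrite rmorphB !rmorphM sE rE E subrr.
  have hg t := gradient_relation t E' XP YP.
  have rel t : chi a b c p0 s' * chi a b c p0 X^`M(t) = chi a b c p0 r' * chi a b c p0 Y^`M(t).
    by apply/eqP; rewrite -subr_eq0 hg cf0 mulr0.
  have : chi a b c p0 s' * (chi a b c p0 X^`M(i) * chi a b c p0 Y^`M(j)) =
         chi a b c p0 s' * (chi a b c p0 X^`M(j) * chi a b c p0 Y^`M(i)).
    by rewrite !mulrA !rel; ring.
  move/(mulfI s0)/(congr1 (fun u => u.[1])).
  by rewrite !hornerM !chi1.
have mz x y : (forall i j, gradat p0 x i * gradat p0 y j = gradat p0 x j * gradat p0 y i) ->
    forall L, det3 0 1 2%:R (gradat p0 y) (gradat p0 x) L = 0.
  move=> hm L; rewrite /det3.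
  have h01 := hm 0 1; have h02 := hm 0 2%:R; have h12 := hm 1 2%:R.
  move: (gradat p0 x 0) (gradat p0 x 1) (gradat p0 x 2%:R) h01 h02 h12.
  move: (gradat p0 y 0) (gradat p0 y 1) (gradat p0 y 2%:R) => y0 y1 y2 x0 x1 x2 h01 h02 h12.
  transitivity (L 0 * (x2 * y1 - x1 * y2) + L 1 * (x0 * y2 - x2 * y0) + L 2%:R * (x1 * y0 - x0 * y1)).
    by ring.
  by rewrite h01 h02 h12 !subrr !mulr0 !addr0.
split=> /key hk.
  by case/eqP: (fr_det fr); apply: mz; apply: hk; [exact: frame_z|exact: frame_y].
have E : det3 0 1 2%:R (gradat p0 Ny) (gradat p0 Nz) (dlogat p0 'X_[m1] 'X_[m2]) =
    - det3 0 1 2%:R (gradat p0 Nz) (gradat p0 Ny) (dlogat p0 'X_[m1] 'X_[m2]).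
  by rewrite /det3; ring.
by case/eqP: (fr_det fr); rewrite E mz ?oppr0 //; apply: hk; [exact: frame_y|exact: frame_z].
Qed.

(* zeta = ny^i nz^j / x0 with i + j maximal among those outside S maps the
   maximal ideal to S; as R is normal it does not map it to itself. *)
Lemma normal_frame_rel : normal_domain R -> exists s r, s \notin P /\
  (s * pi Nz = r * pi Ny \/ s * pi Ny = r * pi Nz).
Proof.
move=> nR; have pP := point_prime P.
set ny := pi Ny; set nz := pi Nz.
have yP : ny \in P := frame_y; have zP : nz \in P := frame_z.
have gy : gr dy ny by exists Ny => //; exact: (fr_y_hom fr).
have gz : gr dz nz by exists Nz => //; exact: (fr_z_hom fr).
have [x0 [e0 [gx x0P x00]]] : exists x0 e0, [/\ gr e0 x0, x0 \in P & x0 != 0].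
  by case/orP: frame_neq0 => ne; [exists ny, dy|exists nz, dz].
(* S is the ideal of multiples of x0 in the local ring at P. *)
pose inS u := exists s r, s \notin P /\ s * u = x0 * r.
have inSl u v : inS u -> inS (v * u).
  by move=> [s [r [sP E]]]; exists s, (v * r); split=> //; rewrite mulrCA E mulrCA.
have [ey [sy [ry [syP Ey]]]] := power_in_ideal gy yP gx x00.
have [ez [sz [rz [szP Ez]]]] := power_in_ideal gz zP gx x00.
pose T n := `[< exists i j, (i + j)%N = n /\ ~ inS (ny ^+ i * nz ^+ j) >].
have T0 : exists n, T n.
  exists 0%N; apply/asboolP; exists 0%N, 0%N; split=> // -[s [r [sP]]].
  rewrite !expr0 !mulr1 => E; move: sP; rewrite E pidMr //.
have Tb n : T n -> (n <= ey + ez)%N.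
  move=> /asboolP[i [j [<- nS]]]; rewrite leqNgt; apply/negP => lt; apply: nS.
  have [ei|ei] := leqP ey i.
    rewrite mulrC; apply: (inSl); rewrite -(subnK ei) exprD; apply: (inSl).
    by exists sy, ry.
  have ej : (ez <= j)%N.
    rewrite leqNgt; apply/negP => ej; move: lt; rewrite ltnNge.
    by rewrite (leq_add (ltnW ei) (ltnW ej)).
  by apply: (inSl); rewrite -(subnK ej) exprD; apply: (inSl); exists sz, rz.
have [n /asboolP[i [j [ijn nS]]] nmax] := ex_maxnP T0 Tb.
set b0 := ny ^+ i * nz ^+ j in nS.
have by_ : inS (b0 * ny).
  apply: contrapT => no; suff /nmax : T n.+1 by rewrite ltnn.
  apply/asboolP; exists i.+1, j; rewrite addSn ijn; split=> // hS; apply: no.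
  by move: hS; rewrite exprSr -mulrA [ny * _]mulrC mulrA.
have bz_ : inS (b0 * nz).
  apply: contrapT => no; suff /nmax : T n.+1 by rewrite ltnn.
  apply/asboolP; exists i, j.+1; rewrite addnS ijn; split=> // hS; apply: no.
  by move: hS; rewrite exprSr mulrA.
have [s1 [r1 [s1P E1]]] := by_; have [s2 [r2 [s2P E2]]] := bz_.
have b00 : b0 != 0.
  by apply/eqP => b00; apply: nS; exists 1, 0; rewrite b00 !mulr0 pid1.
have rel : s1 * r2 * ny = s2 * r1 * nz.
  apply: (mulfI (mulf_neq0 x00 b00)).
  transitivity (s1 * (b0 * ny) * (x0 * r2)); first by ring.
  by rewrite -E2 E1; ring.
(* If r1 or r2 is a unit at P, [rel] is the wanted relation. Otherwise multiplication by b0 / x0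
   maps the local maximal ideal, generated by ny and nz, into itself. *)
have [r2P|r2P] := boolP (r2 \in P); last first.
  by exists (s1 * r2), (s2 * r1); rewrite pidM // negb_or s1P r2P; split=> //; right.
have [r1P|r1P] := boolP (r1 \in P); last first.
  by exists (s2 * r1), (s1 * r2); rewrite pidM // negb_or s2P r1P; split=> //; left.
have [N1 [A1 [B1 F1]]] := frame_gen_mem r1P.
have [N2 [A2 [B2 F2]]] := frame_gen_mem r2P.
pose V1 := U2 ^+ N1; pose V2 := U2 ^+ N2.
have VP N : U2 ^+ N \notin P by rewrite pidX // (negbTE frame_U2) andbF.
pose s := s1 * s2 * V1 * V2.
have sP : s \notin P by rewrite /s !pidM // !negb_or s1P s2P !VP.
pose A := s2 * V2 * A1; pose B := s2 * V2 * B1.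
pose C := s1 * V1 * A2; pose D := s1 * V1 * B2.
have G1 : s * (b0 * ny) = x0 * (A * ny + B * nz).
  transitivity (s2 * V2 * V1 * (s1 * (b0 * ny))); first by rewrite /s; ring.
  rewrite E1; transitivity (s2 * V2 * x0 * (V1 * r1)); first by ring.
  by rewrite F1 /A /B; ring.
have G2 : s * (b0 * nz) = x0 * (C * ny + D * nz).
  transitivity (s1 * V1 * V2 * (s2 * (b0 * nz))); first by rewrite /s; ring.
  rewrite E2; transitivity (s1 * V1 * x0 * (V2 * r2)); first by ring.
  by rewrite F2 /C /D; ring.
pose eta := (s * b0)%:F / x0%:F.
have x0F : x0%:F != 0 by rewrite tofrac_eq0.
have eta_x : eta * x0%:F = (s * b0)%:F by rewrite divfK.
have K1 : eta * ny%:F = A%:F * ny%:F + B%:F * nz%:F.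
  apply: (mulIf x0F); rewrite mulrAC eta_x -!tofracM -tofracD -tofracM.
  by congr (_%:F); rewrite -mulrA G1 mulrC.
have K2 : eta * nz%:F = C%:F * ny%:F + D%:F * nz%:F.
  apply: (mulIf x0F); rewrite mulrAC eta_x -!tofracM -tofracD -tofracM.
  by congr (_%:F); rewrite -mulrA G2 mulrC.
(* Cayley-Hamilton for multiplication by eta on the span of ny and nz. By normality eta = s b0 / x0
   is then in R, and b0 would be in S. *)
have charp : eta ^+ 2 - (A + D)%:F * eta + (A * D - B * C)%:F = 0.
  rewrite tofracD tofracB (tofracM A) (tofracM B).
  move: K1 K2; move: (ny%:F) (nz%:F) (A%:F) (B%:F) (C%:F) (D%:F) (tofrac_eq0 ny) (tofrac_eq0 nz).
  move=> y z A' B' C' D' y0 z0 K1 K2.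
  have det_y : (eta ^+ 2 - (A' + D') * eta + (A' * D' - B' * C')) * y = 0.
    transitivity ((eta - D') * (eta * y - (A' * y + B' * z)) + B' * (eta * z - (C' * y + D' * z))).
      by ring.
    by rewrite K1 K2 !subrr !mulr0 addr0.
  have det_z : (eta ^+ 2 - (A' + D') * eta + (A' * D' - B' * C')) * z = 0.
    transitivity ((eta - A') * (eta * z - (C' * y + D' * z)) + C' * (eta * y - (A' * y + B' * z))).
      by ring.
    by rewrite K1 K2 !subrr !mulr0 addr0.
  case/orP: frame_neq0 => ne.
    by apply/eqP; move/eqP: det_y; rewrite mulf_eq0 y0 (negbTE ne) orbF.
  by apply/eqP; move/eqP: det_z; rewrite mulf_eq0 z0 (negbTE ne) orbF.
have [u uE] : exists u, eta = u%:F.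
  move: charp; clear K1 K2 eta_x; move: eta (A + D) (A * D - B * C) => et t1 t2 charp.
  apply: nR; exists ('X^2 - t1 *: 'X + t2%:P).
    rewrite monicE lead_coefE.
    have -> : size ('X^2 - t1 *: 'X + t2%:P) = 3%N.
      rewrite -addrA size_polyDl size_polyXn //.
      apply: leq_ltn_trans (size_polyD _ _) _; rewrite gtn_max size_polyN.
      by rewrite (leq_ltn_trans (size_scale_leq _ _)) ?size_polyX // (leq_ltn_trans (size_polyC_leq1 _)).
    by rewrite !coefE /= mulr0 subr0 addr0.
  rewrite /root rmorphD rmorphB /= map_polyXn map_polyZ map_polyX map_polyC !hornerE.
  exact/eqP.
case: nS; exists s, u; split=> //; apply/eqP; rewrite -tofrac_eq -eta_x uE -tofracM.
by rewrite mulrC.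
Qed.

End AtPoint.

Lemma normal_smooth : normal_domain R -> smooth.
Proof.
move=> nR p0 p0n f0; have [P hP] := point_of_kpoint H p0n f0.
have [B hB] := @frame_ex k a b c (wt_gt0 H).
have [q [m1 [m2 [Ny [Nz [dy [dz [fr _]]]]]]]] := hB p0 p0n.
apply: contrapT => no.
have df0 t : f^`M(t).@[p0] = 0.
  by apply/eqP; apply: contrapT => /negP ne; apply: no; exists t.
have [s [r [sP rel]]] := normal_frame_rel hP fr nR.
by have [n1 n2] := frame_indep hP fr r sP df0; case: rel.
Qed.

End LocalStructure.

(** * Homogeneous fractions and local parameters *)

Section GradedFractions.

Variables (k : closedFieldType) (a b c : nat) (R : idomainType).
Variables (pi : {rmorphism {mpoly k[3]} -> R}) (h : nat) (f : {mpoly k[3]}).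
Hypothesis H : hsurf a b c pi h f.

Local Notation gr := (piece a b c pi).
Local Notation cst := (structure_map pi).
Local Notation "x %:F" := (@FracField.tofrac R x).

(* z is a homogeneous fraction of degree D, as an element of Frac R *)
Definition hfr (D : int) (z : {fraction R}) := exists i j x y,
  [/\ gr i x, gr j y, y != 0, z = x%:F / y%:F & D = i%:Z - j%:Z].

Lemma hfr_R n x : gr n x -> hfr n x%:F.
Proof.
move=> hx; exists n, 0%N, x, 1; rewrite oner_neq0 tofrac1 divr1 subr0.
by split=> //; apply: (gr1 H).
Qed.

Lemma hfrM D D' z z' : hfr D z -> hfr D' z' -> hfr (D + D') (z * z').
Proof.
move=> [i [j [x [y [hx hy y0 -> ->]]]]] [i' [j' [x' [y' [hx' hy' y0' -> ->]]]]].
exists (i + i')%N, (j + j')%N, (x * x'), (y * y'); split.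
- exact: (grM H).
- exact: (grM H).
- by rewrite mulf_neq0.
- by rewrite !tofracM invfM mulrACA.
- by rewrite !PoszD; ring.
Qed.

Lemma hfrV D z : z != 0 -> hfr D z -> hfr (- D) z^-1.
Proof.
move=> z0 [i [j [x [y [hx hy y0 zE ->]]]]]; exists j, i, y, x; split=> //.
- by apply: contraNneq z0 => x0; rewrite zE x0 tofrac0 mul0r.
- by rewrite zE invfM invrK mulrC.
- by rewrite opprB.
Qed.

Lemma hfr1 : hfr 0 1.
Proof. by rewrite -tofrac1; apply: (@hfr_R 0); apply: (gr1 H). Qed.

Lemma hfrXn D z n : hfr D z -> hfr (D *+ n) (z ^+ n).
Proof.
move=> hz; elim: n => [|n IH]; first by rewrite mulr0n expr0; apply: hfr1.
by rewrite mulrS exprS; apply: hfrM.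
Qed.

Lemma hfrX D z (n : int) : z != 0 -> hfr D z -> hfr (D * n) (z ^ n).
Proof.
move=> z0 hz; have DE m : D * m%:Z = D *+ m by rewrite -mulr_natr natz.
case: n => n; first by rewrite DE; apply: hfrXn.
rewrite NegzE mulrN DE; apply: (@hfrV _ (z ^+ n.+1)); first by rewrite expf_neq0.
exact: hfrXn.
Qed.

Lemma hfrD D z z' : hfr D z -> hfr D z' -> hfr D (z + z').
Proof.
have [->|z0] := eqVneq z 0; first by rewrite add0r.
have [->|z0'] := eqVneq z' 0; first by rewrite addr0.
move=> [i [j [x [y [hx hy y0 zE DE]]]]] [i' [j' [x' [y' [hx' hy' y0' zE' DE']]]]].
exists (i + j')%N, (j + j')%N, (x * y' + x' * y), (y * y'); split.
- apply: (grD H); first exact: (grM H).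
  have -> : (i + j' = i' + j)%N by apply/eqP; rewrite -eqz_nat !PoszD; apply/eqP; lia.
  exact: (grM H).
- exact: (grM H).
- by rewrite mulf_neq0.
- rewrite zE zE' addf_div ?tofrac_eq0 // !tofracD !tofracM.
  by [].
- by rewrite DE !PoszD; ring.
Qed.

Lemma hfrN D z : hfr D z -> hfr D (- z).
Proof.
move=> [i [j [x [y [hx hy y0 -> ->]]]]]; exists i, j, (- x), y; split=> //.
  exact: (grN H).
by rewrite tofracN mulNr.
Qed.

Lemma ratfun_hfr z : ratfun gr z <-> hfr 0 z.
Proof.
split=> [[n [x [y [hx hy y0 ->]]]]|[i [j [x [y [hx hy y0 -> E]]]]]].
  by exists n, n, x, y; rewrite subrr.
exists i, x, y; split=> //; have -> // : i = j.
by apply/eqP; rewrite -eqz_nat -subr_eq0 -E.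
Qed.

Lemma ratfun_deg0 z : ratfun gr z -> hfr 0 z.
Proof. by move/ratfun_hfr. Qed.

Lemma hfr_eq D D' z : hfr D z -> D = D' -> hfr D' z.
Proof. by move=> hz <-. Qed.

Section Valuation.

Variable P : point gr.

Let pP := point_prime P.

Definition inloc (z : {fraction R}) := exists x y, y \notin P /\ z = x%:F / y%:F.

Definition unitat (e : {fraction R}) := exists x y, [/\ x \notin P, y \notin P & e = x%:F / y%:F].

Lemma notin_neq0 x : x \notin P -> x != 0.
Proof. by apply: contraNneq => ->; rewrite pid0. Qed.

Lemma notin1 : 1 \notin P. Proof. by rewrite pid1. Qed.

Lemma notinM x y : x \notin P -> y \notin P -> x * y \notin P.
Proof. by move=> hx hy; rewrite pidM // negb_or hx hy. Qed.

Lemma unitat_R x : x \notin P -> unitat x%:F.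
Proof. by move=> hx; exists x, 1; rewrite hx notin1 tofrac1 divr1. Qed.

Lemma unitat_neq0 e : unitat e -> e != 0.
Proof.
move=> [x [y [hx hy ->]]].
by rewrite mulf_neq0 ?invr_eq0 ?tofrac_eq0 ?notin_neq0.
Qed.

Lemma unitat1 : unitat 1.
Proof. by rewrite -tofrac1; apply: unitat_R; exact: notin1. Qed.

Lemma unitatM e e' : unitat e -> unitat e' -> unitat (e * e').
Proof.
move=> [x [y [hx hy ->]]] [x' [y' [hx' hy' ->]]].
by exists (x * x'), (y * y'); rewrite !notinM // !tofracM invfM mulrACA.
Qed.

Lemma unitatV e : unitat e -> unitat e^-1.
Proof.
by move=> [x [y [hx hy ->]]]; exists y, x; rewrite hx hy invfM invrK mulrC.
Qed.

Lemma unitatX e (n : int) : unitat e -> unitat (e ^ n).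
Proof.
move=> he; have hX m : unitat (e ^+ m).
  by elim: m => [|m IH]; [rewrite expr0; apply: unitat1|rewrite exprS; apply: unitatM].
by case: n => n; [exact: hX|exact: unitatV (hX _)].
Qed.

Lemma inlocM z z' : inloc z -> inloc z' -> inloc (z * z').
Proof.
move=> [x [y [hy ->]]] [x' [y' [hy' ->]]].
by exists (x * x'), (y * y'); rewrite notinM // !tofracM invfM mulrACA.
Qed.

Lemma unitat_inloc e : unitat e -> inloc e.
Proof. by move=> [x [y [hx hy ->]]]; exists x, y. Qed.

(** Some homogeneous component of the denominator y' is outside P. Comparing components of x y' = x'
    y in the corresponding degree replaces x' and y' by homogeneous elements. *)
Lemma hloc D z : hfr D z -> inloc z -> z != 0 -> exists i j x y,
  [/\ gr i x, gr j y, y \notin P, z = x%:F / y%:F & D = i%:Z - j%:Z].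
Proof.
move=> [i [j [x [y [hx hy y0 zE DE]]]]] [x' [y' [y'P zE']]] z0.
have y0' := notin_neq0 y'P.
have E : x * y' = x' * y.
  apply/eqP; rewrite -tofrac_eq !tofracM -eqr_div ?tofrac_eq0 //.
  by rewrite -zE -zE'.
have [t yt] : exists t, (grading H y')`_t \notin P.
  apply/not_existsP => all; case/negP: y'P; apply: (point_coefP (H := H)) => t.
  by apply/negPn/negP; apply: all.
have x0 : x != 0 by apply: contraNneq z0 => x0; rewrite zE x0 tofrac0 mul0r.
have yt0 := notin_neq0 yt.
have E2 s : (grading H (x * y'))`_(i + s) = x * (grading H y')`_s.
  by rewrite rmorphM; move/(grP H): (hx) => ->; rewrite -scalerAl coefZ addnC coefXnM
    ltnNge leq_addl /= addnK.
have E3 s : (grading H (x' * y))`_s = if (s < j)%N then 0 else (grading H x')`_(s - j) * y.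
  rewrite rmorphM; move/(grP H): (hy) => ->; rewrite -scalerAr coefZ coefMXn.
  by case: ifP => _; rewrite ?mulr0 // mulrC.
have := E2 t; rewrite E E3; case: ltnP => [_ /esym/eqP|le E4].
  by rewrite mulf_eq0 (negbTE x0) (negbTE yt0).
exists (i + t - j)%N, t, (grading H x')`_(i + t - j), (grading H y')`_t.
split=> //; try exact: gr_coef.
  apply/eqP; rewrite zE eqr_div ?tofrac_eq0 // -!tofracM tofrac_eq.
  by rewrite E4.
by rewrite DE -subzn // PoszD; ring.
Qed.

End Valuation.

End GradedFractions.

Arguments ratfun_hfr {k a b c R pi} z.

Section LocalParameters.

Variables (k : closedFieldType) (a b c : nat) (R : idomainType).
Variables (pi : {rmorphism {mpoly k[3]} -> R}) (h : nat) (f : {mpoly k[3]}).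
Hypothesis H : hsurf a b c pi h f.
Hypothesis sm : smooth f.

Local Notation w := (wt a b c).
Local Notation hom n p := (p \is n.-homog for (wdeg a b c)).
Local Notation gr := (piece a b c pi).
Local Notation cst := (structure_map pi).
Local Notation "x %:F" := (@FracField.tofrac R x).

(** The determinant of dN, U1 U2 dlog(U1 / U2) and df. It is, up to units and T, the logarithmic
    derivative of the uniformizer built from N, so its being a unit at P computes the canonical
    divisor. *)
Definition jacobian (N : {mpoly k[3]}) (m1 m2 : 'X_{1..3}) : {mpoly k[3]} :=
  det3 0 1 2%:R (fun t => N^`M(t))
    (fun t => 'X_[m2] * 'X_[m1]^`M(t) - 'X_[m1] * 'X_[m2]^`M(t))
    (fun t => f^`M(t)).

Record locpar (P : point gr) := LocPar {
  lq : nat;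
  lm1 : 'X_{1..3};
  lm2 : 'X_{1..3};
  lN : {mpoly k[3]};
  ld : nat;
  lq_gt0 : (0 < lq)%N;
  lU_deg : wdeg a b c lm1 = (wdeg a b c lm2 + lq)%N;
  lU1 : pi 'X_[lm1] \notin P;
  lU2 : pi 'X_[lm2] \notin P;
  lN_hom : hom ld lN;
  lN_mem : pi lN \in P;
  lN_neq0 : pi lN != 0;
  l_dvd : forall n x, gr n x -> x \notin P -> (lq %| n)%N;
  l_gen : forall x, x \in P -> exists s r, s \notin P /\ s * x = r * pi lN;
  l_jac : pi (jacobian lN lm1 lm2) \notin P }.

Lemma meval_jacobian p0 N m1 m2 : (jacobian N m1 m2).@[p0] =
  det3 0 1 2%:R (gradat p0 N) (dlogat p0 'X_[m1] 'X_[m2]) (gradat p0 f).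
Proof.
by rewrite /jacobian det3_rmorph /det3 /dlogat /gradat /= !mevalB !mevalM.
Qed.

(** Locally f = A Ny + B' Nz up to a unit, so df is proportional to A dNy + B' dNz at p0 and by
    smoothness A or B' is a unit there. If B' is, Nz is a multiple of Ny in the local ring and N =
    Ny; putting df in place of dNz in the frame determinant gives [l_jac]. If A is, the roles are
    exchanged. *)
Lemma locpar_bounded : exists B, forall P : point gr, exists L : locpar P,
  (ld L <= B)%N /\ (wdeg a b c (lm1 L) <= B)%N.
Proof.
have [B hB] := @frame_ex k a b c (wt_gt0 H); exists B => P.
have pP := point_prime P; have [p0 hP] := kpoint_ex H P.
have p0n : exists i, p0 i != 0 by case: hP.
have [q [m1 [m2 [Ny [Nz [dy [dz [fr leB]]]]]]]] := hB p0 p0n.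
have f0 := kpoint_f H hP; have [t0 ft0] := sm p0n f0.
have [K [A [B' E]]] := fr_gen fr (f_hom H) f0.
have U1P := frame_U1 hP fr; have U2P := frame_U2 hP fr.
have piU2 n : pi 'X_[m2] ^+ n \notin P by rewrite pidX // (negbTE U2P) andbF.
have u20 : (('X_[m2] : {mpoly k[3]}).@[p0]) != 0.
  apply/meval_monomial_neq0 => i pi0; by have [] := fr_U_supp fr pi0.
set u := (('X_[m2] : {mpoly k[3]}).@[p0]) ^+ K.
have u0 : u != 0 by rewrite expf_neq0.
have gE t : u * gradat p0 f t = A.@[p0] * gradat p0 Ny t + B'.@[p0] * gradat p0 Nz t.
  have /(congr1 (meval p0)) := congr1 (mderiv t) E.
  rewrite mderivD !mderivM !mevalD !mevalM f0 (fr_y0 fr) (fr_z0 fr) rmorphXn /=.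
  by rewrite !mulr0 !add0r.
have piE : 0 = pi A * pi Ny + pi B' * pi Nz.
  rewrite -!rmorphM -rmorphD -E rmorphM (_ : pi f = 0) ?mulr0 //.
  by apply/(pi_ker H); exists 1; rewrite mul1r.
have dvd n x : gr n x -> x \notin P -> (q %| n)%N.
  by move=> [p hp <-]; rewrite (kpoint_hom hP hp); apply: (fr_dvd fr).
have le1 : (dy <= B)%N /\ (wdeg a b c m1 <= B)%N by move: leB; lia.
have le2 : (dz <= B)%N /\ (wdeg a b c m1 <= B)%N by move: leB; lia.
have yP := frame_y hP fr; have zP := frame_z hP fr.
have n0 := frame_neq0 H hP fr.
have [A0|A0] := eqVneq A.@[p0] 0.
  have B0 : B'.@[p0] != 0.
    apply/eqP => B0; move/eqP: (gE t0); rewrite A0 B0 !mul0r addr0 mulf_eq0.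
    by rewrite (negbTE u0) (negbTE ft0).
  have BP := kpoint_notin hP B0.
  have y0 : pi Ny != 0.
    apply/eqP => y0; move: n0; rewrite y0 eqxx /=; move/esym/eqP: piE.
    by rewrite y0 mulr0 add0r mulf_eq0 (negbTE (notin_neq0 BP)) /= => ->.
  have gen x : x \in P -> exists s r, s \notin P /\ s * x = r * pi Ny.
    move=> xP; have [M [A1 [B1 E1]]] := frame_gen_mem H hP fr xP.
    exists (pi B' * pi 'X_[m2] ^+ M), (pi B' * A1 - B1 * pi A); split.
      by rewrite pidM // negb_or BP piU2.
    rewrite -mulrA E1; transitivity ((pi B' * A1 - B1 * pi A) * pi Ny
      + B1 * (pi A * pi Ny + pi B' * pi Nz)); first by ring.
    by rewrite -piE mulr0 addr0.
  have jac : pi (jacobian Ny m1 m2) \notin P.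
    apply: (kpoint_notin hP); rewrite meval_jacobian.
    suff : u * det3 0 1 2%:R (gradat p0 Ny) (dlogat p0 'X_[m1] 'X_[m2]) (gradat p0 f) != 0.
      by rewrite mulf_eq0 (negbTE u0).
    have -> : u * det3 0 1 2%:R (gradat p0 Ny) (dlogat p0 'X_[m1] 'X_[m2]) (gradat p0 f) =
      - B'.@[p0] * det3 0 1 2%:R (gradat p0 Ny) (gradat p0 Nz) (dlogat p0 'X_[m1] 'X_[m2]).
      transitivity (det3 0 1 2%:R (gradat p0 Ny) (dlogat p0 'X_[m1] 'X_[m2])
        (fun t => u * gradat p0 f t)); first by rewrite /det3; ring.
      by rewrite /det3 !gE; ring.
    by rewrite mulf_neq0 ?oppr_eq0 //; exact: (fr_det fr).
  by exists (LocPar (fr_q_gt0 fr) (fr_U_deg fr) U1P U2P (fr_y_hom fr) yP y0 dvd gen jac).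
have AP := kpoint_notin hP A0.
have z0 : pi Nz != 0.
  apply/eqP => z0; move: n0; rewrite z0 eqxx orbF; move/esym/eqP: piE.
  by rewrite z0 mulr0 addr0 mulf_eq0 (negbTE (notin_neq0 AP)) /= => ->.
have gen x : x \in P -> exists s r, s \notin P /\ s * x = r * pi Nz.
  move=> xP; have [M [A1 [B1 E1]]] := frame_gen_mem H hP fr xP.
  exists (pi A * pi 'X_[m2] ^+ M), (pi A * B1 - A1 * pi B'); split.
    by rewrite pidM // negb_or AP piU2.
  rewrite -mulrA E1; transitivity ((pi A * B1 - A1 * pi B') * pi Nz
    + A1 * (pi A * pi Ny + pi B' * pi Nz)); first by ring.
  by rewrite -piE mulr0 addr0.
have jac : pi (jacobian Nz m1 m2) \notin P.
  apply: (kpoint_notin hP); rewrite meval_jacobian.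
  suff : u * det3 0 1 2%:R (gradat p0 Nz) (dlogat p0 'X_[m1] 'X_[m2]) (gradat p0 f) != 0.
    by rewrite mulf_eq0 (negbTE u0).
  have -> : u * det3 0 1 2%:R (gradat p0 Nz) (dlogat p0 'X_[m1] 'X_[m2]) (gradat p0 f) =
    A.@[p0] * det3 0 1 2%:R (gradat p0 Ny) (gradat p0 Nz) (dlogat p0 'X_[m1] 'X_[m2]).
    transitivity (det3 0 1 2%:R (gradat p0 Nz) (dlogat p0 'X_[m1] 'X_[m2])
      (fun t => u * gradat p0 f t)); first by rewrite /det3; ring.
    by rewrite /det3 !gE; ring.
  by rewrite mulf_neq0 //; exact: (fr_det fr).
by exists (LocPar (fr_q_gt0 fr) (fr_U_deg fr) U1P U2P (fr_z_hom fr) zP z0 dvd gen jac).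
Qed.

End LocalParameters.

(** * Valuations *)

(** A smooth hypersurface with its choices: the fraction T of degree 1 that defines D0, and at each
    point a local parameter, of degree bounded independently of the point. *)
Record curve (k : closedFieldType) (a b c : nat) (R : idomainType)
    (pi : {rmorphism {mpoly k[3]} -> R}) (h : nat) (f : {mpoly k[3]}) := Curve {
  cvH : hsurf a b c pi h f;
  cv_smooth : smooth f;
  cvT : {fraction R};
  cvT_hfr : hfr a b c pi 1 cvT;
  cvT_neq0 : cvT != 0;
  cvloc : forall P : point (piece a b c pi), locpar f P;
  cvB : nat;
  cvlocB : forall P, (ld (cvloc P) <= cvB)%N /\ (wdeg a b c (lm1 (cvloc P)) <= cvB)%N
}.

Section Valuations.

Variables (k : closedFieldType) (a b c : nat) (R : idomainType).
Variables (pi : {rmorphism {mpoly k[3]} -> R}) (h : nat) (f : {mpoly k[3]}).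
Variable C : curve a b c pi h f.

Let H := cvH C.
Local Notation w := (wt a b c).
Local Notation gr := (piece a b c pi).
Local Notation cst := (structure_map pi).
Local Notation hfr := (hfr a b c pi).
Local Notation "x %:F" := (@FracField.tofrac R x).

Section AtPoint.

Variable P : point gr.

Let pP := point_prime P.
Local Notation L := (cvloc C P).
Local Notation N := (pi (lN L)).
Local Notation q := (lq L).

Definition isval (z : {fraction R}) (n : int) :=
  exists2 e, unitat P e & z = N%:F ^ n * e.

Let N0 : N%:F != 0. Proof. by rewrite tofrac_eq0 lN_neq0. Qed.

Let grN : gr (ld L) N. Proof. by exists (lN L) => //; exact: lN_hom. Qed.

Let pow_notunit n : (0 < n)%N -> ~ unitat P (N%:F ^+ n).
Proof.
move=> n0 [x [y [xP yP E]]]; case/negP: xP.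
have -> : x = N ^+ n * y.
  apply/eqP; rewrite -tofrac_eq tofracM tofracXn E divfK // tofrac_eq0.
  exact: (notin_neq0 yP).
by rewrite pidMr // pidX // n0 lN_mem.
Qed.

Lemma isval_uniq z n m : isval z n -> isval z m -> n = m.
Proof.
wlog le : n m / n <= m => [hw|] h1 h2.
  by have [?|/ltW ?] := lerP n m; [apply: hw|symmetry; apply: hw].
move: h1 h2 => [e he ->] [e' he' /eqP E].
have [m' mE] : exists m' : nat, m = n + m'%:Z.
  by exists `|m - n|%N; rewrite gez0_abs ?subr_ge0 //; lia.
case: m' mE => [|m'] mE; first by rewrite mE addr0.
exfalso; apply: (@pow_notunit m'.+1) => //.
move: E; rewrite mE expfzDr // -mulrA (inj_eq (mulfI _)) ?expfz_neq0 // => /eqP E.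
have -> : N%:F ^+ m'.+1 = e / e'.
  by rewrite E -exprnP mulfK // (unitat_neq0 he').
by apply: unitatM => //; apply: unitatV.
Qed.

Lemma isvalM z z' n m : isval z n -> isval z' m -> isval (z * z') (n + m).
Proof.
move=> [e he ->] [e' he' ->]; exists (e * e'); first exact: unitatM.
by rewrite expfzDr // mulrACA.
Qed.

Lemma isvalV z n : isval z n -> isval z^-1 (- n).
Proof.
move=> [e he ->]; exists e^-1; first exact: unitatV.
by rewrite invfM -invr_expz.
Qed.

Lemma isval_unit e : unitat P e -> isval e 0.
Proof. by exists e => //; rewrite expr0z mul1r. Qed.

Lemma isvalN z n : isval z n -> isval (- z) n.
Proof.
move=> hz; rewrite -mulN1r -[n]add0r; apply: isvalM => //; apply: isval_unit.
by rewrite -tofrac1 -tofracN; apply: unitat_R; rewrite pidN // pid1.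
Qed.

Lemma isval_N : isval N%:F 1.
Proof. by exists 1; [exact: unitat1|rewrite expr1z mulr1]. Qed.

(** Otherwise x would be divisible up to units by every power of N, in particular by N^(j+1), while
    by [power_in_ideal] x divides some N^j up to a unit; N would be a unit at P. *)
Lemma isval_gr d x : gr d x -> x != 0 -> exists n : nat, isval x%:F n%:Z.
Proof.
move=> hx x0; apply: contrapT => no.
have step m : exists s r, s \notin P /\ s * x = r * N ^+ m.
  elim: m => [|m [s [r [sP E]]]]; first by exists 1, x; rewrite notin1 mul1r mulr1.
  have [rP|rP] := boolP (r \in P).
    have [s' [r' [sP' E']]] := l_gen L rP; exists (s' * s), r'.
    by rewrite notinM // -mulrA E mulrA E' exprS mulrA.
  case: no; exists m, (r%:F / s%:F); first by exists r, s.
  have s0 : s%:F != 0 by rewrite tofrac_eq0 (notin_neq0 sP).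
  apply: (mulfI s0); rewrite -tofracM E tofracM tofracXn -exprnP.
  by rewrite mulrCA [s%:F * _]mulrC divfK // mulrC.
have [j [s [r [sP E]]]] := power_in_ideal H grN (lN_mem L) hx x0.
have [s' [r' [sP' E']]] := step j.+1.
have Nj : N ^+ j != 0 by rewrite expf_neq0 ?lN_neq0.
have: s * s' \in P.
  have -> : s * s' = r * r' * N.
    apply: (mulfI Nj); transitivity (s' * (s * N ^+ j)); first by ring.
    rewrite E; transitivity (r * (s' * x)); first by ring.
    by rewrite E' exprS; ring.
  by rewrite pidMl // lN_mem.
by rewrite pidM // (negbTE sP) (negbTE sP').
Qed.

Lemma isval_hfr D z : hfr D z -> z != 0 -> exists n, isval z n.
Proof.
move=> [i [j [x [y [hx hy y0 -> _]]]]]; rewrite mulf_eq0 invr_eq0 !tofrac_eq0 negb_or.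
case/andP=> x0 _; have [n hn] := isval_gr hx x0; have [m hm] := isval_gr hy y0.
by exists (n%:Z - m%:Z); apply: isvalM => //; apply: isvalV.
Qed.

Definition val (z : {fraction R}) : int := xget 0 [set n | isval z n].

Lemma val_isval z n : isval z n -> val z = n.
Proof.
move=> hz; apply: (isval_uniq _ hz).
by rewrite /val; case: xgetP => [y _ //|/(_ n)]; case.
Qed.

Lemma valP D z : hfr D z -> z != 0 -> isval z (val z).
Proof. by move=> hz z0; have [n hn] := isval_hfr hz z0; rewrite (val_isval hn). Qed.

Lemma valM D D' z z' : hfr D z -> hfr D' z' -> z != 0 -> z' != 0 ->
  val (z * z') = val z + val z'.
Proof.
by move=> hz hz' z0 z0'; apply: val_isval; apply: isvalM; [apply: (valP hz)|apply: (valP hz')].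
Qed.

Lemma valV D z : hfr D z -> z != 0 -> val z^-1 = - val z.
Proof. by move=> hz z0; apply: val_isval; apply: isvalV; apply: (valP hz). Qed.

Lemma val1 : val 1 = 0.
Proof. by apply: val_isval; apply: isval_unit; apply: unitat1. Qed.

Lemma valN D z : hfr D z -> z != 0 -> val (- z) = val z.
Proof. by move=> hz z0; apply: val_isval; apply: isvalN; apply: (valP hz). Qed.

Lemma valXn D z n : hfr D z -> z != 0 -> val (z ^+ n) = val z *+ n.
Proof.
move=> hz z0; elim: n => [|n IH]; first by rewrite expr0 val1.
by rewrite exprS mulrS -IH; apply: valM; rewrite ?expf_neq0 //; [exact: hz|exact: (hfrXn H _ hz)].
Qed.

Lemma valX D z n : hfr D z -> z != 0 -> val (z ^ n) = val z * n.
Proof.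
move=> hz z0; case: n => n; first by rewrite -exprnP (valXn _ hz) // -mulr_natr natz.
rewrite NegzE -exprnN (@valV (D *+ n.+1)) ?expf_neq0 ?(valXn _ hz) //.
  by rewrite mulrN -mulr_natr natz.
exact: (hfrXn H).
Qed.

Lemma val_unit e : unitat P e -> val e = 0.
Proof. by move/isval_unit/val_isval. Qed.

Lemma val_notin x : x \notin P -> val x%:F = 0.
Proof. by move/unitat_R/val_unit. Qed.

Lemma val_R d x : gr d x -> x != 0 -> 0 <= val x%:F.
Proof. by move=> hx x0; have [n /val_isval ->] := isval_gr hx x0. Qed.

Lemma val_mem d x : gr d x -> x != 0 -> (x \in P) = (0 < val x%:F).
Proof.
move=> hx x0; have [xP|/val_notin -> //] := boolP (x \in P).
have [n hn] := isval_gr hx x0; rewrite (val_isval hn); case: n hn => // -[e [x' [y' [xP' yP' ->]]]].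
rewrite expr0z mul1r => E; case/negP: xP'.
have -> : x' = x * y'.
  by apply/eqP; rewrite -tofrac_eq tofracM E divfK // tofrac_eq0 (notin_neq0 yP').
by rewrite pidMr.
Qed.

Lemma val_ge0 D z : hfr D z -> z != 0 -> (0 <= val z) <-> inloc P z.
Proof.
move=> hz z0; split=> [|zP].
  have [e he ze] := valP hz z0; case: (val z) ze => // n -> _.
  apply: inlocM (unitat_inloc he); exists (N ^+ n), 1.
  by rewrite notin1 tofracXn tofrac1 divr1.
have [i [j [x [y [hx hy yP zE DE]]]]] := hloc H hz zP z0.
have y0 := notin_neq0 yP; have x0 : x != 0 by apply: contraNneq z0 => x0; rewrite zE x0 tofrac0 mul0r.
rewrite zE (valM (hfr_R H hx) (hfrV _ (hfr_R H hy))) ?invr_eq0 ?tofrac_eq0 //.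
by rewrite (valV (hfr_R H hy)) ?tofrac_eq0 // (val_notin yP) subr0 (val_R hx).
Qed.

Lemma inlocD z z' : inloc P z -> inloc P z' -> inloc P (z + z').
Proof.
move=> [x [y [yP ->]]] [x' [y' [yP' ->]]]; exists (x * y' + x' * y), (y * y').
rewrite notinM //; split=> //; rewrite addf_div ?tofrac_eq0 ?(notin_neq0 yP) ?(notin_neq0 yP') //.
by rewrite tofracD !tofracM.
Qed.

Lemma valD n D z z' : hfr D z -> hfr D z' -> z + z' != 0 ->
  (z != 0 -> n <= val z) -> (z' != 0 -> n <= val z') -> n <= val (z + z').
Proof.
move=> hz hz' s0 le le'; have hN : hfr (ld L)%:Z N%:F := hfr_R H grN.
have vN : val N%:F = 1 := val_isval isval_N.
have hNn := hfrX H (- n) N0 hN.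
have loc y : hfr D y -> (y != 0 -> n <= val y) -> inloc P (N%:F ^ (- n) * y).
  move=> hy ley; have [->|y0] := eqVneq y 0.
    by rewrite mulr0; exists 0, 1; rewrite notin1 tofrac0 mul0r.
  apply/(val_ge0 (hfrM H hNn hy)); first by rewrite mulf_neq0 ?expfz_neq0.
  rewrite (valM hNn hy) ?expfz_neq0 // (valX _ hN) // vN mul1r addrC subr_ge0.
  exact: ley.
have := inlocD (loc z hz le) (loc z' hz' le'); rewrite -mulrDr.
have hs := hfrD H hz hz'.
move/(val_ge0 (hfrM H hNn hs)); rewrite mulf_neq0 ?expfz_neq0 // => /(_ isT).
by rewrite (valM hNn hs) ?expfz_neq0 // (valX _ hN) // vN mul1r addrC subr_ge0.
Qed.

Lemma hunit_deg D e : hfr D e -> unitat P e -> (q%:Z %| D)%Z.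
Proof.
move=> he ue; have e0 := unitat_neq0 ue.
have [i [j [x [y [hx hy yP eE ->]]]]] := hloc H he (unitat_inloc ue) e0.
have y0 := notin_neq0 yP; have x0 : x != 0 by apply: contraNneq e0 => x0; rewrite eE x0 tofrac0 mul0r.
have xP : x \notin P.
  rewrite (val_mem hx x0) -leNgt; have := val_unit ue.
  rewrite eE (valM (hfr_R H hx) (hfrV _ (hfr_R H hy))) ?invr_eq0 ?tofrac_eq0 //.
  by rewrite (valV (hfr_R H hy)) ?tofrac_eq0 // (val_notin yP) subr0 => ->.
have /dvdnP[u ->] : (q %| i)%N := l_dvd L hx xP.
have /dvdnP[u' ->] : (q %| j)%N := l_dvd L hy yP.
by apply/dvdzP; exists (u%:Z - u'%:Z); rewrite !PoszM mulrBl.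
Qed.

Lemma val_dvd D z : hfr D z -> z != 0 -> (q%:Z %| D - val z * ld L)%Z.
Proof.
move=> hz z0; have [e ue zE] := valP hz z0.
have hN := hfrX H (- val z) N0 (hfr_R H grN).
have eE : e = N%:F ^ (- val z) * z.
  by rewrite {2}zE mulrA -expfzDr // addNr expr0z mul1r.
have := hunit_deg (e := e); rewrite {1}eE => /(_ _ (hfrM H hN hz) ue).
by rewrite mulrN addrC [_ * val z]mulrC.
Qed.

(** T / N^val(T) is a unit of degree 1 - val(T) ld, and q divides the degree of every homogeneous
    unit. *)
Lemma coprime_ld : coprimez q%:Z (ld L)%:Z.
Proof.
have /dvdzP[u E] := val_dvd (cvT_hfr C) (cvT_neq0 C).
apply/coprimezP; exists (u, val (cvT C)) => /=.
by rewrite -E; ring.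
Qed.

Lemma val_ratfun z : ratfun gr z -> z != 0 -> (q%:Z %| val z)%Z.
Proof.
move=> /ratfun_hfr hz z0; have := val_dvd hz z0.
by rewrite sub0r rpredN Gauss_dvdzl // coprime_ld.
Qed.

(** A uniformizer of k(X) at P: N^q brought to degree 0 by a power of the unit U2 / U1, of degree
    -q. *)
Definition tpar : {fraction R} :=
  N%:F ^+ q * ((pi 'X_[lm2 L])%:F / (pi 'X_[lm1 L])%:F) ^+ ld L.

Let grU1 : gr (wdeg a b c (lm1 L)) (pi 'X_[lm1 L]).
Proof. by exists 'X_[lm1 L] => //; rewrite dhomogX. Qed.

Let grU2 : gr (wdeg a b c (lm2 L)) (pi 'X_[lm2 L]).
Proof. by exists 'X_[lm2 L] => //; rewrite dhomogX. Qed.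

Let U0 : (pi 'X_[lm1 L])%:F != 0 /\ (pi 'X_[lm2 L])%:F != 0.
Proof.
by rewrite !tofrac_eq0; split; [apply: (notin_neq0 (lU1 L))|apply: (notin_neq0 (lU2 L))].
Qed.

Lemma tpar_neq0 : tpar != 0.
Proof.
have [u1 u2] := U0; apply: mulf_neq0; first by rewrite expf_neq0.
by rewrite expf_neq0 // mulf_neq0 // invr_eq0.
Qed.

Lemma hfr_U21 : hfr (- q%:Z) ((pi 'X_[lm2 L])%:F / (pi 'X_[lm1 L])%:F).
Proof.
have -> : - q%:Z = (wdeg a b c (lm2 L))%:Z - (wdeg a b c (lm1 L))%:Z.
  by rewrite lU_deg PoszD; ring.
apply: (hfrM H); first exact: (hfr_R H).
by apply: hfrV; [case: U0|apply: (hfr_R H)].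
Qed.

Lemma ratfun_tpar : ratfun gr tpar.
Proof.
apply/ratfun_hfr; apply: (hfr_eq (hfrM H (hfrXn H q (hfr_R H grN)) (hfrXn H (ld L) hfr_U21))).
by move: (ld L) q => x y; rewrite mulNrn -[x%:Z *+ y]mulr_natr -[y%:Z *+ x]mulr_natr !natz mulrC subrr.
Qed.

Lemma unit_U21 : unitat P ((pi 'X_[lm2 L])%:F / (pi 'X_[lm1 L])%:F).
Proof. by exists (pi 'X_[lm2 L]), (pi 'X_[lm1 L]); split; [exact: lU2|exact: lU1|]. Qed.

Lemma val_tpar : val tpar = q%:Z.
Proof.
apply: val_isval; exists (((pi 'X_[lm2 L])%:F / (pi 'X_[lm1 L])%:F) ^+ ld L) => //.
exact: (unitatX (ld L) unit_U21).
Qed.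

Lemma local_ring_val z : local_ring P z <-> ratfun gr z /\ (z != 0 -> 0 <= val z).
Proof.
split=> [[n [x [y [hx hy yP zE]]]]|[rz vz]].
  have hz : ratfun gr z by exists n, x, y; split=> //; apply: (notin_neq0 yP).
  by split=> // z0; apply/(val_ge0 (ratfun_deg0 hz) z0); exists x, y.
have [->|z0] := eqVneq z 0.
  by exists 0%N, 0, 1; rewrite notin1 tofrac0 mul0r; split=> //; [exact: (gr0 H)|exact: (gr1 H)].
have hz := ratfun_deg0 rz.
have [i [j [x [y [hx hy yP zE /esym/eqP]]]]] := hloc H hz (iffLR (val_ge0 hz z0) (vz z0)) z0.
rewrite subr_eq0 eqz_nat => /eqP ij.
by exists j, x, y; split=> //; rewrite -ij.
Qed.

Lemma local_max_val z : local_max P z <-> ratfun gr z /\ (z != 0 -> 0 < val z).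
Proof.
split=> [[n [x [y [hx hy xP yP zE]]]]|[rz vz]].
  have hz : ratfun gr z by exists n, x, y; split=> //; apply: (notin_neq0 yP).
  split=> // z0; have y0 := notin_neq0 yP.
  have x0 : x != 0 by apply: contraNneq z0 => x0; rewrite zE x0 tofrac0 mul0r.
  rewrite zE (valM (hfr_R H hx) (hfrV _ (hfr_R H hy))) ?invr_eq0 ?tofrac_eq0 //.
  by rewrite (valV (hfr_R H hy)) ?tofrac_eq0 // (val_notin yP) subr0 -(val_mem hx x0).
have [|n [x [y [hx hy yP zE]]]] := iffRL (local_ring_val z).
  by split=> // z0; apply: ltW; apply: vz.
exists n, x, y; split=> //.
have [->|x0] := eqVneq x 0; first by rewrite pid0.
have y0 := notin_neq0 yP.
have z0 : z != 0 by rewrite zE mulf_neq0 ?invr_eq0 ?tofrac_eq0.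
have := vz z0; rewrite zE (valM (hfr_R H hx) (hfrV _ (hfr_R H hy))) ?invr_eq0 ?tofrac_eq0 //.
by rewrite (valV (hfr_R H hy)) ?tofrac_eq0 // (val_notin yP) subr0 -(val_mem hx x0).
Qed.

Let q0 : 0 < q%:Z. Proof. by rewrite ltz_nat lq_gt0. Qed.

Lemma ratfun_div z z' : ratfun gr z -> ratfun gr z' -> z' != 0 -> ratfun gr (z / z').
Proof.
move=> /ratfun_hfr hz /ratfun_hfr hz' z0'; apply/ratfun_hfr.
by apply: (hfr_eq (hfrM H hz (hfrV z0' hz'))); rewrite subr0.
Qed.

(** On k(X) the values of [val] are multiples of q and [tpar] attains q, so q is the least positive
    one. *)
Lemma uniformizer_val t : uniformizer P t <-> [/\ ratfun gr t, t != 0 & val t = q%:Z].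
Proof.
split=> [[/local_max_val[rt vt] t0 gen]|[rt t0 vt]].
  split=> //; have /gen[r /local_ring_val[rr vr] E] : local_max P tpar.
    apply/local_max_val; split; first exact: ratfun_tpar.
    by rewrite val_tpar.
  have r0 : r != 0 by apply: contraNneq tpar_neq0 => r0; rewrite E r0 mul0r.
  have := val_tpar; rewrite E (valM (ratfun_deg0 rr) (ratfun_deg0 rt)) //.
  have := vr r0; have := vt t0; have /dvdzP[m ->] := val_ratfun rt t0.
  rewrite pmulr_lgt0 // => m0 vr0 E'; apply/eqP; rewrite eq_le -{2}E' lerDr vr0 /=.
  by rewrite ler_peMl ?(ltW q0) // -gtz0_ge1.
split=> //; first by apply/local_max_val; rewrite vt.
move=> s /local_max_val[rs vs]; exists (s / t); last by rewrite divfK.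
apply/local_ring_val; split; first exact: ratfun_div.
rewrite mulf_eq0 negb_or invr_eq0 t0 andbT => s0.
rewrite (valM (ratfun_deg0 rs) (hfrV _ (ratfun_deg0 rt))) ?invr_eq0 //.
rewrite (valV (ratfun_deg0 rt)) // vt.
have := vs s0; have /dvdzP[m ->] := val_ratfun rs s0.
by rewrite pmulr_lgt0 // => m0; rewrite subr_ge0 ler_peMl ?(ltW q0) // -gtz0_ge1.
Qed.

Lemma ord_val z : ratfun gr z -> z != 0 -> val z = ord P z * q%:Z.
Proof.
move=> rz z0; have hz := ratfun_deg0 rz.
rewrite /ord; case: xgetP => [n _ [t [r [/uniformizer_val[rt t0 vt] lr lr' r0 zE]]]|].
  have /local_ring_val[rr /(_ r0) vr] := lr.
  have /local_ring_val[_ vr'] := lr'; rewrite invr_eq0 in vr'; move/(_ r0): vr'.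
  have hr := ratfun_deg0 rr; have ht := ratfun_deg0 rt.
  rewrite (valV hr) // => vr'.
  rewrite zE (valM hr (hfrX H n t0 ht)) ?expfz_neq0 // (valX _ ht) // vt; lia.
have /dvdzP[n nE] := val_ratfun rz z0.
move/(_ n); case; exists tpar, (z / tpar ^ n).
have rt := ratfun_tpar; have ht := ratfun_deg0 rt.
have htn : hfr 0 (tpar ^ n) by have := hfrX H n tpar_neq0 ht; rewrite mul0r.
have tn0 : tpar ^ n != 0 by rewrite expfz_neq0 // tpar_neq0.
have z0' : z / tpar ^ n != 0 by rewrite mulf_neq0 ?invr_eq0.
have rz' : ratfun gr (z / tpar ^ n) by apply: ratfun_div => //; apply/ratfun_hfr.
have v0 : val (z / tpar ^ n) = 0.
  rewrite (valM hz (hfrV tn0 htn)) ?invr_eq0 // (valV htn) // (valX _ ht) ?tpar_neq0 //.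
  by rewrite val_tpar nE; ring.
split=> //; last by rewrite divfK.
- by apply/uniformizer_val; rewrite tpar_neq0 val_tpar; split.
- by apply/local_ring_val; rewrite v0.
apply/local_ring_val; rewrite (valV (ratfun_deg0 rz')) // v0; split=> //.
by apply/ratfun_hfr; apply: (hfr_eq (hfrV z0' (ratfun_deg0 rz'))); rewrite oppr0.
Qed.

End AtPoint.

End Valuations.

(** * Homogeneous fractions without poles *)

Lemma ord3_ind (Q : 'I_3 -> Prop) : Q 0 -> Q 1 -> Q 2%:R -> forall i, Q i.
Proof.
move=> q0 q1 q2 [[|[|[|]]]] // p.
- by rewrite (_ : Ordinal p = 0) //; apply/val_inj.
- by rewrite (_ : Ordinal p = 1) //; apply/val_inj.
by rewrite (_ : Ordinal p = 2%:R) //; apply/val_inj.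
Qed.

Section Koszul.

Variable k : fieldType.
Local Notation S := {mpoly k[3]}.

Lemma zero_var (i : 'I_3) : exists rho : {rmorphism S -> S},
  [/\ rho 'X_i = 0, forall j, j != i -> rho 'X_j = 'X_j &
      forall p, exists E, p = 'X_i * E + rho p].
Proof.
pose v (j : 'I_3) : S := if j == i then 0 else 'X_j.
have rX j : mmap (@mpolyC 3 k) v 'X_j = v j by rewrite mmapX mmap1U.
exists (mmap (@mpolyC 3 k) v); split=> [|j /negbTE ji|p].
- by rewrite /= rX /v eqxx.
- by rewrite /= rX /v ji.
have hX j : exists E, 'X_j = 'X_i * E + v j.
  rewrite /v; case: eqP => [->|_]; first by exists 1; rewrite mulr1 addr0.
  by exists 0; rewrite mulr0 add0r.
have hm (m : 'X_{1..3}) : exists E, 'X_[m] = 'X_i * E + mmap1 v m.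
  rewrite mpolyXE_id /mmap1; elim/big_rec2: _ => [|j x y _ [E ->]].
    by exists 0; rewrite mulr0 add0r.
  have [F hF] : exists F, 'X_j ^+ m j = 'X_i * F + v j ^+ m j.
    elim: (m j) => [|n [F IH]]; first by exists 0; rewrite mulr0 add0r !expr0.
    have [G hG] := hX j; exists (G * ('X_i * F + v j ^+ n) + v j * F).
    by rewrite !exprS {1}hG IH; ring.
  by exists (F * ('X_i * E + x) + v j ^+ m j * E); rewrite hF; ring.
suff [E hE] : exists E, \sum_(m <- msupp p) p@_m *: 'X_[m] =
    'X_i * E + \sum_(m <- msupp p) (p@_m)%:MP * mmap1 v m.
  by exists E; rewrite {1}(mpolyE p) hE.
elim: (msupp p) => [|m r [E IH]].
  by exists 0; rewrite !big_nil mulr0 addr0.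
have [F hF] := hm m; exists (p@_m *: F + E).
by rewrite !big_cons IH hF -!mul_mpolyC /=; ring.
Qed.

Let X0 i : 'X_i != 0 :> S. Proof. exact: mpolyX_neq0. Qed.

Lemma var_dvd (i j : 'I_3) (P Q : S) : i != j -> 'X_i * P = 'X_j * Q ->
  exists E, P = 'X_j * E /\ Q = 'X_i * E.
Proof.
move=> ij E; have [rho [rj ri hr]] := zero_var j.
have [F hF] := hr P; have := congr1 rho E.
rewrite !rmorphM /= rj mul0r (ri _ ij) => /eqP; rewrite mulf_eq0 (negbTE (X0 i)) /= => /eqP r0.
exists F; rewrite {1}hF r0 addr0; split=> //; apply: (mulfI (X0 j)).
by rewrite -E hF r0 addr0 mulrCA.
Qed.

(** Exactness of the Koszul complex of the three variables at the first syzygies. Modulo X_0 only a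
    relation between X_1 and X_2 remains, which [var_dvd] solves. *)
Lemma koszul3 (A B C : S) : 'X_0 * A + 'X_1 * B + 'X_2%:R * C = 0 ->
  exists D E F, [/\ A = 'X_1 * D - 'X_2%:R * E, B = 'X_2%:R * F - 'X_0 * D
    & C = 'X_0 * E - 'X_1 * F].
Proof.
move=> K; have [rho [r0 ri hr]] := zero_var 0.
have [B1 hB] := hr B; have [C1 hC] := hr C.
have := congr1 rho K; rewrite rmorph0 !rmorphD !rmorphM /= r0 mul0r add0r.
rewrite !ri // => /eqP; rewrite addr_eq0 -mulrN => /eqP /var_dvd[] // E [EB EC].
have CE : rho C = - ('X_1 * E) by rewrite -EC opprK.
exists (- B1), C1, E; split; last 2 first.
- by rewrite hB EB; ring.
- by rewrite hC CE; ring.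
apply: (mulfI (X0 0)); apply/eqP; rewrite -subr_eq0 -K hB EB hC CE; apply/eqP; ring.
Qed.

End Koszul.

(** Rehomogenization: the g m are the components of 1 - r x + r, with r indexed by degree and
    shifted by one, and multiplying them by complementary powers of x cancels all but x^n and the
    last r. *)
Lemma telescoping_sum (A : comNzRingType) (x : A) (r g : nat -> A) n : r 0%N = 0 ->
  (forall m, g m = (m == 0%N)%:R - r m * x + r m.+1) ->
  \sum_(m < n.+1) x ^+ (n - m) * g m = x ^+ n + r n.+1.
Proof.
move=> r0 hg; elim: n => [|n IH].
  by rewrite big_ord1 subn0 hg r0 mul0r subr0 expr0 mul1r.
rewrite big_ord_recr /= subnn mul1r hg sub0r.
under eq_bigr => m _ do rewrite subSn -1?ltnS // exprS -mulrA.
by rewrite -mulr_sumr IH mulrDr exprS -addrA [x * r _]mulrC addNKr.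
Qed.

Section Intersection.

Variables (k : closedFieldType) (a b c : nat) (R : idomainType).
Variables (pi : {rmorphism {mpoly k[3]} -> R}) (h : nat) (f : {mpoly k[3]}).
Hypothesis H : hsurf a b c pi h f.

Local Notation w := (wt a b c).
Local Notation hom n p := (p \is n.-homog for (wdeg a b c)).
Local Notation gr := (piece a b c pi).
Local Notation cst := (structure_map pi).
Local Notation hfr := (hfr a b c pi).
Local Notation "x %:F" := (@FracField.tofrac R x).
Local Notation x_ i := (pi 'X_i).

Definition idl (I : R -> Prop) :=
  [/\ I 0, forall x y, I x -> I y -> I (x + y) & forall r x, I x -> I (r * x)].

Definition ext_idl (I : R -> Prop) t : R -> Prop := fun x => exists u r, I u /\ x = u + r * t.

Lemma ext_idlP I t : idl I -> [/\ idl (ext_idl I t), forall x, I x -> ext_idl I t x & ext_idl I t t].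
Proof.
move=> [I0 ID IM]; split; first split.
- by exists 0, 0; rewrite mul0r addr0.
- move=> x y [u [r [hu ->]]] [u' [r' [hu' ->]]]; exists (u + u'), (r + r').
  by split; [apply: ID|ring].
- move=> s x [u [r [hu ->]]]; exists (s * u), (s * r).
  by split; [apply: IM|ring].
- by move=> x hx; exists x, 0; rewrite mul0r addr0.
- by exists 0, 1; rewrite mul1r add0r.
Qed.

Lemma ext_idl_root I x (zs : seq k) : idl I -> ~ I 1 ->
  I (\prod_(z <- zs) (x - cst z)) -> exists z, ~ ext_idl I (x - cst z) 1.
Proof.
move=> iI I1; elim: zs => [|z zs IH]; first by rewrite big_nil.
rewrite big_cons => hI; have [[u [r [hu E]]]|no] := EM (ext_idl I (x - cst z) 1); last by exists z.
apply: IH; have [I0 ID IM] := iI.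
have -> : \prod_(j <- zs) (x - cst j) = (\prod_(j <- zs) (x - cst j)) * u
   + r * ((x - cst z) * \prod_(j <- zs) (x - cst j)).
  by rewrite -[LHS]mulr1 E; ring.
by apply: ID; apply: IM.
Qed.

Lemma unity_roots_list n (z : k) : (0 < n)%N -> exists rs : seq k,
  forall x, x ^+ n - cst z = \prod_(r <- rs) (x - cst r).
Proof.
move=> n0; have [rs E] := closed_field_poly_normal ('X^n - z%:P : {poly k}).
rewrite (monicP (monicXnsubC z n0)) scale1r in E.
exists rs => x; have := congr1 (fun p => (map_poly cst p).[x]) E.
rewrite rmorphB rmorph_prod /= map_polyXn map_polyC /= !hornerE => ->.
rewrite horner_prod; apply: eq_bigr => r _.
by rewrite rmorphB /= map_polyX map_polyC /= !hornerE.
Qed.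

(* A homogeneous ideal with x_i not in its radical has a zero with i-th
   coordinate 1. *)
Lemma idl_point I i : idl I -> (forall x n, I x -> I (grading H x)`_n) ->
  (exists e y, [/\ gr e y, y != 0 & I y]) -> (forall n, ~ I (x_ i ^+ n)) ->
  exists P : point gr, forall n x, gr n x -> I x -> x \in P.
Proof.
move=> iI hI [e [y [hy y0 Iy]]] nI.
have wi := wt_gt0 H i.
(* If 1 = u + r (x_i - 1) with u in I, the components of u in the degrees m w_i lie in I, and their
   telescoping sum is a power of x_i. *)
have p1 : ~ ext_idl I (x_ i - cst 1) 1.
  rewrite rmorph1 => -[u [r [Iu E]]].
  pose M := size (grading H r); apply: (nI M).
  have -> : x_ i ^+ M = \sum_(m < M.+1) x_ i ^+ (M - m) * (grading H u)`_(m * w i); last first.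
    have [I0 ID IM] := iI; elim/big_ind: _ => [||m _]; [exact: I0|exact: ID|].
    by apply: (IM); apply: hI.
  have uE : u = 1 - r * x_ i + r by apply/eqP; rewrite -subr_eq0 E; apply/eqP; ring.
  have [rr [rr0 rrM cE]] : exists rr : nat -> R, [/\ rr 0%N = 0, rr M.+1 = 0 &
      forall m, (grading H u)`_(m * w i) = (m == 0%N)%:R - rr m * x_ i + rr m.+1].
    exists (fun m => if m is m'.+1 then (grading H r)`_(m' * w i) else 0); split=> [//||m].
      by rewrite nth_default // leq_pmulr.
    rewrite uE !rmorphE /= !coefE; congr (_ - _ + _).
      by rewrite muln_eq0 (gtn_eqF wi) orbF; case: (m == 0%N).
    rewrite rmorphM (iffLR (grP H _ _) (gr_X a b c pi i)) -scalerAr coefZ coefMXn mulrC.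
    case: m => [|m]; first by rewrite mul0n wi /= mul0r.
    by rewrite mulSn ltnNge leq_addr /= addKn.
  by rewrite (telescoping_sum M rr0 cE) rrM addr0.
have ext J t : idl J -> ~ ext_idl J t 1 -> idl (ext_idl J t) /\ (forall x, J x -> ext_idl J t x).
  by move=> iJ _; have [? ? ?] := ext_idlP t iJ.
(* Modulo J one has x_i = 1, so [binary_form_in_ideal] applied to y in I gives a product of factors
   x_j - z in J; some factor can be adjoined to J without reaching 1. *)
have step (J : R -> Prop) j : idl J -> ~ J 1 -> (forall x, I x -> J x) -> J (x_ i - 1) ->
    exists z, ~ ext_idl J (x_ j - cst z) 1.
  move=> iJ J1 IJ Ji; have [J0 JD JM] := iJ.
  have hX : gr (w i * w j) (x_ j ^+ w i) by rewrite mulnC; apply: (grXn H); apply: gr_X.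
  have hY : gr (w i * w j) (x_ i ^+ w j) by apply: (grXn H); apply: gr_X.
  have d0 : (0 < w i * w j)%N by rewrite muln_gt0 wi (wt_gt0 H).
  have [zs [m [r E]]] := binary_form_in_ideal H hX hY d0 hy y0.
  have Jy : J (x_ i ^+ w j ^+ m * \prod_(z <- zs) (x_ j ^+ w i - cst z * x_ i ^+ w j)).
    by rewrite E mulrC; apply: JM; apply: IJ.
  have cong x x' : J (x - x') -> J x -> J x'.
    move=> h1 h2; rewrite (_ : x' = x + (-1) * (x - x')); last by ring.
    by apply: JD => //; apply: JM.
  have congM x x' u u' : J (x - x') -> J (u - u') -> J (x * u - x' * u').
    move=> h1 h2; rewrite (_ : _ - _ = u * (x - x') + x' * (u - u')); last by ring.
    by apply: JD; apply: JM.
  have congX n : J (x_ i ^+ n - 1).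
    elim: n => [|n IH]; first by rewrite expr0 subrr.
    by rewrite exprS -[X in _ - X]mulr1; apply: (congM).
  have : J (\prod_(z <- zs) (x_ j ^+ w i - cst z)).
    move: Jy; apply: cong; rewrite -[X in _ - X]mul1r; apply: (congM); first by rewrite -exprM.
    elim: zs {E} => [|z zs IH]; first by rewrite !big_nil subrr.
    rewrite !big_cons; apply: (congM) => //.
    rewrite (_ : _ - _ = - cst z * (x_ i ^+ w j - 1)); last by ring.
    exact: JM.
  have -> : \prod_(z <- zs) (x_ j ^+ w i - cst z) =
            \prod_(r <- flatten [seq projT1 (cid (unity_roots_list z wi)) | z <- zs]) (x_ j - cst r).
    rewrite big_flatten big_map; apply: eq_bigr => z _.
    by case: cid => rs /= ->.
  exact: ext_idl_root.
set J1 := ext_idl I _ in p1; have [i1 s1] := ext _ _ iI p1.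
have J1i : J1 (x_ i - 1) by rewrite /J1 rmorph1; have [_ _] := ext_idlP (x_ i - 1) iI.
pose good J := [/\ idl J, ~ J 1, forall x, I x -> J x & J (x_ i - 1)].
have step' J j : good J -> exists z J', [/\ good J', forall x, J x -> J' x & J' (x_ j - cst z)].
  move=> [iJ nJ IJ Ji]; have [z hz] := step J j iJ nJ IJ Ji.
  exists z, (ext_idl J (x_ j - cst z)).
  by have [iJ' JJ' hJ'] := ext_idlP (x_ j - cst z) iJ; split=> //; split=> //; auto.
have g1 : good J1 by split.
have [z0 [J2 [g2 s2 h2]]] := step' J1 0 g1.
have [z1 [J3 [g3 s3 h3]]] := step' J2 1 g2.
have [z2 [J [g4 s4 h4]]] := step' J3 2%:R g3.
pose p0 (t : 'I_3) := nth 0 [:: z0; z1; z2] t.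
have [iJ nJ IJ Ji] := g4; have [J0 JD JM] := iJ.
have Jx t : J (x_ t - cst (p0 t)).
  by elim/ord3_ind: t; [apply: s4; apply: s3|apply: s4|].
have Jcst z : J (cst z) -> z = 0.
  move=> hz; apply/eqP/negPn/negP => z0'; apply: nJ.
  by rewrite -(rmorph1 cst) -(mulVf z0') rmorphM; apply: JM.
have congM x x' u u' : J (x - x') -> J (u - u') -> J (x * u - x' * u').
  move=> h1 h2'; rewrite (_ : _ - _ = u * (x - x') + x' * (u - u')); last by ring.
  by apply: JD; apply: JM.
have Jev p : J (pi p - cst p.@[p0]).
  rewrite mevalE {1}(mpolyE p) !rmorph_sum -sumrB; elim/big_ind: _ => [||m _]; [exact: J0|exact: JD|].
  rewrite -cstM rmorphM -mulrBr; apply: (JM).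
  rewrite mpolyX_prod3 rmorph_prod; elim/big_rec2: _ => [|t x x' _ IH]; first by rewrite subrr.
  apply: (congM) => //; rewrite rmorphXn; elim: (m t) => [|n IHn]; first by rewrite !expr0 subrr.
  by rewrite !exprS; apply: (congM).
have p0i : p0 i = 1.
  apply/eqP; rewrite -subr_eq0; apply/eqP; apply: Jcst.
  rewrite rmorphB rmorph1 (_ : _ - _ = x_ i - 1 + (-1) * (x_ i - cst (p0 i))); last by ring.
  by apply: (JD) => //; apply: (JM).
have f0 : f.@[p0] = 0.
  apply: Jcst; have := Jev f; rewrite (_ : pi f = 0); last first.
    by apply/(pi_ker H); exists 1; rewrite mul1r.
  by move/(JM (-1)); rewrite sub0r mulrNN mul1r.
have pn : exists i, p0 i != 0 by exists i; rewrite p0i oner_neq0.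
have [P hP] := point_of_kpoint H pn f0.
exists P => n x [p hp <-] Ip; rewrite (kpoint_hom hP hp); apply/eqP; apply: Jcst.
rewrite (_ : cst _ = pi p + (-1) * (pi p - cst p.@[p0])); last by ring.
by apply: (JD); [apply: IJ|apply: (JM); apply: Jev].
Qed.

(** R has depth two at the origin. The conductor I of z has no zero on X, so it contains powers of
    all variables. If 1 is not in I, take a monomial m of maximal degree outside I: every X_i m z is
    some Y_i in R, and the relations X_i Y_j = X_j Y_i, lifted to k[u,v,w], show that the Y_i are
    X_i Q modulo f, so m z = Q is in R. *)
Lemma hfr_cap D z : hfr D z -> (forall P : point gr, inloc P z) -> exists x, z = x%:F.
Proof.
move=> hz loc; have [->|z0] := eqVneq z 0; first by exists 0; rewrite tofrac0.
pose I x := exists y, x%:F * z = y%:F.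
have iI : idl I.
  split; first by exists 0; rewrite tofrac0 mul0r.
    by move=> x y [u E] [v F]; exists (u + v); rewrite !tofracD mulrDl E F.
  by move=> r x [u E]; exists (r * u); rewrite !tofracM -mulrA E.
have [i0 [j0 [u [v [hu hv v0 zE _]]]]] := hz.
have v0F : v%:F != 0 by rewrite tofrac_eq0.
have hI x n : I x -> I (grading H x)`_n.
  move=> [y E]; have E1 : x * u = y * v.
    by apply/eqP; rewrite -tofrac_eq !tofracM -E zE mulrA divfK.
  have := congr1 (fun s => (grading H s)`_(n + i0)) E1.
  rewrite !rmorphM; move/(grP H): (hu) => ->; move/(grP H): (hv) => ->.
  rewrite -!scalerAr !coefZ !coefMXn ltnNge leq_addl /= addnK => E2.
  exists (if (n + i0 < j0)%N then 0 else (grading H y)`_(n + i0 - j0)).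
  apply: (mulIf v0F); rewrite zE mulrA divfK // -!tofracM mulrC E2 mulrC.
  by case: ifP.
have [|no] := EM (I 1); first by move=> [y]; rewrite tofrac1 mul1r => ->; exists y.
have pow i : exists n, I (x_ i ^+ n).
  apply/not_existsP => nI.
  have [|P hP] := @idl_point I i iI hI _ nI.
    by exists j0, v; split=> //; exists u; rewrite zE mulrC divfK.
  have [i1 [j1 [x [y [hx hy yP zE' _]]]]] := hloc H hz (loc P) z0.
  have y0F : y%:F != 0 by rewrite tofrac_eq0 (notin_neq0 yP).
  case/negP: yP; apply: (hP _ _ hy); exists x.
  by rewrite zE' mulrC divfK.
have [I0 ID IM] := iI.
have [M hM] : exists M, forall i, I (x_ i ^+ M).
  pose e i := projT1 (cid (pow i)); exists (\sum_i e i)%N => i.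
  rewrite (bigD1 i) //= addnC exprD; apply: (IM); rewrite /e; by case: cid.
pose T n := `[< exists m : 'X_{1..3}, mdeg m = n /\ ~ I (pi 'X_[m]) >].
have T0 : exists n, T n.
  by exists 0%N; apply/asboolP; exists 0%MM; rewrite mdeg0 mpolyX0 rmorph1.
have Tb n : T n -> (n <= 3 * M)%N.
  move=> /asboolP[m [<- nI]]; rewrite leqNgt; apply/negP => lt; apply: nI.
  have [i hi] : exists i, (M <= m i)%N.
    apply/existsP; apply: contraLR lt; rewrite negb_exists -leqNgt => /forallP lt.
    rewrite mdegE; have -> : (3 * M = \sum_(i < 3) M)%N by rewrite sum_nat_const card_ord.
    by apply: leq_sum => i _; rewrite ltnW // ltnNge lt.
  rewrite mpolyX_prod3 (bigD1 i) //= -(subnK hi) exprD mulrC mulrA.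
  exact: (IM).
have [n /asboolP[m [mn nI]] nmax] := ex_maxnP T0 Tb.
have Im i : I (x_ i * pi 'X_[m]).
  apply: contrapT => no'; suff /nmax : T n.+1 by rewrite ltnn.
  apply/asboolP; exists (U_(i) + m)%MM; rewrite mdegD mdeg1 mn add1n; split=> //.
  by rewrite mpolyXD rmorphM.
pose ze := (pi 'X_[m])%:F * z.
have hy i : exists Y, (x_ i)%:F * ze = (pi Y)%:F.
  have [y E] := Im i; have [Y hY] := pi_surj H y; exists Y.
  by rewrite hY -E tofracM mulrA.
pose Y i := projT1 (cid (hy i)).
have hY i : (x_ i)%:F * ze = (pi (Y i))%:F by rewrite /Y; case: cid.
have rel i j : exists A, 'X_i * Y j - 'X_j * Y i = A * f.
  apply/(pi_ker H); apply/eqP; rewrite rmorphB !rmorphM subr_eq0 -tofrac_eq !tofracM -!hY.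
  by rewrite mulrCA.
have [A01 e01] := rel 0 1; have [A12 e12] := rel 1 2%:R; have [A20 e20] := rel 2%:R 0.
(* Since f is nonzero in a domain, the cofactors A form a Koszul cycle. Writing it as a boundary
   gives multiples of f to subtract from the Y_i so that X_i Y_j = X_j Y_i holds in k[u,v,w]
   itself. *)
have K : 'X_0 * A12 + 'X_1 * A20 + 'X_2%:R * A01 = 0.
  apply: (mulIf (f_neq0 H)); rewrite mul0r !mulrDl -!mulrA -e01 -e12 -e20; ring.
have [B2 [B1 [B0 [E12 E20 E01]]]] := koszul3 K.
have key01 : 'X_0 * (Y 1 - f * B1) = 'X_1 * (Y 0 - f * B0).
  apply/eqP; rewrite -subr_eq0; apply/eqP.
  transitivity ('X_0 * Y 1 - 'X_1 * Y 0 - f * ('X_0 * B1 - 'X_1 * B0)); first by ring.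
  by rewrite e01 E01; ring.
have key12 : 'X_1 * (Y 2%:R - f * B2) = 'X_2%:R * (Y 1 - f * B1).
  apply/eqP; rewrite -subr_eq0; apply/eqP.
  transitivity ('X_1 * Y 2%:R - 'X_2%:R * Y 1 - f * ('X_1 * B2 - 'X_2%:R * B1)); first by ring.
  by rewrite e12 E12; ring.
have [//|Q [Q1 Q0]] := var_dvd _ key01.
have Q2 : Y 2%:R - f * B2 = 'X_2%:R * Q.
  by apply: (mulfI (mpolyX_neq0 k U_(1)%MM)); rewrite key12 Q1 mulrCA.
have [P _] := plane_point H 0; have [i iP] := point_var P.
have x0 : (x_ i)%:F != 0 by rewrite tofrac_eq0 (notin_neq0 iP).
have pf0 u' : pi (f * u') = 0 by apply/(pi_ker H); exists u'; rewrite mulrC.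
have YQ j : pi (Y j) = x_ j * pi Q.
  rewrite -rmorphM; elim/ord3_ind: j.
  - by rewrite -Q0 rmorphB pf0 subr0.
  - by rewrite -Q1 rmorphB pf0 subr0.
  by rewrite -Q2 rmorphB pf0 subr0.
case: nI; exists (pi Q); apply: (mulfI x0); rewrite hY YQ tofracM.
by [].
Qed.

End Intersection.

(** * Centers of graded valuations *)

Section FinitePoints.

Variables (k : closedFieldType) (a b c : nat) (R : idomainType).
Variables (pi : {rmorphism {mpoly k[3]} -> R}) (h : nat) (f : {mpoly k[3]}).
Hypothesis H : hsurf a b c pi h f.

Local Notation w := (wt a b c).
Local Notation hom n p := (p \is n.-homog for (wdeg a b c)).
Local Notation gr := (piece a b c pi).
Local Notation cst := (structure_map pi).
Local Notation "x %:F" := (@FracField.tofrac R x).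

Definition finpts (A : point gr -> Prop) :=
  exists n (s : 'I_n -> point gr), forall P, A P -> exists i, P = s i.

Lemma finpts_seq (A : point gr -> Prop) (T : eqType) (s : seq T) (r : T -> point gr -> Prop) :
  (forall t P Q, r t P -> r t Q -> P = Q) ->
  (forall P, A P -> exists2 t, t \in s & r t P) -> finpts A.
Proof.
move=> ru hA; have [P0 _] := plane_point H 0.
have e t : exists P, forall Q, r t Q -> Q = P.
  by have [[P hP]|no] := EM (exists P, r t P);
    [exists P => Q hQ; apply: (ru t)|exists P0 => Q hQ; case: no; exists Q].
exists (size s), (fun i => projT1 (cid (e (tnth (in_tuple s) i)))) => P /hA[t ts tP].
have it : (index t s < size s)%N by rewrite index_mem.
exists (Ordinal it); case: cid => Q /= hQ; apply: hQ.
by rewrite (tnth_nth t) /= nth_index.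
Qed.

Lemma kpoint_uniq (P Q : point gr) p0 : kpoint P p0 -> kpoint Q p0 -> P = Q.
Proof.
move=> [_ hP] [_ hQ]; apply: point_eq => x; have [p <-] := pi_surj H x.
by rewrite hP hQ.
Qed.

(** Move along the orbit by t with t^w_i = 1 / p0_i. *)
Lemma kpoint_normalize_at (P : point gr) i : pi 'X_i \notin P -> exists p0, kpoint P p0 /\ p0 i = 1.
Proof.
have [p0 hP] := kpoint_ex H P; rewrite (kpoint_hom hP (homX k a b c i)) mevalXU => pi0.
have [t tE] := closed_root (p0 i)^-1 (wt_gt0 H i).
have t0 : t != 0.
  by apply: contraNneq pi0 => t0; rewrite -invr_eq0 -tE t0 expr0n gtn_eqF ?wt_gt0 // (wt_gt0 H).
pose p1 j := t ^+ w j * p0 j; exists p1.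
have p1i : p1 i = 1 by rewrite /p1 tE mulVf.
split=> //; split; first by exists i; rewrite p1i oner_neq0.
have ev n p : hom n p -> p.@[p1] = t ^+ n * p.@[p0].
  move=> hp; rewrite !mevalE mulr_sumr big_seq [RHS]big_seq; apply: eq_bigr => m mp.
  rewrite mulrCA; congr (_ * _); rewrite -(hom_wdeg hp mp) wdegE -prodrXr -big_split /=.
  by apply: eq_bigr => j _; rewrite exprMn -exprM mulnC.
move=> p; case: hP => _ ->.
have coefE n : (chi a b c p1 p)`_n = t ^+ n * (chi a b c p0 p)`_n.
  by rewrite !chi_coef; apply: ev; apply: pihomogP.
apply/eqP/eqP => /polyP E; apply/polyP => n; rewrite coef0.
  by rewrite coefE E coef0 mulr0.
have := coefE n; rewrite E coef0 => /esym/eqP; rewrite mulf_eq0 expf_eq0 (negbTE t0) andbF /=.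
by move/eqP.
Qed.

Lemma kpoint_normalize (P : point gr) : exists i p0, kpoint P p0 /\ p0 i = 1.
Proof. by have [i /kpoint_normalize_at[p0 h0]] := point_var P; exists i, p0. Qed.

(** Once a coordinate is normalized to 1, [binary_form_in_ideal] confines each coordinate of a zero
    of y to a finite list of roots. *)
Lemma finpts_zeros n y : gr n y -> y != 0 -> finpts (fun P => y \in P).
Proof.
move=> hy y0.
have cand i j : exists zs : seq k, forall (P : point gr) p0, kpoint P p0 -> p0 i = 1 ->
    y \in P -> p0 j \in zs.
  have wi := wt_gt0 H i.
  have hX : gr (w i * w j) (pi 'X_j ^+ w i) by rewrite mulnC; apply: (grXn H); apply: gr_X.
  have hY : gr (w i * w j) (pi 'X_i ^+ w j) by apply: (grXn H); apply: gr_X.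
  have d0 : (0 < w i * w j)%N by rewrite muln_gt0 wi (wt_gt0 H).
  have [zs [m [r E]]] := binary_form_in_ideal H hX hY d0 hy y0.
  exists (flatten [seq projT1 (cid (unity_roots_list pi z wi)) | z <- zs]) => P p0 hP p0i yP.
  have pP := point_prime P.
  have : pi 'X_i ^+ w j ^+ m * \prod_(z <- zs) (pi 'X_j ^+ w i - cst z * pi 'X_i ^+ w j) \in P.
    by rewrite E pidMr.
  rewrite pidM // pidX // pidX // => /orP[/and3P[_ _]|].
    by rewrite (kpoint_hom hP (homX _ _ _ _ i)) mevalXU p0i oner_eq0.
  move=> /(pid_prodP pP)[z zzs].
  rewrite -!rmorphXn cstM -rmorphB => hz.
  have : p0 j ^+ w i - z = 0.
    case: hP => _ hP; move: hz; rewrite hP => /eqP /(congr1 (fun u => u.[1])).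
    by rewrite chi1 mevalB mevalZ !rmorphXn /= !mevalXU p0i expr1n mulr1 horner0.
  move=> hz0; apply/flatten_mapP; exists z => //; case: cid => rs /= hrs.
  have := hrs (cst (p0 j)); rewrite -rmorphXn -rmorphB hz0 rmorph0 => /esym/eqP.
  have -> : \prod_(r0 <- rs) (cst (p0 j) - cst r0) = cst (\prod_(r0 <- rs) (p0 j - r0)).
    by rewrite rmorph_prod; apply: eq_bigr => r0 _; rewrite rmorphB.
  rewrite cst_eq0 prodf_seq_eq0 => /hasP[r0 r0s /=]; rewrite subr_eq0 => /eqP ->.
  exact: r0s.
pose Z i j := projT1 (cid (cand i j)).
have hZ i j (P : point gr) (p0 : 'I_3 -> k) : kpoint P p0 -> p0 i = 1 -> y \in P -> p0 j \in Z i j.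
  by rewrite /Z; case: cid => zs /= hz; apply: hz.
pose fn (t : k * k * k) (i : 'I_3) := nth 0 [:: t.1.1; t.1.2; t.2] i.
pose s := flatten [seq [seq (u, z) | u <- [seq (x, y) | x <- Z i 0, y <- Z i 1], z <- Z i 2%:R] | i : 'I_3].
apply: (@finpts_seq _ _ s (fun t P => kpoint P (fn t))).
  by move=> t P Q; apply: kpoint_uniq.
move=> P yP; have [i [p0 [hP p0i]]] := kpoint_normalize P.
exists (p0 0, p0 1, p0 2%:R).
  apply/flatten_imageP; exists i => //; apply: allpairs_f; last exact: hZ hP p0i yP.
  by apply: allpairs_f; exact: hZ hP p0i yP.
have -> // : fn (p0 0, p0 1, p0 2%:R) = p0.
by apply/funext => -[[|[|[|]]]] // p; rewrite /fn /=; congr p0; apply/val_inj.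
Qed.

End FinitePoints.

Section Centers.

Variables (k : closedFieldType) (a b c : nat) (R : idomainType).
Variables (pi : {rmorphism {mpoly k[3]} -> R}) (h : nat) (f : {mpoly k[3]}).
Variable C : curve a b c pi h f.

Let H := cvH C.
Local Notation w := (wt a b c).
Local Notation gr := (piece a b c pi).
Local Notation cst := (structure_map pi).
Local Notation "x %:F" := (@FracField.tofrac R x).

Record gradedval (om : R -> rat) : Prop := GradedVal {
  gv_ge0 : forall n x, gr n x -> x != 0 -> 0 <= om x;
  gvM : forall n m x y, gr n x -> gr m y -> x != 0 -> y != 0 -> om (x * y) = om x + om y;
  gvD : forall n x y t, gr n x -> gr n y -> x != 0 -> y != 0 -> x + y != 0 ->
    t <= om x -> t <= om y -> t <= om (x + y);
  gv_proper : exists n x, [/\ (0 < n)%N, gr n x, x != 0 & om x = 0];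
  gv_pos : exists n x, [/\ gr n x, x != 0 & 0 < om x] }.

Section Center.

Variable om : R -> rat.
Hypothesis hom : gradedval om.

Let inI x := (x == 0) || (0 < om x).
Let I : {pred R} := fun x => `[< forall n, inI (grading H x)`_n >].

Let inI0 : inI 0. Proof. by rewrite /inI eqxx. Qed.

Let inID n x y : gr n x -> gr n y -> inI x -> inI y -> inI (x + y).
Proof.
rewrite /inI => hx hy; have [->|x0] := eqVneq x 0; first by rewrite add0r.
have [->|y0] := eqVneq y 0; first by rewrite addr0 (negbTE x0).
have [//|s0 /= px py] := eqVneq (x + y) 0.
have [le|/ltW le] := lerP (om x) (om y).
  exact: lt_le_trans px (gvD hom hx hy x0 y0 s0 (lexx _) le).
exact: lt_le_trans py (gvD hom hx hy x0 y0 s0 le (lexx _)).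
Qed.

Let inIM n m x y : gr n x -> gr m y -> inI y -> inI (x * y).
Proof.
rewrite /inI => hx hy; rewrite mulf_eq0.
have [//|x0] := eqVneq x 0; have [//|y0 /= py] := eqVneq y 0.
by rewrite (gvM hom hx hy) // ltr_wpDl // (gv_ge0 hom hx).
Qed.

Let inI_sum n (T : Type) (r : seq T) (F : T -> R) : (forall i, gr n (F i)) ->
  (forall i, inI (F i)) -> inI (\sum_(i <- r) F i).
Proof.
move=> hF iF; elim: r => [|i r IH]; first by rewrite big_nil.
by rewrite big_cons; apply: (@inID n) => //; apply: (gr_sum H).
Qed.

Let mem_hom n x : gr n x -> (x \in I) = inI x.
Proof.
move=> hx; apply/asboolP/idP => [/(_ n)|hi m]; first by rewrite (gr_coef_eq H hx).
have [->|ne] := eqVneq m n; first by rewrite (gr_coef_eq H hx).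
by rewrite (gr_coef_ne H hx).
Qed.

Let coefM x y n : (grading H (x * y))`_n =
  \sum_(i < n.+1) (grading H x)`_i * (grading H y)`_(n - i).
Proof. by rewrite rmorphM coefM. Qed.

Let I_prime : prime_ideal I.
Proof.
split; first split=> [||r x y].
- by apply/asboolP => n; rewrite rmorph0 coef0.
- rewrite (mem_hom (gr1 H)) /inI oner_eq0 -leNgt.
  have e := gvM hom (gr1 H) (gr1 H) (oner_neq0 R) (oner_neq0 R).
  by move: e; rewrite mulr1; lra.
- move=> /asboolP hx /asboolP hy; apply/asboolP => n; rewrite rmorphD coefD.
  apply: (@inID n); [|exact: gr_coef| |exact: hy]; first exact: gr_coef.
  rewrite coefM; apply: (@inI_sum n) => i.
    by rewrite -[X in gr X _](@subnKC i) ?leq_ord //; apply: (grM H); apply: gr_coef.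
  by apply: (@inIM i (n - i)); [apply: gr_coef|apply: gr_coef|apply: hx].
move=> x y /asboolP hxy; apply/negPn/negP; rewrite negb_or => /andP[xI yI].
have minex z : z \notin I -> exists n, ~~ inI (grading H z)`_n /\
    forall m, (m < n)%N -> inI (grading H z)`_m.
  move=> zI; have ex : exists n, ~~ inI (grading H z)`_n.
    by apply/not_existsP => all; case/negP: zI; apply/asboolP => n; apply/negPn/negP; apply: all.
  case: (ex_minnP ex) => n hn mn; exists n; split=> // m lt.
  by apply/negPn/negP => /mn; rewrite leqNgt lt.
have [n [hn ln]] := minex _ xI; have [m [hm lm]] := minex _ yI.
have ltn : (n < (n + m).+1)%N by rewrite ltnS leq_addr.
have := hxy (n + m)%N; rewrite coefM (bigD1 (Ordinal ltn)) //= addKn.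
set p := _ * _; set s := \sum_(_ < _ | _) _ => ps.
have gp : gr (n + m)%N p by apply: (grM H); apply: gr_coef.
have gF (i : 'I_(n + m).+1) : gr (n + m)%N ((grading H x)`_i * (grading H y)`_(n + m - i)).
  by rewrite -[X in gr X _](@subnKC i) ?leq_ord //; apply: (grM H); apply: gr_coef.
have gs : gr (n + m)%N s by apply: (gr_sum H).
have is_ : inI (- s).
  rewrite /s -sumrN big_mkcond /=; apply: (@inI_sum (n + m)%N) => i.
    by case: ifP => _; [apply: (grN H)|apply: (gr0 H)].
  case: ifP => // ne; have N1 : gr 0%N (-1 : R) by apply: (grN H); apply: (gr1 H).
  rewrite -mulN1r; apply: (inIM N1 (gF i)).
  have [lt|gt|e] := ltngtP i n.
  - by rewrite mulrC; apply: (inIM (gr_coef H _ _) (gr_coef H _ _)); apply: ln.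
  - apply: (inIM (gr_coef H _ _) (gr_coef H _ _)); apply: lm.
    by rewrite ltn_subLR ?leq_ord // ltn_add2r.
  by case/eqP: ne; apply/val_inj.
have : inI p.
  have -> : p = (p + s) + - s by rewrite addrK.
  by apply: (@inID (n + m)%N) => //; [apply: (grD H)|apply: (grN H)].
rewrite /inI mulf_eq0 => /orP[/orP[] e|].
- by move: hn; rewrite /inI e.
- by move: hm; rewrite /inI e.
move: hn hm; rewrite /inI !negb_or -!leNgt => /andP[x0 hx] /andP[y0 hy].
rewrite (gvM hom (gr_coef H _ _) (gr_coef H _ _)) // => lt.
by move: (lt_le_trans lt (lerD hx hy)); rewrite addr0 ltxx.
Qed.

(** The homogeneous elements of positive value generate a homogeneous prime P. Degree 0 units at P
    have value 0, so on k(X) the valuation is ord P times the value e of a uniformizer. *)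
Lemma center : exists P : point gr,
  (forall n x, gr n x -> x != 0 -> (x \in P) = (0 < om x)) /\
  exists2 e, 0 < e & forall n x y, gr n x -> gr n y -> x != 0 -> y != 0 ->
    om x - om y = e * (ord P (x%:F / y%:F))%:~R.
Proof.
have c1 x : x \in I -> exists n (s : 'I_n -> R), (forall i : 'I_n, gr i (s i) /\ s i \in I) /\ x = \sum_i s i.
  move=> /asboolP hx; exists (size (grading H x)), (fun i => (grading H x)`_i).
  split; last exact: gr_decomp.
  by move=> i; have gx := gr_coef H x i; rewrite (mem_hom gx).
have c2 : exists n x, [/\ (0 < n)%N, gr n x & x \notin I].
  have [n [x [n0 gx x0 ox]]] := gv_proper hom; exists n, x; split=> //.
  by rewrite (mem_hom gx) /inI (negbTE x0) ox ltxx.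
have c3 : exists x, x \in I /\ x != 0.
  have [n [x [gx x0 ox]]] := gv_pos hom; exists x; split=> //.
  by rewrite (mem_hom gx) /inI (negbTE x0) ox.
pose P : point gr := Point I_prime c1 c2 c3.
have memP n x : gr n x -> x != 0 -> (x \in P) = (0 < om x).
  by move=> gx x0; have := mem_hom gx; rewrite /inI (negbTE x0).
have om0 n x : gr n x -> x \notin P -> om x = 0.
  move=> gx xP; have x0 := notin_neq0 xP; move: xP; rewrite (memP _ _ gx x0) -leNgt => le.
  by apply/eqP; rewrite eq_le le (gv_ge0 hom gx).
exists P; split=> //.
(* The extension of [om] to fractions of degree 0, as a relation; [vr_uniq] makes it
   single-valued. *)
pose vr z t := exists n x y, [/\ gr n x /\ gr n y, x != 0, y != 0, z = x%:F / y%:F & t = om x - om y].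
have vr_uniq z t t' : vr z t -> vr z t' -> t = t'.
  move=> [n [x [y [[gx gy] x0 y0 -> ->]]]] [n' [x' [y' [[gx' gy'] x0' y0' E ->]]]].
  have : x * y' = x' * y.
    by apply/eqP; rewrite -tofrac_eq !tofracM -eqr_div ?tofrac_eq0 // E.
  move/(congr1 om); rewrite (gvM hom gx gy') // (gvM hom gx' gy) //; lra.
have vrM z t z' t' : vr z t -> vr z' t' -> vr (z * z') (t + t').
  move=> [n [x [y [[gx gy] x0 y0 -> ->]]]] [n' [x' [y' [[gx' gy'] x0' y0' -> ->]]]].
  exists (n + n')%N, (x * x'), (y * y'); rewrite !mulf_neq0 //; split=> //.
  - by split; apply: (grM H).
  - by rewrite !tofracM invfM mulrACA.
  by rewrite (gvM hom gx gx') // (gvM hom gy gy') //; ring.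
have vrV z t : vr z t -> vr z^-1 (- t).
  move=> [n [x [y [[gx gy] x0 y0 -> ->]]]]; exists n, y, x; split=> //.
    by rewrite invfM invrK mulrC.
  by rewrite opprB.
have vr1 : vr 1 0.
  exists 0%N, 1, 1; rewrite oner_neq0 divff ?tofrac_eq0 ?oner_neq0 // subrr.
  by split=> //; split; apply: (gr1 H).
have vrX z t (n : int) : vr z t -> vr (z ^ n) (t * n%:~R).
  move=> hz; have hX m : vr (z ^+ m) (t * m%:R).
    elim: m => [|m IH]; first by rewrite expr0 mulr0.
    by rewrite exprS mulrS mulrDr mulr1; apply: vrM.
  case: n => n; first exact: hX.
  by rewrite NegzE -exprnN mulrNz mulrN; apply: vrV; apply: hX.
have tE : local_max P (tpar C P).
  apply/(local_max_val C P); rewrite val_tpar; split; first exact: ratfun_tpar.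
  by move=> _; rewrite ltz_nat lq_gt0.
have [e [e0 vt]] : exists e, 0 < e /\ vr (tpar C P) e.
  case: tE => n [x [y [gx gy xP yP E]]].
  have y0 := notin_neq0 yP.
  have x0 : x != 0 by apply: contraNneq (tpar_neq0 C P) => x0; rewrite E x0 tofrac0 mul0r.
  exists (om x); rewrite -(memP _ _ gx) //; split=> //.
  by exists n, x, y; rewrite (om0 _ _ gy yP) subr0.
exists e => // n x y gx gy x0 y0.
set z := x%:F / y%:F; have z0 : z != 0 by rewrite mulf_neq0 ?invr_eq0 ?tofrac_eq0.
have rz : ratfun gr z by exists n, x, y.
set m := ord P z; pose z' := z / tpar C P ^ m.
have tm0 : tpar C P ^ m != 0 by rewrite expfz_neq0 ?tpar_neq0.
have rt := ratfun_deg0 (ratfun_tpar C P).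
have rtm : hfr a b c pi 0 (tpar C P ^ m).
  by apply: (hfr_eq (hfrX H m (tpar_neq0 C P) rt)); rewrite mul0r.
have rz' : ratfun gr z' by apply: (ratfun_div C rz) => //; apply/ratfun_hfr.
have z0' : z' != 0 by rewrite mulf_neq0 ?invr_eq0.
have vz' : val C P z' = 0.
  rewrite (valM C P (ratfun_deg0 rz) (hfrV tm0 rtm)) ?invr_eq0 //.
  rewrite (valV C P rtm) // (valX C P _ rt) ?tpar_neq0 // val_tpar (ord_val C P rz z0).
  by rewrite mulrC subrr.
have lz' : local_ring P z' by apply/(local_ring_val C P); rewrite vz'.
have [d [u [u' [gu gu' u'P E]]]] := lz'.
have u0' := notin_neq0 u'P.
have u0 : u != 0 by apply: contraNneq z0' => u0; rewrite E u0 tofrac0 mul0r.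
have uP : u \notin P.
  apply/negP => uP; have /(local_max_val C P)[_ /(_ z0')] : local_max P z' by exists d, u, u'.
  by rewrite vz' ltxx.
have v1 : vr z' 0.
  by exists d, u, u'; rewrite (om0 _ _ gu uP) (om0 _ _ gu' u'P) subrr.
have v2 : vr z (om x - om y) by exists n, x, y.
apply: (vr_uniq _ _ _ v2); rewrite -[e * _]add0r.
have -> : z = z' * tpar C P ^ m by rewrite divfK.
by apply: vrM => //; apply: vrX.
Qed.

End Center.

End Centers.

(** * Derivations and the canonical divisor *)

Section QuotientRule.

Variable K : fieldType.

Lemma quotient_rule_wd (X Y N M dX dY dN dM : K) : Y != 0 -> M != 0 ->
  X * M = N * Y -> dX * M + X * dM = dN * Y + N * dY ->
  (dN * M - N * dM) / M ^+ 2 = (dX * Y - X * dY) / Y ^+ 2.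
Proof.
move=> Y0 M0 E1 E2; have NE : N = X * M / Y by apply: (mulIf Y0); rewrite divfK // E1.
have dNE : dN = (dX * M + X * dM - N * dY) / Y.
  by apply: (mulIf Y0); rewrite divfK // E2; ring.
by rewrite dNE NE; field; apply/andP.
Qed.

Lemma quotient_ruleD (A B A' B' dA dB dA' dB' : K) : B != 0 -> B' != 0 ->
  ((dA * B' + A * dB' + (dA' * B + A' * dB)) * (B * B')
    - (A * B' + A' * B) * (dB * B' + B * dB')) / (B * B') ^+ 2 =
  (dA * B - A * dB) / B ^+ 2 + (dA' * B' - A' * dB') / B' ^+ 2.
Proof. by move=> B0 B0'; field; apply/andP. Qed.

Lemma quotient_ruleM (A B A' B' dA dB dA' dB' : K) : B != 0 -> B' != 0 ->
  ((dA * A' + A * dA') * (B * B') - (A * A') * (dB * B' + B * dB')) / (B * B') ^+ 2 =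
  (dA * B - A * dB) / B ^+ 2 * (A' / B') + A / B * ((dA' * B' - A' * dB') / B' ^+ 2).
Proof. by move=> B0 B0'; field; apply/andP. Qed.

End QuotientRule.

Section FractionDerivations.

Variable R : idomainType.
Local Notation "x %:F" := (@FracField.tofrac R x).

Lemma frac_ex (z : {fraction R}) : exists x y : R, y != 0 /\ z = x%:F / y%:F.
Proof.
elim/quotW: z => r; exists (\n_r), (\d_r); split; first exact: denom_ratioP.
rewrite -[_ / _]/(FracField.mul (FracField.tofrac _) (FracField.inv (FracField.tofrac _))).
rewrite !piE; apply/eqP; rewrite piE /= FracField.equivfE /FracField.mulf /FracField.invf.
by rewrite !numden_Ratio ?oner_eq0 ?mul1r ?mulr1 ?denom_ratioP // mulrC.
Qed.

Definition isderiv (del : {fraction R} -> {fraction R}) :=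
  (forall x y, del (x + y) = del x + del y) /\
  (forall x y, del (x * y) = del x * y + x * del y).

Lemma frac_derivation (d : R -> {fraction R}) :
  (forall x y, d (x + y) = d x + d y) ->
  (forall x y, d (x * y) = d x * y%:F + x%:F * d y) ->
  exists del, isderiv del /\ forall x, del x%:F = d x.
Proof.
move=> dD dM; have ex z : exists p : R * R, p.2 != 0 /\ z = p.1%:F / p.2%:F.
  by have [x [y hxy]] := frac_ex z; exists (x, y).
pose num z := (projT1 (cid (ex z))).1; pose den z := (projT1 (cid (ex z))).2.
have nd z : den z != 0 /\ z = (num z)%:F / (den z)%:F by rewrite /den /num; case: cid.
pose del z := (d (num z) * (den z)%:F - (num z)%:F * d (den z)) / (den z)%:F ^+ 2.
have delE x y : y != 0 -> del (x%:F / y%:F) = (d x * y%:F - x%:F * d y) / y%:F ^+ 2.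
  move=> y0; rewrite /del; have [] := nd (x%:F / y%:F).
  set n := num _; set m := den _ => m0 /eqP.
  have m0F : m%:F != 0 by rewrite tofrac_eq0.
  have y0F : y%:F != 0 by rewrite tofrac_eq0.
  rewrite eqr_div // -!tofracM tofrac_eq => /eqP E.
  have := congr1 d E; have := congr1 (@FracField.tofrac R) E; rewrite !dM !tofracM.
  exact: quotient_rule_wd.
have del1 : d 1 = 0.
  by have := dM 1 1; rewrite !mulr1 tofrac1 mul1r => /eqP; rewrite -{1}[d 1]addr0 (inj_eq (addrI _)) => /eqP.
exists del; split; [split|] => [x y|x y|x].
- have [a [b [b0 ->]]] := frac_ex x; have [a' [b' [b0' ->]]] := frac_ex y.
  rewrite addf_div ?tofrac_eq0 // -!tofracM -tofracD !delE ?mulf_neq0 // dD !dM tofracD !tofracM.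
  by apply: quotient_ruleD; rewrite tofrac_eq0.
- have [a [b [b0 ->]]] := frac_ex x; have [a' [b' [b0' ->]]] := frac_ex y.
  rewrite mulf_div -!tofracM !delE ?mulf_neq0 // !dM !tofracM.
  by apply: quotient_ruleM; rewrite tofrac_eq0.
by rewrite -[x%:F]divr1 -tofrac1 delE ?oner_neq0 // tofrac1 del1 mulr0 subr0 mulr1 expr1n divr1.
Qed.

Section Rules.

Variable del : {fraction R} -> {fraction R}.
Hypothesis hd : isderiv del.

Lemma deriv1 : del 1 = 0.
Proof.
have [_ /(_ 1 1)] := hd; rewrite !mulr1 mul1r => /eqP.
by rewrite -{1}[del 1]addr0 (inj_eq (addrI _)) => /eqP.
Qed.

Lemma dlogM x y : x != 0 -> y != 0 -> del (x * y) / (x * y) = del x / x + del y / y.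
Proof.
move=> x0 y0; have [_ ->] := hd; rewrite addf_div //; congr (_ / _); first by rewrite [x * _]mulrC.
Qed.

Lemma dlogV x : x != 0 -> del x^-1 / x^-1 = - (del x / x).
Proof.
move=> x0; apply/eqP; rewrite -addr_eq0 -dlogM ?invr_eq0 // mulVf // deriv1 mul0r.
by [].
Qed.

Lemma dlogX x n : x != 0 -> del (x ^+ n) / x ^+ n = n%:R * (del x / x).
Proof.
move=> x0; elim: n => [|n IH]; first by rewrite expr0 deriv1 !mul0r.
by rewrite exprS dlogM ?expf_neq0 // IH -natr1; ring.
Qed.

End Rules.

End FractionDerivations.

Lemma det3_orth (K : fieldType) (u v w e : 'I_3 -> K) : (exists i, e i != 0) ->
  \sum_i u i * e i = 0 -> \sum_i v i * e i = 0 -> \sum_i w i * e i = 0 ->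
  det3 0 1 2%:R u v w = 0.
Proof.
rewrite !big_ord_recl !big_ord0 /=.
have -> : lift ord0 ord0 = 1 :> 'I_3 by apply/val_inj.
have -> : lift ord0 (lift ord0 ord0) = 2%:R :> 'I_3 by apply/val_inj.
rewrite !addr0 -[ord0]/(0 : 'I_3) /det3 => -[i ei].
move: (u 0) (u 1) (u 2%:R) (v 0) (v 1) (v 2%:R) (w 0) (w 1) (w 2%:R) => u0 u1 u2 v0 v1 v2 w0 w1 w2.
move=> E1 E2 E3; apply/eqP; move: ei; apply: contraNT => d0; apply/eqP.
apply: (mulIf d0); rewrite mul0r; elim/ord3_ind: i.
- transitivity ((u0 * e 0 + (u1 * e 1 + u2 * e 2%:R)) * (v1 * w2 - v2 * w1)
    - (v0 * e 0 + (v1 * e 1 + v2 * e 2%:R)) * (u1 * w2 - u2 * w1)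
    + (w0 * e 0 + (w1 * e 1 + w2 * e 2%:R)) * (u1 * v2 - u2 * v1)); first by ring.
  by rewrite E1 E2 E3; ring.
- transitivity (- (u0 * e 0 + (u1 * e 1 + u2 * e 2%:R)) * (v0 * w2 - v2 * w0)
    + (v0 * e 0 + (v1 * e 1 + v2 * e 2%:R)) * (u0 * w2 - u2 * w0)
    - (w0 * e 0 + (w1 * e 1 + w2 * e 2%:R)) * (u0 * v2 - u2 * v0)); first by ring.
  by rewrite E1 E2 E3; ring.
transitivity ((u0 * e 0 + (u1 * e 1 + u2 * e 2%:R)) * (v0 * w1 - v1 * w0)
  - (v0 * e 0 + (v1 * e 1 + v2 * e 2%:R)) * (u0 * w1 - u1 * w0)
  + (w0 * e 0 + (w1 * e 1 + w2 * e 2%:R)) * (u0 * v1 - u1 * v0)); first by ring.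
by rewrite E1 E2 E3; ring.
Qed.

(** The vectors q u - d v, L - (al u + be v) and g are orthogonal to e, hence dependent, so L may be
    replaced by al u + be v in the determinant; what remains is the factor al d + be q = 1. *)
Lemma det3_dlog (K : fieldType) (u v L g e : 'I_3 -> K) (d q al be : K) :
  (exists i, e i != 0) ->
  \sum_i u i * e i = d -> \sum_i v i * e i = q -> \sum_i g i * e i = 0 ->
  \sum_i L i * e i = 1 -> al * d + be * q = 1 ->
  det3 0 1 2%:R (fun i => q * u i - d * v i) L g = det3 0 1 2%:R u v g.
Proof.
move=> e0 hu hv hg hL ab.
have sumZ (c : K) (x : 'I_3 -> K) : \sum_i c * x i * e i = c * \sum_i x i * e i.
  by rewrite mulr_sumr; apply: eq_bigr => i _; rewrite mulrA.
have o1 : \sum_i (q * u i - d * v i) * e i = 0.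
  under eq_bigr => i _ do rewrite mulrBl.
  by rewrite sumrB !sumZ hu hv; ring.
have o2 : \sum_i (L i - (al * u i + be * v i)) * e i = 0.
  under eq_bigr => i _ do rewrite mulrBl mulrDl.
  by rewrite sumrB big_split /= !sumZ hu hv hL ab subrr.
have := det3_orth e0 o1 o2 hg; rewrite /det3 => /eqP.
move: (u 0) (u 1) (u 2%:R) (v 0) (v 1) (v 2%:R) (g 0) (g 1) (g 2%:R) (L 0) (L 1) (L 2%:R).
move=> u0 u1 u2 v0 v1 v2 g0 g1 g2 l0 l1 l2 E.
transitivity ((al * d + be * q) * (u0 * (v1 * g2 - v2 * g1) - u1 * (v0 * g2 - v2 * g0) + u2 * (v0 * g1 - v1 * g0))); last by rewrite ab mul1r.
by apply/eqP; rewrite -subr_eq0 -(eqP E); apply/eqP; ring.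
Qed.

Lemma det3_dlog_mul (K : fieldType) (x y z g : 'I_3 -> K) (n1 n2 n3 : K) :
  n1 != 0 -> n2 != 0 -> n3 != 0 ->
  det3 0 1 2%:R (fun t => x t / n1) (fun t => y t / n2 - z t / n3) g =
  det3 0 1 2%:R x (fun t => n3 * y t - n2 * z t) g / (n1 * (n2 * n3)).
Proof. by move=> h1 h2 h3; rewrite /det3; field; rewrite h1 h2 h3. Qed.

Section CanonicalDivisor.

Variables (k : closedFieldType) (a b c : nat) (R : idomainType).
Variables (pi : {rmorphism {mpoly k[3]} -> R}) (h : nat) (f : {mpoly k[3]}).
Variable C : curve a b c pi h f.
Hypothesis hK : h = (a + b + c).+1.

Let H := cvH C.
Local Notation w := (wt a b c).
Local Notation hom n p := (p \is n.-homog for (wdeg a b c)).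
Local Notation gr := (piece a b c pi).
Local Notation cst := (structure_map pi).
Local Notation hfr := (hfr a b c pi).
Local Notation "x %:F" := (@FracField.tofrac R x).
Local Notation grad p := (fun t => (pi p^`M(t))%:F).

Lemma hfr0 D : hfr D 0.
Proof.
have [P _] := plane_point H 0; have [i iP] := point_var P.
have x0 := notin_neq0 iP; have wi := wt_gt0 H i.
pose n := `|D|%N; exists (absz (D + (w i * n)%:Z)), (w i * n)%N, 0, (pi 'X_i ^+ n).
have hX : gr (w i * n) (pi 'X_i ^+ n) by apply: (grXn H); apply: gr_X.
split; [exact: (gr0 H)|exact: hX|by rewrite expf_neq0|by rewrite tofrac0 mul0r|].
rewrite gez0_abs ?addrK //.
have : (n <= w i * n)%N by rewrite leq_pmull.
by rewrite /n; lia.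
Qed.

Lemma hfr_grad n p t : hom n p -> hfr (n%:Z - (w t)%:Z) (grad p t).
Proof.
move=> hp; case: (ltnP n (w t)) => [lt|le]; first by rewrite (deriv_small hp lt) rmorph0 tofrac0; apply: hfr0.
apply: (hfr_eq (hfr_R H (n := n - w t) _)); first by exists (p^`M(t)) => //; apply: hom_deriv.
by rewrite subzn.
Qed.

Lemma hfr_det3 (u v x : 'I_3 -> {fraction R}) (al be ga : int) :
  (forall t, hfr (al - (w t)%:Z) (u t)) -> (forall t, hfr (be - (w t)%:Z) (v t)) ->
  (forall t, hfr (ga - (w t)%:Z) (x t)) ->
  hfr (al + be + ga - ((w 0)%:Z + (w 1)%:Z + (w 2%:R)%:Z)) (det3 0 1 2%:R u v x).
Proof.
move=> hu hv hx; rewrite /det3.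
have m2 i j be1 ga1 y z : hfr (be1 - (w i)%:Z) (y i) -> hfr (ga1 - (w j)%:Z) (z j) ->
    hfr (be1 + ga1 - ((w i)%:Z + (w j)%:Z)) (y i * z j).
  by move=> h1 h2; apply: (hfr_eq (hfrM H h1 h2)); ring.
have m3 i j : hfr (be + ga - ((w i)%:Z + (w j)%:Z)) (v i * x j - v j * x i).
  apply: (hfrD H); first exact: m2; apply: (hfrN H).
  by apply: (hfr_eq (m2 j i be ga _ _ (hv j) (hx i))); ring.
apply: (hfrD H); first apply: (hfrD H).
- by apply: (hfr_eq (hfrM H (hu 0) (m3 1 2%:R))); ring.
- by apply: (hfrN H); apply: (hfr_eq (hfrM H (hu 1) (m3 0 2%:R))); ring.
by apply: (hfr_eq (hfrM H (hu 2%:R) (m3 0 1))); ring.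
Qed.

Let e (t : 'I_3) : {fraction R} := (w t)%:R * (pi 'X_t)%:F.

Lemma grad_euler n p : hom n p -> \sum_t grad p t * e t = n%:R * (pi p)%:F.
Proof.
move=> /euler /(congr1 (fun u => (pi u)%:F)) /=.
rewrite scaler_nat rmorphMn tofracMn mulr_natl => <-.
rewrite !rmorph_sum; apply: eq_bigr => t _ /=.
by rewrite scaler_nat rmorphMn tofracMn rmorphM tofracM /e -mulr_natl; ring.
Qed.

Lemma pi_f : pi f = 0.
Proof. by apply/(pi_ker H); exists 1; rewrite mul1r. Qed.

Definition jac P := (pi (jacobian f (lN (cvloc C P)) (lm1 (cvloc C P)) (lm2 (cvloc C P))))%:F.

(** The derivation is p -> T^-1 det(dp, dlog T, df). The row df makes it vanish on multiples of f,
    and since h exceeds the sum of the weights by one, the factor T^-1 makes it of degree 0. *)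
Lemma curve_derivation : exists del, [/\ isderiv del, forall x, del (cst x)%:F = 0,
  forall D z, hfr D z -> hfr D (del z) &
  forall P, del (tpar C P) / tpar C P = (cvT C)^-1 * (jac P /
   ((pi (lN (cvloc C P)))%:F * ((pi 'X_[lm1 (cvloc C P)])%:F * (pi 'X_[lm2 (cvloc C P)])%:F)))].
Proof.
have [i [j [_ [_ [[t1 ht1 <-] [t2 ht2 <-] t20 TE ijE]]]]] := cvT_hfr C.
have T0 := cvT_neq0 C.
have t10 : pi t1 != 0 by apply: contraNneq T0 => t10; rewrite TE t10 tofrac0 mul0r.
(* dlog T for T = t1 / t2. Its pairing with the Euler vector e is deg T = 1, whatever the
   characteristic. *)
pose L t := grad t1 t / (pi t1)%:F - grad t2 t / (pi t2)%:F.
have hL t : hfr (0 - (w t)%:Z) (L t).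
  apply: (hfrD H); last apply: (hfrN H).
    apply: (hfr_eq (hfrM H (hfr_grad t ht1) (hfrV _ (hfr_R H (n := i) _)))); last by ring.
      by rewrite tofrac_eq0.
    by exists t1.
  apply: (hfr_eq (hfrM H (hfr_grad t ht2) (hfrV _ (hfr_R H (n := j) _)))); last by ring.
    by rewrite tofrac_eq0.
  by exists t2.
have Le : \sum_t L t * e t = 1.
  under eq_bigr => t _ do rewrite mulrBl ![_ / _ * _]mulrAC.
  rewrite sumrB -!mulr_suml (grad_euler ht1) (grad_euler ht2) !mulfK ?tofrac_eq0 //.
  have -> : i = j.+1 by lia.
  by rewrite -natr1 addrAC subrr add0r.
pose d0 p := (cvT C)^-1 * det3 0 1 2%:R (grad p) L (grad f).
have d0D p q : d0 (p + q) = d0 p + d0 q.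
  rewrite -mulrDr; congr (_ * _); rewrite /det3 !mderivD !rmorphD /=.
  move: (grad f) => g; move: (L) => l; rewrite /=; ring.
have d0M p q : d0 (p * q) = d0 p * (pi q)%:F + (pi p)%:F * d0 q.
  rewrite mulrCA -mulrA -mulrDr; congr (_ * _); rewrite /det3 !mderivM !rmorphD !rmorphM /=.
  move: (grad f) => g; move: (L) => l; rewrite /=; ring.
have d0f p : d0 (p * f) = 0.
  rewrite d0M pi_f tofrac0 mulr0 add0r /d0 (_ : det3 _ _ _ _ _ _ = 0) ?mulr0 //.
  by rewrite /det3; move: (grad f) => g; move: (L) => l; rewrite /=; ring.
have d0eq p q : pi p = pi q -> d0 p = d0 q.
  move=> E; have /(pi_ker H)[r E'] : pi (p - q) = 0 by rewrite rmorphB E subrr.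
  by rewrite -(subrK q p) d0D E' d0f add0r.
pose d1 x := d0 (projT1 (cid (pi_surj H x))).
have d1E p : d1 (pi p) = d0 p by rewrite /d1; case: cid => q /= /d0eq.
have [del [hd dE]] : exists del, isderiv del /\ forall x, del x%:F = d1 x.
  apply: frac_derivation => x y; have [p <-] := pi_surj H x; have [q <-] := pi_surj H y.
    by rewrite -rmorphD !d1E d0D.
  by rewrite -rmorphM !d1E d0M.
have delE p : del (pi p)%:F = d0 p by rewrite dE d1E.
have hdelR n x : gr n x -> hfr n (del x%:F).
  move=> [p hp <-]; rewrite delE /d0.
  have hT := hfrV T0 (cvT_hfr C).
  apply: (hfr_eq (hfrM H hT (hfr_det3 (fun t => hfr_grad t hp) hL (fun t => hfr_grad t (f_hom H))))).
  have -> : h%:Z = (w 0)%:Z + (w 1)%:Z + (w 2%:R)%:Z + 1 by rewrite hK /wt /=; lia.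
  by ring.
exists del; split=> //.
- by move=> x; rewrite /structure_map delE /d0 /det3 !mderivC !rmorph0; ring.
- move=> D z [i1 [j1 [x [y [hx hy y0 -> ->]]]]].
  have [_ ->] := hd; have y0F : y%:F != 0 by rewrite tofrac_eq0.
  have hyV := hfrV y0F (hfr_R H hy).
  apply: (hfrD H); first by apply: (hfrM H) => //; apply: hdelR.
  have -> : del y%:F^-1 = - (del y%:F / y%:F) / y%:F.
    by rewrite -(dlogV hd) // divfK // invr_eq0.
  apply: (hfrM H); first exact: (hfr_R H).
  apply: (hfr_eq (hfrM H (hfrN H (hfrM H (hdelR _ _ hy) hyV)) hyV)); ring.
move=> P; set l := cvloc C P.
have N0 : (pi (lN l))%:F != 0 by rewrite tofrac_eq0 lN_neq0.
have u1 : (pi 'X_[lm1 l])%:F != 0 by rewrite tofrac_eq0 (notin_neq0 (lU1 l)).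
have u2 : (pi 'X_[lm2 l])%:F != 0 by rewrite tofrac_eq0 (notin_neq0 (lU2 l)).
have homU (m : 'X_{1..3}) : hom (wdeg a b c m) ('X_[m] : {mpoly k[3]}) by rewrite dhomogX.
pose u t := grad (lN l) t / (pi (lN l))%:F.
pose v t := grad 'X_[lm1 l] t / (pi 'X_[lm1 l])%:F - grad 'X_[lm2 l] t / (pi 'X_[lm2 l])%:F.
have dl p : pi p != 0 -> del (pi p)%:F / (pi p)%:F =
    (cvT C)^-1 * det3 0 1 2%:R (fun t => grad p t / (pi p)%:F) L (grad f).
  move=> p0; rewrite delE /d0 -mulrA; congr (_ * _); rewrite /det3.
  move: (grad f) => g; move: (L) ((pi p)%:F^-1) => L' x; rewrite /=; ring.
(* [tpar] is N^q (U2 / U1)^ld, so its logarithmic gradient is q dlog N - ld dlog(U1 / U2). *)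
have -> : del (tpar C P) / tpar C P = (cvT C)^-1 *
    det3 0 1 2%:R (fun t => (lq l)%:R * u t - (ld l)%:R * v t) L (grad f).
  rewrite (dlogM hd) ?expf_neq0 ?mulf_neq0 ?invr_eq0 // !(dlogX hd) ?mulf_neq0 ?invr_eq0 //.
  rewrite (dlogM hd) ?invr_eq0 // (dlogV hd) // !dl ?lN_neq0 ?(notin_neq0 (lU1 l)) ?(notin_neq0 (lU2 l)) //.
  rewrite -/l /det3 /u /v; move: (grad f) (grad (lN l)) (grad 'X_[lm1 l]) (grad 'X_[lm2 l]) => g g1 g2 g3.
  move: (L) (cvT C)^-1 ((lq l)%:R : {fraction R}) ((ld l)%:R : {fraction R}) => L' x y z.
  move: ((pi (lN l))%:F^-1) ((pi 'X_[lm1 l])%:F^-1) ((pi 'X_[lm2 l])%:F^-1) => x1 x2 x3 /=.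
  ring.
have /coprimezP[[al be] /= E] := coprime_ld C P.
have ab : (be%:~R : {fraction R}) * (ld l)%:R + al%:~R * (lq l)%:R = 1.
  by have := congr1 (fun z : int => (z%:~R : {fraction R})) E; rewrite rmorphD !rmorphM /= addrC.
(* The weights cannot all vanish in k, since L pairs to 1 with e. *)
have e0 : exists i, e i != 0.
  apply: contrapT => no; have et t : e t = 0.
    by apply/eqP/negPn/negP => et; apply: no; exists t.
  have Le0 : \sum_t L t * e t = 0 by apply: big1 => t _; rewrite et mulr0.
  by have := oner_neq0 {fraction R}; rewrite -Le Le0 eqxx.
have hu : \sum_t u t * e t = (ld l)%:R.
  under eq_bigr => t _ do rewrite mulrAC.
  by rewrite -mulr_suml (grad_euler (lN_hom l)) mulfK.
have hv : \sum_t v t * e t = (lq l)%:R.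
  under eq_bigr => t _ do rewrite mulrBl ![_ / _ * _]mulrAC.
  rewrite sumrB -!mulr_suml !(grad_euler (homU _)) !mulfK // lU_deg natrD.
  by rewrite addrAC subrr add0r.
have hg : \sum_t grad f t * e t = 0 by rewrite (grad_euler (f_hom H)) pi_f tofrac0 mulr0.
rewrite (det3_dlog e0 hu hv hg Le ab); congr (_ * _).
rewrite /u /v det3_dlog_mul //; congr (_ / _).
rewrite /jac /jacobian !det3_rmorph; congr det3.
by apply/funext => t /=; rewrite !(rmorphB, rmorphM).
Qed.

Definition canK (P : point gr) : rat :=
  ((val C P (cvT C))%:~R - (lq (cvloc C P))%:R + 1) / (lq (cvloc C P))%:R.

Let T0 := cvT_neq0 C.
Let hT := cvT_hfr C.

(** By [l_jac] the Jacobian is a unit at P, so the logarithmic derivative of [tpar] has value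
    -val(T) - 1, coming from T^-1 and from N in the denominator; [tpar] itself has value q. *)
Lemma tpar_deriv : exists del, [/\ kderivation cst gr del,
  forall P, del (tpar C P) != 0 &
  forall P, canK P = (ord P (del (tpar C P))^-1)%:~R].
Proof.
have [del [hd dc dh dl]] := curve_derivation.
have d0 P : isval C P (del (tpar C P)) ((lq (cvloc C P))%:Z - 1 - val C P (cvT C)).
  have t0 := tpar_neq0 C P; have rt := ratfun_deg0 (ratfun_tpar C P).
  set l := cvloc C P in dl *.
  have -> : del (tpar C P) = tpar C P * ((cvT C)^-1 * (jac P /
       ((pi (lN l))%:F * ((pi 'X_[lm1 l])%:F * (pi 'X_[lm2 l])%:F)))).
    by rewrite -dl mulrCA mulfV ?mulr1.
  have -> : (lq l)%:Z - 1 - val C P (cvT C) =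
      val C P (tpar C P) + (- val C P (cvT C) + (0 - (1 + (0 + 0)))).
    by rewrite val_tpar; ring.
  apply: isvalM; first exact: valP rt t0.
  apply: isvalM; first by apply: isvalV; exact: valP hT T0.
  apply: isvalM; first by apply: isval_unit; apply: unitat_R; exact: l_jac.
  apply: isvalV; apply: isvalM; first exact: isval_N.
  by apply: isvalM; apply: isval_unit; apply: unitat_R; [exact: lU1|exact: lU2].
have n0 P : del (tpar C P) != 0.
  have [eu ue ->] := d0 P.
  by rewrite mulf_neq0 ?(unitat_neq0 ue) // expfz_neq0 // tofrac_eq0 lN_neq0.
have rd P : ratfun gr (del (tpar C P)).
  by apply/ratfun_hfr; apply: dh; apply/ratfun_hfr; apply: ratfun_tpar.
exists del; split=> // [|P].
  split=> //.
  - by move=> x /ratfun_hfr hx; apply/ratfun_hfr; apply: dh.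
  - by move=> x y _ _; case: hd.
  - by move=> x y _ _; case: hd.
have q0 : (lq (cvloc C P))%:R != 0 :> rat by rewrite pnatr_eq0 -lt0n lq_gt0.
have rV : ratfun gr (del (tpar C P))^-1.
  by apply/ratfun_hfr; rewrite -oppr0; apply: hfrV => //; apply/ratfun_hfr.
have := ord_val C P rV; rewrite invr_eq0 => /(_ (n0 P)).
rewrite (valV C P (ratfun_deg0 (rd P))) // (val_isval (d0 P)) => E.
apply: (mulIf q0); rewrite divfK //.
have := congr1 (fun z : int => (z%:~R : rat)) E.
by rewrite rmorphM /= => <-; rewrite !(rmorphN, rmorphB, rmorph1) /=; ring.
Qed.

Lemma canonical_canK : canonical_divisor cst canK.
Proof.
have [del [kd d0 E]] := tpar_deriv; have [P0 _] := plane_point H 0.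
have [dr dc dD dM] := kd.
have rt P := ratfun_tpar C P.
have rd P : ratfun gr (del (tpar C P)) by apply: dr.
have rV P : ratfun gr (del (tpar C P))^-1.
  by apply/ratfun_hfr; rewrite -oppr0; apply: hfrV => //; apply/ratfun_hfr.
have rM x y : ratfun gr x -> ratfun gr y -> ratfun gr (x * y).
  by move=> /ratfun_hfr hx /ratfun_hfr hy; apply/ratfun_hfr; apply: (hfr_eq (hfrM H hx hy)).
(* The differential dx / del x with x = [tpar] at P0. At P, with parameter t, d/dt is del / del t,
   so this differential is dt / del t and P0 drops out. *)
exists (tpar C P0), (del (tpar C P0))^-1; split=> //; first by rewrite invr_eq0.
  by exists del.
move=> P; exists (tpar C P), (fun z => del z / del (tpar C P)); split.
- by apply/(uniformizer_val C P); rewrite tpar_neq0 val_tpar; split.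
- split=> [x rx|x|x y rx ry|x y rx ry].
  + by apply: rM => //; apply: dr.
  + by rewrite dc mul0r.
  + by rewrite dD // mulrDl.
  by rewrite dM // mulrDl mulrAC mulrA.
- by rewrite divff.
by rewrite E mulrA mulVf // mul1r.
Qed.

(** For z in k(X) the value of z T is -1 modulo q, so val(z T) >= 0 already means val(z T) >= q - 1,
    which is the condition ord z + canK >= 0. Then [hfr_cap] puts z T in R_1. *)
Lemma H0_canK z : H0 (gr := gr) canK z <-> exists x, gr 1 x /\ z = x%:F / cvT C.
Proof.
have [del [kd d0 E]] := tpar_deriv.
have q0 P : 0 < (lq (cvloc C P))%:R :> rat by rewrite ltr0n lq_gt0.
have dvd P : (((lq (cvloc C P))%:Z) %| val C P (cvT C) - (lq (cvloc C P))%:Z + 1)%Z.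
  apply/dvdzP; exists (ord P (del (tpar C P))^-1).
  apply: (@intr_inj rat); rewrite rmorphM /= -E divfK ?(gt_eqF (q0 P)) //.
  by rewrite !(rmorphD, rmorphN, rmorph1).
have vE P z0 : ratfun gr z0 -> z0 != 0 ->
    (0 <= (ord P z0)%:~R + canK P) <-> 0 <= val C P (z0 * cvT C).
  move=> rz z00; rewrite (valM C P (ratfun_deg0 rz) hT) // (ord_val C P rz z00).
  rewrite -(pmulr_lge0 _ (q0 P)) mulrDl divfK ?(gt_eqF (q0 P)) //.
  have /dvdzP[m mE] := dvd P.
  have -> : (val C P (cvT C))%:~R - (lq (cvloc C P))%:R + 1 = (m * (lq (cvloc C P))%:Z)%:~R :> rat.
    by rewrite -mE !(rmorphD, rmorphN, rmorph1).
  rewrite -[X in _ * X + _]/((lq (cvloc C P))%:Z%:~R) -rmorphM -rmorphD /= ler0z -mulrDl.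
  have -> : val C P (cvT C) = m * (lq (cvloc C P))%:Z + (lq (cvloc C P))%:Z - 1 by rewrite -mE; ring.
  have q1 : 0 < (lq (cvloc C P))%:Z by rewrite ltz_nat lq_gt0.
  rewrite pmulr_lge0 //; move: (ord P z0) (lq _)%:Z q1 => o q q1.
  have -> : o * q + (m * q + q - 1) = (o + m + 1) * q - 1 by ring.
  split=> [le|le].
    rewrite subr_ge0; apply: (@le_trans _ _ q); first by rewrite -gtz0_ge1.
    by rewrite ler_peMl ?(ltW q1) // lerDr.
  have : 0 < (o + m + 1) * q by rewrite gtz0_ge1 -subr_ge0.
  by rewrite pmulr_lgt0 // gtz0_ge1 lerDr.
split=> [[->|[rz z0 hz]]|[x [gx ->]]].
- by exists 0; rewrite tofrac0 mul0r; split=> //; exact: (gr0 H).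
- have hzT := hfr_eq (hfrM H (ratfun_deg0 rz) hT) (add0r 1).
  have zT0 : z * cvT C != 0 by rewrite mulf_neq0.
  have [|x xE] := hfr_cap H hzT.
    by move=> P; apply/(val_ge0 C P hzT zT0); apply/vE.
  exists x; rewrite -xE mulfK //; split=> //.
  have [i [j [u [v [hu hv v0 E1 E2]]]]] := hzT.
  have E3 : u = v * x.
    apply/eqP; rewrite -tofrac_eq tofracM -xE E1 mulrC divfK // tofrac_eq0 //.
  have [_] := gr_div H hu hv v0 E3.
  by have -> : (i - j = 1)%N by lia.
have [->|x0] := eqVneq x 0; first by left; rewrite tofrac0 mul0r.
have rz : ratfun gr (x%:F / cvT C).
  by apply/ratfun_hfr; apply: (hfr_eq (hfrM H (hfr_R H gx) (hfrV T0 hT))); rewrite subrr.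
have z0 : x%:F / cvT C != 0 by rewrite mulf_neq0 ?invr_eq0 // tofrac_eq0.
right; split=> // P; apply/vE => //; rewrite divfK //.
exact: val_R gx x0.
Qed.

(** Forms of degree 1 are combinations of the variables of weight 1, and the kernel of pi starts in
    degree h > 1. *)
Lemma gr1_basis : exists e : 'I_#|[pred i | w i == 1%N]| -> R,
  (forall i, gr 1 (e i)) /\
  forall x, gr 1 x -> exists! r : 'rV[k]_#|[pred i | w i == 1%N]|,
    x = \sum_i cst (r 0 i) * e i.
Proof.
set A := [pred i | w i == 1%N].
have wA (i : 'I_#|A|) : w (enum_val i) = 1%N by have := enum_valP i; rewrite inE => /eqP.
have Uinj (i j : 'I_3) : U_(i)%MM = U_(j)%MM -> i = j.
  by move/(congr1 (fun m : 'X_{1..3} => m j)); rewrite !mnm1E eqxx; case: eqP.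
have coefX i (m : 'X_{1..3}) : ('X_i : {mpoly k[3]})@_m = (U_(i)%MM == m)%:R by rewrite mcoeffX.
exists (fun i => pi 'X_(enum_val i)); split=> [i|x [p hp <-]].
  by have := gr_X a b c pi (enum_val i); rewrite wA.
have uE (m : 'X_{1..3}) : wdeg a b c m = 1%N -> exists i, m = U_(i)%MM /\ w i = 1%N.
  move=> hm; have [i mi] : exists i, (0 < m i)%N.
    apply/existsP; apply: contraPT hm; rewrite negb_exists wdegE => /forallP m0.
    by rewrite big1 // => i _; move: (m0 i); rewrite -eqn0Ngt => /eqP ->.
  have mE : m = (U_(i) + (m - U_(i)))%MM by rewrite addmC submK // lep1mP -lt0n.
  move: hm; rewrite {1}mE wdegD wdegU => hm; have wi := wt_gt0 H i.
  have w1 : w i = 1%N by lia.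
  have d0 : wdeg a b c (m - U_(i))%MM = 0%N by lia.
  exists i; split=> //; rewrite mE; suff -> : (m - U_(i) = 0)%MM by rewrite addm0.
  apply/mnmP => j; rewrite mnm0E; move/eqP: d0; rewrite wdegE sum_nat_eq0 => /forallP /(_ j) /=.
  by rewrite muln_eq0 (gtn_eqF (wt_gt0 H j)) orbF => /eqP.
have sumE (r : 'rV[k]_#|A|) : \sum_i cst (r 0 i) * pi 'X_(enum_val i) =
    pi (\sum_(i < #|A|) r 0 i *: 'X_(enum_val i)).
  by rewrite rmorph_sum; apply: eq_bigr => i _; rewrite cstM.
have inj p' : hom 1 p' -> pi p' = 0 -> p' = 0.
  move=> hp' /(pi_ker H)[q E].
  pose Phi := gmap a b c (structure_map (idfun : {rmorphism {mpoly k[3]} -> {mpoly k[3]}})) (fun i => 'X_i).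
  have PhiE n r : hom n r -> Phi r = r *: 'X^n.
    move=> hr; rewrite /Phi (gmap_hom _ _ hr); congr (_ *: _).
    exact: (pi_mmap (idfun : {rmorphism {mpoly k[3]} -> {mpoly k[3]}})).
  have := congr1 (fun u : {poly {mpoly k[3]}} => u`_1) (congr1 Phi E).
  have PhiM : Phi (q * f) = Phi q * Phi f by rewrite /Phi; exact: rmorphM.
  rewrite PhiM (PhiE 1%N) // (PhiE _ _ (f_hom H)) -scalerAr !coefZ coefXn coefMXn hK ltnS.
  by rewrite (_ : (0 < a + b + c)%N) ?mulr0 ?mulr1 // !addn_gt0 (wt_gt0 H 0).
exists (\row_i p@_U_(enum_val i)); split.
  rewrite sumE; congr (pi _); apply/mpolyP => m.
  rewrite raddf_sum /=; under eq_bigr => i _ do rewrite mcoeffZ coefX mxE.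
  have [/uE[i [-> wi]]|ne] := eqVneq (wdeg a b c m) 1%N.
    have iA : i \in A by rewrite inE wi.
    rewrite (bigD1 (enum_rank_in iA i)) //= enum_rankK_in // eqxx mulr1.
    rewrite big1 ?addr0 // => j jne; case: eqP => [/Uinj ji|_]; last by rewrite mulr0.
    by case/eqP: jne; apply: enum_val_inj; rewrite enum_rankK_in.
  rewrite big1 => [|i _].
    by apply/eqP; rewrite mcoeff_eq0; apply/negP => /(hom_wdeg hp) /eqP; rewrite (negbTE ne).
  case: eqP => [E|_]; last by rewrite mulr0.
  by move: ne; rewrite -E wdegU wA.
move=> r; rewrite sumE => E.
have : p - \sum_(i < #|A|) r 0 i *: 'X_(enum_val i) = 0.
  apply: inj; last by rewrite rmorphB E subrr.
  apply: rpredB => //; apply: rpred_sum => i _; apply: rpredZ.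
  by have := homX k a b c (enum_val i); rewrite wA.
move/eqP; rewrite subr_eq0 => /eqP pE; apply/rowP => i; rewrite mxE pE raddf_sum /=.
rewrite (bigD1 i) //= mcoeffZ coefX eqxx mulr1 big1 ?addr0 // => j ji.
rewrite mcoeffZ coefX; case: eqP => [/Uinj /enum_val_inj E1|]; last by rewrite mulr0.
by rewrite E1 eqxx in ji.
Qed.

Lemma genus_weights : genus cst gr #|[pred i | w i == 1%N]|.
Proof.
exists canK; split; first exact: canonical_canK.
have [e1 [ge he]] := gr1_basis; exists (fun i => (e1 i)%:F / cvT C); split=> [i|z].
  by apply/H0_canK; exists (e1 i).
have sumE (r : 'rV[k]_#|[pred i | w i == 1%N]|) :
    \sum_i (cst (r 0 i))%:F * ((e1 i)%:F / cvT C) = (\sum_i cst (r 0 i) * e1 i)%:F / cvT C.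
  rewrite rmorph_sum mulr_suml; apply: eq_bigr => i _.
  by rewrite rmorphM mulrA.
move=> /H0_canK[x [gx ->]]; have [r [xE ru]] := he x gx; exists r; split.
  by rewrite sumE -xE.
move=> r'; rewrite sumE => /(mulIf _) E; apply: ru; apply/eqP; rewrite -tofrac_eq E //.
by rewrite invr_eq0.
Qed.

End CanonicalDivisor.

(** * Orders of rational functions *)

Section Orders.

Variables (k : closedFieldType) (a b c : nat) (R : idomainType).
Variables (pi : {rmorphism {mpoly k[3]} -> R}) (h : nat) (f : {mpoly k[3]}).
Variable C : curve a b c pi h f.

Let H := cvH C.
Local Notation w := (wt a b c).
Local Notation gr := (piece a b c pi).
Local Notation cst := (structure_map pi).
Local Notation hfr := (hfr a b c pi).
Local Notation "x %:F" := (@FracField.tofrac R x).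
Local Notation lq P := (lq (cvloc C P)).

Lemma ratfunM y z : ratfun gr y -> ratfun gr z -> ratfun gr (y * z).
Proof.
by move=> /ratfun_hfr hy /ratfun_hfr hz; apply/ratfun_hfr; apply: (hfr_eq (hfrM H hy hz)).
Qed.

Lemma ratfunD y z : ratfun gr y -> ratfun gr z -> ratfun gr (y + z).
Proof. by move=> /ratfun_hfr hy /ratfun_hfr hz; apply/ratfun_hfr; apply: (hfrD H). Qed.

Lemma ratfun_cst x : ratfun gr (cst x)%:F.
Proof. by apply/ratfun_hfr; apply: (@hfr_R _ _ _ _ _ _ _ _ H 0); apply: gr_cst. Qed.

Lemma ratfunV z : ratfun gr z -> ratfun gr z^-1.
Proof.
have [->|z0] := eqVneq z 0; first by rewrite invr0.
move=> /ratfun_hfr hz; apply/ratfun_hfr; apply: (hfr_eq (hfrV z0 hz)); by rewrite oppr0.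
Qed.

Lemma ratfunXn z n : ratfun gr z -> ratfun gr (z ^+ n).
Proof.
move=> rz; elim: n => [|n IH]; last by rewrite exprS; apply: ratfunM.
by rewrite expr0 -tofrac1 -(rmorph1 cst); apply: ratfun_cst.
Qed.

Section AtPoint.

Variable P : point gr.

Lemma lq_neq0 : (lq P)%:Z != 0.
Proof. by rewrite eqz_nat -lt0n lq_gt0. Qed.

Lemma ordM y z : ratfun gr y -> ratfun gr z -> y != 0 -> z != 0 ->
  ord P (y * z) = ord P y + ord P z.
Proof.
move=> ry rz y0 z0; apply: (mulIf lq_neq0); rewrite mulrDl -!ord_val ?mulf_neq0 //; last exact: ratfunM.
exact: (valM C P (ratfun_deg0 ry) (ratfun_deg0 rz)).
Qed.

Lemma ordV z : ratfun gr z -> z != 0 -> ord P z^-1 = - ord P z.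
Proof.
move=> rz z0; apply: (mulIf lq_neq0); rewrite mulNr -!ord_val ?invr_eq0 //; last exact: ratfunV.
exact: (valV C P (ratfun_deg0 rz)).
Qed.

Lemma ord0 : ord P (0 : {fraction R}) = 0.
Proof.
rewrite /ord; case: xgetP => // n _ [t [r [/(uniformizer_val C P)[_ t0 _] _ _ r0 /esym/eqP]]].
by rewrite mulf_eq0 (negbTE r0) expfz_eq0 (negbTE t0) andbF.
Qed.

Lemma ordD n y z : ratfun gr y -> ratfun gr z -> y + z != 0 ->
  (y != 0 -> n <= ord P y) -> (z != 0 -> n <= ord P z) -> n <= ord P (y + z).
Proof.
move=> ry rz s0 hy hz; have q0 : 0 < (lq P)%:Z by rewrite ltz_nat lq_gt0.
rewrite -(ler_pM2r q0) -ord_val //; last exact: ratfunD.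
apply: (valD (ratfun_deg0 ry) (ratfun_deg0 rz)) => // u0.
  by rewrite ord_val // ler_pM2r //; apply: hy.
by rewrite ord_val // ler_pM2r //; apply: hz.
Qed.

Lemma uniformizer_ord t : uniformizer P t <-> [/\ ratfun gr t, t != 0 & ord P t = 1].
Proof.
split=> [/(uniformizer_val C P)[rt t0 vt]|[rt t0 o1]].
  by split=> //; apply: (mulIf lq_neq0); rewrite -ord_val // vt mul1r.
by apply/(uniformizer_val C P); split=> //; rewrite ord_val // o1 mul1r.
Qed.

Lemma ord_tpar : ord P (tpar C P) = 1.
Proof.
have /uniformizer_ord[] // : uniformizer P (tpar C P).
by apply/(uniformizer_val C P); rewrite tpar_neq0 val_tpar; split=> //; apply: ratfun_tpar.
Qed.

(* constants have roots of every order *)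
Lemma ord_cst x : x != 0 -> ord P (cst x)%:F = 0.
Proof.
move=> x0; apply: (mulIf lq_neq0); rewrite -ord_val ?tofrac_eq0 ?cst_eq0 ?mul0r //.
  exact: val_notin (cst_notin P x0).
exact: ratfun_cst.
Qed.

End AtPoint.

(** Membership of x in a point with X_i nonzero is read off the order of x^w_i / X_i^n, where n =
    deg x; only the signs of the orders matter. *)
Lemma point_eq_ord (Q Q' : point gr) (d e : rat) : 0 < d -> 0 < e ->
  (forall z, ratfun gr z -> z != 0 -> d * (ord Q z)%:~R = e * (ord Q' z)%:~R) -> Q = Q'.
Proof.
move=> d0 e0 E.
suff key (Q1 Q2 : point gr) : (forall z, ratfun gr z -> z != 0 -> 0 < ord Q1 z -> 0 < ord Q2 z) ->
    forall n x, gr n x -> x \in Q1 -> x \in Q2.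
  have sub (Q1 Q2 : point gr) : (forall n x, gr n x -> x \in Q1 -> x \in Q2) -> forall x, x \in Q1 -> x \in Q2.
    move=> hh x xQ; apply: (point_coefP (H := H)) => n.
    by apply: (hh n); [apply: gr_coef|apply: point_coef].
  apply: point_eq => x; apply/idP/idP; apply: sub; apply: key => z rz z0.
    by rewrite -(ltr0z rat) -(pmulr_rgt0 _ d0) E // pmulr_rgt0 // ltr0z.
  by rewrite -(ltr0z rat) -(pmulr_rgt0 _ e0) -E // pmulr_rgt0 // ltr0z.
move=> hQ n x gx xQ; have [->|x0] := eqVneq x 0; first by rewrite pid0 //; apply: point_prime.
have [i iQ] := point_var Q1; have i0 := notin_neq0 iQ; have wi := wt_gt0 H i.
pose z := x%:F ^+ w i / (pi 'X_i)%:F ^+ n.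
have xF : x%:F != 0 by rewrite tofrac_eq0.
have iF : (pi 'X_i)%:F != 0 by rewrite tofrac_eq0.
have z0 : z != 0 by rewrite mulf_neq0 ?invr_eq0 ?expf_neq0.
have h1 := hfrXn H (w i) (hfr_R H gx); have h2 := hfrXn H n (hfr_R H (gr_X a b c pi i)).
have h2V := hfrV (z := (pi 'X_i)%:F ^+ n) (expf_neq0 _ iF) h2.
have rz : ratfun gr z.
  apply/ratfun_hfr; apply: (hfr_eq (hfrM H h1 h2V)).
  by rewrite -[n%:Z *+ _]mulr_natr -[(w i)%:Z *+ _]mulr_natr !natz mulrC subrr.
have vz (Q0 : point gr) : val C Q0 z = val C Q0 x%:F *+ w i - val C Q0 (pi 'X_i)%:F *+ n.
  rewrite (valM C Q0 h1 h2V) ?invr_eq0 ?expf_neq0 // (valV C Q0 h2) ?expf_neq0 //.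
  by rewrite (valXn C Q0 _ (hfr_R H gx)) // (valXn C Q0 _ (hfr_R H (gr_X a b c pi i))).
have q0 (Q0 : point gr) : 0 < (lq Q0)%:Z by rewrite ltz_nat lq_gt0.
have : 0 < ord Q2 z.
  apply: (hQ) => //; rewrite -(pmulr_lgt0 _ (q0 Q1)) -ord_val // vz (val_notin C iQ) mul0rn subr0.
  by rewrite pmulrn_lgt0 // -(val_mem C Q1 gx).
rewrite -(pmulr_lgt0 _ (q0 Q2)) -ord_val // vz subr_gt0 => lt.
have : 0 < val C Q2 x%:F *+ w i.
  by apply: le_lt_trans lt; rewrite mulrn_wge0 // (val_R C Q2 (gr_X a b c pi i)).
by rewrite pmulrn_lgt0 // -(val_mem C Q2 gx).
Qed.

(** The divisor D0, that is div(T) with fractional multiplicities. *)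
Definition stdD (P : point gr) : rat := (val C P (cvT C))%:~R / (lq P)%:R.

End Orders.

(** * Isomorphisms of section rings *)

Section Transport.

Variables (k : closedFieldType) (a b c : nat) (R : idomainType).
Variables (pi : {rmorphism {mpoly k[3]} -> R}) (h : nat) (f : {mpoly k[3]}).
Variable C : curve a b c pi h f.

Let H := cvH C.
Local Notation w := (wt a b c).
Local Notation gr := (piece a b c pi).
Local Notation cst := (structure_map pi).
Local Notation hfr := (hfr a b c pi).
Local Notation "x %:F" := (@FracField.tofrac R x).
Local Notation lq P := (lq (cvloc C P)).

Variable D : point gr -> rat.
Variable theta : {rmorphism R -> {poly {fraction R}}}.
Hypothesis theta_inj : injective theta.
Hypothesis theta_img : forall p, section_ring D p <-> exists x, theta x = p.
Hypothesis theta_gr : forall n x, gr n x -> exists phi, theta x = phi *: 'X^n.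

(** For homogeneous x this is the section of nD that corresponds to x. As a leading coefficient it
    is multiplicative on all of R. *)
Definition ph (x : R) : {fraction R} := lead_coef (theta x).

Lemma theta_eq0 x : (theta x == 0) = (x == 0).
Proof. by rewrite -(rmorph0 theta) (inj_eq theta_inj). Qed.

Lemma ph_eq0 x : (ph x == 0) = (x == 0).
Proof. by rewrite /ph lead_coef_eq0 theta_eq0. Qed.

Lemma phE n x : gr n x -> theta x = ph x *: 'X^n.
Proof.
move=> /theta_gr[phi E]; rewrite /ph E; congr (_ *: _).
by rewrite lead_coefZ lead_coefXn mulr1.
Qed.

Lemma phM x y : ph (x * y) = ph x * ph y.
Proof. by rewrite /ph rmorphM lead_coefM. Qed.

Lemma phD n x y : gr n x -> gr n y -> ph (x + y) = ph x + ph y.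
Proof.
move=> hx hy; have := phE (grD H hx hy); rewrite rmorphD (phE hx) (phE hy) -scalerDl.
by move/(congr1 (fun p : {poly {fraction R}} => p`_n)); rewrite !coefZ coefXn eqxx !mulr1.
Qed.

Lemma ph_H0 n x : gr n x -> H0 (gr := gr) (fun P => n%:R * D P) (ph x).
Proof.
move=> hx; have /theta_img /(_ n) : exists y, theta y = theta x by exists x.
by rewrite {1}(phE hx) coefZ coefXn eqxx mulr1.
Qed.

Lemma ph_surj n phi : H0 (gr := gr) (fun P => n%:R * D P) phi -> exists x, gr n x /\ ph x = phi.
Proof.
move=> hphi; have /theta_img[x xE] : section_ring D (phi *: 'X^n).
  move=> m; rewrite coefZ coefXn; have [->|_] := eqVneq m n; first by rewrite mulr1.
  by rewrite mulr0; left.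
have tc m : theta (grading H x)`_m = (if m == n then phi else 0) *: 'X^m.
  have [p hp] := theta_gr (gr_coef H x m); rewrite hp; congr (_ *: _).
  have E : theta x = \sum_(i < size (grading H x)) ph (grading H x)`_i *: 'X^i.
    rewrite {1}(gr_decomp H x) rmorph_sum; apply: eq_bigr => i _.
    by rewrite (phE (gr_coef H x i)).
  have pE : p = ph (grading H x)`_m.
    have := phE (gr_coef H x m); rewrite hp => /(congr1 (fun p0 : {poly {fraction R}} => p0`_m)).
    by rewrite !coefZ coefXn eqxx !mulr1.
  have := congr1 (fun p0 : {poly {fraction R}} => p0`_m) E.
  rewrite xE coefZ coefXn coef_sum; under eq_bigr => i _ do rewrite coefZ coefXn.
  have [lt|le] := ltnP m (size (grading H x)).
    rewrite (bigD1 (Ordinal lt)) //= eqxx mulr1 -pE big1 ?addr0 => [|i].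
      by case: (m == n); rewrite ?mulr1 ?mulr0 => <-.
    by rewrite -val_eqE /= eq_sym => /negbTE ->; rewrite mulr0.
  rewrite big1 => [|i _]; last by rewrite (gtn_eqF (leq_trans (ltn_ord i) le)) mulr0.
  rewrite pE nth_default // /ph rmorph0 lead_coef0.
  by case: (m == n); rewrite ?mulr1 // => ->.
have xn : x = (grading H x)`_n.
  rewrite {1}(gr_decomp H x); have z m : m != n -> (grading H x)`_m = 0.
    by move=> /negbTE mn; apply/eqP; rewrite -theta_eq0 tc mn scale0r.
  have [lt|le] := ltnP n (size (grading H x)).
    rewrite (bigD1 (Ordinal lt)) //= big1 ?addr0 // => i; rewrite -val_eqE => /=; exact: z.
  by rewrite (nth_default _ le) big1 // => i _; apply: z; rewrite neq_ltn (leq_trans (ltn_ord i) le).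
exists x; rewrite {1}xn; split; first exact: gr_coef.
by rewrite /ph xE lead_coefZ lead_coefXn mulr1.
Qed.

Lemma ph_ratfun n x : gr n x -> ratfun gr (ph x).
Proof.
move=> /ph_H0[->|[]] //; rewrite -tofrac0 -(rmorph0 cst); exact: (ratfun_cst C).
Qed.

Definition hdeg (x : R) : nat := (size (theta x)).-1.

Lemma hdegE n x : gr n x -> x != 0 -> hdeg x = n.
Proof.
move=> hx x0; rewrite /hdeg (phE hx) size_scale ?ph_eq0 // size_polyXn.
by [].
Qed.

(** The order of vanishing at P of x seen as a section of nD, n = deg x. Its center on R is the
    point [sig_pt P], which gives the permutation of the points. *)
Definition omD (P : point gr) (x : R) : rat := (ord P (ph x))%:~R + (hdeg x)%:R * D P.

Hypothesis amp : ample_qdivisor D.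

Lemma ample_sections : exists M, [/\ (0 < M)%N,
  forall P Q : point gr, P <> Q -> exists x, [/\ gr M x, x != 0, omD P x = 0 & 0 < omD Q x] &
  forall P : point gr, exists x, [/\ gr M x, x != 0 & omD P x = 1]].
Proof.
have [_ [N [N0 _ [m m0 [sep tan]]]]] := amp.
exists (m * N)%N; split; first by rewrite muln_gt0 m0.
  move=> P Q /sep[s [hs s0 e1 e2]].
  have [|x [gx xE]] := @ph_surj (m * N) s.
    by case: hs => [->|[rs _ hs]]; [left|right; split=> // P'; rewrite natrM -mulrA].
  have x0 : x != 0 by rewrite -ph_eq0 xE.
  by exists x; split=> //; rewrite /omD (hdegE gx) // xE natrM -mulrA.
move=> P; have [s [hs s0 e1]] := tan P.
have [|x [gx xE]] := @ph_surj (m * N) s.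
  by case: hs => [->|[rs _ hs]]; [left|right; split=> // P'; rewrite natrM -mulrA].
have x0 : x != 0 by rewrite -ph_eq0 xE.
by exists x; split=> //; rewrite /omD (hdegE gx) // xE natrM -mulrA.
Qed.

Lemma omD_gradedval P : gradedval a b c pi (omD P).
Proof.
have [M [M0 sep _]] := ample_sections; have [Q PQ] := other_point H P.
have QP : P <> Q by move=> e; apply: PQ.
split.
- move=> n x gx x0; rewrite /omD (hdegE gx) //.
  by case: (ph_H0 gx) => [/eqP|[_ _ /(_ P)//]]; rewrite ph_eq0 (negbTE x0).
- move=> n m x y gx gy x0 y0; have xy0 : x * y != 0 by rewrite mulf_neq0.
  rewrite /omD (hdegE (grM H gx gy)) // (hdegE gx) // (hdegE gy) // phM.
  rewrite (ordM C P (ph_ratfun gx) (ph_ratfun gy)) ?ph_eq0 // natrD rmorphD /=; ring.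
- move=> n x y t gx gy x0 y0 s0; rewrite /omD (hdegE (grD H gx gy)) // (hdegE gx) // (hdegE gy) //.
  rewrite -!lerBlDr (phD gx gy) => le1 le2.
  have n0 : ph x + ph y != 0 by rewrite -(phD gx gy) ph_eq0.
  have := @ordD _ _ _ _ _ _ _ _ C P (Num.min (ord P (ph x)) (ord P (ph y))) _ _ (ph_ratfun gx) (ph_ratfun gy) n0.
  rewrite !ge_min !lexx orbT => /(_ (fun _ => isT) (fun _ => isT)).
  by case/orP; rewrite -(ler_int rat) => le; [apply: le_trans le1 le|apply: le_trans le2 le].
- by have [x [gx x0 e1 _]] := sep _ _ QP; exists M, x.
by have [x [gx x0 _ e1]] := sep _ _ PQ; exists M, x.
Qed.

Definition sig_pt (P : point gr) : point gr := projT1 (cid (center C (omD_gradedval P))).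

Lemma sig_pt_mem P n x : gr n x -> x != 0 -> (x \in sig_pt P) = (0 < omD P x).
Proof. by have [hQ _] := projT2 (cid (center C (omD_gradedval P))); apply: hQ. Qed.

Lemma omD_ord P n x y : gr n x -> gr n y -> x != 0 -> y != 0 ->
  omD P x - omD P y = (ord P (ph x / ph y))%:~R.
Proof.
move=> gx gy x0 y0; rewrite /omD (hdegE gx) // (hdegE gy) //.
rewrite (ordM C P (ph_ratfun gx) (ratfunV (ph_ratfun gy))) ?invr_eq0 ?ph_eq0 //.
rewrite (ordV C P (ph_ratfun gy)) ?ph_eq0 // rmorphB /=; ring.
Qed.

Lemma sig_pt_ord P n x y : gr n x -> gr n y -> x != 0 -> y != 0 ->
  ord P (ph x / ph y) = ord (sig_pt P) (x%:F / y%:F).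
Proof.
have : exists2 e, 0 < e & forall n x y, gr n x -> gr n y -> x != 0 -> y != 0 ->
    omD P x - omD P y = e * (ord (sig_pt P) (x%:F / y%:F))%:~R.
  by have [_ hQ] := projT2 (cid (center C (omD_gradedval P))).
move=> [e e0 he].
have [M [M0 sep tan]] := ample_sections; have [Q PQ] := other_point H P.
(* e is an integer, being the order of the image of a uniformizer, and e z = 1 for an integer z
   because sections separate tangent vectors at P. *)
have e1 : e = 1.
  have [u [gu u0 ou]] := tan P.
  have [v [gv v0 ov _]] := sep P Q (fun e => PQ (esym e)).
  have := he _ _ _ gu gv u0 v0; rewrite ou ov subr0.
  set z := ord _ _ => ez.
  have [m [s [t [gs gt t0 tE]]]] := ratfun_tpar C (sig_pt P).
  have s0 : s != 0 by apply: contraNneq (tpar_neq0 C (sig_pt P)) => s0; rewrite tE s0 tofrac0 mul0r.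
  have := he _ _ _ gs gt s0 t0; rewrite -tE ord_tpar mulr1 (omD_ord P gs gt) // => E.
  move: e0 ez; rewrite -E ltr0z -[1]/(1%:~R) -rmorphM => o0 /intr_inj oz.
  have z0 : 0 < z by rewrite -(pmulr_rgt0 _ o0) -oz.
  by congr (_%:~R); nia.
move=> gx gy x0 y0; apply: (@intr_inj rat); rewrite -(omD_ord P gx gy) //.
by rewrite (he _ _ _ gx gy) // e1 mul1r.
Qed.

(** The field endomorphism of k(X) induced by theta on fractions of degree 0. As theta is only a
    ring morphism, constants may be moved. *)
Definition sig (z : {fraction R}) : {fraction R} :=
  xget 0 [set u | exists n x y, [/\ gr n x, gr n y, y != 0, z = x%:F / y%:F & u = ph x / ph y]].

Lemma ph_inj n x y : gr n x -> gr n y -> ph x = ph y -> x = y.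
Proof. by move=> gx gy E; apply: theta_inj; rewrite (phE gx) (phE gy) E. Qed.

Lemma sigE n x y : gr n x -> gr n y -> y != 0 -> sig (x%:F / y%:F) = ph x / ph y.
Proof.
move=> gx gy y0; rewrite /sig; case: xgetP => [_ _ [n' [x' [y' [gx' gy' y0' E ->]]]]|].
  apply/eqP; rewrite eqr_div ?ph_eq0 // -!phM; apply/eqP; congr ph.
  by apply/eqP; rewrite -tofrac_eq !tofracM -eqr_div ?tofrac_eq0 // E.
by move=> /(_ (ph x / ph y)); case; exists n, x, y.
Qed.

Lemma sig0 : sig 0 = 0.
Proof.
have := sigE (gr0 H 0) (gr1 H) (oner_neq0 R).
by rewrite tofrac0 mul0r => ->; rewrite /ph rmorph0 lead_coef0 mul0r.
Qed.

Lemma sig1 : sig 1 = 1.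
Proof.
have := sigE (gr1 H) (gr1 H) (oner_neq0 R).
by rewrite divff ?tofrac_eq0 ?oner_neq0 // => ->; rewrite divff // ph_eq0 oner_neq0.
Qed.

Lemma sig_ratfun z : ratfun gr z -> ratfun gr (sig z).
Proof.
move=> [n [x [y [gx gy y0 ->]]]]; rewrite (sigE gx gy y0).
by apply: (ratfunM C) (ph_ratfun gx) _; apply: ratfunV; apply: ph_ratfun gy.
Qed.

Lemma sigM z z' : ratfun gr z -> ratfun gr z' -> sig (z * z') = sig z * sig z'.
Proof.
move=> [n [x [y [gx gy y0 ->]]]] [n' [x' [y' [gx' gy' y0' ->]]]].
rewrite mulf_div -!tofracM (sigE (grM H gx gx') (grM H gy gy')) ?mulf_neq0 //.
by rewrite (sigE gx gy y0) (sigE gx' gy' y0') mulf_div !phM.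
Qed.

Lemma sigD z z' : ratfun gr z -> ratfun gr z' -> sig (z + z') = sig z + sig z'.
Proof.
move=> [n [x [y [gx gy y0 ->]]]] [n' [x' [y' [gx' gy' y0' ->]]]].
rewrite addf_div ?tofrac_eq0 // -!tofracM -tofracD.
have g1 := grM H gx gy'; have g2 := grM H gx' gy; rewrite addnC in g2.
rewrite (sigE (grD H g1 g2) (grM H gy gy')) ?mulf_neq0 //.
by rewrite (sigE gx gy y0) (sigE gx' gy' y0') addf_div ?ph_eq0 // (phD g1 g2) !phM.
Qed.

Lemma sig_inj z z' : ratfun gr z -> ratfun gr z' -> sig z = sig z' -> z = z'.
Proof.
move=> [n [x [y [gx gy y0 ->]]]] [n' [x' [y' [gx' gy' y0' ->]]]].
rewrite (sigE gx gy y0) (sigE gx' gy' y0') => /eqP; rewrite eqr_div ?ph_eq0 // -!phM => /eqP E.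
have g2 := grM H gx' gy; rewrite addnC in g2.
apply/eqP; rewrite eqr_div ?tofrac_eq0 // -!tofracM; apply/eqP; congr (_%:F).
exact: ph_inj (grM H gx gy') g2 E.
Qed.

Lemma sig_neq0 z : ratfun gr z -> z != 0 -> sig z != 0.
Proof.
move=> rz; apply: contraNneq => E; apply/eqP; apply: sig_inj => //; last by rewrite E sig0.
by rewrite -tofrac0 -(rmorph0 cst); apply: (ratfun_cst C).
Qed.

Lemma sig_ord P z : ratfun gr z -> ord P (sig z) = ord (sig_pt P) z.
Proof.
have [->|z0] := eqVneq z 0; first by rewrite sig0 !(ord0 C).
move=> [n [x [y [gx gy y0 E]]]]; rewrite E (sigE gx gy y0); apply: (sig_pt_ord P gx gy) => //.
by apply: contraNneq z0 => x0; rewrite E x0 tofrac0 mul0r.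
Qed.

Lemma omD_ge0 P n x : gr n x -> x != 0 -> 0 <= omD P x.
Proof. exact: (gv_ge0 (omD_gradedval P)). Qed.

Lemma omD_prod P (I : eqType) (r : seq I) (F : I -> R) n : (forall i, gr n (F i)) -> (forall i, F i != 0) ->
  0 <= omD P (\prod_(i <- r) F i) /\ forall i, i \in r -> omD P (F i) <= omD P (\prod_(i <- r) F i).
Proof.
move=> gF nF; elim: r => [|j r [IH1 IH2]].
  by rewrite big_nil (omD_ge0 P (gr1 H)) ?oner_neq0.
have g2 := gr_prod H r gF; have n2 : \prod_(i <- r) F i != 0.
  by rewrite prodf_seq_neq0; apply/allP => i _; rewrite nF implybT.
rewrite big_cons (gvM (omD_gradedval P) (gF j) g2) //; split.
  by rewrite addr_ge0 // (omD_ge0 P (gF j)).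
move=> i; rewrite inE => /orP[/eqP ->|ir]; first by rewrite lerDl.
by apply: le_trans (IH2 i ir) _; rewrite lerDr (omD_ge0 P (gF j)).
Qed.

Lemma omDXn P n x e : gr n x -> x != 0 -> omD P (x ^+ e) = e%:R * omD P x.
Proof.
move=> gx x0; elim: e => [|e IH].
  rewrite mul0r expr0; have := gvM (omD_gradedval P) (gr1 H) (gr1 H) (oner_neq0 R) (oner_neq0 R).
  by rewrite mulr1; lra.
rewrite exprS (gvM (omD_gradedval P) gx (grXn H e gx)) ?expf_neq0 // IH -natr1; ring.
Qed.

(* Poles are cancelled by products of sections vanishing at them. *)
Lemma sig_surj z : ratfun gr z -> exists z', ratfun gr z' /\ sig z' = z.
Proof.
have [->|z0] := eqVneq z 0.
  by exists 0; rewrite sig0; split=> //; rewrite -tofrac0 -(rmorph0 cst); apply: (ratfun_cst C).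
move=> rz; have [n [x [y [gx gy y0 zE]]]] := rz.
have [m [s hs]] := finpts_zeros H gy y0.
have [M [M0 _ tan]] := ample_sections.
pose t i := projT1 (cid (tan (s i))).
have ht i : [/\ gr M (t i), t i != 0 & omD (s i) (t i) = 1] by rewrite /t; case: cid.
(* Poles of z occur only at zeros of y, among the s i, and e bounds their orders there. *)
pose e := (\sum_i absz (ord (s i) z))%N.
have gt i : gr (M * e) (t i ^+ e) by apply: (grXn H); case: (ht i).
have nt i : t i ^+ e != 0 by rewrite expf_neq0 //; case: (ht i).
pose u := \prod_(i <- enum 'I_m) t i ^+ e.
have gu : gr (M * e * size (enum 'I_m)) u by apply: (gr_prod H) => i; apply: gt.
have u0 : u != 0 by rewrite prodf_seq_neq0; apply/allP => i _; rewrite nt.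
have [|x' [gx' x'E]] := @ph_surj (M * e * size (enum 'I_m)) (ph u * z).
  right; split; first exact: (ratfunM C) (ph_ratfun gu) rz.
    by rewrite mulf_neq0 ?ph_eq0.
  move=> P; rewrite (ordM C P (ph_ratfun gu) rz) ?ph_eq0 // rmorphD /= addrAC.
  rewrite -[X in _ + X%:R * _](hdegE gu u0) -/(omD P u).
  have [h1 h2] := omD_prod P (enum 'I_m) gt nt.
  have [yP|yP] := boolP (y \in P); last first.
    rewrite addr_ge0 // ler0z; have q0 : 0 < (lq P)%:Z by rewrite ltz_nat lq_gt0.
    rewrite -(pmulr_lge0 _ q0) -ord_val //.
    have /(local_ring_val C P)[_ /(_ z0)//] : local_ring P z by exists n, x, y.
  have [i Pi] := hs P yP.
  have := h2 i; rewrite mem_enum => /(_ isT); rewrite {1}Pi.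
  have [gi ti oi] := ht i; rewrite (omDXn _ _ gi ti) oi mulr1 -/u => le.
  apply: le_trans (_ : e%:R + (ord P z)%:~R <= _); last by rewrite lerD2r.
  rewrite -[e%:R]/((e%:Z)%:~R) -rmorphD ler0z Pi.
  have : (absz (ord (s i) z) <= e)%N by rewrite /e (bigD1 i) //= leq_addr.
  by lia.
exists (x'%:F / u%:F); split; first by exists (M * e * size (enum 'I_m))%N, x', u.
by rewrite (sigE gx' gu u0) x'E mulrAC divff ?ph_eq0 // mul1r.
Qed.

Lemma sig_pt_inj : injective sig_pt.
Proof.
move=> P Q E; apply: contrapT => PQ; have [M [M0 sep _]] := ample_sections.
have [x [gx x0 e0 e1]] := sep P Q PQ.
by have := sig_pt_mem P gx x0; rewrite E (sig_pt_mem Q gx x0) e1 e0 ltxx.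
Qed.

Definition tau (z : {fraction R}) : {fraction R} := xget 0 [set z' | ratfun gr z' /\ sig z' = z].

Lemma tauP z : ratfun gr z -> ratfun gr (tau z) /\ sig (tau z) = z.
Proof. by move=> /sig_surj[z' hz']; rewrite /tau; case: xgetP => [y _ //|/(_ z')]. Qed.

Lemma tauK z : ratfun gr z -> tau (sig z) = z.
Proof.
by move=> rz; have [r E] := tauP (sig_ratfun rz); apply: sig_inj.
Qed.

Lemma tauM z z' : ratfun gr z -> ratfun gr z' -> tau (z * z') = tau z * tau z'.
Proof.
move=> rz rz'; have [r E] := tauP rz; have [r' E'] := tauP rz'.
by rewrite -{1}E -{1}E' -sigM // tauK //; apply: (ratfunM C).
Qed.

Lemma tauD z z' : ratfun gr z -> ratfun gr z' -> tau (z + z') = tau z + tau z'.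
Proof.
move=> rz rz'; have [r E] := tauP rz; have [r' E'] := tauP rz'.
by rewrite -{1}E -{1}E' -sigD // tauK //; apply: (ratfunD C).
Qed.

Lemma tau_neq0 z : ratfun gr z -> z != 0 -> tau z != 0.
Proof. by move=> rz; have [r E] := tauP rz; apply: contraNneq => t0; rewrite -E t0 sig0. Qed.

Section Surjectivity.

Variable Q : point gr.

Let v z := ord Q (tau z).

Let vM z z' : ratfun gr z -> ratfun gr z' -> z != 0 -> z' != 0 -> v (z * z') = v z + v z'.
Proof.
move=> rz rz' z0 z0'; rewrite /v tauM // (ordM C) ?tau_neq0 //.
  by case: (tauP rz).
by case: (tauP rz').
Qed.

Let v1 : v 1 = 0.
Proof.
have r1 : ratfun gr (1 : {fraction R}) by rewrite -tofrac1 -(rmorph1 cst); apply: (ratfun_cst C).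
by have := vM r1 r1 (oner_neq0 _) (oner_neq0 _); rewrite mulr1; lia.
Qed.

Let vXn z n : ratfun gr z -> z != 0 -> v (z ^+ n) = v z *+ n.
Proof.
move=> rz z0; elim: n => [|n IH]; first by rewrite expr0 v1.
by rewrite exprS mulrS -IH vM ?expf_neq0 //; apply: (ratfunXn C).
Qed.

Let vV z : ratfun gr z -> z != 0 -> v z^-1 = - v z.
Proof.
move=> rz z0; have := vM rz (ratfunV rz) z0; rewrite invr_eq0 => /(_ z0).
by rewrite divff // v1; lia.
Qed.

Let vD n z z' : ratfun gr z -> ratfun gr z' -> z + z' != 0 ->
  (z != 0 -> n <= v z) -> (z' != 0 -> n <= v z') -> n <= v (z + z').
Proof.
move=> rz rz' s0 h1 h2; rewrite /v tauD //.
have [r E] := tauP rz; have [r' E'] := tauP rz'.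
apply: (ordD C) => //.
- by rewrite -tauD //; apply: tau_neq0 => //; apply: (ratfunD C).
- by move=> t0; apply: h1; apply: contraNneq t0 => z0; apply/eqP; apply: sig_inj => //;
    [rewrite -tofrac0 -(rmorph0 cst); apply: (ratfun_cst C)|rewrite E z0 sig0].
by move=> t0; apply: h2; apply: contraNneq t0 => z0; apply/eqP; apply: sig_inj => //;
    [rewrite -tofrac0 -(rmorph0 cst); apply: (ratfun_cst C)|rewrite E' z0 sig0].
Qed.

(* a constant has roots of every order *)
Let vcst x : x != 0 -> v (cst x)%:F = 0.
Proof.
move=> x0; set n := v _; have [y yE] := closed_root x (ltn0Sn (absz n)).
have y0 : y != 0 by apply: contraNneq x0 => y0; rewrite -yE y0 expr0n.
have c0 : (cst y)%:F != 0 by rewrite tofrac_eq0 cst_eq0.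
have := vXn (absz n).+1 (ratfun_cst C y) c0; rewrite -tofracXn -rmorphXn yE -/n => E.
have E2 : n = v (cst y)%:F * (absz n).+1%:Z by rewrite {1}E -mulr_natr natz.
by move: (v _) E2 => z E2; have [z0|z0] := eqVneq z 0; [rewrite E2 z0 mul0r|nia].
Qed.

(** A common multiple of the weights, so that the powers y_i of the variables share the degree W and
    their quotients lie in k(X). *)
Let W := (a * b * c)%N.

Let W0 : (0 < W)%N.
Proof. by rewrite /W !muln_gt0 (wt_gt0 H 0) (wt_gt0 H 1) (wt_gt0 H 2%:R). Qed.

Let Wd i : (w i %| W)%N.
Proof.
elim/ord3_ind: i; rewrite /W /wt /=.
- by rewrite -mulnA dvdn_mulr.
- by rewrite dvdn_mulr // dvdn_mull.
by rewrite dvdn_mull.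
Qed.

Let y i := pi 'X_i ^+ (W %/ w i).

Let gy i : gr W (y i).
Proof. by rewrite -{1}(divnK (Wd i)) mulnC; apply: (grXn H); apply: gr_X. Qed.

Let minvar : exists i, y i != 0 /\ forall j, y j != 0 -> 0 <= v ((y j)%:F / (y i)%:F).
Proof.
have [P _] := plane_point H 0; have [i0 iP] := point_var P.
have y0 : y i0 != 0 by rewrite expf_neq0 // (notin_neq0 iP).
pose u j := v ((y j)%:F / (y i0)%:F).
pose A := [pred j | y j != 0].
have [i yi mi] : exists2 i, A i & forall j, A j -> u i <= u j.
  by case: (@Order.TotalTheory.arg_minP _ _ _ i0 A u) => // i; exists i.
have rat1 j l : y l != 0 -> ratfun gr ((y j)%:F / (y l)%:F) by exists W, (y j), (y l).
exists i; split=> // j yj.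
have -> : (y j)%:F / (y i)%:F = ((y j)%:F / (y i0)%:F) / ((y i)%:F / (y i0)%:F).
  by rewrite invf_div mulrA divfK // tofrac_eq0.
have n0 l : y l != 0 -> (y l)%:F / (y i0)%:F != 0 by move=> ?; rewrite mulf_neq0 ?invr_eq0 ?tofrac_eq0.
rewrite vM ?invr_eq0 ?n0 //; [|exact: rat1|by apply: ratfunV; exact: rat1].
rewrite vV ?n0 //; last exact: rat1.
by rewrite subr_ge0; apply: mi.
Qed.

(** The valuation v = ord Q o tau of k(X) has a center: if y_i is of least value, x -> v(x^W /
    y_i^n) with n = deg x is nonnegative on monomials, hence on R. By [point_eq_ord] the center P is
    mapped to Q. *)
Lemma sig_pt_surj : exists P, sig_pt P = Q.
Proof.
have [i [yi mi]] := minvar.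
have yiF : (y i)%:F != 0 by rewrite tofrac_eq0.
pose q n x := x%:F ^+ W / (y i)%:F ^+ n.
have rq n x : gr n x -> ratfun gr (q n x).
  move=> gx; exists (n * W)%N, (x ^+ W), (y i ^+ n); split.
  - exact: (grXn H).
  - by rewrite mulnC; apply: (grXn H).
  - by rewrite expf_neq0.
  by rewrite /q -!rmorphXn.
have q0 n x : x != 0 -> q n x != 0 by move=> x0; rewrite mulf_neq0 ?invr_eq0 ?expf_neq0 ?tofrac_eq0.
have [om omE] : exists om : R -> rat, forall n x, gr n x -> x != 0 -> om x = (v (q n x))%:~R.
  by exists (fun x => (v (q (hdeg x) x))%:~R) => n x gx x0; rewrite (hdegE gx).
have qM n m x x' : q (n + m)%N (x * x') = q n x * q m x'.
  by rewrite /q tofracM exprMn exprD invfM mulrACA.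
have vq n x x' : gr n x -> gr n x' -> x != 0 -> x' != 0 ->
    v (q n x) - v (q n x') = v (x%:F / x'%:F) *+ W.
  move=> gx gx' x0 x0'; have rx : ratfun gr (x%:F / x'%:F) by exists n, x, x'.
  have n0 : x%:F / x'%:F != 0 by rewrite mulf_neq0 ?invr_eq0 ?tofrac_eq0.
  have -> : q n x = (x%:F / x'%:F) ^+ W * q n x'.
    by rewrite /q mulrA -exprMn divfK ?tofrac_eq0.
  rewrite vM ?vXn ?expf_neq0 ?addrK //; [exact: (ratfunXn C)|exact: rq|exact: q0].
have vqD n x x' t : gr n x -> gr n x' -> x + x' != 0 ->
    (x != 0 -> t <= v (q n x)) -> (x' != 0 -> t <= v (q n x')) -> t <= v (q n (x + x')).
  move=> gx gx' s0; have [x0|x0] := eqVneq x 0.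
    by rewrite x0 add0r => _ h2; apply: h2; move: s0; rewrite x0 add0r.
  have [->|x0'] := eqVneq x' 0; first by rewrite addr0 => h1 _; apply: h1.
  move=> /(_ isT) h1 /(_ isT) h2.
  wlog le : x x' gx gx' s0 x0 x0' h1 h2 / v (q n x) <= v (q n x').
    move=> hw; have [le|/ltW le] := lerP (v (q n x)) (v (q n x')); first exact: hw.
    by rewrite addrC; apply: hw => //; rewrite addrC.
  apply: le_trans h1 _; rewrite -subr_ge0 (vq _ _ _ (grD H gx gx') gx) // mulrn_wge0 //.
  rewrite tofracD mulrDl divff ?tofrac_eq0 //.
  apply: vD; first by rewrite -tofrac1 -(rmorph1 cst); apply: (ratfun_cst C).
  - by exists n, x', x.
  - rewrite -[1](divff (x := x%:F)) ?tofrac_eq0 // -mulrDl -tofracD mulf_neq0 ?invr_eq0 ?tofrac_eq0 //.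
  - by rewrite v1.
  move=> _; have := vq _ _ _ gx' gx x0' x0; have : 0 <= v (q n x') - v (q n x) by rewrite subr_ge0.
  by move=> + E; rewrite E pmulrn_lge0.
have ge0 n x : gr n x -> x != 0 -> 0 <= v (q n x).
  move=> [p hp <-] x0.
    have gm (m : 'X_{1..3}) : m \in msupp p -> gr n (cst p@_m * pi 'X_[m]).
      move=> mp; rewrite cstM; exists (p@_m *: 'X_[m]) => //; apply: rpredZ.
      by rewrite dhomogX; apply/eqP; apply: hom_wdeg hp mp.
    have vm (m : 'X_{1..3}) : m \in msupp p -> cst p@_m * pi 'X_[m] != 0 -> 0 <= v (q n (cst p@_m * pi 'X_[m])).
      move=> mp; rewrite mulf_eq0 negb_or => /andP[c0 m0].
      have -> : q n (cst p@_m * pi 'X_[m]) = (cst p@_m)%:F ^+ W * \prod_j ((y j)%:F / (y i)%:F) ^+ (m j * w j).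
        rewrite /q tofracM exprMn -mulrA; congr (_ * _).
        have -> : (pi 'X_[m])%:F ^+ W = \prod_j (y j)%:F ^+ (m j * w j).
          rewrite -rmorphXn mpolyX_prod3 -prodrXl rmorph_prod; apply: eq_bigr => j _.
          have -> : pi 'X_j ^+ m j ^+ W = y j ^+ (m j * w j).
            by rewrite /y -!exprM; congr (_ ^+ _); rewrite mulnCA divnK.
          by rewrite rmorphXn.
        rewrite -(hom_wdeg hp mp) wdegE -prodrXr -prodf_div; apply: eq_bigr => j _.
        by rewrite expr_div_n.
      have h1 : ratfun gr ((cst p@_m)%:F ^+ W) by apply: (ratfunXn C); apply: (ratfun_cst C).
      have cF : (cst p@_m)%:F != 0 by rewrite tofrac_eq0.
      have mj j : (0 < m j)%N -> y j != 0.
        move=> mj; rewrite expf_neq0 //; apply: contraNneq m0 => xj.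
        by rewrite mpolyX_prod3 (bigD1 j) //= xj expr0n (gtn_eqF mj) mul0r.
      have h2 (r : seq 'I_3) : [/\ ratfun gr (\prod_(j <- r) ((y j)%:F / (y i)%:F) ^+ (m j * w j)),
          \prod_(j <- r) ((y j)%:F / (y i)%:F) ^+ (m j * w j) != 0 &
          0 <= v (\prod_(j <- r) ((y j)%:F / (y i)%:F) ^+ (m j * w j))].
        have r1 : ratfun gr (1 : {fraction R}) by rewrite -tofrac1 -(rmorph1 cst); apply: (ratfun_cst C).
        elim: r => [|j r [r2 n2 v2]]; first by rewrite big_nil v1 oner_neq0.
        rewrite big_cons; have [->|mj0] := posnP (m j); first by rewrite mul0n expr0 mul1r.
        have yj := mj j mj0; have rj : ratfun gr ((y j)%:F / (y i)%:F) by exists W, (y j), (y i).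
        have nj : (y j)%:F / (y i)%:F != 0 by rewrite mulf_neq0 ?invr_eq0 ?tofrac_eq0.
        have rX : ratfun gr (((y j)%:F / (y i)%:F) ^+ (m j * w j)) by apply: (ratfunXn C).
        have nX : ((y j)%:F / (y i)%:F) ^+ (m j * w j) != 0 by rewrite expf_neq0.
        split; [exact: (ratfunM C)|by rewrite mulf_neq0|].
        by rewrite vM // addr_ge0 // vXn // mulrn_wge0 // mi.
      have [r2 n2 v2] := h2 (index_enum 'I_3).
      rewrite vM ?expf_neq0 // vXn //; last exact: (ratfun_cst C).
      by rewrite vcst ?mul0rn ?add0r //; rewrite -(cst_eq0 pi).
    move: x0; rewrite {1 2}(mpolyE p) rmorph_sum.
    under eq_bigr => m _ do rewrite /= -cstM.
    have : forall m, m \in msupp p -> m \in msupp p by [].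
    elim: {1 3 4}(msupp p) => [|m r IH] sub; first by rewrite big_nil eqxx.
    rewrite big_cons => s0; apply: vqD => //.
    + by apply: gm; apply: sub; rewrite mem_head.
    + rewrite big_seq; apply: (gr_sum H) => m' m'r; apply: gm; apply: sub.
      by rewrite inE m'r orbT.
    + by apply: vm; apply: sub; rewrite mem_head.
    by apply: IH => m' m'r; apply: sub; rewrite inE m'r orbT.
have hom : gradedval a b c pi om.
  split.
  - by move=> n x gx x0; rewrite (omE _ _ gx) // ler0z; apply: ge0.
  - move=> n m x x' gx gx' x0 x0'; rewrite (omE _ _ (grM H gx gx') (mulf_neq0 x0 x0')) (omE _ _ gx x0) (omE _ _ gx' x0').
    rewrite qM vM ?q0 ?rmorphD //; [exact: rq|exact: rq].
  - move=> n x x' t gx gx' x0 x0' s0; rewrite (omE _ _ (grD H gx gx') s0) (omE _ _ gx x0) (omE _ _ gx' x0').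
    have key s h1 h2 := vqD n x x' s gx gx' s0 (fun _ => h1) (fun _ => h2).
    move: (v (q n x)) (v (q n x')) (v (q n (x + x'))) key => A B B' key t1 t2.
    have [le|/ltW le] := lerP A B; [have := key A (lexx _) le|have := key B le (lexx _)];
      rewrite -(ler_int rat); exact: le_trans.
  - exists W, (y i); split=> //; rewrite (omE _ _ (gy i)) // /q divff ?v1 //.
    by rewrite expf_neq0.
  have rt := ratfun_tpar C Q; have [n [x [x' [gx gx' x0' E]]]] := sig_ratfun rt.
  have n0 := sig_neq0 rt (tpar_neq0 C Q).
  have x0 : x != 0 by apply: contraNneq n0 => x0; rewrite E x0 tofrac0 mul0r.
  have : v (q n x) - v (q n x') = W%:Z.
    by rewrite (vq _ _ _ gx gx') // -E /v tauK // ord_tpar -mulr_natr mul1r natz.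
  move=> E2; exists n, x; rewrite (omE _ _ gx) // ltr0z; split=> //.
  by have := ge0 _ _ gx' x0'; move: E2 W0; lia.
have [P [_ [e e0 he]]] := center C hom; exists P.
apply/esym; apply: (point_eq_ord C (d := W%:R) (e := e)) => //; first by rewrite ltr0n.
move=> z rz z0; rewrite -sig_ord //; have [n [x [x' [gx gx' x0' E]]]] := sig_ratfun rz.
have n0 := sig_neq0 rz z0.
have x0 : x != 0 by apply: contraNneq n0 => x0; rewrite E x0 tofrac0 mul0r.
rewrite E -(he _ _ _ gx gx') // (omE _ _ gx) // (omE _ _ gx') // -rmorphB (vq _ _ _ gx gx') //.
by rewrite -E /v tauK // rmorphMn /= mulr_natl.
Qed.

End Surjectivity.

(** Take a section y of degree M that does not vanish at P: x^M / y^n has degree 0, where orders at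
    P and at [sig_pt P] correspond, and y contributes nothing to either side. *)
Lemma omD_val P n x : gr n x -> x != 0 ->
  omD P x = (val C (sig_pt P) x%:F)%:~R / (lq (sig_pt P))%:R.
Proof.
move=> gx x0; have [M [M0 sep _]] := ample_sections; have [Q PQ] := other_point H P.
have [y [gy y0 oy _]] := sep P Q (fun e => PQ (esym e)).
have yP : y \notin sig_pt P by rewrite (sig_pt_mem P gy y0) oy ltxx.
have g1 := grXn H M gx; have g2 := grXn H n gy; rewrite mulnC in g2.
have x1 : x ^+ M != 0 by rewrite expf_neq0.
have y1 : y ^+ n != 0 by rewrite expf_neq0.
have := omD_ord P g1 g2 x1 y1; rewrite (sig_pt_ord P g1 g2 x1 y1).
rewrite (omDXn P M gx x0) (omDXn P n gy y0) oy mulr0 subr0.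
have yP' : y ^+ n \notin sig_pt P by rewrite pidX ?(negbTE yP) ?andbF //; apply: point_prime.
set z := (x ^+ M)%:F / _; have rz : ratfun gr z by exists (n * M)%N, (x ^+ M), (y ^+ n).
have z0 : z != 0 by rewrite mulf_neq0 ?invr_eq0 ?tofrac_eq0.
have vz : val C (sig_pt P) z = val C (sig_pt P) x%:F *+ M.
  have yF : (y ^+ n)%:F != 0 by rewrite tofrac_eq0.
  have xF : (x ^+ M)%:F != 0 by rewrite tofrac_eq0.
  rewrite (valM C _ (hfr_R H g1) (hfrV yF (hfr_R H g2))) ?invr_eq0 //.
  rewrite (valV C _ (hfr_R H g2)) // (val_notin C yP') subr0 tofracXn.
  by rewrite (valXn C _ _ (hfr_R H gx)) // tofrac_eq0.
have q0 : (lq (sig_pt P))%:R != 0 :> rat by rewrite pnatr_eq0 -lt0n lq_gt0.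
have M0' : M%:R != 0 :> rat by rewrite pnatr_eq0 -lt0n.
move=> E; apply: (mulIf q0); rewrite divfK //; apply: (mulfI M0').
rewrite mulrA E; have := congr1 (fun u : int => (u%:~R : rat)) (ord_val C (sig_pt P) rz z0).
by rewrite vz rmorphMn rmorphM /= mulr_natl => <-.
Qed.

(** Write T = x / y with deg x = deg y + 1. Subtracting [omD_val] for y from that for x, the degree
    terms leave exactly one D, and the rest is the divisor of ph y / ph x. *)
Lemma sig_pt_equiv : linear_equiv D (fun P => stdD C (sig_pt P)).
Proof.
have [i [j [x [y [gx gy y0 TE ijE]]]]] := cvT_hfr C.
have x0 : x != 0 by apply: contraNneq (cvT_neq0 C) => x0; rewrite TE x0 tofrac0 mul0r.
have rx := ph_ratfun gx; have ry := ph_ratfun gy.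
exists (ph y / ph x); split.
- exact: (ratfunM C) ry (ratfunV rx).
- by rewrite mulf_neq0 ?invr_eq0 ?ph_eq0.
move=> P; rewrite (ordM C P ry (ratfunV rx)) ?invr_eq0 ?ph_eq0 // (ordV C P rx) ?ph_eq0 //.
have := omD_val P gx x0; have := omD_val P gy y0.
rewrite /omD (hdegE gx) // (hdegE gy) // /stdD TE.
rewrite (valM C _ (hfr_R H gx) (hfrV _ (hfr_R H gy))) ?invr_eq0 ?tofrac_eq0 //.
rewrite (valV C _ (hfr_R H gy)) ?tofrac_eq0 // !rmorphB /= mulrBl => <- <-.
have -> : i = j.+1 by lia.
by rewrite -natr1; ring.
Qed.

Lemma sig_pt_ratfun phi : ratfun gr phi -> phi != 0 ->
  exists psi, [/\ ratfun gr psi, psi != 0 & forall P, ord P psi = ord (sig_pt P) phi].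
Proof.
move=> rp p0; exists (sig phi); split; [exact: sig_ratfun|exact: sig_neq0|].
by move=> P; apply: sig_ord.
Qed.

(** tau of a nonzero constant has neither zeros nor poles, so it lies in R_0 = k by [hfr_cap]. *)
Lemma tau_cst x : exists y, tau (cst x)%:F = (cst y)%:F.
Proof.
have rc := ratfun_cst C x; have [rt E] := tauP rc.
have [x0|x0] := eqVneq x 0.
  have z0 : (cst 0)%:F = 0 by rewrite !rmorph0.
  exists 0; rewrite z0; apply: sig_inj => //; last by rewrite E x0 z0 sig0.
  by rewrite -z0; apply: (ratfun_cst C).
have t0 : tau (cst x)%:F != 0 by apply: tau_neq0 => //; rewrite tofrac_eq0 cst_eq0.
have [|y yE] := hfr_cap H (ratfun_deg0 rt).
  move=> Q; have [P <-] := sig_pt_surj Q; apply/(val_ge0 C _ (ratfun_deg0 rt)) => //.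
  by rewrite ord_val // -sig_ord // E (ord_cst C P x0) mul0r.
have [n [u [u' [gu gu' u0' tE]]]] := rt.
have E3 : u = u' * y.
  by apply/eqP; rewrite -tofrac_eq tofracM -yE tE mulrC divfK // tofrac_eq0.
have [_] := gr_div H gu gu' u0' E3; rewrite subnn => /(gr0_cst H)[z zE].
by exists z; rewrite yE zE.
Qed.

(** A derivation del is conjugated to sig o del o tau; it still kills constants because tau maps
    constants to constants. *)
Lemma sig_pt_canonical (K : point gr -> rat) :
  canonical_divisor cst K -> canonical_divisor cst (fun P => K (sig_pt P)).
Proof.
move=> [x [y [rx ry y0 [del0 [kd0 dx0]] hK]]].
have trans del : kderivation cst gr del -> kderivation cst gr (fun z => sig (del (tau z))) /\
    forall z, ratfun gr z -> sig (del (tau (sig z))) = sig (del z).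
  move=> [dr dc dD dM]; split; last by move=> z rz; rewrite tauK.
  split=> [z rz|z|z z' rz rz'|z z' rz rz'].
  - by apply: sig_ratfun; apply: dr; case: (tauP rz).
  - by have [z' ->] := tau_cst z; rewrite dc sig0.
  - have [r E] := tauP rz; have [r' E'] := tauP rz'.
    by rewrite tauD // dD // sigD //; apply: dr.
  have [r E] := tauP rz; have [r' E'] := tauP rz'.
  have rd := dr _ r; have rd' := dr _ r'.
  rewrite tauM // dM // sigD; [|exact: (ratfunM C)|exact: (ratfunM C)].
  by rewrite !sigM // E E'.
exists (sig x), (sig y); split.
- exact: sig_ratfun.
- exact: sig_ratfun.
- exact: sig_neq0.
- have [kd E] := trans _ kd0; exists (fun z => sig (del0 (tau z))); split=> //.
  rewrite E //; apply: sig_neq0 => //; by case: kd0 => dr _ _ _; apply: dr.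
move=> P; have [t [del [/(uniformizer_ord C)[rt t0 ot] kd dt KE]]] := hK (sig_pt P).
have [kd' E] := trans _ kd; exists (sig t), (fun z => sig (del (tau z))); split=> //.
- apply/(uniformizer_ord C); split; [exact: sig_ratfun|exact: sig_neq0|].
  by rewrite sig_ord.
- by rewrite E // dt sig1.
rewrite KE E // -sigM //; last by case: kd => dr _ _ _; apply: dr.
by rewrite sig_ord //; apply: (ratfunM C) => //; case: kd => dr _ _ _; apply: dr.
Qed.

End Transport.

Lemma section_ring_transport (k : closedFieldType) (a b c : nat) (R : idomainType)
    (pi : {rmorphism {mpoly k[3]} -> R}) (h : nat) (f : {mpoly k[3]})
    (C : curve a b c pi h f) (D : point (piece a b c pi) -> rat) :
  ample_qdivisor D -> is_section_ring D ->
  exists s : point (piece a b c pi) -> point (piece a b c pi),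
  [/\ injective s, forall Q, exists P, s P = Q,
      linear_equiv D (fun P => stdD C (s P)),
      forall phi, ratfun (piece a b c pi) phi -> phi != 0 ->
        exists psi, [/\ ratfun (piece a b c pi) psi, psi != 0 & forall P, ord P psi = ord (s P) phi] &
      forall K, canonical_divisor (structure_map pi) K ->
        canonical_divisor (structure_map pi) (fun P => K (s P))].
Proof.
move=> amp [theta [ti timg tgr]]; exists (sig_pt C ti timg tgr amp); split.
- exact: sig_pt_inj.
- exact: sig_pt_surj.
- exact: sig_pt_equiv.
- exact: sig_pt_ratfun.
exact: sig_pt_canonical.
Qed.

(** * The numerical classification *)

(** The vertex conditions with h = a + b + c + 1. c divides a positive number at most 2c + 1 of a
    special form, which leaves five values in terms of a and b; then b divides one of a few small
    linear forms, whence b <= 2a + 2. For a >= 15 the condition at a becomes finitely many linear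
    equations without solution. *)
Lemma axis_bound a b c : (0 < a)%N -> (a <= b)%N -> (b <= c)%N ->
  [|| c %| a + b + 1, c %| b + 1 | c %| a + 1]%N ->
  [|| b %| a + c + 1, b %| c + 1 | b %| a + 1]%N ->
  [|| a %| b + c + 1, a %| c + 1 | a %| b + 1]%N ->
  [&& a <= 14, b <= 2 * a + 2 & c <= a + b + 1]%N.
Proof.
move=> a0 ab bc hc hb ha.
have c1 : (c <= a + b + 1)%N.
  by clear ha hb; case/or3P: hc => /dvdn_leq le; have {le} := le _; lia.
have cb : [|| c == a + b + 1, 2 * c == a + b + 1, c == 1, c == b + 1 | c == a + 1]%N.
  clear ha hb; case/or3P: hc => /dvdnP[m E].
  - case: m E => [|[|[|m]]] E; [lia|lia|lia|].
    have : (3 * c <= a + b + 1)%N by rewrite E leq_mul2r orbT.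
    lia.
  - case: m E => [|[|m]] E; [lia|lia|].
    have : (2 * c <= b + 1)%N by rewrite E leq_mul2r orbT.
    lia.
  case: m E => [|[|m]] E; [lia|lia|].
  have : (2 * c <= a + 1)%N by rewrite E leq_mul2r orbT.
  lia.
have bb : (b <= 2 * a + 2)%N.
  clear ha hc.
  have red m r n : (b %| n)%N -> (n = m * b + r)%N -> (0 < r)%N -> (b <= r)%N.
    by move=> + nE r0; rewrite nE dvdn_addr ?dvdn_mull // => /dvdn_leq; apply.
  case/or4P: cb => [/eqP cE|/eqP cE|/eqP cE|/orP[/eqP cE|/eqP cE]];
    try (by clear red hb; lia).
  - by case/or3P: hb => [/(red 1%N (2 * a + 2)%N)|/(red 1%N (a + 2)%N)|/(red 0%N (a + 1)%N)]; clear red; lia.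
  - by case/or3P: hb => [/(red 1%N (a + 2)%N)|/(red 1%N 2%N)|/(red 0%N (a + 1)%N)]; clear red; lia.
clear hc; rewrite bb c1 !andbT leqNgt; apply/negP => a15.
have bE : [|| b == 2 * a + 2, b == a, b == a + 1 | b == a + 2]%N.
  clear ha; have q n : (b %| n)%N -> (n < 3 * b)%N -> [|| n == 0, n == b | n == 2 * b]%N.
    by move=> /dvdnP[m ->]; rewrite ltn_mul2r => /andP[_]; case: m => [|[|[|]]] //; rewrite ?mul0n ?mul1n eqxx ?orbT.
  case/or4P: cb => [/eqP cE|/eqP cE|/eqP cE|/orP[/eqP cE|/eqP cE]]; try lia;
  by case/or3P: hb => /q {q}; lia.
clear hb; have qa n : (a %| n)%N -> (n < 7 * a)%N -> [|| n == 0, n == a, n == 2 * a, n == 3 * a, n == 4 * a, n == 5 * a | n == 6 * a]%N.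
  move=> /dvdnP[m ->]; rewrite ltn_mul2r => /andP[_].
  by case: m => [|[|[|[|[|[|[|]]]]]]] //; rewrite ?mul0n ?mul1n ?eqxx ?orbT.
by case/or3P: ha => /qa {qa}; case/or4P: bE => /eqP bE; case/or4P: cb => [/eqP cE|/eqP cE|/eqP cE|/orP[/eqP cE|/eqP cE]]; lia.
Qed.

(** A coefficient 1 - 1/q is recorded by q, so that the comparison with the computed orders stays
    within natural numbers. *)
Definition type_table : seq (nat * bool * seq nat * (nat * nat * nat * nat)) := [::
  (3, true,  [::], (1, 1, 1, 4)); (2, true,  [::], (1, 1, 3, 6));
  (2, true,  [:: 2], (1, 1, 2, 5)); (1, false, [:: 2; 2; 2], (1, 2, 2, 6));
  (1, false, [:: 2; 2], (1, 2, 4, 8)); (1, false, [:: 2; 3], (1, 2, 3, 7));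
  (1, false, [:: 2], (1, 4, 6, 12)); (1, false, [:: 3], (1, 3, 5, 10));
  (1, false, [:: 4], (1, 3, 4, 9)); (0, true,  [:: 2; 2; 2; 2; 2], (2, 2, 5, 10));
  (0, true,  [:: 2; 2; 2; 2; 3], (2, 2, 3, 8)); (0, true,  [:: 2; 3; 3; 3], (2, 3, 3, 9));
  (0, true,  [:: 2; 2; 3; 3], (2, 3, 6, 12)); (0, true,  [:: 2; 2; 3; 4], (2, 3, 4, 10));
  (0, true,  [:: 2; 2; 2; 5], (2, 4, 5, 12)); (0, true,  [:: 2; 2; 2; 4], (2, 4, 7, 14));
  (0, true,  [:: 2; 2; 2; 3], (2, 6, 9, 18)); (0, true,  [:: 4; 4; 4], (3, 4, 4, 12));
  (0, true,  [:: 3; 4; 5], (3, 4, 5, 13)); (0, true,  [:: 3; 4; 4], (3, 4, 8, 16));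
  (0, true,  [:: 3; 3; 6], (3, 5, 6, 15)); (0, true,  [:: 3; 3; 5], (3, 5, 9, 18));
  (0, true,  [:: 3; 3; 4], (3, 8, 12, 24)); (0, true,  [:: 2; 3; 7], (6, 14, 21, 42));
  (0, true,  [:: 2; 3; 8], (6, 8, 15, 30)); (0, true,  [:: 2; 3; 9], (6, 8, 9, 24));
  (0, true,  [:: 2; 5; 6], (4, 5, 6, 16)); (0, true,  [:: 2; 5; 5], (4, 5, 10, 20));
  (0, true,  [:: 2; 4; 5], (4, 10, 15, 30)); (0, true,  [:: 2; 4; 6], (4, 6, 11, 22));
  (0, true,  [:: 2; 4; 7], (4, 6, 7, 18))]%N.

Lemma hypersurface_listE : hypersurface_list =
  [seq (t.1.1.1, t.1.1.2, [seq (1 - d%:R^-1 : rat) | d <- t.1.2], t.2) | t <- type_table].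
Proof. by apply/eqP; vm_compute. Qed.

Section Numerics.
Local Open Scope nat_scope.

(** e says that the vertex lies on the curve. If not, f contains a power of X_i; if so, smoothness
    puts a monomial X_i^m X_j or X_i^m X_l in f. *)
Definition axis_ok (h wi wj wl : nat) (e : bool) : bool :=
  if e then (wi %| h - wj) || (wi %| h - wl) else wi %| h.

(** When gcd(wi, wj) > 1, f on this coordinate plane is X_i^ej X_j^ei times distinct binomials of
    degree lcm(wi, wj), one for each point off the vertices, and this counts them. The exponents are
    crossed because the vertex i lies on the curve when X_j divides the restriction. *)
Definition interior (h wi wj : nat) (ei ej : bool) : nat := (h - (ej * wi + ei * wj)) %/ lcmn wi wj.

Definition plane_ok (h wi wj : nat) (ei ej : bool) : bool :=
  (1 < gcdn wi wj) ==> (h == ej * wi + ei * wj + interior h wi wj ei ej * lcmn wi wj).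

Definition axis_orders (wi : nat) (e : bool) : seq nat := if e && (1 < wi) then [:: wi] else [::].

Definition plane_orders (h wi wj : nat) (ei ej : bool) : seq nat :=
  if 1 < gcdn wi wj then nseq (interior h wi wj ei ej) (gcdn wi wj) else [::].

Definition orders a b c h (ea eb ec : bool) : seq nat :=
  axis_orders a ea ++ axis_orders b eb ++ axis_orders c ec ++
  plane_orders h a b ea eb ++ plane_orders h a c ea ec ++ plane_orders h b c eb ec.

Definition type_ok a b c (ea eb ec : bool) : bool :=
  let h := (a + b + c).+1 in
  [&& gcdn a (gcdn b c) == 1, axis_ok h a b c ea, axis_ok h b a c eb, axis_ok h c a b ec,
      plane_ok h a b ea eb, plane_ok h a c ea ec & plane_ok h b c eb ec].

Lemma type_classification a b c ea eb ec : 0 < a -> a <= b -> b <= c -> type_ok a b c ea eb ec ->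
  exists g K ds, [/\ (g, K, ds, (a, b, c, (a + b + c).+1)) \in type_table,
    g = count_mem 1 [:: a; b; c],
    perm_eq ds (orders a b c (a + b + c).+1 ea eb ec) & K = (g != 1)].
Proof.
move=> a0 ab bc ok.
have [a14 b2 c2] : [/\ a <= 14, b <= 2 * a + 2 & c <= a + b + 1].
  apply/and3P; apply: axis_bound => //; move: ok; rewrite /type_ok => /and5P[_ oa ob oc _].
  - move: oc; rewrite /axis_ok; case: ec.
      have -> : (a + b + c).+1 - a = c + (b + 1) by lia.
      have -> : (a + b + c).+1 - b = c + (a + 1) by lia.
      by rewrite !(dvdn_addr _ (dvdnn _)) => /orP[] ->; rewrite ?orbT.
    have -> : (a + b + c).+1 = c + (a + b + 1) by lia.
    by rewrite (dvdn_addr _ (dvdnn _)) => ->.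
  - move: ob; rewrite /axis_ok; case: eb.
      have -> : (a + b + c).+1 - a = b + (c + 1) by lia.
      have -> : (a + b + c).+1 - c = b + (a + 1) by lia.
      by rewrite !(dvdn_addr _ (dvdnn _)) => /orP[] ->; rewrite ?orbT.
    have -> : (a + b + c).+1 = b + (a + c + 1) by lia.
    by rewrite (dvdn_addr _ (dvdnn _)) => ->.
  move: oa; rewrite /axis_ok; case: ea.
    have -> : (a + b + c).+1 - b = a + (c + 1) by lia.
    have -> : (a + b + c).+1 - c = a + (b + 1) by lia.
    by rewrite !(dvdn_addr _ (dvdnn _)) => /orP[] ->; rewrite ?orbT.
  have -> : (a + b + c).+1 = a + (b + c + 1) by lia.
  by rewrite (dvdn_addr _ (dvdnn _)) => ->.
pose good (a b c : nat) (ea eb ec : bool) := has (fun t : nat * bool * seq nat * (nat * nat * nat * nat) =>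
  [&& t.2 == (a, b, c, (a + b + c).+1), t.1.1.1 == count_mem 1 [:: a; b; c],
      perm_eq t.1.2 (orders a b c (a + b + c).+1 ea eb ec) & t.1.1.2 == (t.1.1.1 != 1)]) type_table.
suff /hasP[[[[g K] ds] t] tin /and4P[/eqP /= t2 /eqP /= gE pE /eqP KE]] : good a b c ea eb ec.
  by exists g, K, ds; rewrite -t2.
have bools x : x \in [:: true; false] by case: x.
(* The ranges are those of [axis_bound]. The vertex condition at c prunes the search before the
   flags of the vertices are enumerated. *)
have key : all (fun a => all (fun b => all (fun c =>
     if gcdn a (gcdn b c) == 1 then if axis_ok (a + b + c).+1 c a b true || axis_ok (a + b + c).+1 c a b false then
       all (fun ea => all (fun eb => all (fun ec => if type_ok a b c ea eb ec then good a b c ea eb ec else true)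
     [:: true; false]) [:: true; false]) [:: true; false] else true else true)
     (iota b (a + 2))) (iota a (a + 3))) (iota 1 14).
  by vm_compute.
move/allP: key => /(_ a); rewrite mem_iota => /(_ _)/allP/(_ b); rewrite mem_iota => h1.
have /allP/(_ c) := h1 ltac:(lia) ltac:(lia); rewrite mem_iota => h2.
have := h2 ltac:(lia); have := ok; rewrite {1}/type_ok => /and5P[-> _ _ oc _].
have -> : axis_ok (a + b + c).+1 c a b true || axis_ok (a + b + c).+1 c a b false.
  by move: oc; case: ec {ok} => ->; rewrite ?orbT.
by move=> /allP/(_ ea (bools _))/allP/(_ eb (bools _))/allP/(_ ec (bools _)); rewrite ok.
Qed.

End Numerics.

(** * The points with nontrivial stabilizer *)

Lemma perm_eq_repeated (T : eqType) (s : seq T) : ~~ uniq s ->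
  exists z s', perm_eq s [:: z, z & s'].
Proof.
elim: s => [//|y s IH] /=; rewrite negb_and negbK => /orP[ys|/IH[z [s' pz]]].
  by exists y, (rem y s); rewrite perm_cons; apply: perm_to_rem.
exists z, (y :: s'); rewrite -(perm_cons y) in pz; apply: (perm_trans pz).
by rewrite (perm_catCA [:: y] [:: z; z] s').
Qed.

(* Points live in too large a universe to form an eqType. *)
Section Lists.

Variable T : Type.
Implicit Types (s t : seq T) (x y : T).

Fixpoint lmem x s : Prop := if s is y :: s' then x = y \/ lmem x s' else False.

Fixpoint luniq s : Prop := if s is y :: s' then ~ lmem y s' /\ luniq s' else True.

Lemma lmem_cat x s t : lmem x (s ++ t) <-> lmem x s \/ lmem x t.
Proof.
elim: s => [|y s IH] /=; first by split=> [|[]] //; right.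
split=> [[->|/IH[]]|[[->|h]|h]]; try by [left; left|left; right|right|left].
  by right; apply/IH; left.
by right; apply/IH; right.
Qed.

Lemma luniq_cat s t : luniq s -> luniq t -> (forall x, lmem x s -> ~ lmem x t) ->
  luniq (s ++ t).
Proof.
elim: s => [//|y s IH] /= [ys us] ut dis; split; last by apply: IH => // x xs; apply: dis; right.
by move=> /lmem_cat[//|]; apply: dis; left.
Qed.

Lemma lcat_disjoint s t (e e' : T -> bool) :
  luniq s /\ (forall x, lmem x s <-> e x) -> luniq t /\ (forall x, lmem x t <-> e' x) ->
  (forall x, ~~ (e x && e' x)) -> luniq (s ++ t) /\ forall x, lmem x (s ++ t) <-> e x || e' x.
Proof.
move=> [us hs] [ut ht] dis; split=> [|x]; last by rewrite lmem_cat hs ht; split=> /orP.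
by apply: luniq_cat => // x /hs ex /ht ex'; have := dis x; rewrite ex ex'.
Qed.

Lemma lmem_nth x0 s x : lmem x s <-> exists2 i, (i < size s)%N & x = nth x0 s i.
Proof.
elim: s => [|y s IH] /=; first by split=> // -[].
split=> [[->|/IH[i lt ->]]|[[|i] lt E]]; [by exists 0%N|by exists i.+1|by left|].
by right; apply/IH; exists i.
Qed.

Lemma luniq_nth x0 s i j : luniq s -> (i < size s)%N -> (j < size s)%N ->
  nth x0 s i = nth x0 s j -> i = j.
Proof.
elim: s i j => [//|y s IH] [|i] [|j] //= [ys us] li lj E.
- by case: ys; apply/(lmem_nth x0); exists j.
- by case: ys; apply/(lmem_nth x0); exists i.
by congr _.+1; apply: IH E.
Qed.

Lemma lmem_map (U : eqType) (r : seq U) (F : U -> T) x :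
  lmem x (map F r) <-> exists2 u, u \in r & x = F u.
Proof.
elim: r => [|y r IH] /=; first by split=> // -[].
split=> [[->|/IH[u ur ->]]|[u]]; first by exists y; rewrite ?mem_head.
  by exists u; rewrite // inE ur orbT.
by rewrite inE => /orP[/eqP ->|ur] E; [left|right; apply/IH; exists u].
Qed.

Lemma luniq_map (U : eqType) (r : seq U) (F : U -> T) :
  uniq r -> {in r &, injective F} -> luniq (map F r).
Proof.
elim: r => [//|y r IH] /= /andP[yr ur] inj; split.
  move=> /lmem_map[u ur' E]; case/negP: yr; rewrite (inj y u) ?mem_head //.
  by rewrite inE ur' orbT.
by apply: IH => // u v hu hv; apply: inj; rewrite inE ?hu ?hv orbT.
Qed.

End Lists.

Section SpecialPoints.

Variables (k : closedFieldType) (a b c : nat) (R : idomainType).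
Variables (pi : {rmorphism {mpoly k[3]} -> R}) (h : nat) (f : {mpoly k[3]}).
Variable C : curve a b c pi h f.
Hypothesis hK : h = (a + b + c).+1.
Hypothesis w_coprime : forall d, (forall i, d %| wt a b c i)%N -> d = 1%N.

Let H := cvH C.
Local Notation w := (wt a b c).
Local Notation hom n p := (p \is n.-homog for (wdeg a b c)).
Local Notation gr := (piece a b c pi).
Local Notation cst := (structure_map pi).
Local Notation "x %:F" := (@FracField.tofrac R x).
Local Notation lq P := (lq (cvloc C P)).

Definition axis (i t : 'I_3) : k := (t == i)%:R.

Definition on_axis i : bool := f.@[axis i] == 0.

Lemma axis_neq0 i : exists t, axis i t != 0.
Proof. by exists i; rewrite /axis eqxx oner_neq0. Qed.

Lemma axis1 i : axis i i = 1.
Proof. by rewrite /axis eqxx. Qed.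

Lemma axisE i t : t != i -> axis i t = 0.
Proof. by rewrite /axis => /negbTE ->. Qed.

Lemma lq_dvd (P : point gr) (p0 : 'I_3 -> k) t : kpoint P p0 -> p0 t != 0 -> (lq P %| w t)%N.
Proof.
move=> hP pt; apply: (l_dvd (cvloc C P) (gr_X a b c pi t)).
by rewrite (kpoint_hom hP (homX k a b c t)) mevalXU.
Qed.

Lemma dvd_lq (P : point gr) (p0 : 'I_3 -> k) d : kpoint P p0 ->
  (forall t, p0 t != 0 -> (d %| w t)%N) -> (d %| lq P)%N.
Proof.
move=> hP hd; have dm (m : 'X_{1..3}) : pi 'X_[m] \notin P -> (d %| wdeg a b c m)%N.
  have hm : hom (wdeg a b c m) ('X_[m] : {mpoly k[3]}) by rewrite dhomogX.
  by rewrite (kpoint_hom hP hm) => /(hom_dvd hd hm).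
have := dm _ (lU1 (cvloc C P)); rewrite lU_deg.
by rewrite dvdn_addr // (dm _ (lU2 (cvloc C P))).
Qed.

(** On the axis only the power X_i^(n / w_i) survives, and its derivative is n / w_i times its value
    there. The quotient is taken in the integers, so w_i may vanish in k. *)
Lemma axis_deriv i n p : hom n p -> p.@[axis i] = 0 -> p^`M(i).@[axis i] = 0.
Proof.
move=> hp p0; have -> : p^`M(i) = \sum_(m <- msupp p) p@_m *: ('X_[m])^`M(i).
  by rewrite {1}(mpolyE p) raddf_sum; apply: eq_bigr => m _; rewrite /= mderivZ.
rewrite rmorph_sum /= big_seq.
transitivity (\sum_(m <- msupp p) (n %/ w i)%:R * (p@_m * ('X_[m] : {mpoly k[3]}).@[axis i])); last first.
  rewrite -mulr_sumr; suff -> : \sum_(m <- msupp p) p@_m * 'X_[m].@[axis i] = p.@[axis i] by rewrite p0 mulr0.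
  by rewrite mevalE; apply: eq_bigr => m _; rewrite mevalX.
rewrite [RHS]big_seq; apply: eq_bigr => m mp.
rewrite mevalZ mulrCA; congr (_ * _).
have := dmonomial (axis i) m i; rewrite /gradat {1}/axis eqxx mul1r => ->.
have [e|ne] := eqVneq ('X_[m] : {mpoly k[3]}).@[axis i] 0; first by rewrite e !mulr0.
congr (_%:R * _); have wi := wt_gt0 H i.
rewrite -(hom_wdeg hp mp) wdegE (bigD1 i) //= big1 ?addn0 ?mulnK // => t ti.
by move/meval_monomial_neq0: ne => /(_ t (axisE ti)) ->.
Qed.

Lemma wt_lt_h i : (w i < h)%N.
Proof.
have := wt_gt0 H 0; have := wt_gt0 H 1; have := wt_gt0 H 2%:R; rewrite hK.
by elim/ord3_ind: i; rewrite /wt /=; lia.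
Qed.

Lemma axis_condition i j l : j != i -> l != i -> j != l ->
  axis_ok h (w i) (w j) (w l) (on_axis i).
Proof.
move=> ji li jl; have dv n p : hom n p -> p.@[axis i] != 0 -> (w i %| n)%N.
  by apply: hom_dvd => t; have [-> //|/axisE ->] := eqVneq t i; rewrite eqxx.
rewrite /axis_ok; case: ifP => [/eqP f0|/negbT f0]; last exact: dv (f_hom H) f0.
have [t ft] := cv_smooth C (axis_neq0 i) f0.
have := dv _ _ (hom_deriv t (f_hom H)) ft; case: (ord3_cases ji li jl t) => tE.
- by move: ft; rewrite tE (axis_deriv (f_hom H) f0) eqxx.
- by rewrite tE => ->.
by rewrite tE => ->; rewrite orbT.
Qed.

Lemma f_not_mulX i E n : hom n E -> f <> 'X_i * E.
Proof.
move=> hE fE; have : pi 'X_i * pi E = 0 by rewrite -rmorphM -fE; exact: pi_f C.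
move/eqP; rewrite mulf_eq0 => /orP[] /eqP e0.
  by have /eqP := pi_small H (homX k a b c i) (wt_lt_h i) e0; rewrite (negbTE (mpolyX_neq0 _ _)).
have fn := f_neq0 H; move: e0 => /(pi_ker H)[q qE].
have X1 : 'X_i * q = 1.
  by apply: (mulIf fn); rewrite mul1r {2}fE qE mulrA.
have := congr1 (meval (fun _ => 0 : k)) X1.
by rewrite mevalM mevalXU mul0r meval1 => /eqP; rewrite eq_sym oner_eq0.
Qed.

Section Plane.

Variables (i j l : 'I_3).
Hypotheses (ji : j != i) (li : l != i) (jl : j != l).

Local Notation g := (gcdn (w j) (w l)).
Local Notation bin z := ('X_j ^+ (w l %/ g) - z *: 'X_l ^+ (w j %/ g)).

Let g0 : (0 < g)%N. Proof. by rewrite gcdn_gt0 (wt_gt0 H j). Qed.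
Let b0 : (0 < w l %/ g)%N. Proof. by rewrite divn_gt0 // dvdn_leq ?(wt_gt0 H) // dvdn_gcdr. Qed.
Let a0 : (0 < w j %/ g)%N. Proof. by rewrite divn_gt0 // dvdn_leq ?(wt_gt0 H) // dvdn_gcdl. Qed.

(** By [plane_split], vanishing depends only on whether z is a root of the restriction of p; the
    invariant z therefore determines the point. *)
Lemma plane_eval n p (p0 : 'I_3 -> k) z : hom n p ->
  p0 i = 0 -> p0 j != 0 -> p0 l != 0 -> p0 j ^+ (w l %/ g) = z * p0 l ^+ (w j %/ g) ->
  forall p1, p1 i = 0 -> p1 j != 0 -> p1 l != 0 -> p1 j ^+ (w l %/ g) = z * p1 l ^+ (w j %/ g) ->
  (p.@[p0] == 0) = (p.@[p1] == 0).
Proof.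
move=> hp.
have [[E hE ->]|[u [r [s [zs [E [u0 z0 hE _ ->]]]]]]] := plane_split (wt_gt0 H) ji li jl hp.
  by move=> pi0 _ _ _ p1 qi0 _ _ _; rewrite !mevalM !mevalXU pi0 qi0 !mul0r.
have ev (q : 'I_3 -> k) : q i = 0 -> q j != 0 -> q l != 0 -> q j ^+ (w l %/ g) = z * q l ^+ (w j %/ g) ->
    ((u *: ('X_j ^+ r * 'X_l ^+ s * \prod_(z <- zs) bin z) + 'X_i * E).@[q] == 0) = (z \in zs).
  move=> qi qj ql qz; rewrite mevalD mevalZ !mevalM mevalXU qi mul0r addr0.
  rewrite !rmorphXn /= !mevalXU !mulf_eq0 (negbTE u0) !expf_eq0 (negbTE qj) (negbTE ql) !andbF /=.
  rewrite rmorph_prod prodf_seq_eq0; apply/hasP/idP => [[y ys /=]|zzs].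
    rewrite mevalB mevalZ !rmorphXn /= !mevalXU qz -mulrBl mulf_eq0 expf_eq0 (negbTE ql) andbF orbF.
    by rewrite subr_eq0 => /eqP ->.
  exists z => //=; rewrite mevalB mevalZ !rmorphXn /= !mevalXU qz subrr.
  by [].
by move=> h1 h2 h3 h4 p1 h5 h6 h7 h8; rewrite !ev.
Qed.

Lemma plane_point_eq (P Q : point gr) p0 p1 z : kpoint P p0 -> kpoint Q p1 ->
  p0 i = 0 -> p0 j != 0 -> p0 l != 0 -> p0 j ^+ (w l %/ g) = z * p0 l ^+ (w j %/ g) ->
  p1 i = 0 -> p1 j != 0 -> p1 l != 0 -> p1 j ^+ (w l %/ g) = z * p1 l ^+ (w j %/ g) -> P = Q.
Proof.
move=> hP hQ pi0 pj pl pz qi qj ql qz.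
have E n x : gr n x -> (x \in P) = (x \in Q).
  by move=> [p hp <-]; rewrite (kpoint_hom hP hp) (kpoint_hom hQ hp); apply: plane_eval hp _ _ _ pz _ _ _ _ qz.
apply: point_eq => x; apply/idP/idP => hx; apply: (point_coefP (H := H)) => n;
  have := point_coef H n hx; by rewrite (E n) //; apply: gr_coef.
Qed.

Hypothesis g1 : (1 < g)%N.

(** g divides h but, by coprimality of the weights, not w_i. So the derivative of f along X_i, of
    degree h - w_i, vanishes at the points of the plane, and smoothness must come from the
    restriction of f: it has no square factor, which bounds the exponents by 1 and makes the roots
    distinct. *)
Lemma plane_f : exists (u : k) (zs : seq k) (E : {mpoly k[3]}),
  [/\ u != 0, 0 \notin zs, uniq zs,
    h = (on_axis l * w j + on_axis j * w l + size zs * lcmn (w j) (w l))%N &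
    f = u *: ('X_j ^+ on_axis l * 'X_l ^+ on_axis j * \prod_(z <- zs) bin z) + 'X_i * E].
Proof.
have := plane_split (wt_gt0 H) ji li jl (f_hom H) => /=.
case=> [[E hE /(f_not_mulX hE)]//|[u [r [s [zs [E [u0 z0 hE hd fE]]]]]]].
have lcmE : (w j * (w l %/ g) = lcmn (w j) (w l))%N by rewrite /lcmn muln_divA // dvdn_gcdr.
have gh : (g %| h)%N.
  rewrite -hd; apply: dvdn_add.
    by apply: dvdn_add; apply: dvdn_mull; rewrite ?dvdn_gcdl ?dvdn_gcdr.
  by apply: dvdn_mull; apply: dvdn_mulr; apply: dvdn_gcdl.
have gi : ~~ (g %| w i)%N.
  apply/negP => gi; have g1' := @w_coprime g.
  suff /g1' : forall t, (g %| w t)%N by move=> e; move: g1; rewrite e.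
  by move=> t; case: (ord3_cases ji li jl t) => ->; rewrite ?gi ?dvdn_gcdl ?dvdn_gcdr.
have dvdX (p0 : 'I_3 -> k) : p0 i = 0 -> forall t, p0 t != 0 -> (g %| w t)%N.
  move=> pi0 t; case: (ord3_cases ji li jl t) => ->; rewrite ?dvdn_gcdl ?dvdn_gcdr //.
  by rewrite pi0 eqxx.
have di (p0 : 'I_3 -> k) : p0 i = 0 -> f^`M(i).@[p0] = 0.
  move=> pi0; apply/eqP/negPn/negP => ne.
  have := hom_dvd (dvdX p0 pi0) (hom_deriv i (f_hom H)) ne.
  by rewrite dvdn_subr ?(negbTE gi) // ltnW // wt_lt_h.
have XiE (p0 : 'I_3 -> k) t : p0 i = 0 -> t != i -> ('X_i * E)^`M(t).@[p0] = 0.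
  move=> pi0 ti; rewrite mderivM mevalD !mevalM mevalXU pi0 mul0r addr0.
  rewrite mderivX mnm1E eq_sym (negbTE ti) mevalZ mul0r mul0r.
  by [].
(* the square of a polynomial vanishing at p0 cannot divide f on the plane *)
have nosq (p0 : 'I_3 -> k) G A : p0 i = 0 -> (exists t, p0 t != 0) -> G.@[p0] = 0 ->
    f = G ^+ 2 * A + 'X_i * E -> False.
  move=> pi0 pn G0 fE'; have f0 : f.@[p0] = 0.
    by rewrite fE' expr2 mevalD !mevalM G0 mevalXU pi0 !mul0r addr0.
  have [t] := cv_smooth C pn f0; have [->|ti] := eqVneq t i; first by rewrite di // eqxx.
  rewrite fE' mderivD mevalD (XiE _ _ pi0 ti) addr0 mderivM expr2 mderivM.
  by rewrite !(mevalD, mevalM) G0 !(mul0r, mulr0, addr0) eqxx.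
have axis_i t : t != i -> axis t i = 0 by move=> ti; rewrite axisE // eq_sym.
have s1 : (s <= 1)%N.
  case: (s) fE => [|[|s']] // fE; exfalso.
  apply: (nosq (axis j) 'X_l (u *: ('X_j ^+ r * 'X_l ^+ s' * \prod_(z <- zs) bin z))).
  - exact: axis_i.
  - exact: axis_neq0.
  - by rewrite mevalXU axisE // eq_sym.
  rewrite fE; congr (_ + _); rewrite -scalerAr; congr (_ *: _).
  by rewrite -[s'.+2]addn2 exprD; ring.
have r1 : (r <= 1)%N.
  case: (r) fE => [|[|r']] // fE; exfalso.
  apply: (nosq (axis l) 'X_j (u *: ('X_j ^+ r' * 'X_l ^+ s * \prod_(z <- zs) bin z))).
  - exact: axis_i.
  - exact: axis_neq0.
  - by rewrite mevalXU axisE.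
  rewrite fE; congr (_ + _); rewrite -scalerAr; congr (_ *: _).
  by rewrite -[r'.+2]addn2 exprD; ring.
have ajl : axis j l = 0 by rewrite axisE // eq_sym.
have alj : axis l j = 0 by rewrite axisE.
have sE : s = on_axis j :> nat.
  rewrite /on_axis fE mevalD mevalZ !mevalM mevalXU axis_i // mul0r addr0.
  rewrite !rmorphXn /= !mevalXU ajl axis1 expr1n mul1r.
  rewrite rmorph_prod (_ : \prod_(z <- zs) _ = 1).
    by rewrite mulr1 mulf_eq0 (negbTE u0) /=; case: (s) s1 => [|[|]] // _; rewrite ?expr0 ?expr1 ?oner_eq0 ?eqxx.
  apply: big1_seq => z _ /=; rewrite mevalB mevalZ !rmorphXn /= !mevalXU ajl.
  by rewrite axis1 expr1n expr0n (gtn_eqF a0) mulr0 subr0.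
have rE : r = on_axis l :> nat.
  rewrite /on_axis fE mevalD mevalZ !mevalM mevalXU axis_i // mul0r addr0.
  rewrite !rmorphXn /= !mevalXU alj axis1 expr1n mulr1.
  rewrite rmorph_prod /= mulf_eq0 (negbTE u0) /= mulf_eq0.
  have -> : (\prod_(z <- zs) (meval (axis l)) (bin z) == 0) = false.
    apply/negbTE; rewrite prodf_seq_neq0; apply/allP => z zzs /=.
    rewrite mevalB mevalZ !rmorphXn /= !mevalXU alj axis1 expr1n mulr1.
    by rewrite expr0n (gtn_eqF b0) sub0r oppr_eq0; apply: contraNneq z0 => <-.
  by rewrite orbF; case: (r) r1 => [|[|]] // _; rewrite ?expr0 ?expr1 ?oner_eq0 ?eqxx.
exists u, zs, E; split=> //; last by rewrite -sE -rE.
  apply/negPn/negP => nu.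
  have [z [zs' pz]] := perm_eq_repeated nu.
  have [t tE] := closed_root z b0.
  have z0' : z != 0.
    by apply: contraNneq z0 => <-; rewrite (perm_mem pz) mem_head.
  pose p0 (v : 'I_3) : k := if v == j then t else if v == l then 1 else 0.
  have p0j : p0 j = t by rewrite /p0 eqxx.
  have p0l : p0 l = 1 by rewrite /p0 [l == j]eq_sym (negbTE jl) eqxx.
  have p0i : p0 i = 0 by rewrite /p0 ![i == _]eq_sym (negbTE ji) (negbTE li).
  apply: (nosq p0 (bin z) (u *: ('X_j ^+ r * 'X_l ^+ s * \prod_(z <- zs') bin z)) p0i).
  - by exists l; rewrite p0l oner_neq0.
  - by rewrite mevalB mevalZ !rmorphXn /= !mevalXU p0j p0l expr1n mulr1 tE subrr.
  rewrite fE (perm_big _ pz) !big_cons /=; congr (_ + _); rewrite -scalerAr; congr (_ *: _).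
  by rewrite expr2; ring.
by rewrite -sE -rE -lcmE hd.
Qed.

End Plane.

Lemma axis_kpoint (P : point gr) i j l : j != i -> l != i -> j != l ->
  pi 'X_j \in P -> pi 'X_l \in P -> kpoint P (axis i).
Proof.
move=> ji li jl jP lP; have [i' [p0 [hP pi1]]] := kpoint_normalize H P.
have z t : pi 'X_t \in P -> p0 t = 0.
  by rewrite (kpoint_hom hP (homX k a b c t)) mevalXU => /eqP.
have i'E : i' = i.
  case: (ord3_cases ji li jl i') => // e; move: pi1; rewrite e z // => /eqP;
  by rewrite eq_sym oner_eq0.
suff -> : axis i = p0 by [].
apply/funext => t; case: (ord3_cases ji li jl t) => ->.
- by rewrite axis1 -pi1 i'E.
- by rewrite axisE // z.
by rewrite axisE // z.
Qed.

Definition pattern (P : point gr) : bool * bool * bool :=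
  (pi 'X_0 \in P, pi 'X_1 \in P, pi 'X_2%:R \in P).

Local Notation pts := (seq (point gr)).

Lemma axis_points i j l : j != i -> l != i -> j != l -> exists s : pts,
  [/\ luniq s, [seq lq P | P <- s] = axis_orders (w i) (on_axis i) &
   forall P : point gr, lmem P s <-> [&& pi 'X_i \notin P, pi 'X_j \in P, pi 'X_l \in P & (1 < lq P)%N]].
Proof.
move=> ji li jl; have qE (P : point gr) : kpoint P (axis i) -> lq P = w i.
  move=> hP; apply/eqP; rewrite eqn_dvd (lq_dvd hP) ?axis1 ?oner_neq0 //=.
  by apply: (dvd_lq hP) => t; have [->|/axisE ->] := eqVneq t i; rewrite ?dvdnn ?eqxx.
have mem (P : point gr) t : kpoint P (axis i) -> (pi 'X_t \in P) = (t != i).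
  move=> hP; rewrite (kpoint_hom hP (homX k a b c t)) mevalXU.
  by have [->|/axisE ->] := eqVneq t i; rewrite ?axis1 ?oner_eq0 ?eqxx.
have [/andP[/eqP f0 w1]|no] := boolP (on_axis i && (1 < w i)%N).
  have [P0 hP0] := point_of_kpoint H (axis_neq0 i) f0.
  exists [:: P0]; split=> [|/=|P]; first by split.
    by rewrite /axis_orders /on_axis f0 eqxx w1 qE.
  split=> [[->|//]|/and4P[_ jP lP _]].
    by rewrite !mem // eqxx ji li qE.
  by left; apply: (kpoint_uniq H (axis_kpoint ji li jl jP lP) hP0).
exists [::]; split=> [//||P]; first by rewrite /axis_orders (negbTE no).
split=> // /and4P[_ jP lP q1]; case/negP: no.
have hP := axis_kpoint ji li jl jP lP.
by rewrite /on_axis (kpoint_f H hP) eqxx -(qE _ hP).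
Qed.

Lemma plane_points i j l : j != i -> l != i -> j != l -> exists s : pts,
  [/\ luniq s, [seq lq P | P <- s] = plane_orders h (w j) (w l) (on_axis j) (on_axis l),
   forall P : point gr, lmem P s <-> [&& pi 'X_i \in P, pi 'X_j \notin P, pi 'X_l \notin P & (1 < lq P)%N] &
   plane_ok h (w j) (w l) (on_axis j) (on_axis l)].
Proof.
move=> ji li jl; set g := gcdn (w j) (w l).
have kz (P : point gr) p0 t : kpoint P p0 -> (pi 'X_t \in P) = (p0 t == 0).
  by move=> hP; rewrite (kpoint_hom hP (homX k a b c t)) mevalXU.
have qE (P : point gr) p0 : kpoint P p0 -> p0 i = 0 -> p0 j != 0 -> p0 l != 0 -> lq P = g.
  move=> hP pi0 pj pl; apply/eqP; rewrite eqn_dvd dvdn_gcd !(lq_dvd hP) //=.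
  apply: (dvd_lq hP) => t; case: (ord3_cases ji li jl t) => ->; rewrite ?dvdn_gcdl ?dvdn_gcdr //.
  by rewrite pi0 eqxx.
have [g1|g1] := ltnP 1 g; last first.
  exists [::]; split=> [//||P|]; rewrite ?/plane_orders ?/plane_ok -/g ?(ltnNge 1 g) ?g1 //.
  split=> // /and4P[iP jP lP q1].
  have [p0 hP] := kpoint_ex H P; move: iP jP lP; rewrite !(kz _ _ _ hP) => /eqP pi0 pj pl.
  by move: q1; rewrite (qE _ _ hP) // ltnNge g1.
have [u [zs [E [u0 z0 uz hE fE]]]] := plane_f ji li jl g1.
have lcm0 : (0 < lcmn (w j) (w l))%N by rewrite lcmn_gt0 !(wt_gt0 H).
have intE : interior h (w j) (w l) (on_axis j) (on_axis l) = size zs.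
  by rewrite /interior {1}hE addKn mulnK.
have b0 : (0 < w l %/ g)%N by rewrite divn_gt0 ?gcdn_gt0 ?(wt_gt0 H) // dvdn_leq ?(wt_gt0 H) // dvdn_gcdr.
have ptz z : exists P : (point gr), z \in zs -> exists p0, [/\ kpoint P p0, p0 i = 0,
    p0 j != 0, p0 l = 1 & p0 j ^+ (w l %/ g) = z].
  have [P1 _] := plane_point H 0.
  have [zzs|_] := boolP (z \in zs); last by exists P1.
  have [t tE] := closed_root z b0.
  have zn : z != 0 by apply: contraNneq z0 => <-.
  have t0 : t != 0 by apply: contraNneq zn => t0; rewrite -tE t0 expr0n (gtn_eqF b0).
  pose p0 (v : 'I_3) : k := if v == j then t else if v == l then 1 else 0.
  have p0j : p0 j = t by rewrite /p0 eqxx.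
  have p0l : p0 l = 1 by rewrite /p0 [l == j]eq_sym (negbTE jl) eqxx.
  have p0i : p0 i = 0 by rewrite /p0 ![i == _]eq_sym (negbTE ji) (negbTE li).
  have pn : exists v, p0 v != 0 by exists l; rewrite p0l oner_neq0.
  have f0 : f.@[p0] = 0.
    rewrite fE mevalD mevalZ !mevalM mevalXU p0i mul0r addr0 (big_rem z) //= !mevalM.
    rewrite mevalB mevalZ !rmorphXn /= !mevalXU p0j p0l !expr1n !mulr1 tE subrr mul0r.
    by rewrite !mulr0.
  by have [P hP] := point_of_kpoint H pn f0; exists P => _; exists p0; rewrite p0j p0l.
pose pt z := projT1 (cid (ptz z)).
have hpt z : z \in zs -> exists p0, [/\ kpoint (pt z) p0, p0 i = 0,
    p0 j != 0, p0 l = 1 & p0 j ^+ (w l %/ g) = z] by rewrite /pt; case: cid.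
exists (map pt zs); split.
- apply: luniq_map => // z z' zzs zzs' E1.
  have [p0 [hP pi0 pj pl pz]] := hpt z zzs; have [p1 [hP' qi0 qj ql qz]] := hpt z' zzs'.
  rewrite E1 in hP; pose B : {mpoly k[3]} := 'X_[U_(j) *+ (w l %/ g)] - z *: 'X_[U_(l) *+ (w j %/ g)].
  have hB : hom (w j * (w l %/ g))%N B.
    apply: rpredB; [|apply: rpredZ]; rewrite dhomogX -?[_ == _]/(wdeg a b c _ == _) wdegMn wdegU 1?mulnC //.
    exact/eqP/esym/muln_divCA_gcd.
  have ev (q : 'I_3 -> k) : q l = 1 -> B.@[q] = q j ^+ (w l %/ g) - z.
    by move=> q1; rewrite /B -!mpolyXn mevalB mevalZ !rmorphXn /= !mevalXU q1 expr1n mulr1.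
  have := kpoint_hom hP hB; rewrite (kpoint_hom hP' hB) !ev // pz qz subrr eqxx subr_eq0.
  by move/eqP.
- rewrite /plane_orders -/g g1 intE -map_comp.
  rewrite (eq_in_map _ (fun=> g) zs).1 => [|z zzs /=].
    by elim: (zs) => //= ? ? ->.
  by have [p0 [hP pi0 pj pl _]] := hpt z zzs; apply: (qE _ _ hP) => //; rewrite pl oner_neq0.
- move=> P; split=> [/lmem_map[z zzs ->]|/and4P[iP jP lP q1]].
    have [p0 [hP pi0 pj pl _]] := hpt z zzs.
    by rewrite !(kz _ _ _ hP) pi0 pl eqxx oner_eq0 pj (qE _ _ hP) // pl oner_neq0.
  have [p0 hP] := kpoint_ex H P; move: iP jP lP; rewrite !(kz _ _ _ hP) => /eqP pi0 pj pl.
  have := kpoint_f H hP; rewrite fE mevalD mevalZ !mevalM mevalXU pi0 mul0r addr0.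
  rewrite !rmorphXn /= !mevalXU => /eqP; rewrite !mulf_eq0 (negbTE u0) !expf_eq0 (negbTE pj) (negbTE pl) !andbF /=.
  rewrite rmorph_prod prodf_seq_eq0 => /hasP[z zzs /=].
  rewrite mevalB mevalZ !rmorphXn /= !mevalXU subr_eq0 => /eqP pz.
  apply/lmem_map; exists z => //; have [p1 [hP1 qi qj ql qz]] := hpt z zzs.
  apply: (plane_point_eq ji li jl hP hP1 pi0 pj pl pz qi qj); first by rewrite ql oner_neq0.
  by rewrite ql expr1n mulr1.
by rewrite /plane_ok -/g g1 /= intE {1}hE.
Qed.

Lemma special_points : exists s : pts,
  [/\ luniq s, [seq lq P | P <- s] = orders a b c h (on_axis 0) (on_axis 1) (on_axis 2%:R),
   forall P : point gr, lmem P s <-> (1 < lq P)%N &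
   type_ok a b c (on_axis 0) (on_axis 1) (on_axis 2%:R)].
Proof.
have [s0 [u0 m0 h0]] := @axis_points 0 1 2%:R isT isT isT.
have [s1 [u1 m1 h1]] := @axis_points 1 0 2%:R isT isT isT.
have [s2 [u2 m2 h2]] := @axis_points 2%:R 0 1 isT isT isT.
have [t2 [v2 n2 g2 o2]] := @plane_points 2%:R 0 1 isT isT isT.
have [t1 [v1 n1 g1 o1]] := @plane_points 1 0 2%:R isT isT isT.
have [t0 [v0 n0 g0 o0]] := @plane_points 0 1 2%:R isT isT isT.
have c1 := lcat_disjoint (conj v1 g1) (conj v0 g0) (fun P => ltac:(cbv beta; by
  move: (pi 'X_0 \in P) (pi 'X_1 \in P) (pi 'X_2%:R \in P) (1 < lq P)%N => [] [] [] [])).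
have c2 := lcat_disjoint (conj v2 g2) c1 (fun P => ltac:(cbv beta; by
  move: (pi 'X_0 \in P) (pi 'X_1 \in P) (pi 'X_2%:R \in P) (1 < lq P)%N => [] [] [] [])).
have c3 := lcat_disjoint (conj u2 h2) c2 (fun P => ltac:(cbv beta; by
  move: (pi 'X_0 \in P) (pi 'X_1 \in P) (pi 'X_2%:R \in P) (1 < lq P)%N => [] [] [] [])).
have c4 := lcat_disjoint (conj u1 h1) c3 (fun P => ltac:(cbv beta; by
  move: (pi 'X_0 \in P) (pi 'X_1 \in P) (pi 'X_2%:R \in P) (1 < lq P)%N => [] [] [] [])).
have [c5 c6] := lcat_disjoint (conj u0 h0) c4 (fun P => ltac:(cbv beta; by
  move: (pi 'X_0 \in P) (pi 'X_1 \in P) (pi 'X_2%:R \in P) (1 < lq P)%N => [] [] [] [])).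
exists (s0 ++ s1 ++ s2 ++ t2 ++ t1 ++ t0); split.
- exact: c5.
- by rewrite !map_cat m0 m1 m2 n2 n1 n0.
- move=> P; rewrite c6.
  have [i iP] := point_var P; have [p0 hP] := kpoint_ex H P.
  have nall : ~~ [&& pi 'X_0 \in P, pi 'X_1 \in P & pi 'X_2%:R \in P].
    by apply: contra iP => /and3P[P0 P1 P2]; elim/ord3_ind: i.
  have none : [&& pi 'X_0 \notin P, pi 'X_1 \notin P & pi 'X_2%:R \notin P] -> lq P = 1%N.
    move=> /and3P[P0 P1 P2]; apply: w_coprime => t; apply: (lq_dvd hP).
    by rewrite -mevalXU -(kpoint_hom hP (homX k a b c t)); elim/ord3_ind: t.
  move: nall none.
  by case: (pi 'X_0 \in P); case: (pi 'X_1 \in P); case: (pi 'X_2%:R \in P) => //= _;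
    rewrite ?orbF //; move=> ->.
rewrite /type_ok -hK; apply/and5P; split.
- apply/eqP; apply: w_coprime => t; have d := dvdn_gcdl a (gcdn b c).
  elim/ord3_ind: t => //; rewrite /wt /=.
    exact: dvdn_trans (dvdn_gcdr _ _) (dvdn_gcdl _ _).
  exact: dvdn_trans (dvdn_gcdr _ _) (dvdn_gcdr _ _).
- exact: (@axis_condition 0 1 2%:R).
- exact: (@axis_condition 1 0 2%:R).
- exact: (@axis_condition 2%:R 0 1).
by apply/and3P.
Qed.

End SpecialPoints.

Lemma ker_prime (A : comNzRingType) (B : idomainType) (t : {rmorphism A -> B}) :
  prime_ideal (fun x => t x == 0).
Proof.
split; first split=> [||r x y]; rewrite /in_mem /=.
- by rewrite rmorph0.
- by rewrite rmorph1 oner_eq0.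
- by move=> /eqP x0 /eqP y0; rewrite rmorphD rmorphM x0 y0 mulr0 addr0.
by move=> x y; rewrite /in_mem /= rmorphM mulf_eq0.
Qed.

(** Excludes f = 0: the chain of coordinate ideals, realized as kernels of successive substitutions
    X_i = 0, is too long for dimension 2. *)
Lemma poly_ring_chain (k : fieldType) (R : idomainType) (pi : {rmorphism {mpoly k[3]} -> R}) :
  (forall x, exists p, pi p = x) -> (forall p, pi p = 0 -> p = 0) -> prime_chain R 3.
Proof.
move=> sj inj; have [g gE] := rmorphism_factor (Phi := idfun) sj inj.
have [r0 [r00 r0X _]] := zero_var k 0; have [r1 [r11 r1X _]] := zero_var k 1.
have [r2 [r22 r2X _]] := zero_var k 2%:R.
pose I (n : nat) : {pred R} := fun x => nth (g x == 0) [:: g x == 0; r0 (g x) == 0; r1 (r0 (g x)) == 0; r2 (r1 (r0 (g x))) == 0] n.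
exists I; split=> [[|[|[|[|]]]] //= _|[|[|[|]]] //= _].
- exact: ker_prime g.
- exact: (ker_prime (r0 \o g)).
- exact: (ker_prime (r1 \o (r0 \o g))).
- exact: (ker_prime (r2 \o (r1 \o (r0 \o g)))).
- split=> [x|]; rewrite /I /in_mem /=; first by move=> /eqP e; rewrite e rmorph0.
  exists (pi 'X_0); rewrite gE /= r00 eqxx; split=> //; exact: mpolyX_neq0.
- split=> [x|]; rewrite /I /in_mem /=; first by move=> /eqP e; rewrite e rmorph0.
  exists (pi 'X_1); rewrite gE /= r0X // r11 eqxx; split=> //; exact: mpolyX_neq0.
split=> [x|]; rewrite /I /in_mem /=; first by move=> /eqP e; rewrite e rmorph0.
exists (pi 'X_2%:R); rewrite gE /= r0X // r1X // r22 eqxx; split=> //; exact: mpolyX_neq0.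
Qed.

Section CurveExistence.

Variables (k : closedFieldType) (a b c : nat) (R : idomainType).
Variables (pi : {rmorphism {mpoly k[3]} -> R}) (h : nat).

Local Notation gr := (piece a b c pi).

Lemma curve_ex f : hsurf a b c pi h f -> smooth f ->
  (exists n0, forall n, (n0 <= n)%N -> exists x, gr n x /\ x != 0) ->
  inhabited (curve a b c pi h f).
Proof.
move=> H sm [n0 hn]; have [x [gx x0]] := hn n0.+1 (leqnSn _); have [y [gy y0]] := hn n0 (leqnn _).
have [B hB] := locpar_bounded H sm.
pose loc P := projT1 (cid (hB P)).
split; apply: (@Curve _ _ _ _ _ _ _ _ H sm (FracField.tofrac x / FracField.tofrac y) _ _ loc B).
- exists n0.+1, n0, x, y; split=> //; lia.
- by rewrite mulf_neq0 ?invr_eq0 ?tofrac_eq0.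
by move=> P; rewrite /loc; case: cid.
Qed.

Lemma wt_coprime d : (exists n0, forall n, (n0 <= n)%N -> exists x, gr n x /\ x != 0) ->
  (forall i, d %| wt a b c i)%N -> d = 1%N.
Proof.
move=> [n0 hn] hd; have dv n : (n0 <= n)%N -> (d %| n)%N.
  move=> /hn[x [[p hp <-] x0]]; have [m mp] : exists m, m \in msupp p.
    case E : (msupp p) => [|m s]; last by exists m; rewrite mem_head.
    by move/eqP: E; rewrite msupp_eq0 => /eqP p0; rewrite p0 rmorph0 eqxx in x0.
  by rewrite -(hom_wdeg hp mp) wdegE; apply: dvdn_sum => i _; rewrite dvdn_mull.
have := dv n0.+1 (leqnSn _); rewrite -addn1 dvdn_addr ?dvdn1; first by move/eqP.
exact: dv (leqnn _).
Qed.

Lemma normal_graded_curve : normal_graded_hypersurface a b c pi h -> exists f,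
  inhabited (curve a b c pi h f) /\ forall d, (forall i, d %| wt a b c i)%N -> d = 1%N.
Proof.
move=> [[a0 b0 c0] sj [f hf kf] [[_ kd] nR] hn].
have f0 : f != 0.
  apply/eqP => f0; apply: kd; apply: (poly_ring_chain sj) => p /kf[q ->].
  by rewrite f0 mulr0.
have H : hsurf a b c pi h f.
  by split=> // i; elim/ord3_ind: i.
exists f; split; last by move=> d; apply: wt_coprime.
by apply: curve_ex => //; apply: (normal_smooth H).
Qed.

End CurveExistence.

Lemma mnm_subnn n (m : 'X_{1..n}) : (m - m = 0)%MM.
Proof. by apply/mnmP => i; rewrite mnmBE subnn mnm0E. Qed.

(** * The canonical class in genus one *)

Section GenusOne.

Variables (k : closedFieldType) (a b c : nat) (R : idomainType).
Variables (pi : {rmorphism {mpoly k[3]} -> R}) (h : nat) (f : {mpoly k[3]}).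
Variable C : curve a b c pi h f.
Hypothesis hK : h = (a + b + c).+1.
Hypothesis w_coprime : forall d, (forall i, d %| wt a b c i)%N -> d = 1%N.

Let H := cvH C.
Local Notation w := (wt a b c).
Local Notation hom n p := (p \is n.-homog for (wdeg a b c)).
Local Notation gr := (piece a b c pi).
Local Notation cst := (structure_map pi).
Local Notation "x %:F" := (@FracField.tofrac R x).
Local Notation lq P := (lq (cvloc C P)).

Lemma canK_dvd P : ((lq P)%:Z %| val C P (cvT C) + 1)%Z.
Proof.
have [del [_ _ E]] := tpar_deriv C hK; apply/dvdzP.
have q0 : (lq P)%:R != 0 :> rat by rewrite pnatr_eq0 -lt0n lq_gt0.
exists (ord P (del (tpar C P))^-1 + 1); apply: (@intr_inj rat).
rewrite rmorphM !rmorphD /= -E mulrDl divfK // mul1r.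
by rewrite -addrA addrACA addrC addrA [X in _ = X]addrC; ring.
Qed.

Lemma var_neq0 i : pi 'X_i != 0.
Proof. by apply: (pi_X_neq0 H); apply: (wt_lt_h C). Qed.

(** If X_t had value at least 2, [gradient_relation] would make its gradient along the orbit a
    multiple of that of f. The s-component forces the multiplier to be 0, and the t-component of the
    gradient of X_t is 1. *)
Lemma val_var1 (P : point gr) (p0 : 'I_3 -> k) s t : kpoint P p0 -> pi 'X_t \in P -> s != t ->
  f^`M(s).@[p0] != 0 -> val C P (pi 'X_t)%:F = 1.
Proof.
move=> hP tP st fs; have x0 := var_neq0 t; have gx := gr_X a b c pi t.
have xF : (pi 'X_t)%:F != 0 by rewrite tofrac_eq0.
have := val_mem C P gx x0; rewrite tP => /esym v0.
have := valP C P (hfr_R H gx) xF; case: (val C P _) v0 => // -[|[|n]] // _ [e [y [y' [yP y'P ->]]]].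
move=> E; exfalso.
have E2 : y' * pi 'X_t = pi (lN (cvloc C P)) ^+ n.+1 * y * pi (lN (cvloc C P)).
  apply/eqP; rewrite -tofrac_eq !tofracM tofracXn E -exprnP exprSr mulrCA.
  have y0 : y'%:F != 0 by rewrite tofrac_eq0 (notin_neq0 y'P).
  have y'0 : y'%:F != 0 by rewrite tofrac_eq0 (notin_neq0 y'P).
  by rewrite [y'%:F * _]mulrC divfK // mulrAC.
have [Y' Y'E] := pi_surj H y'; have [Z ZE] := pi_surj H (pi (lN (cvloc C P)) ^+ n.+1 * y).
have [u uE] : exists u, Y' * 'X_t - Z * lN (cvloc C P) = u * f.
  by apply/(pi_ker H); rewrite rmorphB !rmorphM Y'E ZE E2 subrr.
have Z0 : chi a b c p0 Z = 0.
  apply: (kpoint_chi0 hP); rewrite ZE pidMr ?pidX ?lN_mem //; exact: point_prime.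
have rel v := gradient_relation H hP v uE tP (lN_mem (cvloc C P)).
have Y0 : chi a b c p0 Y' != 0.
  by case: (hP) => _ hP'; have := y'P; rewrite -Y'E hP'.
have chif v : chi a b c p0 f^`M(v) = (f^`M(v)).@[p0] *: 'X^(h - w v).
  exact: chi_hom (hom_deriv v (f_hom H)).
have dX v : ('X_t : {mpoly k[3]})^`M(v) = (t == v)%:R.
  rewrite mderivX mnm1E; case: eqP => [->|_]; last by rewrite scale0r.
  by rewrite scale1r mnm_subnn mpolyX0.
have r1 := rel t; rewrite Z0 mul0r subr0 dX eqxx rmorph1 mulr1 chif in r1.
have r2 := rel s; rewrite Z0 mul0r subr0 dX [t == s]eq_sym (negbTE st) rmorph0 mulr0 chif in r2.
move/esym/eqP: r2; rewrite mulf_eq0 scaler_eq0 (negbTE fs) expf_eq0 polyX_eq0 andbF !orbF.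
by move=> /eqP u0; move: Y0; rewrite r1 u0 mul0r eqxx.
Qed.

(** As in [plane_f]: gcd(w_j, w_l) divides h and not w_i, so no monomial of the derivative survives
    on the plane. *)
Lemma plane_deriv i j l : j != i -> l != i -> j != l -> (1 < gcdn (w j) (w l))%N ->
  forall p0 : 'I_3 -> k, f.@[p0] = 0 -> p0 i = 0 -> f^`M(i).@[p0] = 0.
Proof.
move=> ji li jl g1 p0 f0 pi0; set g := gcdn _ _ in g1.
have := plane_f C hK w_coprime ji li jl g1 => -[u [zs [E [_ _ _ hE _]]]].
have gh : (g %| h)%N.
  rewrite hE; apply: dvdn_add.
    by apply: dvdn_add; apply: dvdn_mull; rewrite ?dvdn_gcdl ?dvdn_gcdr.
  by apply: dvdn_mull; apply: dvdn_trans (dvdn_gcdl _ _) (dvdn_lcml _ _).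
have gi : ~~ (g %| w i)%N.
  apply/negP => gi; have g1' := @w_coprime g.
  suff /g1' : forall t, (g %| w t)%N by move=> e; move: g1; rewrite e.
  by move=> t; case: (ord3_cases ji li jl t) => ->; rewrite ?gi ?dvdn_gcdl ?dvdn_gcdr.
have dvdX t : p0 t != 0 -> (g %| w t)%N.
  case: (ord3_cases ji li jl t) => ->; rewrite ?dvdn_gcdl ?dvdn_gcdr //.
  by rewrite pi0 eqxx.
apply/eqP/negPn/negP => ne; have := hom_dvd dvdX (hom_deriv i (f_hom H)) ne.
by rewrite dvdn_subr ?(negbTE gi) // ltnW // (wt_lt_h C hK).
Qed.

(** On the curve X_0 E = - u X_j^r X_l^s. For s = 1 the derivative along X_l is nonzero and X_0 has
    value 1. For s >= 2 only the derivative along X_0 can be nonzero, so E is a unit, X_l has value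
    1 and X_0 has value s. *)
Lemma axis_val (P : point gr) (p0 : 'I_3 -> k) j l r s u E : j != 0 -> l != 0 -> j != l ->
  u != 0 -> (0 < s)%N -> f = u *: ('X_j ^+ r * 'X_l ^+ s) + 'X_0 * E -> hom (h - w 0) E ->
  kpoint P p0 -> p0 0 = 0 -> p0 l = 0 -> p0 j != 0 -> val C P (pi 'X_0)%:F = s%:Z.
Proof.
move=> j0 l0 jl u0 s0 fE hE hP p00 pl pj.
have mem t : (pi 'X_t \in P) = (p0 t == 0) by rewrite (kpoint_hom hP (homX k a b c t)) mevalXU.
have f0 := kpoint_f H hP.
have XE t : t != 0 -> ('X_0 * E)^`M(t).@[p0] = 0.
  move=> t0; rewrite mderivM mevalD !mevalM mevalXU p00 mul0r addr0.
  by rewrite mderivX mnm1E eq_sym (negbTE t0) mevalZ !mul0r.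
have mE : u *: ('X_j ^+ r * 'X_l ^+ s) = u *: 'X_[U_(j) *+ r + U_(l) *+ s] :> {mpoly k[3]}.
  by rewrite mpolyXD -!mpolyXn.
have [s1|s2] := leqP s 1.
  have s1' : s = 1%N by apply/eqP; rewrite eqn_leq s1.
  rewrite s1'; apply: (val_var1 hP _ l0); first by rewrite mem p00.
  rewrite fE mderivD mevalD XE // addr0 mderivZ mevalZ mulf_neq0 //.
  rewrite s1' expr1 mderivM mevalD !mevalM mevalXU pl mulr0 add0r mderivX mnm1E eqxx scale1r.
  by rewrite mnm_subnn mpolyX0 meval1 mulr1 rmorphXn /= mevalXU expf_neq0.
have d12 t : t != 0 -> f^`M(t).@[p0] = 0.
  move=> t0; rewrite fE mderivD mevalD XE // addr0 mderivZ mevalZ mderivM mevalD !mevalM.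
  rewrite -[s](prednK s0) exprS mderivM mevalD !mevalM mevalXU pl !mul0r mulr0 !add0r.
  by rewrite ['X_l ^+ _]lock -lock rmorphXn /= rmorphXn /= !mevalXU pl expr0n -subn1 subn_eq0 leqNgt s2 !(mulr0, addr0).
have [t ft] := cv_smooth C (let: conj pn _ := hP in pn) f0.
have t0 : t = 0 by apply/eqP/negPn/negP => /d12 e; rewrite e eqxx in ft.
have E0 : E.@[p0] != 0.
  move: ft; rewrite t0 fE mderivD mevalD mE mderivZ mevalZ mderivX mnmDE !mnm1Mn.
  rewrite (negbTE j0) (negbTE l0) !mul0n addn0 scale0r meval0 mulr0 add0r.
  by rewrite mderivM mevalD !mevalM mevalXU p00 mul0r addr0 mderivX mnm1E eqxx scale1r mnm_subnn mpolyX0 meval1 mul1r.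
have EP : pi E \notin P := kpoint_notin hP E0.
have vl : val C P (pi 'X_l)%:F = 1.
  by apply: (@val_var1 P p0 0 l hP); rewrite ?mem ?pl ?eqxx // -t0 // t0 eq_sym.
have gl := gr_X a b c pi l; have lF : (pi 'X_l)%:F != 0 by rewrite tofrac_eq0 var_neq0.
have g0 := gr_X a b c pi 0; have oF : (pi 'X_0)%:F != 0 by rewrite tofrac_eq0 var_neq0.
have gE : gr (h - w 0) (pi E) by exists E.
have EF : (pi E)%:F != 0 by rewrite tofrac_eq0 (notin_neq0 EP).
have jP : cst u * pi 'X_j ^+ r \notin P.
  apply: notinM; first exact: cst_notin.
  by rewrite pidX ?mem ?(negbTE pj) ?andbF //; apply: point_prime.
have gj : gr (w j * r)%N (cst u * pi 'X_j ^+ r) by apply: (gr_scale H); apply: (grXn H); apply: gr_X.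
have jF : (cst u * pi 'X_j ^+ r)%:F != 0 by rewrite tofrac_eq0 (notin_neq0 jP).
have rel : (cst u * pi 'X_j ^+ r)%:F * (pi 'X_l)%:F ^+ s = - ((pi 'X_0)%:F * (pi E)%:F).
  apply/eqP; rewrite -addr_eq0 -tofracXn -!tofracM -tofracD tofrac_eq0.
  rewrite -(pi_f C) fE rmorphD -cstM !rmorphM !rmorphXn mulrA.
  by [].
have := congr1 (val C P) rel.
rewrite (valM C P (hfr_R H gj) (hfrXn H s (hfr_R H gl))) ?expf_neq0 //.
rewrite (val_notin C jP) (valXn C P _ (hfr_R H gl)) // vl.
rewrite (valN C P (hfrM H (hfr_R H g0) (hfr_R H gE))) ?mulf_neq0 //.
rewrite (valM C P (hfr_R H g0) (hfr_R H gE)) // (val_notin C EP) addr0 add0r => <-.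
by rewrite natz.
Qed.

Hypothesis a1 : a = 1%N.
Hypothesis b1 : (1 < b)%N.
Hypothesis c1 : (1 < c)%N.
Hypothesis bc : (1 < gcdn b c)%N || ((b, c) \in [:: (2, 3); (3, 4); (3, 5)])%N.

(** The variable of weight 1 has divisor K_X up to equivalence, and this value makes K_X trivial. In
    general q divides val(X_0) + 1. At a zero of X_0 with gcd(b, c) > 1 the value is 1, so q = 2;
    the three coprime pairs are settled by the restriction of f to X_0 = 0. *)
Lemma genus1_val P : val C P (pi 'X_0)%:F = (lq P)%:Z - 1.
Proof.
have g0 := gr_X a b c pi 0; have oF : (pi 'X_0)%:F != 0 by rewrite tofrac_eq0 var_neq0.
have w0 : w 0 = 1%N by rewrite /wt /= a1.
have div : dvdz (lq P)%:Z (val C P (pi 'X_0)%:F + 1).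
  have hz := hfrM H (hfr_R H g0) (hfrV (cvT_neq0 C) (cvT_hfr C)).
  have rz : ratfun gr ((pi 'X_0)%:F / cvT C).
    by apply/ratfun_hfr; apply: (hfr_eq hz); rewrite w0 subrr.
  have zn : (pi 'X_0)%:F / cvT C != 0 by rewrite mulf_neq0 ?invr_eq0 ?cvT_neq0.
  have := val_ratfun C P rz zn; rewrite (valM C P (hfr_R H g0) (hfrV (cvT_neq0 C) (cvT_hfr C))) ?invr_eq0 ?cvT_neq0 //.
  rewrite (valV C P (cvT_hfr C)) ?cvT_neq0 // => d1.
  have /dvdzP[m mE] := d1; have /dvdzP[n nE] := canK_dvd P.
  by apply/dvdzP; exists (m + n); rewrite mulrDl -mE -nE; ring.
have [p0 hP] := kpoint_ex H P.
have mem t : (pi 'X_t \in P) = (p0 t == 0) by rewrite (kpoint_hom hP (homX k a b c t)) mevalXU.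
have [oP|oP] := boolP (pi 'X_0 \in P); last first.
  move: div; rewrite (val_notin C oP) add0r /dvdz dvdn1 /= => /eqP qE.
  by rewrite qE subrr.
have p00 : p0 0 = 0 by apply/eqP; rewrite -mem.
have f0 := kpoint_f H hP.
have [g1|g1] := boolP (1 < gcdn b c)%N.
  have d0 := @plane_deriv 0 1 2%:R isT isT isT g1 p0 f0 p00.
  have [t ft] := cv_smooth C (let: conj pn _ := hP in pn) f0.
  have t0 : t != 0 by apply: contraNneq ft => ->; rewrite d0.
  have v1 := val_var1 hP oP t0 ft; rewrite v1.
  have q1 : (1 < lq P)%N.
    apply: (leq_trans g1); apply: dvdn_leq (lq_gt0 _) _; apply: (dvd_lq C hP) => s.
    by elim/ord3_ind: s; rewrite ?p00 ?eqxx // => _; rewrite ?dvdn_gcdl ?dvdn_gcdr.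
  have {}div : (lq P %| 2)%N by move: div; rewrite v1.
  have : (lq P <= 2)%N by apply: dvdn_leq.
  by case: (lq P) q1 => [|[|[|]]].
have one j l r s u E : j != 0 -> l != 0 -> j != l -> u != 0 -> (0 < s)%N ->
    f = u *: ('X_j ^+ r * 'X_l ^+ s) + 'X_0 * E -> hom (h - w 0) E -> p0 l = 0 ->
    w j = s.+1 -> val C P (pi 'X_0)%:F = (lq P)%:Z - 1.
  move=> j0 l0 jl u0 s0 fE hE pl wj.
  have cases t : t = 0 \/ t = j \/ t = l by case: (ord3_cases j0 l0 jl t); tauto.
  have pj : p0 j != 0.
    have [[t pt] _] := hP; apply: contraNneq pt => pj.
    by case: (cases t) => [|[]] ->; rewrite ?p00 ?pj ?pl.
  rewrite (axis_val j0 l0 jl u0 s0 fE hE hP p00 pl pj).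
  have -> : lq P = s.+1; last by rewrite -addn1 PoszD addrK.
  apply/eqP; rewrite eqn_dvd -{1}wj (lq_dvd C hP pj) /=; apply: (dvd_lq C hP) => t.
  by case: (cases t) => [|[]] ->; rewrite ?p00 ?pl ?eqxx // wj.
have hE := hK.
have := plane_split (wt_gt0 H) (i := 0) (j := 1) (l := 2%:R) isT isT isT (f_hom H) => /=.
case=> [[E hE' /(f_not_mulX C hK hE')]//|[u [r [s [zs [E [u0 z0 hE' hd fE]]]]]]].
have w1 : w 1 = b by []. have w2 : w 2%:R = c by [].
rewrite w1 w2 in hd.
have bc' : ((b, c) \in [:: (2, 3); (3, 4); (3, 5)])%N by case/orP: bc => // e; rewrite e in g1.
(* Here h = b + c + 2 leaves no room for a binomial of degree b c: 7 - 6 = 1 is not a combination of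
   2 and 3, while 9 < 12 and 10 < 15. Then h = r b + s c has a single solution, and the point is a
   vertex of weight s + 1 as in [one]. *)
have zs0 : zs = [::].
  move: hd; rewrite hE a1; move: bc'; rewrite !inE => /or3P[] /eqP[-> ->];
  by case: (zs) => // z zs' /=; rewrite /divn /=; lia.
rewrite zs0 big_nil mulr1 in fE; rewrite zs0 /= mul0n addn0 hE a1 in hd.
have ev : p0 1 ^+ r * p0 2%:R ^+ s = 0.
  move: f0; rewrite fE mevalD mevalZ !mevalM !rmorphXn /= !mevalXU p00 mul0r addr0.
  by move/eqP; rewrite mulf_eq0 (negbTE u0) => /eqP.
have fE' : f = u *: ('X_2%:R ^+ s * 'X_1 ^+ r) + 'X_0 * E by rewrite fE ['X_2%:R ^+ s * _]mulrC.
move: bc'; rewrite !inE => /or3P[] /eqP[bE cE]; rewrite bE cE in hd.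
- have [rE sE] : r = 2%N /\ s = 1%N by lia.
  rewrite rE sE in fE fE' ev; move/eqP: ev; rewrite mulf_eq0 !expf_eq0 /= => /orP[] /eqP pz.
    by apply: (one _ _ _ _ _ _ _ _ _ u0 _ fE' hE' pz cE).
  by apply: (one _ _ _ _ _ _ _ _ _ u0 _ fE hE' pz bE).
- have [rE sE] : r = 3%N /\ s = 0%N by lia.
  rewrite rE sE in fE fE' ev; move/eqP: ev; rewrite mulf_eq0 !expf_eq0 /= orbF => /eqP pz.
  by apply: (one _ _ _ _ _ _ _ _ _ u0 _ fE' hE' pz cE).
have [rE sE] : r = 0%N /\ s = 2%N by lia.
rewrite rE sE in fE fE' ev; move/eqP: ev; rewrite mulf_eq0 !expf_eq0 /= => /eqP pz.
by apply: (one _ _ _ _ _ _ _ _ _ u0 _ fE hE' pz bE).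
Qed.

End GenusOne.

(** * The classification *)

Lemma enumerate_perm (T : Type) (U : eqType) (G : T -> U) (s : seq T) (q : seq U) :
  luniq s -> perm_eq q [seq G x | x <- s] ->
  exists P : 'I_(size q) -> T,
    [/\ injective P, forall u0 (i : 'I_(size q)), nth u0 q i = G (P i) & forall x, lmem x s -> exists i, x = P i].
Proof.
case: s => [_ /perm_nilP -> |x0 s' us]; first by exists (fun i : 'I_0 => False_rect T (notF (ltn_ord i))); split=> [[]|u []|x []].
set s := x0 :: s' in us *; move=> pq.
have [Is pI qE] := perm_iotaP (G x0) pq; rewrite size_map in pI.
have szI : size Is = size q by rewrite qE size_map.
have ltI (i : 'I_(size q)) : (nth 0%N Is i < size s)%N.
  by have := mem_nth 0%N (s := Is) (n := i); rewrite szI (perm_mem pI) mem_iota /= ltn_ord => /(_ isT).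
exists (fun i => nth x0 s (nth 0%N Is i)); split=> [i j|u0 i|x /(lmem_nth x0)[n ns ->]].
- move=> /(luniq_nth us (ltI i) (ltI j)) /eqP.
  by rewrite nth_uniq ?szI // ?(perm_uniq pI) ?iota_uniq // => /eqP /val_inj.
- transitivity (nth u0 [seq nth (G x0) [seq G x | x <- s] i | i <- Is] i); first by rewrite -qE.
  by rewrite (nth_map 0%N) ?szI //; apply: (nth_map x0); exact: ltI.
have nI : n \in Is by rewrite (perm_mem pI) mem_iota.
have lt : (index n Is < size q)%N by rewrite -szI index_mem.
by exists (Ordinal lt); rewrite /= nth_index.
Qed.

Lemma sum_points_eq (R : idomainType) (gr : nat -> set R) (q : seq rat)
    (P : 'I_(size q) -> point gr) (G : point gr -> rat) :
  injective P -> (forall i : 'I_(size q), q`_i = G (P i)) ->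
  (forall Q, G Q != 0 -> exists i, Q = P i) -> forall Q, sum_points P Q = G Q.
Proof.
move=> inj qG supp Q; rewrite /sum_points.
have [[i QE]|nQ] := pselect (exists i, Q = P i).
  rewrite (bigD1 i) //= big1 ?addr0 => [|j ji].
    by rewrite asboolT // QE qG.
  by rewrite asboolF // QE => /inj ij; rewrite ij eqxx in ji.
rewrite big1 => [|i _]; last by rewrite asboolF // => e; apply: nQ; exists i.
by apply/esym/eqP/negPn/negP => /supp.
Qed.

Lemma type_table_genus1 t : t \in type_table -> t.1.1.1 = 1%N ->
  let: (a, b, c, h) := t.2 in
  [/\ a = 1%N, (1 < b)%N, (1 < c)%N &
     (1 < gcdn b c)%N || ((b, c) \in [:: (2, 3); (3, 4); (3, 5)])%N].
Proof.
have : all (fun t : nat * bool * seq nat * (nat * nat * nat * nat) => (t.1.1.1 == 1) ==>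
  let: (a, b, c, h) := t.2 in [&& a == 1, 1 < b, 1 < c &
     (1 < gcdn b c) || ((b, c) \in [:: (2, 3); (3, 4); (3, 5)])])%N type_table by vm_compute.
move=> /allP h tt g1; have := h _ tt; rewrite g1 eqxx /=.
by case: t.2 => [[[a b] c] hh] /and4P[/eqP].
Qed.

Section Forward.

Variables (k : closedFieldType) (a b c : nat) (R : idomainType).
Variables (pi : {rmorphism {mpoly k[3]} -> R}) (h : nat).

Local Notation gr := (piece a b c pi).
Local Notation cst := (structure_map pi).

Theorem hypersurface_classification (D : point gr -> rat) :
  (a <= b <= c)%N -> normal_graded_hypersurface a b c pi h -> h%:Z - (a + b + c)%:Z = 1 ->
  ample_qdivisor D -> is_section_ring D ->
  exists (g : nat) (withK : bool) (q : seq rat),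
    [/\ (g, withK, q, (a, b, c, h)) \in hypersurface_list, genus cst gr g &
        equiv_to_listed cst withK q D].
Proof.
move=> /andP[ab bc] nH hK' aD sD.
have hK : h = (a + b + c).+1 by lia.
have [f [[C] w_coprime]] := normal_graded_curve nH.
have [s [us lqs ms tok]] := special_points C hK w_coprime.
have [a0 _ _ _ _] := nH; have a1 : (0 < a)%N by case: a0.
have [g [K [ds [tt gE pds KE]]]] := type_classification a1 ab bc tok.
have [sg [inj surj [om [rom om0 omE]] tr trK]] := section_ring_transport C aD sD.
pose e_ P := lq (cvloc C P).
pose G P : rat := 1 - (e_ P)%:R^-1.
pose q : seq rat := [seq 1 - d%:R^-1 | d <- ds].
have pq : perm_eq q [seq G P | P <- s].
  have -> : [seq G P | P <- s] = [seq 1 - d%:R^-1 | d <- [seq e_ P | P <- s]] by rewrite -map_comp.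
  by rewrite lqs; apply: perm_map; rewrite hK.
have lq0 P : (e_ P)%:R != 0 :> rat by rewrite pnatr_eq0 -lt0n lq_gt0.
have [P [Pinj qP Pmem]] := enumerate_perm us pq.
(* The special points are found on the side of D0 and pulled back along the permutation [sg]. *)
have [P' P'E] : exists P', forall i, sg (P' i) = P i.
  by exists (fun i => projT1 (cid (surj (P i)))) => i; case: cid.
have sumE Q : sum_points P' Q = G (sg Q).
  apply: (@sum_points_eq _ _ q P' (G \o sg)) => [i j e|i|Q' G0] /=.
  - by apply: Pinj; rewrite -!P'E e.
  - by rewrite P'E (qP 0).
  have /ms/Pmem[i iE] : (1 < e_ (sg Q'))%N.
    rewrite ltnNge; apply: contra_neqN G0 => le; have := lq_gt0 (cvloc C (sg Q')).
    by rewrite /G /=; move: le; rewrite /e_; case: (lq _) => [|[|]] // _ _; rewrite invr1 subrr.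
  by exists i; apply: inj; rewrite iE P'E.
exists g, K, q; split.
- by rewrite hypersurface_listE; apply/mapP; exists (g, K, ds, (a, b, c, h)) => //; rewrite hK.
- suff -> : g = #|[pred i | wt a b c i == 1%N]| by apply: genus_weights C hK.
  rewrite gE -sum1_card big_mkcond /= !big_ord_recl big_ord0 /= !inE /wt /=.
  by do 3!case: eqP => _ //=.
exists P'; split=> [i j e|]; first by apply: Pinj; rewrite -!P'E e.
(* In genus 1 the function T / u, with u = X_0, has order (val(T) - q + 1) / q by [genus1_val], so
   D0 minus its divisor is the sum of (1 - 1/q) P. Otherwise D0 is compared with [canK]. *)
rewrite KE; have [g1|g1] := eqVneq g 1%N.
  have [/= a1' b1 c1 hbc] := type_table_genus1 tt g1.
  have vu := genus1_val C hK w_coprime a1' b1 c1 hbc.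
  have u0 := var_neq0 C hK 0; have uF : tofrac (pi 'X_0) != 0 by rewrite tofrac_eq0.
  have gu := gr_X a b c pi 0; have w0 : wt a b c 0 = 1%N by rewrite /wt /= a1'.
  have hz := hfrM (cvH C) (cvT_hfr C) (hfrV uF (hfr_R (cvH C) gu)).
  have rz : ratfun gr (cvT C / tofrac (pi 'X_0)).
    by apply/ratfun_hfr; apply: (hfr_eq hz); rewrite w0 subrr.
  have z0 : cvT C / tofrac (pi 'X_0) != 0 by rewrite mulf_neq0 ?invr_eq0 ?cvT_neq0.
  have [psi [rpsi psi0 psiE]] := tr _ rz z0.
  exists (om * psi); split; [exact: ratfunM C _ _ rom rpsi|by rewrite mulf_neq0|].
  move=> Q; rewrite (ordM C Q rom rpsi om0 psi0) rmorphD /= -omE sumE psiE.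
  rewrite -addrA; congr (_ + _); rewrite /stdD.
  have := ord_val C (sg Q) rz z0.
  rewrite (valM C _ (cvT_hfr C) (hfrV uF (hfr_R (cvH C) gu))) ?invr_eq0 ?cvT_neq0 //.
  rewrite (valV C _ (hfr_R (cvH C) gu)) // vu -/(e_ _) => vE.
  have -> : val C (sg Q) (cvT C) = ord (sg Q) (cvT C / tofrac (pi 'X_0)) * (e_ (sg Q))%:Z + (e_ (sg Q))%:Z - 1.
    by rewrite -vE; ring.
  rewrite /G rmorphB rmorphD rmorphM rmorph1 /= -!pmulrn; move: (ord _ _)%:~R (lq0 (sg Q)) => o q0.
  by field.
exists (fun Q => canK C (sg Q)); split; first by apply: trK; apply: canonical_canK.
exists om; split=> // Q; rewrite -omE sumE; congr (_ - _).
rewrite /canK /stdD /G -/(e_ _); move: (val _ _ _)%:~R (lq0 (sg Q)) => o q0.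
by field.
Qed.

End Forward.

(** * Section rings of smooth hypersurfaces *)

(** Integral implies almost integral: with m the degree of the monic equation, y^m clears the
    denominators of the first m powers, and higher powers reduce to these. *)
Lemma integral_bounded (R : idomainType) (x y : R) : y != 0 ->
  integralOver (@FracField.tofrac R) (FracField.tofrac x / FracField.tofrac y) ->
  exists d, d != 0 /\ forall n, exists r,
    FracField.tofrac d * (FracField.tofrac x / FracField.tofrac y) ^+ n = FracField.tofrac r.
Proof.
set z := _ / _ => y0 [p mp rp]; pose m := (size p).-1.
have yF : FracField.tofrac y != 0 by rewrite tofrac_eq0.
have sp : size p = m.+1 by rewrite prednK // lt0n size_poly_eq0 monic_neq0.
exists (y ^+ m); split; first by rewrite expf_neq0.
elim/ltn_ind => n IH; have [nm|mn] := leqP n m.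
  exists (x ^+ n * y ^+ (m - n)); rewrite -{1}(subnKC nm) exprD !(tofracM, tofracXn) expr_div_n.
  by rewrite mulrAC [_ * (_ / _)]mulrC divfK ?expf_neq0.
have zm : z ^+ m = - \sum_(i < m) FracField.tofrac p`_i * z ^+ i.
  apply/eqP; rewrite -addr_eq0 addrC; move: rp; rewrite /root horner_coef size_map_inj_poly ?tofrac0 //; last first.
    by move=> u v /eqP; rewrite tofrac_eq => /eqP.
  rewrite sp big_ord_recr /= coef_map /= -[p`_m]/(lead_coef p) -{1}[m]/((size p).-1) (eqP mp) rmorph1 mul1r.
    move=> /eqP E; rewrite -[X in _ == X]E; apply/eqP; congr (_ + _).
    by apply: eq_bigr => i _; rewrite coef_map.
have -> : z ^+ n = - \sum_(i < m) FracField.tofrac p`_i * z ^+ (n - m + i).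
  rewrite -(subnK (ltnW mn)) exprD zm mulrN mulr_sumr addnK; congr (- _).
  by apply: eq_bigr => i _; rewrite exprD mulrCA.
rewrite mulrN mulr_sumr -sumrN.
apply: (big_ind (fun u => exists r, u = FracField.tofrac r)) => [|u v [r ->] [s ->]|i _].
- by exists 0; rewrite tofrac0.
- by exists (r + s); rewrite tofracD.
have [|r rE] := IH (n - m + i)%N; first by have := ltn_ord i; lia.
by exists (- (p`_i * r)); rewrite mulrCA rE tofracN tofracM.
Qed.

Lemma integral_tofracB (R : idomainType) (z : {fraction R}) (r : R) :
  integralOver (@FracField.tofrac R) z -> integralOver (@FracField.tofrac R) (z - FracField.tofrac r).
Proof. by move=> hz; apply: (integral_sub hz (integral_id _ r)). Qed.

Lemma size_subr_lead (A : nzRingType) (p q : {poly A}) : p != 0 -> size p = size q ->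
  lead_coef p = lead_coef q -> (size (p - q)%R < size p)%N.
Proof.
move=> p0 sE lE; have sp : (0 < size p)%N by rewrite lt0n size_poly_eq0.
rewrite -(prednK sp) ltnS; apply/leq_sizeP => j; rewrite leq_eqVlt => /orP[/eqP <-|lt].
  by rewrite coefB -[p`__]/(lead_coef p) lE {1}sE subrr.
have le : (size p <= j)%N by rewrite -(prednK sp).
by rewrite coefB !nth_default ?subrr // -sE.
Qed.

Lemma addmulrn_lt0 (v u : int) : v < 0 -> 0 <= u -> u + v *+ `|u|.+1 < 0.
Proof.
move=> v0; case: u => // m _; rewrite -mulr_natr natz absz_nat.
by nia.
Qed.

Section Converse.

Variables (k : closedFieldType) (a b c : nat) (R : idomainType).
Variables (pi : {rmorphism {mpoly k[3]} -> R}) (h : nat) (f : {mpoly k[3]}).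
Variable C : curve a b c pi h f.

Let H := cvH C.
Local Notation w := (wt a b c).
Local Notation hom n p := (p \is n.-homog for (wdeg a b c)).
Local Notation gr := (piece a b c pi).
Local Notation cst := (structure_map pi).
Local Notation "x %:F" := (@FracField.tofrac R x).
Local Notation lq P := (lq (cvloc C P)).
Local Notation T := (cvT C).

Lemma hfr_gr (n : nat) z : hfr a b c pi n%:Z z -> (forall P : point gr, inloc P z) ->
  exists x, gr n x /\ z = x%:F.
Proof.
move=> hz hl; have [x xE] := hfr_cap H hz hl; exists x; split=> //.
have [i [j [u [v [hu hv v0 E1 E2]]]]] := hz.
have E3 : u = v * x.
  by apply/eqP; rewrite -tofrac_eq tofracM -xE E1 mulrC divfK // tofrac_eq0.
have [_] := gr_div H hu hv v0 E3.
by have -> : (i - j = n)%N by lia.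
Qed.

Lemma section_val (n : nat) x P : gr n x -> x != 0 ->
  (ord P (x%:F / T ^+ n))%:~R + n%:R * stdD C P = (val C P x%:F)%:~R / (lq P)%:R.
Proof.
move=> gx x0; have xF : x%:F != 0 by rewrite tofrac_eq0.
have hT := hfrXn H n (cvT_hfr C); have Tn : T ^+ n != 0 by rewrite expf_neq0 ?cvT_neq0.
have rz : ratfun gr (x%:F / T ^+ n).
  by apply/ratfun_hfr; apply: (hfr_eq (hfrM H (hfr_R H gx) (hfrV Tn hT))); lia.
have := ord_val C P rz; rewrite mulf_neq0 ?invr_eq0 // => /(_ isT).
rewrite (valM C P (hfr_R H gx) (hfrV Tn hT)) ?invr_eq0 // (valV C P hT) // (valXn C P n (cvT_hfr C)) ?cvT_neq0 //.
rewrite /stdD; move: (ord _ _) (val C P x%:F) (val C P T) => o v v' E.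
have q0 : (lq P)%:R != 0 :> rat by rewrite pnatr_eq0 -lt0n lq_gt0.
have -> : v = o * (lq P)%:Z + v' *+ n by rewrite -E subrK.
rewrite rmorphD rmorphM rmorphMn /= -!pmulrn -[v'%:~R *+ n]mulr_natr.
by field.
Qed.

Lemma H0_stdD (n : nat) z : H0 (gr := gr) (fun P => n%:R * stdD C P) z <->
  exists x, gr n x /\ z = x%:F / T ^+ n.
Proof.
have q0 P : 0 < (lq P)%:R :> rat by rewrite ltr0n lq_gt0.
have Tn : T ^+ n != 0 by rewrite expf_neq0 ?cvT_neq0.
have hT := hfrXn H n (cvT_hfr C).
split=> [[->|[rz z0 hz]]|[x [gx ->]]].
- by exists 0; rewrite tofrac0 mul0r; split=> //; exact: (gr0 H).
- have hzT : hfr a b c pi n%:Z (z * T ^+ n).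
    by apply: (hfr_eq (hfrM H (ratfun_deg0 rz) hT)); lia.
  have zT0 : z * T ^+ n != 0 by rewrite mulf_neq0.
  have [|x [gx xE]] := hfr_gr hzT; last by exists x; rewrite -xE mulfK.
  move=> P; apply/(val_ge0 C P hzT zT0).
  rewrite (valM C P (ratfun_deg0 rz) hT) // (ord_val C P rz z0) (valXn C P n (cvT_hfr C)) ?cvT_neq0 //.
  have := hz P; rewrite /stdD -(pmulr_lge0 _ (q0 P)) mulrDl mulrA divfK ?(gt_eqF (q0 P)) //.
  rewrite [n%:R * _]mulrC -(ler0z rat) rmorphD rmorphM rmorphMn /= -!pmulrn.
  by rewrite -[X in _ -> is_true (_ <= _ + X)]mulr_natr.
have [->|x0] := eqVneq x 0; first by left; rewrite tofrac0 mul0r.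
right; split.
- by apply/ratfun_hfr; apply: (hfr_eq (hfrM H (hfr_R H gx) (hfrV Tn hT))); lia.
- by rewrite mulf_neq0 ?invr_eq0 // tofrac_eq0.
by move=> P; rewrite section_val // divr_ge0 ?ler0n // ler0z (val_R C P gx).
Qed.

Lemma section_ring_stdD : is_section_ring (gr := gr) (stdD C).
Proof.
(* Each component x_n is sent to x_n / T^n times the n-th power of the variable: the grading
   followed by the substitution of X / T for X. *)
pose th x := map_poly (@FracField.tofrac R) (grading H x) \Po (T^-1 *: 'X).
pose theta : {rmorphism R -> {poly {fraction R}}} :=
  comp_poly (T^-1 *: 'X) \o (map_poly (@FracField.tofrac R) \o grading H).
have compE (p : {poly {fraction R}}) n : (p \Po (T^-1 *: 'X))`_n = p`_n / T ^+ n.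
  elim/poly_ind: p n => [|p x IH] n; first by rewrite comp_poly0 !coef0 mul0r.
  rewrite comp_polyD comp_polyM comp_polyX comp_polyC !coefD !coefC -scalerAr coefZ !coefMX.
  case: n => [|n]; first by rewrite mulr0 !add0r expr0 divr1.
  by rewrite !addr0 IH exprS invfM mulrCA mulrC.
have thE x n : (theta x)`_n = ((grading H x)`_n)%:F / T ^+ n by rewrite /= compE coef_map.
have Tn n : T ^+ n != 0 by rewrite expf_neq0 ?cvT_neq0.
exists theta; split=> [x y E|p|n x gx].
- rewrite -(grading1 H x) -(grading1 H y); congr (_.[1]); apply/polyP => n.
  have /eqP := thE y n; rewrite -E thE (inj_eq (mulIf _)) ?invr_eq0 // tofrac_eq.
  by move/eqP.
- split=> [hp|[x <-] n]; last by apply/H0_stdD; exists (grading H x)`_n; split; [apply: gr_coef|apply: thE].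
  have [x xE] : exists x : nat -> R, forall n, gr n (x n) /\ p`_n = (x n)%:F / T ^+ n.
    by exists (fun n => projT1 (cid ((H0_stdD n p`_n).1 (hp n)))) => n; case: cid.
  exists (\sum_(n < size p) x n); apply/polyP => n; rewrite thE rmorph_sum coef_sum /=.
  have cE (i : 'I_(size p)) : (grading H (x i))`_n = (x i) *+ (n == i).
    have [/(grP H) -> _] := xE i; rewrite coefZ coefXn.
    by case: eqP => _; rewrite ?mulr1 ?mulr0.
  under eq_bigr do rewrite cE.
  have [ln|ln] := ltnP n (size p).
    rewrite (bigD1 (Ordinal ln)) //= eqxx big1 ?addr0; first by have [_ ->] := xE n.
    by move=> i; rewrite -val_eqE /= eq_sym => /negbTE ->.
  rewrite big1 ?tofrac0 ?mul0r ?nth_default // => i _.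
  by rewrite gtn_eqF // (leq_trans (ltn_ord i)).
exists (x%:F / T ^+ n); apply/polyP => i; rewrite thE coefZ coefXn.
have [/eqP -> |ni] := boolP (i == n); first by rewrite (gr_coef_eq H gx) mulr1.
by rewrite (gr_coef_ne H gx ni) tofrac0 mul0r mulr0.
Qed.

Lemma stdD_finite_support : finite_support (stdD C).
Proof.
have [i [j [x [y [gx gy y0 TE _]]]]] := cvT_hfr C.
have x0 : x != 0.
  by apply: contraTneq (cvT_neq0 C) => x0; rewrite TE x0 tofrac0 mul0r eqxx.
have [n [s hs]] := finpts_zeros H (grM H gx gy) (mulf_neq0 x0 y0).
exists n, s => P DP; apply: hs; rewrite (pidM (point_prime P)).
apply: contraNT DP; rewrite negb_or => /andP[xP yP].
have xF : x%:F != 0 by rewrite tofrac_eq0.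
have yF : y%:F != 0 by rewrite tofrac_eq0.
rewrite /stdD TE (valM C P (hfr_R H gx) (hfrV yF (hfr_R H gy))) ?invr_eq0 //.
by rewrite (valV C P (hfr_R H gy)) // !val_notin // subrr mul0r.
Qed.

Lemma point_eq_gr (P Q : point gr) : (forall n x, gr n x -> (x \in P) = (x \in Q)) -> P = Q.
Proof.
move=> E; apply: point_eq => x; apply/idP/idP => hx; apply: (point_coefP (H := H)) => n;
  by have := point_coef H n hx; rewrite (E n) //; apply: gr_coef.
Qed.

(** Normalize X_t to 1 at both points. If no section separated them, all monomials of degree M would
    agree at p0 and q0, hence all monomials in X_j, X_l of degree divisible by w_t: reducing
    exponents modulo w_t keeps the degree below M. Then the w_t-th power of every form agrees, and
    the points coincide. *)
Lemma separating_section M (P Q : point gr) : (forall i, w i %| M)%N ->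
  (forall i j l, w i * w j + w i * w l <= M)%N -> P <> Q ->
  exists x, [/\ gr M x, x \notin P & x \in Q].
Proof.
move=> dM bM PQ; have [t tP] := point_var P; have wt0 := wt_gt0 H t.
have M0 : (0 < M)%N by apply: leq_trans (bM t t t); rewrite addn_gt0 muln_gt0 wt0.
have gXt : gr M (pi 'X_t ^+ (M %/ w t)).
  by rewrite -{1}(divnK (dM t)) mulnC; apply: (grXn H); apply: gr_X.
have d0 : (0 < M %/ w t)%N by rewrite divn_gt0 // dvdn_leq.
have [tQ|tQ] := boolP (pi 'X_t \in Q).
  exists (pi 'X_t ^+ (M %/ w t)); split=> //.
    by rewrite (pidX (point_prime P)) d0.
  by rewrite (pidX (point_prime Q)) d0.
have [p0 [hP pt]] := kpoint_normalize_at H tP; have [q0 [hQ qt]] := kpoint_normalize_at H tQ.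
apply: contrapT => no; apply: PQ.
have hX m n : wdeg a b c m = n -> hom n ('X_[m] : {mpoly k[3]}) by move=> <-; rewrite dhomogX.
have agreeM m : wdeg a b c m = M -> ('X_[m] : {mpoly k[3]}).@[p0] = ('X_[m] : {mpoly k[3]}).@[q0].
  move=> mM; apply: contrapT => /eqP ne; apply: no.
  have hp : hom M ('X_[m] - ('X_[m] : {mpoly k[3]}).@[q0] *: 'X_t ^+ (M %/ w t)).
    apply: rpredB; first exact: hX.
    by apply: rpredZ; rewrite mpolyXn; apply: hX; rewrite wdegMn wdegU divnK.
  exists (pi ('X_[m] - ('X_[m] : {mpoly k[3]}).@[q0] *: 'X_t ^+ (M %/ w t))); split.
  - by exists ('X_[m] - ('X_[m] : {mpoly k[3]}).@[q0] *: 'X_t ^+ (M %/ w t)).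
  - by rewrite (kpoint_hom hP hp) mevalB mevalZ rmorphXn /= mevalXU pt expr1n mulr1 subr_eq0.
  by rewrite (kpoint_hom hQ hp) mevalB mevalZ rmorphXn /= mevalXU qt expr1n mulr1 subrr.
have [j [l [jt lt jl]]] := ord3_split t.
have evE (r : 'I_3 -> k) m : r t = 1 -> ('X_[m] : {mpoly k[3]}).@[r] = r j ^+ m j * r l ^+ m l.
  move=> r1; rewrite mevalX (bigD1 t) //= r1 expr1n mul1r (bigD1 j) //= (bigD1 l) /=; last by rewrite lt eq_sym.
  rewrite big1 ?mulr1 // => s /andP[/andP[st sj] sl].
  by case: (ord3_cases jt lt jl s) => e; move: st sj sl; rewrite e eqxx.
have agree x y : (w t %| x * w j + y * w l)%N -> (x * w j + y * w l <= M)%N ->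
    p0 j ^+ x * p0 l ^+ y = q0 j ^+ x * q0 l ^+ y.
  move=> dv le; pose m := (U_(j) *+ x + U_(l) *+ y + U_(t) *+ ((M - (x * w j + y * w l)) %/ w t))%MM.
  have mj : m j = x.
    by rewrite !mnmDE !mnm1Mn eqxx [l == j]eq_sym (negbTE jl) [t == j]eq_sym (negbTE jt) !addn0 mul1n.
  have ml : m l = y.
    by rewrite !mnmDE !mnm1Mn eqxx (negbTE jl) [t == l]eq_sym (negbTE lt) addn0 mul1n.
  have mt : m t = ((M - (x * w j + y * w l)) %/ w t)%N.
    by rewrite !mnmDE !mnm1Mn eqxx (negbTE jt) (negbTE lt) mul1n.
  have := agreeM m; rewrite !evE // mj ml; apply.
  rewrite (wdeg3 a b c m jt lt jl) mj ml mt divnK ?dvdn_sub // -addnA subnK //.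
have agree' x y : (w t %| x * w j + y * w l)%N -> p0 j ^+ x * p0 l ^+ y = q0 j ^+ x * q0 l ^+ y.
  have aj := agree (w t) 0%N; have al := agree 0%N (w t).
  rewrite mul0n addn0 !expr0 !mulr1 dvdn_mulr // in aj.
  rewrite mul0n add0n !expr0 !mul1r dvdn_mulr // in al.
  have {}aj := aj isT (leq_trans (leq_addr _ _) (bM t j l)).
  have {}al := al isT (leq_trans (leq_addl _ _) (bM t j l)).
  move=> dv; rewrite (divn_eq x (w t)) (divn_eq y (w t)) !exprD.
  rewrite ![(_ %/ _ * w t)%N]mulnC !exprM aj al mulrACA [RHS]mulrACA; congr (_ * _).
  apply: agree; last first.
    apply: leq_trans (bM t j l); apply: leq_add; rewrite leq_mul2r ltnW ?orbT // ltn_pmod //.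
  move: dv; rewrite {1}(divn_eq x (w t)) {1}(divn_eq y (w t)) !mulnDl addnACA dvdn_addr //.
  by rewrite dvdn_add // -mulnA mulnCA dvdn_mulr.
have agreeH n p : (w t %| n)%N -> hom n p -> p.@[p0] = p.@[q0].
  move=> dn hp; rewrite [p]mpolyE !raddf_sum /= big_seq [RHS]big_seq; apply: eq_bigr => m mp.
  rewrite !mevalZ; congr (_ * _); rewrite !evE //; apply: agree'.
  have := hom_wdeg hp mp; rewrite (wdeg3 a b c m jt lt jl) => E.
  by move: dn; rewrite -E -addnA dvdn_addr // dvdn_mull.
apply: point_eq_gr => n x [p hp <-]; rewrite (kpoint_hom hP hp) (kpoint_hom hQ hp).
have hpw : hom (n * w t) (p ^+ w t) by exact: dhomogMn.
have := agreeH _ _ (dvdn_mull _ (dvdnn _)) hpw; rewrite !rmorphXn /= => E.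
have ex (u : k) : (u == 0) = (u ^+ w t == 0) by rewrite expf_eq0 wt0.
by rewrite ex E -ex.
Qed.

(** The section is N^q y with y a monomial in the units U1, U2, X_t of degree M - q ld. These have
    degrees (e + 1) q, e q and r q; taking r factors among U1 and U2 adjusts the degree modulo r q,
    and X_t supplies the rest once M is large. *)
Lemma tangent_section M (P : point gr) : (forall i, w i %| M)%N ->
  (forall i, w i * (cvB C).*2 <= M)%N -> exists x, [/\ gr M x, x != 0 & val C P x%:F = (lq P)%:Z].
Proof.
move=> dM bM; set L := cvloc C P; have pP := point_prime P.
have [t tP] := point_var P; have wt0 := wt_gt0 H t.
have /dvdnP[r wE] := l_dvd L (gr_X a b c pi t) tP.
have /dvdnP[s MdE] : (lq P %| M)%N by apply: dvdn_trans (dM t); rewrite wE dvdn_mull.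
have g2 : gr (wdeg a b c (lm2 L)) (pi 'X_[lm2 L]) by exists 'X_[lm2 L] => //; rewrite dhomogX.
have g1 : gr (wdeg a b c (lm1 L)) (pi 'X_[lm1 L]) by exists 'X_[lm1 L] => //; rewrite dhomogX.
have gt := gr_X a b c pi t; have gN : gr (ld L) (pi (lN L)) by exists (lN L) => //; exact: lN_hom.
have /dvdnP[e eE] := l_dvd L g2 (lU2 L).
have [ldB m1B] := cvlocB C P; have q0 := lq_gt0 L.
have r0 : (0 < r)%N by move: wt0; rewrite wE muln_gt0 => /andP[].
have le : (ld L + r * e <= s)%N.
  rewrite -(leq_pmul2r q0) -MdE; apply: leq_trans (bM t); rewrite wE -addnn mulnDr mulnDl.
  apply: leq_add.
    rewrite mulnAC leq_mul2r mulnC; apply/orP; right.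
    by apply: leq_trans ldB _; rewrite leq_pmulr.
  rewrite -mulnA -eE mulnAC -mulnA leq_mul2l; apply/orP; right.
  apply: leq_trans (leq_pmulr _ q0); apply: leq_trans m1B.
  by rewrite (lU_deg L) leq_addr.
set n := (s - (ld L + r * e))%N.
pose y := pi 'X_[lm1 L] ^+ (n %% r) * pi 'X_[lm2 L] ^+ (r - n %% r) * pi 'X_t ^+ (n %/ r).
have yP : y \notin P by rewrite !(pidM pP) !(pidX pP) (negbTE (lU1 L)) (negbTE (lU2 L)) (negbTE tP) !andbF.
pose x := pi (lN L) ^+ lq P * y.
have gy : gr (M - lq P * ld L) y.
  have -> : (M - lq P * ld L = wdeg a b c (lm1 L) * (n %% r) + wdeg a b c (lm2 L) * (r - n %% r) + w t * (n %/ r))%N.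
    have nr : (n %% r <= r)%N by rewrite ltnW // ltn_pmod.
    have nE : (s = ld L + r * e + (n %/ r * r + n %% r))%N by rewrite -divn_eq /n subnKC.
    have rE : (r = n %% r + (r - n %% r))%N by rewrite subnKC.
    rewrite (lU_deg L) eE wE MdE; move: (lq P) (n %% r)%N (r - n %% r)%N (n %/ r)%N nE rE => q u u' v nE rE.
    apply/(canLR (addnK _)).
    rewrite nE; clear -rE; rewrite [in LHS]rE [in RHS]rE; lia.
  by apply: (grM H); [apply: (grM H)|]; apply: (grXn H).
have gx : gr M x.
  have <- : (lq P * ld L + (M - lq P * ld L) = M)%N.
    rewrite subnKC // MdE mulnC leq_mul2r; apply/orP; right.
    by apply: leq_trans le; rewrite leq_addr.
  by apply: (grM H) gy; rewrite mulnC; apply: (grXn H).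
have N0 : (pi (lN L))%:F != 0 by rewrite tofrac_eq0 lN_neq0.
have yF : y%:F != 0 by rewrite tofrac_eq0 (notin_neq0 yP).
exists x; split=> //; first by rewrite mulf_neq0 ?expf_neq0 ?lN_neq0 // (notin_neq0 yP).
rewrite tofracM tofracXn (valM C P (hfrXn H (lq P) (hfr_R H gN)) (hfr_R H gy)) ?expf_neq0 //.
rewrite (val_notin C yP) addr0 (valXn C P _ (hfr_R H gN)) //.
by rewrite (val_isval (isval_N C P)) natz.
Qed.

Theorem ample_stdD : ample_qdivisor (gr := gr) (stdD C).
Proof.
(* N is divisible by every q_P and so clears the denominators of D0; m makes m N exceed the bounds
   of both section lemmas at all points at once. *)
pose W := (a + b + c)%N; pose N := (a * b * c)%N; pose m := (W * ((cvB C).*2 + W.*2)).+1.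
have wW i : (w i <= W)%N by elim/ord3_ind: i; rewrite /W /wt /=; lia.
have wN i : (w i %| N)%N.
  by elim/ord3_ind: i; rewrite /N /wt /=; [rewrite -mulnA dvdn_mulr|rewrite mulnAC dvdn_mull|rewrite dvdn_mull].
have N0 : (0 < N)%N by rewrite /N !muln_gt0 (wt_gt0 H 0) (wt_gt0 H 1) (wt_gt0 H 2%:R).
have mM : (m <= m * N)%N by rewrite leq_pmulr.
have WM : (W * ((cvB C).*2 + W.*2) <= m * N)%N by apply: leq_trans mM.
have dM i : (w i %| m * N)%N by rewrite dvdn_mull.
have q0 P : 0 < (lq P)%:R :> rat by rewrite ltr0n lq_gt0.
have intD P : N%:R * stdD C P \is a Num.int.
  have [t tP] := point_var P; have /dvdnP[r NE] := dvdn_trans (l_dvd (cvloc C P) (gr_X a b c pi t) tP) (wN t).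
  have -> : N%:R * stdD C P = (r%:Z * val C P T)%:~R; last exact: intr_int.
  rewrite /stdD NE natrM rmorphM /= -pmulrn; have := q0 P; move: (lq P)%:R => q /lt0r_neq0 qn.
  by field.
split; first exact: stdD_finite_support.
exists N; split=> //.
  split=> //; have [n [s hs]] := stdD_finite_support; exists n, s => P; rewrite mulf_eq0 negb_or.
  by move=> /andP[_ /hs].
exists m => //.
have -> : (fun P : point gr => m%:R * (N%:R * stdD C P)) = (fun P => (m * N)%:R * stdD C P).
  by apply/funext => P; rewrite mulrA natrM.
have sec x : gr (m * N) x -> x != 0 -> H0 (gr := gr) (fun P => (m * N)%:R * stdD C P) (x%:F / T ^+ (m * N)) /\
    x%:F / T ^+ (m * N) != 0.
  move=> gx x0; split; first by apply/H0_stdD; exists x.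
  by rewrite mulf_neq0 ?invr_eq0 ?expf_neq0 ?cvT_neq0 // tofrac_eq0.
split=> [P Q PQ|P].
  have bM i j l : (w i * w j + w i * w l <= m * N)%N.
    rewrite -mulnDr; apply: leq_trans WM; apply: leq_mul => //; apply: leq_trans (leq_addl _ _).
    by rewrite -addnn leq_add.
  have [x [gx xP xQ]] := separating_section dM bM PQ; have x0 := notin_neq0 xP.
  have [h0 n0] := sec x gx x0; exists (x%:F / T ^+ (m * N)); split=> //.
    by rewrite section_val // (val_notin C xP) mul0r.
  by rewrite section_val // divr_gt0 // ltr0z -(val_mem C Q gx x0).
have bM i : (w i * (cvB C).*2 <= m * N)%N.
  by apply: leq_trans WM; apply: leq_mul (wW i) (leq_addr _ _).
have [x [gx x0 vx]] := tangent_section P dM bM.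
have [h0 n0] := sec x gx x0; exists (x%:F / T ^+ (m * N)); split=> //.
by rewrite section_val // vx -pmulrn divff // gt_eqF.
Qed.

Lemma grading_neq0 x : x != 0 -> grading H x != 0.
Proof. by apply: contra_neq => g0; rewrite -(grading1 H x) g0 horner0. Qed.

Lemma gr_lead x : gr (size (grading H x)).-1 (lead_coef (grading H x)).
Proof. exact: gr_coef. Qed.

(** Induction on the top degree of the numerator x. The quotient of the top components of x and y is
    a homogeneous fraction whose powers have a common denominator, so it has no poles and lies in R
    by [hfr_cap]; subtracting it from x / y lowers the degree of the numerator. *)
Theorem normal_domain_curve : normal_domain R.
Proof.
move=> z; have [x [y [y0 ->]]] := frac_ex z.
have [n] := ubnP (size (grading H x)); elim: n => // n IH in x *; rewrite ltnS => szx hz.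
have [->|x0] := eqVneq x 0; first by exists 0; rewrite tofrac0 mul0r.
have [d [d0 hd]] := integral_bounded y0 hz.
have yF : y%:F != 0 by rewrite tofrac_eq0.
pose le t := lead_coef (grading H t).
have le0 t : t != 0 -> le t != 0 by move=> /grading_neq0; rewrite lead_coef_eq0.
have leM t u : le (t * u) = le t * le u by rewrite /le rmorphM lead_coefM.
have leX t m : le (t ^+ m) = le t ^+ m by rewrite /le rmorphXn lead_coef_exp.
have lx0 := le0 x x0; have ly0 := le0 y y0; have ld0 := le0 d d0.
have lyF : (le y)%:F != 0 by rewrite tofrac_eq0.
have lxF : (le x)%:F != 0 by rewrite tofrac_eq0.
have ldF : (le d)%:F != 0 by rewrite tofrac_eq0.
have hx := hfr_R H (gr_lead x); have hy := hfr_R H (gr_lead y).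
have hu := hfrM H hx (hfrV lyF hy); set u := _ / _ in hu.
have u0 : u != 0 by rewrite mulf_neq0 ?invr_eq0.
have du m : exists r, (le d)%:F * u ^+ m = (le r)%:F.
  have [r E] := hd m; exists r; apply: (mulIf (expf_neq0 m lyF)).
  rewrite -mulrA -exprMn divfK // -!tofracXn -!tofracM -!leX -!leM; congr (le _)%:F.
  apply/eqP; rewrite -tofrac_eq !tofracM !tofracXn -E -mulrA -exprMn divfK //.
have [|r0 r0E] := hfr_cap H hu.
  move=> P; apply/(val_ge0 C P hu u0); rewrite leNgt; apply/negP => vu.
  have [r E] := du `|val C P (le d)%:F|.+1.
  have um : u ^+ `|val C P (le d)%:F|.+1 != 0 by rewrite expf_neq0.
  have r1 : le r != 0 by rewrite -tofrac_eq0 -E mulf_neq0.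
  have := val_R C P (gr_lead r) r1; rewrite -E.
  rewrite (valM C P (hfr_R H (gr_lead d)) (hfrXn H _ hu)) // (valXn C P _ hu) //.
  have := val_R C P (gr_lead d) ld0; rewrite -/(le d).
  by move=> v0; rewrite leNgt addmulrn_lt0.
have lE : le x = r0 * le y.
  by apply/eqP; rewrite -tofrac_eq tofracM -r0E divfK.
have sgx := gr_lead x; have /(grP H) gx := gr_lead x; have /(grP H) gy := gr_lead y.
have g0 t : t != 0 -> (0 < size (grading H t))%N.
  by move=> /grading_neq0; rewrite lt0n size_poly_eq0.
have r00 : r0 != 0 by apply: contraNneq lx0 => r00; rewrite lE r00 mul0r.
have lr0 := le0 r0 r00.
have E : le x *: 'X^((size (grading H x)).-1) = grading H r0 * (le y *: 'X^((size (grading H y)).-1)).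
  by rewrite -gx -/(le x) lE rmorphM /= gy.
have sE : size (grading H x) = size (grading H (r0 * y)).
  have := congr1 (fun p : {poly R} => size p) E.
  have nz : le y *: 'X^((size (grading H y)).-1) != 0 by rewrite -size_poly_eq0 size_scale // size_polyXn.
  rewrite (size_mul (grading_neq0 r00) nz).
  rewrite !size_scale // !size_polyXn !prednK ?g0 // => ->.
  by rewrite rmorphM size_mul ?grading_neq0.
have lE' : lead_coef (grading H x) = lead_coef (grading H (r0 * y)).
  have := congr1 (fun p : {poly R} => lead_coef p) E.
  by rewrite lead_coefM !lead_coefZ !lead_coefXn !mulr1 rmorphM lead_coefM.
have [||s sE'] := IH (x - r0 * y).
- rewrite rmorphB /=; apply: leq_trans szx; apply: size_subr_lead => //; exact: grading_neq0.
- rewrite tofracB tofracM mulrBl (mulfK yF); exact: integral_tofracB.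
exists (s + r0); rewrite tofracD -sE' tofracB tofracM mulrBl mulfK // subrK.
by [].
Qed.

Theorem krull_dim_curve : krull_dim R 2.
Proof.
split; last exact: no_prime_chain3 H.
have [P _] := plane_point H 0.
(* [t0] keeps the component of degree 0, so its kernel is the irrelevant ideal: the chain is 0, a
   point, the irrelevant ideal. *)
pose t0 : {rmorphism R -> R} := horner_eval 0 \o grading H.
pose I (n : nat) : {pred R} := fun x => if n is 0 then x == 0 else if n is 1 then x \in P else t0 x == 0.
exists I; split=> [[|[|[|]]] //= _|[|[|]] //= _].
- exact: (ker_prime (idfun : {rmorphism R -> R})).
- exact: point_prime.
- exact: (ker_prime t0).
- split=> [x|]; rewrite /I /in_mem /=.
    by move=> /eqP ->; apply: (pid0 (point_prime P)).
  by have [n [x [_ xP x0]]] := point_gr_neq0 H P; exists x.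
split=> [x|]; rewrite /I /in_mem /=.
  move=> xP; have := point_coef H 0 xP; rewrite /horner_eval horner_coef0.
  have [y ->] := gr0_cst H (gr_coef H x 0).
  have [->|y0] := eqVneq y 0; first by rewrite /structure_map mpolyC0 rmorph0 eqxx.
  by rewrite (negbTE (cst_notin P y0)).
have [i iP] := point_var P; exists (pi 'X_i); split=> //.
have /(grP H) := gr_X a b c pi i; rewrite /horner_eval => ->.
by rewrite hornerZ hornerXn expr0n gtn_eqF ?mulr0 ?(wt_gt0 H).
Qed.

End Converse.

(** * Irreducibility *)

Definition prime_elt (A : comNzRingType) (F : A) :=
  forall p q r, p * q = r * F -> (exists s, p = s * F) \/ exists s, q = s * F.

Lemma prime_elt_iso (A B : comNzRingType) (phi : {rmorphism A -> B}) F :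
  injective phi -> (forall y, exists x, phi x = y) -> prime_elt (phi F) -> prime_elt F.
Proof.
move=> inj sj pF p q r E; have := pF (phi p) (phi q) (phi r).
rewrite -!rmorphM E => /(_ erefl)[] [s sE]; have [t tE] := sj s.
  by left; exists t; apply: inj; rewrite rmorphM tE.
by right; exists t; apply: inj; rewrite rmorphM tE.
Qed.

Lemma poly_factor_X (D : idomainType) (p : {poly D}) : p != 0 ->
  exists s u, u.[0] != 0 /\ p = u * 'X^s.
Proof.
move=> p0; have [s [u + ->]] := multiplicity_XsubC p 0.
by rewrite p0 /= subr0 => u0; exists s, u.
Qed.

Lemma poly_root0 (D : idomainType) (p : {poly D}) : p.[0] = 0 -> exists q, p = q * 'X.
Proof. by move=> /eqP/factor_theorem[q ->]; exists q; rewrite subr0. Qed.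

Section Eisenstein.

Variable D : idomainType.
Implicit Types p q r : {poly {poly D}}.

(** Evaluation of the inner variable at 0, obtained by exchanging it with the outer one. *)
Definition atY0 p : {poly D} := (swapXY p).[0].
Definition at00 p : D := p.[0].[0].

HB.instance Definition _ := GRing.RMorphism.copy atY0 (horner_eval 0 \o @swapXY D).
HB.instance Definition _ := GRing.RMorphism.copy at00 (horner_eval 0 \o horner_eval 0).

Lemma coef_atY0 p i : (atY0 p)`_i = (p`_i).[0].
Proof. by rewrite /atY0 !horner_coef0 coef_swapXY. Qed.

Lemma at00_atY0 p : (atY0 p).[0] = at00 p.
Proof. by rewrite /at00 !horner_coef0 coef_atY0 horner_coef0. Qed.

Lemma atY0_root p : atY0 p = 0 -> exists q, p = q * 'Y.
Proof.
move=> /poly_root0[q E]; exists (swapXY q).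
by apply: (can_inj swapXYK); rewrite E rmorphM /= swapXYK swapXY_Y.
Qed.

Lemma atY0_Y : atY0 'Y = 0. Proof. by rewrite /atY0 swapXY_Y hornerX. Qed.
Lemma atY0_X : atY0 'X = 'X. Proof. by rewrite /atY0 swapXY_X hornerC. Qed.
Lemma atY0_map (u : {poly D}) : atY0 u^:P = u.
Proof. by rewrite /atY0 swapXY_map_polyC hornerC. Qed.

Lemma factor_Y p : p != 0 -> exists e q, atY0 q != 0 /\ p = 'Y ^+ e * q.
Proof.
rewrite -swapXY_eq0 => /poly_factor_X[e [u [u0 E]]]; exists e, (swapXY u).
rewrite /atY0 swapXYK; split=> //; apply: (can_inj swapXYK).
by rewrite E rmorphM rmorphXn /= swapXY_Y swapXYK mulrC.
Qed.

Variables (e0 : D) (d : nat) (G : {poly {poly D}}).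
Local Notation F := (e0%:P%:P * 'X^d + 'Y * G).
Local Notation I p := (exists s, p = s * F).

Hypotheses (d_gt0 : (0 < d)%N) (szG : (size G <= d)%N) (G00 : at00 G != 0) (e00 : e0 != 0).
Hypothesis e0_reg : forall p, I (e0%:P%:P * p) -> I p.

Let at00_Y : at00 'Y = 0. Proof. by rewrite /at00 hornerC hornerX. Qed.
Let at00_X : at00 'X = 0. Proof. by rewrite /at00 hornerX horner0. Qed.

Lemma eisenstein_Y_reg p : I ('Y * p) -> I p.
Proof.
move=> [s E]; have := congr1 atY0 E.
rewrite !(rmorphM, rmorphD, rmorphXn) /= atY0_X atY0_Y !mul0r addr0.
have -> : atY0 e0%:P%:P = e0%:P by rewrite -(map_polyC (@polyC D)) atY0_map.
move/esym/eqP; rewrite mulf_eq0 mulf_eq0 polyC_eq0 (negbTE e00) /= expf_eq0 polyX_eq0 andbF orbF.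
move=> /eqP/atY0_root[t tE]; exists t; apply: (@mulfI _ 'Y); first by rewrite polyC_eq0 polyX_eq0.
by rewrite E tE mulrCA mulrA.
Qed.

Lemma eisenstein_X_reg p : I ('X * p) -> I p.
Proof.
move=> [s E]; have := congr1 (fun q => q.[0]) E.
rewrite !hornerM hornerX mul0r hornerD !hornerM !hornerE expr0n gtn_eqF // mulr0 add0r.
have G0 : G.[0] != 0 by apply: contraNneq G00 => G0; rewrite /at00 G0 horner0.
move/esym/eqP; rewrite !mulf_eq0 (negbTE G0) polyX_eq0 !orbF => /eqP/poly_root0[t tE].
exists t; apply: (@mulfI _ 'X); first by rewrite polyX_eq0.
by rewrite E tE mulrCA mulrA.
Qed.

(* At the origin Y is a unit multiple of X^d modulo F, so that up to units
   every element outside (F) is a monomial. *)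
Lemma eisenstein_monomial p : I p \/
  exists m u i j s, [/\ at00 m != 0, at00 u != 0 & m * p = 'Y ^+ i * ('X ^+ j * u) + s * F].
Proof.
have szYG : (size ('Y * G)%R < size (e0%:P%:P * 'X^d : {poly {poly D}})%R)%N.
  rewrite !mul_polyC !size_scale ?polyX_eq0 ?polyC_eq0 // size_polyXn ltnS //.
have lF : lead_coef F = e0%:P by rewrite lead_coefDl // lead_coefM lead_coefC lead_coefXn mulr1.
have F0 : F != 0 by rewrite -lead_coef_eq0 lF polyC_eq0.
have szF : size F = d.+1 by rewrite size_polyDl // mul_polyC size_scale ?polyC_eq0 // size_polyXn.
(* Pseudo-division by F: its leading coefficient e0 need not be a unit, but powers of e0 can be
   cancelled modulo F by [e0_reg]. *)
have := Pdiv.Idomain.divp_eq p F; have := ltn_modp p F; rewrite F0 szF lF ltnS.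
move: (scalp p F) (p %/ F) (p %% F) => n Q S szS; rewrite -mul_polyC => E.
have {}E : e0%:P%:P ^+ n * p = Q * F + S by rewrite -E -!rmorphXn.
have [S0|S0] := eqVneq S 0.
  left; have : I (e0%:P%:P ^+ n * p) by exists Q; rewrite E S0 addr0.
  by elim: (n) => [|i IH]; rewrite ?expr0 ?mul1r // exprS -mulrA => /e0_reg.
right; have [i [S' [S'0 SE]]] := factor_Y S0.
have [j [u0 [u00 uE]]] := poly_factor_X S'0.
have szS' : (size S' <= d)%N.
  apply: leq_trans szS; rewrite SE -rmorphXn mul_polyC size_scale //.
  by rewrite expf_eq0 polyX_eq0 andbF.
have jd : (j < d)%N.
  have : (size (atY0 S') <= d)%N.
    by apply/leq_sizeP => t dt; rewrite coef_atY0 (leq_sizeP _ _ szS') // horner0.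
  have u0n : u0 != 0 by apply: contraNneq u00 => ->; rewrite horner0.
  have su : (0 < size u0)%N by rewrite lt0n size_poly_eq0.
  by rewrite uE size_Mmonic ?monicXn // size_polyXn addnS /=; apply: leq_trans; rewrite -add1n leq_add2r.
have [E1 E1E] : exists E1, S' = (atY0 S')^:P + E1 * 'Y.
  have [|E1 E1E] := @atY0_root (S' - (atY0 S')^:P); first by rewrite rmorphB /= atY0_map subrr.
  by exists E1; rewrite -E1E addrC subrK.
have dj : (0 < d - j)%N by rewrite subn_gt0.
(* The remainder is Y^i S' with S' = X^j u0 + Y E1 and j < d. As Y G is - e0 X^d modulo F,
   multiplying by G turns S' into X^j times G u0 - e0 X^(d - j) E1, which does not vanish at the
   origin. *)
exists (G * e0%:P%:P ^+ n), (G * u0^:P - e0%:P%:P * 'X ^+ (d - j) * E1), i, j, (G * Q + 'Y ^+ i * E1).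
split.
- by rewrite rmorphM rmorphXn /= mulf_neq0 // expf_neq0 // /at00 !hornerC.
- rewrite rmorphB !rmorphM rmorphXn /= at00_X expr0n gtn_eqF // mulr0 mul0r subr0.
  by rewrite -[at00 u0^:P]at00_atY0 atY0_map mulf_neq0.
transitivity (G * (e0%:P%:P ^+ n * p)); first by ring.
rewrite E SE E1E uE rmorphM /= map_polyXn -(subnK (ltnW jd)) exprD.
rewrite addnK; ring.
Qed.

(** If neither factor were in (F), the product of their monomial forms would be. Cancelling the
    powers of X and Y, which are regular modulo F, puts u u' in (F); but F vanishes at the origin
    and u u' does not. The hypothesis [e0_reg] takes the place of invertibility of e0, which in the
    examples is a power of the third variable. *)
Theorem eisenstein_prime : prime_elt F.
Proof.
move=> p q r E; have F00 : at00 F = 0.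
  by rewrite rmorphD !rmorphM rmorphXn /= at00_X at00_Y expr0n gtn_eqF // mul0r mulr0 addr0.
have [|[m [u [i [j [s [m0 u0 mE]]]]]]] := eisenstein_monomial p; first by left.
have [|[m' [u' [i' [j' [s' [m0' u0' mE']]]]]]] := eisenstein_monomial q; first by right.
exfalso; have : I ('Y ^+ i * ('Y ^+ i' * ('X ^+ j * ('X ^+ j' * (u * u'))))).
  exists (m * m' * r - s * (m' * q) - s' * ('Y ^+ i * ('X ^+ j * u))).
  have {1}-> : m * m' * r - s * (m' * q) - s' * ('Y ^+ i * ('X ^+ j * u)) =
    m * m' * r - s * ('Y ^+ i' * ('X ^+ j' * u') + s' * F) - s' * ('Y ^+ i * ('X ^+ j * u)) by rewrite mE'.
  have : m * p * (m' * q) = m * m' * (r * F) by rewrite -E; ring.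
  by rewrite mE mE' => E2; rewrite mulrBl mulrBl -[m * m' * r * _]mulrA -E2; ring.
have regY n x : I ('Y ^+ n * x) -> I x.
  by elim: n => [|n IH]; rewrite ?expr0 ?mul1r // exprS -mulrA => /eisenstein_Y_reg.
have regX n x : I ('X ^+ n * x) -> I x.
  by elim: n => [|n IH]; rewrite ?expr0 ?mul1r // exprS -mulrA => /eisenstein_X_reg.
move=> /regY/regY/regX/regX[t tE]; have : at00 u * at00 u' = at00 t * at00 F by rewrite -!rmorphM tE.
rewrite F00 mulr0 => /eqP; by rewrite mulf_eq0 (negbTE u0) (negbTE u0').
Qed.

End Eisenstein.

(* The norm of p + q X is p^2 + c q^2, whose two terms have degrees of different parity. *)
Lemma sqr_plus_odd_prime (D : idomainType) (c : {poly D}) :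
  ~~ odd (size c) -> c != 0 -> prime_elt ('X^2 + c%:P).
Proof.
move=> oc c0; set F := 'X^2 + c%:P.
have szF : size F = 3 by rewrite size_polyDl size_polyXn // size_polyC; case: eqP.
have mF : F \is monic.
  by rewrite monicE lead_coefDl ?lead_coefXn // size_polyXn size_polyC; case: eqP.
have red (p : {poly {poly D}}) : exists Q x y, p = Q * F + (x%:P + y%:P * 'X).
  exists (Pdiv.Ring.rdivp p F), (Pdiv.Ring.rmodp p F)`_0, (Pdiv.Ring.rmodp p F)`_1; rewrite {1}(Pdiv.RingMonic.rdivp_eq mF p).
  congr (_ + _); apply/polyP => i; rewrite coefD coefC coefCM coefX.
  case: i => [|[|i]]; rewrite ?mulr0 ?addr0 ?mulr1 ?add0r //=.
  apply: (leq_sizeP _ 2) => //; have := Pdiv.Ring.ltn_rmodp p F; rewrite (monic_neq0 mF) szF ltnS.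
  by [].
move=> p q r E; have [Q [x [y pE]]] := red p; have [Q' [x' [y' qE]]] := red q.
have [N0|N0] := eqVneq (x ^+ 2 + c * y ^+ 2) 0.
  have y0 : y = 0.
    apply/eqP/negPn/negP => y0; have x0 : x != 0.
      apply/negP => /eqP x0; move/eqP: N0; rewrite x0 expr0n add0r mulf_eq0 (negbTE c0).
      by rewrite expf_eq0 (negbTE y0).
    have /eqP := N0; rewrite addr_eq0 => /eqP /(congr1 (fun t : {poly D} => size t)).
    rewrite size_polyN size_mul ?expf_neq0 // !expr2 !size_mul ?mulf_neq0 //.
    have sx : (0 < size x)%N by rewrite lt0n size_poly_eq0.
    have sy : (0 < size y)%N by rewrite lt0n size_poly_eq0.
    have sc : (0 < size c)%N by rewrite lt0n size_poly_eq0.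
    by have := odd_double_half (size c); rewrite (negbTE oc); lia.
  left; exists Q; move: N0; rewrite pE y0 expr0n mulr0 addr0 => /eqP.
  by rewrite expf_eq0 => /eqP ->; rewrite mul0r !addr0.
right; exists Q'; rewrite qE.
have [t tE] : exists t, ((x ^+ 2 + c * y ^+ 2) * x')%:P + ((x ^+ 2 + c * y ^+ 2) * y')%:P * 'X = t * F.
  exists ((x%:P - y%:P * 'X) * (r - Q * q) - ((x ^+ 2 + c * y ^+ 2)%:P) * Q' + y%:P ^+ 2 * q).
  have E1 : (x%:P + y%:P * 'X) * q = (r - Q * q) * F by rewrite mulrBl -E pE; ring.
  transitivity ((x%:P - y%:P * 'X) * ((r - Q * q) * F) - (x ^+ 2 + c * y ^+ 2)%:P * Q' * F + y%:P ^+ 2 * q * F).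
    by rewrite -E1 qE /F !(rmorphM, rmorphD, rmorphXn) /=; ring.
  by ring.
have t0 : t = 0.
  apply/eqP/negPn/negP => t0; have := congr1 (fun u : {poly {poly D}} => size u) tE.
  rewrite size_Mmonic // szF addn3 /=; apply/eqP; rewrite ltn_eqF //.
  apply: leq_ltn_trans (size_polyD _ _) _; rewrite gtn_max; apply/andP; split.
    by apply: leq_ltn_trans (size_polyC_leq1 _) _.
  rewrite mul_polyC; apply: leq_ltn_trans (size_scale_leq _ _) _; rewrite size_polyX.
  by rewrite -[2%R]/2%N !ltnS size_poly_gt0.
move: tE; rewrite t0 mul0r => /polyP E2.
have := E2 0%N; rewrite coefD coefC coefCM coefX mulr0 addr0 coef0 => /eqP /=.
have := E2 1%N; rewrite coefD coefC coefCM coefX mulr1 add0r coef0 => /eqP.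
by rewrite !mulf_eq0 (negbTE N0) /= => /eqP -> /eqP ->; rewrite mul0r !addr0.
Qed.

Record prime_elt_of (A : comNzRingType) := PrimeElt {
  prime_elt_val :> A;
  prime_eltP : prime_elt prime_elt_val;
  prime_elt_proper : forall q, 1 != q * prime_elt_val }.

Section PrimeQuotient.

Variables (A : comNzRingType) (F : prime_elt_of A).

Definition multiples : A -> bool := fun x => `[< exists q : A, x = q * prime_elt_val F >].

Lemma multiplesP x : reflect (exists q : A, x = q * prime_elt_val F) (x \in multiples).
Proof. exact: asboolP. Qed.

Lemma multiples_closed : idealr_closed multiples.
Proof.
split.
- by apply/multiplesP; exists 0; rewrite mul0r.
- by apply/multiplesP => -[q /eqP]; apply/negP; apply: prime_elt_proper.
move=> a _ _ /multiplesP[u ->] /multiplesP[v ->]; apply/multiplesP.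
by exists (a * u + v); rewrite mulrDl mulrA.
Qed.

Lemma multiples_prime : prime_idealr_closed multiples.
Proof.
by move=> u v /multiplesP[r /prime_eltP[] [s ->]]; apply/orP; [left|right];
  apply/multiplesP; exists s.
Qed.

HB.instance Definition _ := isIdealr.Build A multiples multiples_closed.
HB.instance Definition _ := isPrimeIdealrClosed.Build A multiples multiples_prime.

Definition multiples_ideal : prime_idealr A := multiples.
Definition prime_quotient := {ideal_quot multiples_ideal}.
HB.instance Definition _ := GRing.ComNzRing.on prime_quotient.

Definition pq_unit (x : prime_quotient) : bool := `[< exists y, y * x = 1 >].
Definition pq_inv (x : prime_quotient) : prime_quotient :=
  if pselect (exists y, y * x = 1) is left h then projT1 (cid h) else x.

Lemma pq_mulV : {in pq_unit, left_inverse 1 pq_inv *%R}.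
Proof. by move=> x /asboolP hx; rewrite /pq_inv; case: pselect => // h; case: cid. Qed.

Lemma pq_unitP (x y : prime_quotient) : y * x = 1 -> x \in pq_unit.
Proof. by move=> E; apply/asboolP; exists y. Qed.

Lemma pq_inv_out : {in [predC pq_unit], pq_inv =1 id}.
Proof. by move=> x /asboolPn hx; rewrite /pq_inv; case: pselect. Qed.

HB.instance Definition _ := GRing.ComNzRing_hasMulInverse.Build prime_quotient
  pq_mulV pq_unitP pq_inv_out.

Lemma pq_domain (x y : prime_quotient) : x * y = 0 -> (x == 0) || (y == 0).
Proof. exact: Quotient.rquot_IdomainAxiom. Qed.

HB.instance Definition _ := GRing.ComUnitRing_isIntegral.Build prime_quotient pq_domain.

End PrimeQuotient.

Lemma prime_quotient_ex (A : comNzRingType) (F : A) :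
  prime_elt F -> (forall q, 1 != q * F) ->
  exists (R : idomainType) (pi : {rmorphism A -> R}),
    (forall x, exists p, pi p = x) /\ forall p, pi p = 0 <-> exists q, p = q * F.
Proof.
move=> pF nF; pose F' := PrimeElt pF nF.
exists (prime_quotient F' : idomainType), (\pi_(prime_quotient F')%qT : {rmorphism A -> prime_quotient F'}).
split=> [x|p]; first by exists (repr x); exact: reprK.
split=> [E|[q pE]].
  apply/(multiplesP F'); rewrite -[p]subr0 Quotient.idealrBE; apply/eqP.
  by rewrite E rmorph0.
have /(multiplesP F') : exists q : A, p = q * prime_elt_val F' by exists q.
rewrite -[p]subr0 Quotient.idealrBE subr0 => /eqP E; transitivity (\pi_(prime_quotient F')%qT 0); last exact: rmorph0.
exact: E.
Qed.

(** * Certified smoothness *)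

(** Bezout gives two consecutive elements s and s + 1 of the semigroup. For n >= s^2 the remainder r
    of n by s is at most the quotient t, and n = r (s + 1) + (t - r) s. *)
Lemma numerical_semigroup a b c : (0 < a)%N -> (0 < b)%N -> gcdn a (gcdn b c) = 1%N ->
  exists n0, forall n, (n0 <= n)%N -> exists i j l, n = (i * a + j * b + l * c)%N.
Proof.
move=> a0 b0 g1; have [x _ /dvdnP[t tE]] := Bezoutl (gcdn b c) a0; rewrite g1 in tE.
have [y _ /dvdnP[z zE]] := Bezoutl c b0.
have sE : (t * a + x * y * c = 1 + x * z * b)%N.
  by rewrite -tE -mulnA -addnA -mulnDr zE mulnA.
exists ((x * z * b) * (x * z * b))%N => n hn; set s := (x * z * b)%N in sE hn.
have [s0|s0] := posnP s.
  exists (n * t)%N, 0%N, (n * (x * y))%N.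
  by rewrite mul0n addn0 -[(n * t * a)%N]mulnA -[(n * _ * c)%N]mulnA -mulnDr sE s0 muln1.
have rq : (n %% s <= n %/ s)%N.
  by apply: leq_trans (ltnW (ltn_pmod n s0)) _; rewrite leq_divRL.
exists (n %% s * t)%N, ((n %/ s - n %% s) * (x * z))%N, (n %% s * (x * y))%N.
have -> : (n %% s * t * a + (n %/ s - n %% s) * (x * z) * b + n %% s * (x * y) * c =
  n %% s * (t * a + x * y * c) + (n %/ s - n %% s) * s)%N by rewrite /s; lia.
by rewrite sE mulnDr muln1 -addnA -mulnDl subnKC // addnC -divn_eq.
Qed.

Section Realization.

Variables (k : closedFieldType) (a b c h : nat) (f : {mpoly k[3]}).
Hypothesis w_gt0 : forall i, (0 < wt a b c i)%N.
Hypothesis w_coprime : gcdn a (gcdn b c) = 1%N.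
Hypothesis hK : h = (a + b + c).+1.
Hypothesis hf : f \is h.-homog for (wdeg a b c).

Lemma smooth_neq0 : smooth f -> f != 0.
Proof.
move=> sm; apply/eqP => f0; have [||t] := sm (fun _ => 1).
- by exists 0; apply: oner_neq0.
- by rewrite f0 meval0.
by rewrite f0 raddf0 meval0 eqxx.
Qed.

Theorem curve_realization : smooth f -> prime_elt f ->
  exists (R : idomainType) (pi : {rmorphism {mpoly k[3]} -> R}) (D : point (piece a b c pi) -> rat),
    [/\ normal_graded_hypersurface a b c pi h, ample_qdivisor D & is_section_ring D].
Proof.
move=> sm pf; have f00 : f.@[fun _ => 0] = 0.
  (* At the origin no coordinate is nonzero, so [hom_dvd] applies with any q; q = h + 1 does not
     divide h > 0. *)
  apply/eqP/negPn/negP => ne; have := @hom_dvd k a b c (fun _ => 0) h.+1 _ h f hf ne.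
  by move=> /(_ (fun i => ltac:(by rewrite eqxx)))/dvdn_leq; rewrite hK ltnn => /(_ isT).
have nu q : 1 != q * f.
  apply/eqP => /(congr1 (meval (fun _ => 0 : k))); rewrite meval1 mevalM f00 mulr0 => /eqP.
  by rewrite oner_eq0.
have [R [pi [sj kr]]] := prime_quotient_ex pf nu; exists R, pi.
have H : hsurf a b c pi h f by split=> //; exact: smooth_neq0.
have wh i : (wt a b c i < h)%N.
  have := w_gt0 0; have := w_gt0 1; have := w_gt0 2%:R; rewrite hK.
  by elim/ord3_ind: i; rewrite /wt /=; lia.
have X0 i := pi_X_neq0 H (wh i).
have pieces : exists n0, forall n, (n0 <= n)%N -> exists x, piece a b c pi n x /\ x != 0.
  have [n0 hn] := numerical_semigroup (w_gt0 0) (w_gt0 1) w_coprime; exists n0 => n /hn[i [j [l ->]]].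
  exists (pi 'X_0 ^+ i * pi 'X_1 ^+ j * pi 'X_2%:R ^+ l); split; last by rewrite !mulf_neq0 ?expf_neq0.
  rewrite [(i * a)%N]mulnC [(j * b)%N]mulnC [(l * c)%N]mulnC.
  by apply: (grM H); [apply: (grM H)|]; apply: (grXn H); [exact: (gr_X a b c pi 0)|exact: (gr_X a b c pi 1)|exact: (gr_X a b c pi 2%:R)].
have [C] := curve_ex H sm pieces; exists (stdD C); split.
- split=> //; first by split; [exact: (w_gt0 0)|exact: (w_gt0 1)|exact: (w_gt0 2%:R)].
    by exists f.
  by split; [exact: krull_dim_curve C|exact: normal_domain_curve C].
- exact: ample_stdD.
exact: section_ring_stdD.
Qed.

End Realization.

Definition mono : Type := nat * nat * nat.
Definition mexp (m : mono) (i : nat) : nat := nth 0%N [:: m.1.1; m.1.2; m.2] i.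
Definition mdec (i : nat) (m : mono) : mono :=
  (m.1.1 - (i == 0), m.1.2 - (i == 1), m.2 - (i == 2))%N.
Definition mmul (m m' : mono) : mono := (m.1.1 + m'.1.1, m.1.2 + m'.1.2, m.2 + m'.2)%N.
Definition mpow (i n : nat) : mono := (n * (i == 0), n * (i == 1), n * (i == 2))%N.

Definition ipoly := seq (int * mono).
Definition imul (x : int * mono) (L : ipoly) : ipoly := [seq (x.1 * y.1, mmul x.2 y.2) | y <- L].
Fixpoint iadd (x : int * mono) (L : ipoly) : ipoly :=
  if L is y :: L' then if x.2 == y.2 then (x.1 + y.1, y.2) :: L' else y :: iadd x L' else [:: x].
Definition igen (s : seq mono) (g : nat) : ipoly :=
  if g is t.+1 then [seq ((mexp m t)%:Z, mdec t m) | m <- s] else [seq (1, m) | m <- s].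

(* (t, N, u, L) certifies u X_t^N = sum of the c M g over the entries (g, M, c)
   of L, where g = 0 stands for f and g = i + 1 for its i-th derivative. *)
Definition cert : Type := (nat * nat * nat * seq (nat * mono * int))%type.
Definition cert_poly (s : seq mono) (C : cert) : ipoly :=
  (- C.1.2%:Z, mpow C.1.1.1 C.1.1.2) :: flatten [seq imul (x.2, x.1.2) (igen s x.1.1) | x <- C.2].
(** p is an integer that is 0 in k, with p = 0 for an identity over the integers, and e one that is
    nonzero in k; u divides e and so can be cancelled. Terms with a variable in [killed], already
    shown to vanish, are dropped. *)
Definition cert_ok (p e : nat) (s : seq mono) (killed : seq nat) (C : cert) : bool :=
  [&& (0 < C.1.1.2)%N, (C.1.2 %| e)%N & all (fun x : int * mono =>
     (p %| `|x.1|)%N || has (fun i => 0 < mexp x.2 i)%N killed) (foldr iadd [::] (cert_poly s C))].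
Fixpoint certs_ok (p e : nat) (s : seq mono) (killed : seq nat) (Cs : seq cert) : bool :=
  if Cs is C :: Cs' then cert_ok p e s killed C && certs_ok p e s (C.1.1.1 :: killed) Cs'
  else all (fun i => i \in killed) [:: 0; 1; 2]%N.

Section Certificates.

Variables (k : closedFieldType) (p0 : 'I_3 -> k).

Definition mval (m : mono) : k := \prod_(i < 3) p0 i ^+ mexp m i.
Definition ieval (L : ipoly) : k := \sum_(x <- L) x.1%:~R * mval x.2.

Lemma mexp_mmul m m' i : mexp (mmul m m') i = (mexp m i + mexp m' i)%N.
Proof. by case: i => [|[|[|i]]] //; rewrite /mexp /= !nth_nil. Qed.

Lemma mexp_mpow t n i : (i < 3)%N -> mexp (mpow t n) i = (n * (t == i))%N.
Proof. by case: i => [|[|[|]]]. Qed.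

Lemma mexp_mdec t m i : (i < 3)%N -> mexp (mdec t m) i = (mexp m i - (t == i))%N.
Proof. by case: i => [|[|[|]]]. Qed.

Lemma mvalM m m' : mval (mmul m m') = mval m * mval m'.
Proof.
by rewrite -big_split; apply: eq_bigr => i _; rewrite mexp_mmul exprD.
Qed.

Lemma mval_mpow (t : 'I_3) n : mval (mpow t n) = p0 t ^+ n.
Proof.
rewrite /mval (bigD1 t) //= mexp_mpow // eqxx muln1 big1 ?mulr1 // => i it.
by rewrite mexp_mpow // [_ == _]eq_sym val_eqE (negbTE it) muln0.
Qed.

Lemma ieval_mul x L : ieval (imul x L) = x.1%:~R * mval x.2 * ieval L.
Proof.
rewrite /ieval big_map mulr_sumr; apply: eq_bigr => y _ /=.
by rewrite rmorphM mvalM mulrACA.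
Qed.

Lemma ieval_add x L : ieval (iadd x L) = x.1%:~R * mval x.2 + ieval L.
Proof.
rewrite /ieval; elim: L => [|y L IH] /=; first by rewrite big_seq1 big_nil addr0.
case: eqP => [->|_]; rewrite !big_cons /=; last by rewrite IH addrCA.
by rewrite rmorphD mulrDl addrA.
Qed.

Lemma ieval_norm L : ieval (foldr iadd [::] L) = ieval L.
Proof. by elim: L => //= x L IH; rewrite ieval_add IH /ieval big_cons. Qed.

Lemma certs_sound p e s killed Cs : p%:R = 0 :> k -> e%:R != 0 :> k ->
  (forall g, ieval (igen s g) = 0) -> (forall i : 'I_3, (i : nat) \in killed -> p0 i = 0) ->
  certs_ok p e s killed Cs -> forall i, p0 i = 0.
Proof.
move=> hp he hg; elim: Cs killed => [|[[[t N] u] L] Cs IH] killed hk /=.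
  by move=> /and4P[h0 h1 h2 _] [[|[|[|]]] i3] //; apply: hk.
move=> /andP[/and3P[/= N0 /dvdnP[v eE] /allP al]]; apply: IH => i.
rewrite inE => /orP[/eqP it|/hk //].
have : ieval (cert_poly s (t, N, u, L)) = 0.
  rewrite -ieval_norm /ieval big_seq big1 // => -[z m] /al /= /orP[/dvdnP[q zE]|/hasP[j jk mj]].
    by rewrite [z]intEsign zE rmorphM /= -pmulrn natrM hp !mulr0 mul0r.
  have j3 : (j < 3)%N by case: (j) mj => [|[|[|n]]] //; rewrite /mexp /= nth_nil.
  by rewrite /mval (bigD1 (Ordinal j3)) //= (hk (Ordinal j3) jk) expr0n gtn_eqF // mul0r mulr0.
rewrite /ieval big_cons -/(ieval _) /= -it mval_mpow rmorphN /= mulNr.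
have -> : ieval (flatten [seq imul (x.2, x.1.2) (igen s x.1.1) | x <- L]) = 0.
  rewrite /ieval big_flatten big_map big1 // => x _.
  by rewrite -/(ieval _) ieval_mul hg mulr0.
rewrite addr0 => /eqP; rewrite oppr_eq0 mulf_eq0 expf_eq0 N0 -pmulrn /= => /orP[/eqP u0|/eqP //].
by move: he; rewrite eE natrM u0 mulr0 eqxx.
Qed.

End Certificates.

Definition mnm3 (m : mono) : 'X_{1..3} := [multinom mexp m i | i < 3].
Definition fpoly (k : closedFieldType) (s : seq mono) : {mpoly k[3]} := \sum_(m <- s) 'X_[mnm3 m].

Section SmoothCheck.

Variables (k : closedFieldType) (s : seq mono).
Local Notation f := (fpoly k s).

Lemma meval_fpoly p0 : f.@[p0] = ieval p0 (igen s 0).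
Proof.
rewrite /f rmorph_sum /ieval big_map; apply: eq_bigr => m _ /=.
by rewrite mevalX mul1r; apply: eq_bigr => i _; rewrite mnmE.
Qed.

Lemma deriv_fpoly p0 (t : 'I_3) : f^`M(t).@[p0] = ieval p0 (igen s t.+1).
Proof.
have -> : f^`M(t) = \sum_(m <- s) ('X_[mnm3 m])^`M(t) by rewrite /f raddf_sum.
rewrite rmorph_sum /ieval big_map; apply: eq_bigr => m _ /=.
rewrite mderivX mevalZ mevalX mnmE -pmulrn; congr (_ * _); apply: eq_bigr => i _.
by rewrite mnmBE mnmE mnm1E mexp_mdec // val_eqE.
Qed.

Lemma smooth_check p e Cs : p%:R = 0 :> k -> e%:R != 0 :> k -> certs_ok p e s [::] Cs -> smooth f.
Proof.
move=> hp he ok p0 [i pi0] f0; apply: contrapT => no.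
move/negP: pi0; apply; apply/eqP; apply: (certs_sound hp he _ _ ok) => // -[|g]; rewrite -?meval_fpoly //.
have [g3|g3] := ltnP g 3.
  rewrite -(deriv_fpoly p0 (Ordinal g3)); apply/eqP/negPn/negP => ne; apply: no.
  by exists (Ordinal g3).
rewrite /ieval big_map big1 // => m _ /=.
by case: g g3 => [|[|[|g]]] // _; rewrite /mexp /= nth_nil mul0r.
Qed.

Lemma hom_check a b c h :
  all (fun m => m.1.1 * a + m.1.2 * b + m.2 * c == h)%N s -> f \is h.-homog for (wdeg a b c).
Proof.
have hX m n : wdeg a b c m = n -> ('X_[m] : {mpoly k[3]}) \is n.-homog for (wdeg a b c).
  by move=> <-; rewrite dhomogX.
move=> /allP al; rewrite /f big_seq; apply: rpred_sum => m /al /eqP <-.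
apply: hX; rewrite wdegE !big_ord_recr big_ord0 /= !mnmE /=.
by rewrite /mexp /wt /= add0n.
Qed.

End SmoothCheck.

(** * The thirty-one examples *)

(** The hypothesis [e0_reg] for e0 = z^n: if F is nonzero at z = 0, then z is regular modulo F. The
    variable z is the innermost one, so reduction at z = 0 acts two levels down. *)
Lemma const_reg (D : idomainType) (F p : {poly {poly {poly D}}}) n :
  map_poly (map_poly (horner_eval 0)) F != 0 ->
  (exists s, ('X^n)%:P%:P * p = s * F) -> exists s, p = s * F.
Proof.
move=> F0; pose mu : {rmorphism {poly {poly {poly D}}} -> {poly {poly D}}} :=
  map_poly (map_poly (horner_eval 0)).
have Z0 : ('X%:P%:P : {poly {poly {poly D}}}) != 0 by rewrite !polyC_eq0 polyX_eq0.
have mu0 s : mu s = 0 -> exists t, s = 'X%:P%:P * t.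
  move=> s0; exists (map_poly (map_poly (drop_poly 1)) s); apply/polyP => i; apply/polyP => j.
  rewrite !coefCM !coef_map_id0 ?drop_poly0r ?map_poly0 // ?rmorph0 //.
  have := congr1 (fun q : {poly {poly D}} => q`_i`_j) s0.
  rewrite /= !coef_map /= !coef0 /horner_eval horner_coef0; move: (s`_i`_j) => c c0.
  by apply/polyP => -[|l]; rewrite coefXM //= coef_drop_poly addn1.
elim: n p => [|n IH] p [s]; first by rewrite expr0 mul1r; exists s.
rewrite exprS !rmorphM /= -mulrA => E; apply: IH.
have muZ : mu 'X%:P%:P = 0.
  have muC (c : {poly {poly D}}) : mu c%:P = (map_poly (horner_eval 0) c)%:P by exact: map_polyC.
  by rewrite muC map_polyC /= /horner_eval hornerX !polyC0.
have := congr1 mu E; rewrite [mu (_ * _)]rmorphM [mu (s * _)]rmorphM muZ mul0r => /esym/eqP.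
rewrite mulf_eq0 (negbTE F0) orbF => /eqP/mu0[t tE]; exists t.
by apply: (mulfI Z0); rewrite E tE mulrA.
Qed.

(** Reads s as z^n x^d + y G, the shape of [eisenstein_prime]. A count equal to 1 isolates a single
    monomial, so that G at x = y = 0, or f at z = 0, is nonzero in every characteristic without
    cancellation. *)
Definition eis_ok (x y z : nat) (s : seq mono) : bool :=
  if s is m0 :: s' then
    [&& mexp m0 y == 0, 0 < mexp m0 x,
        all (fun m => (0 < mexp m y) && (mexp m x < mexp m0 x)) s',
        count (fun m => (mexp m x == 0) && (mexp m y == 1)) s' == 1 &
        (mexp m0 z == 0) || (count (fun m => mexp m z == 0) s == 1)]%N
  else false.

(** For equations such as x^2 + y^3 + z^7, where no variable occurs to the first power and [eis_ok]
    fails; the odd exponent 3 of y serves [sqr_plus_odd_prime]. *)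
Definition odd_sqr_ok (x y z : nat) (s : seq mono) : bool :=
  if s is [:: m0; m1; m2] then
    [&& mexp m0 x == 2, mexp m0 y == 0, mexp m0 z == 0, mexp m1 x == 0, mexp m1 y == 0,
        mexp m2 x == 0, mexp m2 y == 3 & mexp m2 z == 0]%N
  else false.

Lemma sum_count1 (T : eqType) (V : nmodType) (P : pred T) (F : T -> V) (s : seq T) :
  count P s = 1%N -> (forall m, P m -> F m != 0) -> (forall m, m \in s -> ~~ P m -> F m = 0) ->
  \sum_(m <- s) F m != 0.
Proof.
move=> c1 FP F0; rewrite (bigID P) /= [X in _ + X]big1_seq ?addr0; last by move=> m /andP[nP ms]; apply: F0.
rewrite -big_filter; have : size (filter P s) = 1%N by rewrite size_filter.
have := filter_all P s; case: (filter P s) => [|m [|]] //= /andP[Pm _] _.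
by rewrite big_seq1 FP.
Qed.

Lemma poly_eval_ex (S A : comNzRingType) (g : {rmorphism S -> A}) (v : A) :
  exists G : {rmorphism {poly S} -> A}, G 'X = v /\ forall c, G c%:P = g c.
Proof.
exists (horner_eval v \o map_poly g); split=> [|c]; rewrite /= /horner_eval.
  by rewrite map_polyX hornerX.
by rewrite map_polyC hornerC.
Qed.

Section Tower.

Variables (k : closedFieldType) (x y z : 'I_3).
Hypotheses (yx : y != x) (zx : z != x) (yz : y != z).

Local Notation A3 := {poly {poly {poly k}}}.

Definition tower_var (i : 'I_3) : A3 := if i == x then 'X else if i == y then 'X%:P else 'X%:P%:P.

(** The isomorphism of k[x,y,z] with k[z][y][x], x outermost, on which the irreducibility criteria
    are stated. *)
Definition tower : {mpoly k[3]} -> A3 := mmap (polyC \o (polyC \o polyC)) tower_var.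
HB.instance Definition _ := GRing.RMorphism.on tower.

Lemma tower_X i : tower 'X_i = tower_var i.
Proof. by rewrite /tower mmapX mmap1U. Qed.

Lemma tower_C c : tower c%:MP = c%:P%:P%:P.
Proof. by rewrite /tower mmapC. Qed.

Lemma tower_vars : [/\ tower_var x = 'X, tower_var y = 'X%:P & tower_var z = 'X%:P%:P].
Proof. by rewrite /tower_var !eqxx (negbTE yx) (negbTE zx) [z == y]eq_sym (negbTE yz). Qed.

Lemma tower_mnm m : tower 'X_[m] = (('X^(m z))%:P * 'X^(m y))%:P * 'X^(m x).
Proof.
have [vx vy vz] := tower_vars.
rewrite /tower mmapX /mmap1 (bigD1 x) //= (bigD1 y) //= (bigD1 z) /=; last by rewrite zx eq_sym.
rewrite big1 => [|i /andP[/andP[ix iy] iz]].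
  by rewrite mulr1 vx vy vz !(rmorphM, rmorphXn) /= mulrC; congr (_ * _); rewrite mulrC.
by exfalso; case: (ord3_cases yx zx yz i) => e; move: ix iy iz; rewrite e eqxx.
Qed.

Lemma tower_inj : injective tower.
Proof.
have [g1 [g1X g1C]] := poly_eval_ex (@mpolyC 3 k : {rmorphism k -> {mpoly k[3]}}) 'X_z.
have [g2 [g2X g2C]] := poly_eval_ex g1 'X_y; have [g3 [g3X g3C]] := poly_eval_ex g2 'X_x.
pose th : {rmorphism {mpoly k[3]} -> {mpoly k[3]}} := g3 \o tower.
have invK p : th p = p.
  rewrite -(pi_mmap th p) -[RHS](pi_mmap (idfun : {rmorphism {mpoly k[3]} -> {mpoly k[3]}}) p).
  have -> : structure_map th = structure_map (idfun : {rmorphism {mpoly k[3]} -> {mpoly k[3]}}).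
    by apply/funext => c; rewrite /structure_map /= tower_C g3C g2C g1C.
  congr (mmap _ _ p); apply/funext => i; rewrite /= tower_X; have [vx vy vz] := tower_vars.
  by case: (ord3_cases yx zx yz i) => ->; rewrite ?vx ?vy ?vz ?g3C ?g2C.
by move=> p q E; rewrite -(invK p) -(invK q) /= E.
Qed.

Lemma tower_surj q : exists p, tower p = q.
Proof.
have [vx vy vz] := tower_vars.
have h1 (c : {poly k}) : exists p, tower p = c%:P%:P.
  elim/poly_ind: c => [|c d [p pE]]; first by exists 0; rewrite rmorph0 !polyC0.
  by exists (p * 'X_z + d%:MP); rewrite rmorphD rmorphM /= pE tower_X tower_C vz !(rmorphD, rmorphM).
have h2 (c : {poly {poly k}}) : exists p, tower p = c%:P.
  elim/poly_ind: c => [|c d [p pE]]; first by exists 0; rewrite rmorph0 !polyC0.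
  have [r rE] := h1 d.
  by exists (p * 'X_y + r); rewrite rmorphD rmorphM /= pE rE tower_X vy !(rmorphD, rmorphM).
elim/poly_ind: q => [|c d [p pE]]; first by exists 0; rewrite rmorph0.
have [r rE] := h2 d.
by exists (p * 'X_x + r); rewrite rmorphD rmorphM /= pE rE tower_X vx.
Qed.

Lemma tower_fpoly s : tower (fpoly k s) =
  \sum_(m <- s) (('X^(mexp m z))%:P * 'X^(mexp m y))%:P * 'X^(mexp m x).
Proof. by rewrite /fpoly rmorph_sum; apply: eq_bigr => m _; rewrite /= tower_mnm !mnmE. Qed.

Lemma eisenstein_check s : eis_ok x y z s -> prime_elt (fpoly k s).
Proof.
case: s => // m0 s /= /and5P[/eqP y0 x0 /allP al /eqP c1 hz].
apply: (prime_elt_iso tower_inj tower_surj).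
pose G : A3 := \sum_(m <- s) (('X^(mexp m z))%:P * 'X^((mexp m y).-1))%:P * 'X^(mexp m x).
have E : tower (fpoly k (m0 :: s)) = ('X^(mexp m0 z))%:P%:P * 'X^(mexp m0 x) + 'Y * G.
  rewrite tower_fpoly big_cons y0 expr0 mulr1; congr (_ + _).
  rewrite /G mulr_sumr big_seq [RHS]big_seq; apply: eq_bigr => m /al /andP[my _].
  by rewrite mulrA -rmorphM /= mulrCA -exprS prednK.
have at0 (c : {poly k}) i j : at00 ((c%:P * 'X^i)%:P * 'X^j) = c * 0 ^+ i * 0 ^+ j.
  by rewrite /at00 !(hornerM, hornerC, horner_exp, hornerX, horner0).
rewrite -[X in prime_elt X]/(tower (fpoly k (m0 :: s))) E; apply: eisenstein_prime => //.
- rewrite /G big_seq; apply: (big_ind (fun p : A3 => size p <= mexp m0 x)%N); rewrite ?size_poly0 //.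
    by move=> p q hp hq; apply: leq_trans (size_polyD _ _) _; rewrite geq_max hp.
  move=> m /al /andP[_ mx]; rewrite mul_polyC; apply: leq_trans (size_scale_leq _ _) _.
  by rewrite size_polyXn.
- rewrite rmorph_sum; apply: (sum_count1 c1) => m /=; rewrite at0.
    by move=> /andP[/eqP -> /eqP ->]; rewrite !expr0 !mulr1 expf_neq0 ?polyX_eq0.
  move=> /al /andP[my _]; rewrite negb_and => /orP[/negbTE mx|m1].
    by rewrite [0 ^+ mexp m x]expr0n mx mulr0.
  by rewrite [0 ^+ _.-1]expr0n -(inj_eq succn_inj) prednK // (negbTE m1) mulr0 mul0r.
- by rewrite expf_neq0 ?polyX_eq0.
move=> p [t]; rewrite -E => tE.
have [zE|zn] := eqVneq (mexp m0 z) 0%N; first by exists t; rewrite -tE zE expr0 !polyC1 mul1r.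
apply: (const_reg _ (ex_intro _ t tE)); have c0 : count (fun m => mexp m z == 0%N) (m0 :: s) = 1%N.
  by case/orP: hz => /eqP // e; rewrite e in zn.
have muE A i j : map_poly (map_poly (horner_eval 0)) ((A%:P * 'X^i)%:P * 'X^j : A3) =
    ((A.[0])%:P * 'X^i)%:P * 'X^j.
  by rewrite rmorphM /= map_polyXn map_polyC /= rmorphM /= map_polyXn map_polyC.
rewrite tower_fpoly rmorph_sum; apply: (sum_count1 (s := m0 :: s) c0) => m /=; rewrite muE hornerXn.
  by move=> /eqP ->; rewrite expr0 mulf_neq0 ?expf_neq0 ?polyX_eq0 // polyC_eq0 mulf_neq0 ?expf_neq0 ?polyX_eq0 // polyC1 oner_eq0.
by move=> _ mz; rewrite expr0n (negbTE mz) polyC0 mul0r polyC0 mul0r.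
Qed.

Lemma odd_sqr_check s : odd_sqr_ok x y z s -> prime_elt (fpoly k s).
Proof.
case: s => [|m0 [|m1 [|m2 [|]]]] //= /and5P[/eqP x0 /eqP y0 /eqP z0 /eqP x1].
move=> /and4P[/eqP y1 /eqP x2 /eqP y2 /eqP z2].
apply: (prime_elt_iso tower_inj tower_surj).
pose c : {poly {poly k}} := 'X^3 + ('X^(mexp m1 z))%:P.
have E : tower (fpoly k [:: m0; m1; m2]) = 'X^2 + c%:P.
  rewrite tower_fpoly !big_cons big_nil x0 y0 z0 x1 y1 x2 y2 z2 !expr0 !mulr1 !polyC1 !mul1r addr0.
  by rewrite /c polyCD [_ + ('X^3)%:P]addrC.
have sc : size c = 4 by rewrite size_polyDl size_polyXn // size_polyC; case: eqP.
rewrite -[X in prime_elt X]/(tower (fpoly k [:: m0; m1; m2])) E.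
by apply: sqr_plus_odd_prime; rewrite ?sc // -size_poly_eq0 sc.
Qed.

End Tower.

Definition prime_ok (xyz : mono) (s : seq mono) : bool :=
  (xyz \in [:: (0, 1, 2); (0, 2, 1); (1, 0, 2); (1, 2, 0); (2, 0, 1); (2, 1, 0)]%N) &&
  (eis_ok xyz.1.1 xyz.1.2 xyz.2 s || odd_sqr_ok xyz.1.1 xyz.1.2 xyz.2 s).

Lemma prime_check (k : closedFieldType) xyz s : prime_ok xyz s -> prime_elt (fpoly k s).
Proof.
case/andP=> xyzP ok.
suff : forall x y z : 'I_3, y != x -> z != x -> y != z -> xyz = (x : nat, y : nat, z : nat) -> prime_elt (fpoly k s).
  move: xyzP; rewrite !inE => /or4P[/eqP ->|/eqP ->|/eqP ->|/or3P[]/eqP ->] pr.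
  - exact: (pr 0 1 2%:R).
  - exact: (pr 0 2%:R 1).
  - exact: (pr 1 0 2%:R).
  - exact: (pr 1 2%:R 0).
  - exact: (pr 2%:R 0 1).
  exact: (pr 2%:R 1 0).
move=> x y z yx zx yz E; move: ok; rewrite E => /orP[].
  exact: eisenstein_check.
exact: odd_sqr_check.
Qed.

Definition example : Type := (mono * seq mono * seq cert)%type.
Definition no_example : example := ((0, 0, 0)%N, [::], [::]).

Definition example_ok (p e a b c h : nat) (x : example) : bool :=
  [&& all (fun m => m.1.1 * a + m.1.2 * b + m.2 * c == h)%N x.1.2, prime_ok x.1.1 x.1.2 &
      certs_ok p e x.1.2 [::] x.2].

(* (type, p, x, y): the equation x works when the characteristic is not p, and
   y works in characteristic p; p = 1 when x works in all characteristics. *)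
Definition realization_table : seq ((nat * nat * nat * nat) * nat * example * example) :=
[::
  ((1, 1, 1, 4), 3,
   ((0, 1, 2), [:: (4, 0, 0); (0, 1, 3); (1, 3, 0)], [:: (0, 4, 9, [:: (0, (0, 0, 0), (1)%Z); (2, (0, 1, 0), (-1)%Z); (1, (1, 0, 0), (2)%Z)]); (1, 3, 1, [:: (1, (0, 0, 0), (1)%Z)]); (2, 3, 1, [:: (2, (0, 0, 0), (1)%Z)])]),
   ((0, 1, 2), [:: (4, 0, 0); (0, 1, 3); (0, 3, 1)], [:: (0, 3, 1, [:: (1, (0, 0, 0), (1)%Z)]); (1, 3, 1, [:: (3, (0, 0, 0), (1)%Z)]); (2, 3, 1, [:: (2, (0, 0, 0), (1)%Z)])]));
  ((1, 1, 3, 6), 2,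
   ((2, 0, 1), [:: (0, 0, 2); (1, 5, 0); (5, 1, 0)], [:: (2, 1, 2, [:: (3, (0, 0, 0), (1)%Z)]); (0, 9, 4, [:: (1, (1, 3, 0), (-5)%Z); (0, (0, 3, 0), (5)%Z); (2, (4, 0, 0), (4)%Z)]); (1, 5, 1, [:: (1, (0, 0, 0), (1)%Z)])]),
   ((1, 2, 0), [:: (1, 5, 0); (0, 0, 2); (3, 0, 1)], [:: (0, 3, 1, [:: (3, (0, 0, 0), (1)%Z)]); (1, 5, 1, [:: (1, (0, 0, 0), (1)%Z)]); (2, 2, 1, [:: (0, (0, 0, 0), (1)%Z)])]));
  ((1, 1, 2, 5), 2,
   ((0, 1, 2), [:: (5, 0, 0); (0, 1, 2); (1, 4, 0)], [:: (0, 5, 8, [:: (3, (0, 0, 1), (1)%Z); (1, (1, 0, 0), (2)%Z); (0, (0, 0, 0), (-2)%Z)]); (1, 4, 1, [:: (1, (0, 0, 0), (1)%Z)]); (2, 2, 1, [:: (2, (0, 0, 0), (1)%Z)])]),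
   ((0, 1, 2), [:: (5, 0, 0); (0, 1, 2); (0, 3, 1)], [:: (0, 4, 1, [:: (1, (0, 0, 0), (1)%Z)]); (1, 3, 1, [:: (3, (0, 0, 0), (1)%Z)]); (2, 2, 1, [:: (2, (0, 0, 0), (1)%Z)])]));
  ((1, 2, 2, 6), 3,
   ((0, 1, 2), [:: (6, 0, 0); (0, 1, 2); (0, 2, 1)], [:: (1, 3, 3, [:: (3, (0, 1, 0), (3)%Z); (3, (0, 0, 1), (2)%Z); (2, (0, 1, 0), (-4)%Z)]); (0, 6, 1, [:: (0, (0, 0, 0), (1)%Z)]); (2, 2, 1, [:: (2, (0, 0, 0), (1)%Z)])]),
   ((0, 1, 2), [:: (6, 0, 0); (0, 1, 2); (0, 3, 0); (2, 2, 0)], [:: (0, 7, 1, [:: (0, (1, 0, 0), (1)%Z); (3, (1, 0, 1), (1)%Z); (1, (0, 1, 0), (1)%Z); (1, (2, 0, 0), (1)%Z)]); (2, 2, 1, [:: (2, (0, 0, 0), (1)%Z)]); (1, 3, 1, [:: (0, (0, 0, 0), (1)%Z)])]));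
  ((1, 2, 4, 8), 2,
   ((0, 2, 1), [:: (8, 0, 0); (0, 2, 1); (0, 0, 2)], [:: (0, 7, 8, [:: (1, (0, 0, 0), (1)%Z)]); (1, 3, 1, [:: (3, (0, 1, 0), (1)%Z); (2, (0, 0, 0), (-1)%Z)]); (2, 1, 2, [:: (3, (0, 0, 0), (1)%Z)])]),
   ((0, 2, 1), [:: (8, 0, 0); (0, 2, 1); (0, 0, 2); (2, 1, 1)], [:: (2, 3, 1, [:: (0, (0, 0, 1), (1)%Z); (2, (6, 0, 0), (1)%Z); (3, (0, 0, 2), (1)%Z)]); (0, 8, 1, [:: (0, (0, 0, 0), (1)%Z)]); (1, 2, 1, [:: (3, (0, 0, 0), (1)%Z)])]));
  ((1, 2, 3, 7), 2,
   ((0, 2, 1), [:: (7, 0, 0); (0, 2, 1); (1, 0, 2)], [:: (1, 3, 1, [:: (3, (0, 1, 0), (1)%Z); (2, (1, 0, 0), (-1)%Z)]); (0, 7, 2, [:: (3, (0, 0, 1), (-1)%Z); (0, (0, 0, 0), (2)%Z)]); (2, 2, 1, [:: (1, (0, 0, 0), (1)%Z)])]),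
   ((0, 2, 1), [:: (7, 0, 0); (0, 2, 1); (1, 0, 2); (2, 1, 1)], [:: (0, 8, 1, [:: (1, (2, 0, 0), (1)%Z); (2, (0, 0, 1), (1)%Z)]); (1, 2, 1, [:: (3, (0, 0, 0), (1)%Z)]); (2, 2, 1, [:: (1, (0, 0, 0), (1)%Z)])]));
  ((1, 4, 6, 12), 2,
   ((2, 1, 0), [:: (0, 0, 2); (0, 3, 0); (8, 1, 0)], [:: (0, 15, 8, [:: (2, (7, 0, 0), (8)%Z); (1, (0, 1, 0), (-3)%Z)]); (2, 1, 2, [:: (3, (0, 0, 0), (1)%Z)]); (1, 3, 1, [:: (0, (0, 0, 0), (1)%Z)])]),
   ((2, 1, 0), [:: (0, 0, 2); (0, 3, 0); (8, 1, 0); (2, 1, 1)], [:: (1, 3, 1, [:: (2, (0, 1, 0), (1)%Z); (3, (6, 0, 0), (1)%Z); (3, (0, 0, 1), (1)%Z)]); (2, 2, 1, [:: (0, (0, 0, 0), (1)%Z)]); (0, 8, 1, [:: (2, (0, 0, 0), (1)%Z)])]));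
  ((1, 3, 5, 10), 2,
   ((2, 0, 1), [:: (0, 0, 2); (7, 1, 0); (1, 3, 0)], [:: (2, 1, 2, [:: (3, (0, 0, 0), (1)%Z)]); (0, 13, 2, [:: (2, (0, 2, 0), (3)%Z); (0, (0, 1, 0), (-9)%Z); (2, (6, 0, 0), (2)%Z)]); (1, 3, 1, [:: (1, (0, 0, 0), (1)%Z)])]),
   ((2, 0, 1), [:: (0, 0, 2); (7, 1, 0); (1, 3, 0); (2, 1, 1)], [:: (1, 3, 1, [:: (1, (0, 0, 0), (1)%Z); (3, (4, 0, 0), (1)%Z)]); (2, 2, 1, [:: (0, (0, 0, 0), (1)%Z)]); (0, 7, 1, [:: (2, (0, 0, 0), (1)%Z)])]));
  ((1, 3, 4, 9), 3,
   ((1, 0, 2), [:: (0, 3, 0); (5, 0, 1); (1, 0, 2)], [:: (1, 2, 3, [:: (2, (0, 0, 0), (1)%Z)]); (0, 9, 1, [:: (3, (4, 0, 0), (1)%Z); (0, (0, 0, 0), (-4)%Z); (3, (0, 0, 1), (2)%Z)]); (2, 2, 1, [:: (1, (0, 0, 0), (1)%Z)])]),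
   ((1, 0, 2), [:: (0, 3, 0); (5, 0, 1); (1, 0, 2); (2, 1, 1)], [:: (1, 3, 1, [:: (0, (0, 0, 0), (1)%Z); (2, (3, 0, 0), (1)%Z); (1, (1, 0, 0), (-1)%Z); (2, (0, 1, 0), (1)%Z)]); (0, 6, 1, [:: (3, (1, 0, 0), (1)%Z); (2, (0, 0, 0), (1)%Z)]); (2, 2, 1, [:: (1, (0, 0, 0), (1)%Z)])]));
  ((2, 2, 5, 10), 3,
   ((2, 0, 1), [:: (0, 0, 2); (1, 4, 0); (4, 1, 0)], [:: (0, 7, 3, [:: (2, (3, 0, 0), (3)%Z); (1, (1, 2, 0), (-4)%Z); (3, (0, 2, 1), (-2)%Z); (0, (0, 2, 0), (4)%Z)]); (1, 4, 1, [:: (1, (0, 0, 0), (1)%Z)]); (2, 2, 1, [:: (0, (0, 0, 0), (1)%Z)])]),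
   ((2, 0, 1), [:: (0, 0, 2); (1, 4, 0); (5, 0, 0)], [:: (0, 5, 1, [:: (1, (1, 0, 0), (-1)%Z); (2, (0, 1, 0), (1)%Z)]); (1, 4, 1, [:: (1, (0, 0, 0), (1)%Z)]); (2, 1, 1, [:: (3, (0, 0, 0), (-1)%Z)])]));
  ((2, 2, 3, 8), 3,
   ((0, 1, 2), [:: (4, 0, 0); (0, 1, 2); (1, 3, 0)], [:: (0, 4, 3, [:: (3, (0, 0, 1), (-1)%Z); (2, (0, 1, 0), (-1)%Z); (0, (0, 0, 0), (3)%Z)]); (1, 3, 1, [:: (1, (0, 0, 0), (1)%Z)]); (2, 2, 1, [:: (2, (0, 0, 0), (1)%Z)])]),
   ((0, 1, 2), [:: (4, 0, 0); (0, 1, 2); (0, 4, 0)], [:: (0, 3, 1, [:: (1, (0, 0, 0), (1)%Z)]); (1, 4, 1, [:: (0, (0, 0, 0), (1)%Z); (3, (0, 0, 1), (1)%Z)]); (2, 2, 1, [:: (2, (0, 0, 0), (1)%Z)])]));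
  ((2, 3, 3, 9), 2,
   ((0, 1, 2), [:: (3, 0, 1); (0, 3, 0); (0, 1, 2)], [:: (2, 4, 2, [:: (1, (1, 1, 0), (1)%Z); (3, (0, 1, 1), (-3)%Z); (2, (0, 0, 2), (2)%Z)]); (0, 3, 1, [:: (3, (0, 0, 0), (1)%Z)]); (1, 3, 1, [:: (0, (0, 0, 0), (1)%Z)])]),
   ((1, 2, 0), [:: (0, 3, 0); (3, 0, 1); (0, 0, 3)], [:: (0, 5, 1, [:: (3, (2, 0, 0), (1)%Z); (1, (0, 0, 1), (1)%Z)]); (1, 2, 1, [:: (2, (0, 0, 0), (1)%Z)]); (2, 2, 1, [:: (3, (0, 0, 0), (1)%Z)])]));
  ((2, 3, 6, 12), 2,
   ((1, 2, 0), [:: (0, 4, 0); (3, 0, 1); (0, 0, 2)], [:: (1, 3, 4, [:: (2, (0, 0, 0), (1)%Z)]); (2, 2, 1, [:: (3, (0, 0, 1), (1)%Z); (0, (0, 0, 0), (-1)%Z)]); (0, 3, 1, [:: (3, (0, 0, 0), (1)%Z)])]),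
   ((1, 2, 0), [:: (0, 4, 0); (3, 0, 1); (0, 0, 2); (0, 2, 1)], [:: (1, 6, 1, [:: (0, (0, 2, 0), (1)%Z); (3, (0, 2, 1), (1)%Z); (3, (0, 0, 2), (1)%Z); (1, (1, 0, 1), (1)%Z)]); (0, 3, 1, [:: (3, (0, 0, 0), (1)%Z)]); (2, 2, 1, [:: (0, (0, 0, 0), (1)%Z)])]));
  ((2, 3, 4, 10), 2,
   ((0, 2, 1), [:: (5, 0, 0); (0, 2, 1); (1, 0, 2)], [:: (1, 3, 1, [:: (3, (0, 1, 0), (1)%Z); (2, (1, 0, 0), (-1)%Z)]); (0, 5, 2, [:: (3, (0, 0, 1), (-1)%Z); (0, (0, 0, 0), (2)%Z)]); (2, 2, 1, [:: (1, (0, 0, 0), (1)%Z)])]),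
   ((0, 2, 1), [:: (5, 0, 0); (0, 2, 1); (1, 0, 2); (3, 0, 1)], [:: (0, 7, 1, [:: (0, (0, 0, 1), (1)%Z); (3, (0, 0, 2), (1)%Z); (1, (1, 0, 1), (1)%Z); (0, (2, 0, 0), (1)%Z); (3, (2, 0, 1), (1)%Z)]); (1, 2, 1, [:: (3, (0, 0, 0), (1)%Z)]); (2, 2, 1, [:: (1, (0, 0, 0), (1)%Z)])]));
  ((2, 4, 5, 12), 2,
   ((1, 0, 2), [:: (0, 3, 0); (1, 0, 2); (4, 1, 0)], [:: (2, 3, 1, [:: (1, (0, 0, 1), (1)%Z); (3, (2, 1, 0), (-2)%Z)]); (0, 7, 4, [:: (2, (3, 0, 0), (4)%Z); (1, (0, 1, 0), (-3)%Z)]); (1, 3, 1, [:: (0, (0, 0, 0), (1)%Z)])]),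
   ((1, 0, 2), [:: (0, 3, 0); (1, 0, 2); (6, 0, 0)], [:: (1, 2, 1, [:: (2, (0, 0, 0), (1)%Z)]); (2, 2, 1, [:: (1, (0, 0, 0), (1)%Z)]); (0, 6, 1, [:: (0, (0, 0, 0), (1)%Z)])]));
  ((2, 4, 7, 14), 2,
   ((2, 0, 1), [:: (0, 0, 2); (1, 3, 0); (5, 1, 0)], [:: (2, 1, 2, [:: (3, (0, 0, 0), (1)%Z)]); (0, 9, 2, [:: (2, (0, 2, 0), (3)%Z); (0, (0, 1, 0), (-9)%Z); (2, (4, 0, 0), (2)%Z)]); (1, 3, 1, [:: (1, (0, 0, 0), (1)%Z)])]),
   ((2, 0, 1), [:: (0, 0, 2); (1, 3, 0); (7, 0, 0)], [:: (0, 7, 1, [:: (1, (1, 0, 0), (1)%Z); (2, (0, 1, 0), (1)%Z)]); (1, 3, 1, [:: (1, (0, 0, 0), (1)%Z)]); (2, 2, 1, [:: (0, (0, 0, 0), (1)%Z)])]));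
  ((2, 6, 9, 18), 2,
   ((2, 1, 0), [:: (0, 0, 2); (0, 3, 0); (6, 1, 0)], [:: (0, 11, 2, [:: (1, (0, 1, 0), (-1)%Z); (2, (5, 0, 0), (2)%Z)]); (2, 1, 2, [:: (3, (0, 0, 0), (1)%Z)]); (1, 3, 1, [:: (0, (0, 0, 0), (1)%Z)])]),
   ((2, 1, 0), [:: (0, 0, 2); (6, 1, 0); (3, 2, 0); (0, 3, 0)], [:: (0, 8, 1, [:: (2, (2, 0, 0), (1)%Z); (1, (0, 0, 0), (1)%Z)]); (1, 2, 1, [:: (2, (0, 0, 0), (1)%Z)]); (2, 2, 1, [:: (0, (0, 0, 0), (1)%Z)])]));
  ((3, 4, 4, 12), 1,
   ((0, 1, 2), [:: (4, 0, 0); (0, 1, 2); (0, 2, 1)], [:: (1, 3, 1, [:: (3, (0, 1, 0), (1)%Z); (3, (0, 0, 1), (2)%Z); (1, (1, 0, 0), (1)%Z); (0, (0, 0, 0), (-4)%Z)]); (0, 4, 1, [:: (0, (0, 0, 0), (1)%Z)]); (2, 2, 1, [:: (2, (0, 0, 0), (1)%Z)])]),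
   no_example);
  ((3, 4, 5, 13), 1,
   ((0, 2, 1), [:: (3, 1, 0); (1, 0, 2); (0, 2, 1)], [:: (1, 4, 1, [:: (3, (0, 2, 0), (1)%Z); (0, (1, 0, 0), (-3)%Z); (1, (2, 0, 0), (1)%Z); (3, (1, 0, 1), (1)%Z)]); (0, 3, 1, [:: (2, (0, 0, 0), (1)%Z)]); (2, 2, 1, [:: (1, (0, 0, 0), (1)%Z)])]),
   no_example);
  ((3, 4, 8, 16), 1,
   ((0, 2, 1), [:: (4, 1, 0); (0, 0, 2); (0, 2, 1)], [:: (1, 4, 1, [:: (1, (1, 0, 0), (1)%Z); (3, (0, 2, 0), (1)%Z); (3, (0, 0, 1), (2)%Z); (0, (0, 0, 0), (-4)%Z)]); (0, 4, 1, [:: (2, (0, 0, 0), (1)%Z)]); (2, 2, 1, [:: (0, (0, 0, 0), (1)%Z)])]),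
   no_example);
  ((3, 5, 6, 15), 1,
   ((1, 0, 2), [:: (0, 3, 0); (1, 0, 2); (3, 0, 1)], [:: (2, 3, 1, [:: (2, (1, 1, 0), (-1)%Z); (0, (1, 0, 0), (3)%Z); (1, (0, 0, 1), (1)%Z); (3, (1, 0, 1), (-3)%Z)]); (0, 3, 1, [:: (3, (0, 0, 0), (1)%Z)]); (1, 3, 1, [:: (0, (0, 0, 0), (1)%Z)])]),
   no_example);
  ((3, 5, 9, 18), 1,
   ((1, 2, 0), [:: (1, 3, 0); (0, 0, 2); (3, 0, 1)], [:: (1, 5, 1, [:: (1, (0, 2, 0), (1)%Z); (2, (1, 0, 1), (-1)%Z)]); (2, 2, 1, [:: (3, (0, 0, 1), (1)%Z); (0, (0, 0, 0), (-1)%Z)]); (0, 3, 1, [:: (3, (0, 0, 0), (1)%Z)])]),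
   no_example);
  ((3, 8, 12, 24), 1,
   ((1, 2, 0), [:: (0, 3, 0); (0, 0, 2); (4, 0, 1)], [:: (2, 2, 1, [:: (1, (1, 0, 0), (1)%Z); (3, (0, 0, 1), (5)%Z); (2, (0, 1, 0), (3)%Z); (0, (0, 0, 0), (-9)%Z)]); (0, 4, 1, [:: (3, (0, 0, 0), (1)%Z)]); (1, 3, 1, [:: (0, (0, 0, 0), (1)%Z)])]),
   no_example);
  ((6, 14, 21, 42), 1,
   ((2, 1, 0), [:: (0, 0, 2); (7, 0, 0); (0, 3, 0)], [:: (0, 7, 1, [:: (1, (1, 0, 0), (1)%Z); (3, (0, 0, 1), (3)%Z); (0, (0, 0, 0), (-6)%Z); (2, (0, 1, 0), (2)%Z)]); (1, 3, 1, [:: (2, (0, 1, 0), (-1)%Z); (3, (0, 0, 1), (-2)%Z); (0, (0, 0, 0), (4)%Z)]); (2, 2, 1, [:: (0, (0, 0, 0), (1)%Z)])]),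
   no_example);
  ((6, 8, 15, 30), 1,
   ((2, 0, 1), [:: (0, 0, 2); (1, 3, 0); (5, 0, 0)], [:: (0, 5, 1, [:: (2, (0, 1, 0), (1)%Z); (1, (1, 0, 0), (1)%Z); (3, (0, 0, 1), (2)%Z); (0, (0, 0, 0), (-4)%Z)]); (1, 3, 1, [:: (1, (0, 0, 0), (1)%Z)]); (2, 2, 1, [:: (0, (0, 0, 0), (1)%Z)])]),
   no_example);
  ((6, 8, 9, 24), 1,
   ((1, 0, 2), [:: (0, 3, 0); (1, 0, 2); (4, 0, 0)], [:: (0, 4, 1, [:: (2, (0, 1, 0), (1)%Z); (0, (0, 0, 0), (-3)%Z); (1, (1, 0, 0), (1)%Z); (3, (0, 0, 1), (1)%Z)]); (1, 3, 1, [:: (0, (0, 0, 0), (1)%Z)]); (2, 2, 1, [:: (1, (0, 0, 0), (1)%Z)])]),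
   no_example);
  ((4, 5, 6, 16), 1,
   ((0, 2, 1), [:: (4, 0, 0); (0, 2, 1); (1, 0, 2)], [:: (1, 3, 1, [:: (3, (0, 1, 0), (1)%Z); (2, (1, 0, 0), (-1)%Z)]); (2, 3, 1, [:: (1, (0, 0, 1), (1)%Z); (3, (2, 0, 0), (-2)%Z)]); (0, 4, 1, [:: (0, (0, 0, 0), (1)%Z)])]),
   no_example);
  ((4, 5, 10, 20), 1,
   ((0, 2, 1), [:: (5, 0, 0); (0, 2, 1); (0, 0, 2)], [:: (1, 3, 1, [:: (3, (0, 1, 0), (1)%Z); (2, (0, 0, 0), (-1)%Z)]); (0, 5, 1, [:: (1, (1, 0, 0), (-1)%Z); (3, (0, 0, 1), (-3)%Z); (0, (0, 0, 0), (6)%Z)]); (2, 2, 1, [:: (0, (0, 0, 0), (1)%Z)])]),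
   no_example);
  ((4, 10, 15, 30), 1,
   ((2, 1, 0), [:: (0, 0, 2); (5, 1, 0); (0, 3, 0)], [:: (1, 3, 1, [:: (1, (1, 0, 0), (1)%Z); (2, (0, 1, 0), (3)%Z); (3, (0, 0, 1), (4)%Z); (0, (0, 0, 0), (-8)%Z)]); (0, 5, 1, [:: (2, (0, 0, 0), (1)%Z)]); (2, 2, 1, [:: (0, (0, 0, 0), (1)%Z)])]),
   no_example);
  ((4, 6, 11, 22), 1,
   ((2, 0, 1), [:: (0, 0, 2); (1, 3, 0); (4, 1, 0)], [:: (1, 5, 1, [:: (1, (0, 2, 0), (1)%Z); (3, (2, 0, 1), (-1)%Z); (0, (2, 0, 0), (2)%Z); (2, (2, 1, 0), (-2)%Z)]); (0, 4, 1, [:: (2, (0, 0, 0), (1)%Z)]); (2, 2, 1, [:: (0, (0, 0, 0), (1)%Z)])]),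
   no_example);
  ((4, 6, 7, 18), 1,
   ((1, 0, 2), [:: (0, 3, 0); (1, 0, 2); (3, 1, 0)], [:: (1, 3, 1, [:: (0, (0, 0, 0), (-5)%Z); (1, (1, 0, 0), (1)%Z); (2, (0, 1, 0), (2)%Z); (3, (0, 0, 1), (2)%Z)]); (0, 3, 1, [:: (2, (0, 0, 0), (1)%Z)]); (2, 2, 1, [:: (1, (0, 0, 0), (1)%Z)])]),
   no_example)]%N.

(** The certificates of x are identities over the integers whose multipliers u divide p^3, the
    largest needed being 8 for p = 2 and 9 for p = 3; those of y hold modulo p with u = 1. *)
Lemma realization_tableP : all (fun t => let: (a, b, c, h, p, x, y) := t in
  [&& 0 < a, a <= b, b <= c, gcdn a (gcdn b c) == 1, h == (a + b + c).+1,
      example_ok 0 (p ^ 3) a b c h x & (p == 1) || example_ok p 1 a b c h y]%N) realization_table.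
Proof. by vm_compute. Qed.

Lemma realization_types : [seq t.1.1.1 | t <- realization_table] = [seq t.2 | t <- hypersurface_list].
Proof. by vm_compute. Qed.

Theorem hypersurface_realization (k : closedFieldType) g withK q (a b c h : nat) :
  (g, withK, q, (a, b, c, h)) \in hypersurface_list ->
  exists (R : idomainType) (pi : {rmorphism {mpoly k[3]} -> R}) (D : point (piece a b c pi) -> rat),
    [/\ (a <= b <= c)%N, normal_graded_hypersurface a b c pi h, h%:Z - (a + b + c)%:Z = 1,
        ample_qdivisor D & is_section_ring D].
Proof.
move=> inL; have : (a, b, c, h) \in [seq t.2 | t <- hypersurface_list].
  by apply/mapP; exists (g, withK, q, (a, b, c, h)).
rewrite -realization_types => /mapP[[[[ty p] x] y] ti /= tyE].
have := allP realization_tableP _ ti; rewrite -tyE => /and5P[a0 ab bc /eqP g1 /and3P[/eqP hK okx oky]].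
have wt0 i : (0 < wt a b c i)%N by elim/ord3_ind: i; rewrite /wt /=; lia.
have [s [hs sm ps]] : exists s, [/\ fpoly k s \is h.-homog for (wdeg a b c), smooth (fpoly k s) &
    prime_elt (fpoly k s)].
  have [p0|pn] := eqVneq (p%:R : k) 0.
    have p1 : p != 1%N by apply: contra_eqN p0 => /eqP ->; apply: oner_neq0.
    move: oky; rewrite (negbTE p1) => /and3P[hh pp ss]; exists y.1.2; split.
    - exact: hom_check.
    - by apply: (smooth_check p0 _ ss); apply: oner_neq0.
    exact: prime_check pp.
  case/and3P: okx => hh pp ss; exists x.1.2; split.
  - exact: hom_check.
  - by apply: (smooth_check _ _ ss) => //; rewrite natrX expf_neq0.
  exact: prime_check pp.
have [R [pi [D [nR aD sD]]]] := curve_realization wt0 g1 hK hs sm ps.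
by exists R, pi, D; split=> //; rewrite ?ab //; lia.
Qed.

Theorem mainTheorem2 (k : closedFieldType) :
  (forall (a b c h : nat) (R : idomainType)
          (pi : {rmorphism {mpoly k[3]} -> R})
          (D : point (piece a b c pi) -> rat),
     (a <= b <= c)%N ->
     normal_graded_hypersurface a b c pi h ->
     h%:Z - (a + b + c)%:Z = 1 ->
     ample_qdivisor D ->
     is_section_ring D ->
     exists (g : nat) (withK : bool) (q : seq rat),
       [/\ (g, withK, q, (a, b, c, h)) \in hypersurface_list,
           genus (structure_map pi) (piece a b c pi) g &
           equiv_to_listed (structure_map pi) withK q D]) /\
  (forall (g : nat) (withK : bool) (q : seq rat) (a b c h : nat),
     (g, withK, q, (a, b, c, h)) \in hypersurface_list ->
     exists (R : idomainType) (pi : {rmorphism {mpoly k[3]} -> R})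
            (D : point (piece a b c pi) -> rat),
       [/\ (a <= b <= c)%N,
           normal_graded_hypersurface a b c pi h,
           h%:Z - (a + b + c)%:Z = 1,
           ample_qdivisor D &
           is_section_ring D]).
Proof.
split=> [a b c h R pi D|g withK q a b c h]; first exact: hypersurface_classification.
exact: hypersurface_realization.
Qed.
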